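(* Let $K$ be a mixed-growth kernel on $\mathbb{R}^d$, let $\mathcal{L}=\mathcal{L}_K$, let $P$ be its heat kernel, and let $T\in(0,\infty)$. Let $\mu_0$ be a Radon measure on $\mathbb{R}^d$. Suppose that $u_1$ and $u_2$ both belong to $L^1_{\rm loc}([0,T);L^1_{P_1})$ and that, for $u=u_1$ and for $u=u_2$, $$\int_0^T\int_{\mathbb{R}^d}u(x,t)\big(\partial_t\tilde\theta(x,t)-\mathcal{L}\tilde\theta(x,t)\big)\,dx\,dt=-\int_{\mathbb{R}^d}\tilde\theta(x,0)\,d\mu_0(x)\quad\text{for all }\tilde\theta\in C_c^\infty(\mathbb{R}^d\times[0,T)).$$ Then $u_1=u_2$ a.e. in $\mathbb{R}^d\times(0,T)$.
   Context: Mixed-growth kernel: a measurable $K:\mathbb{R}^d\to\mathbb{R}$ such that (a) $K(x)>0$ and $K(x)=K(-x)$ for a.e. $x$, and $\int_{\mathbb{R}^d}\min\{1,|y|^2\}K(y)\,dy<\infty$; and there is a nondecreasing function $\tilde\varphi:(0,\infty)\to(0,\infty)$ (scale function) with (b) $\frac{C^{-1}}{|x|^d\tilde\varphi(|x|)}\le K(x)\le\frac{C}{|x|^d\tilde\varphi(|x|)}$ for all $x\ne0$, for some constant $C>1$; (c) $\lambda_1(R/r)^{\beta_1}\le\tilde\varphi(R)/\tilde\varphi(r)\le\lambda_2(R/r)^{\beta_2}$ for all $0<r\le R<\infty$, for some constants $\lambda_1,\lambda_2>0$ and $\beta_2\ge\beta_1>0$. Operator (acting in the $x$ variable): $\mathcal{L}_Ku(x)=\int_{\mathbb{R}^d}\Big(u(x)-\frac{u(x+y)+u(x-y)}2\Big)K(y)\,dy$.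 Heat kernel: with $m(\xi)=\int_{\mathbb{R}^d}(1-\cos\langle\xi,y\rangle)K(y)\,dy$, $P_t(x)=P(x,t)$ is, for $t>0$, the continuous probability density on $\mathbb{R}^d$ with $\int_{\mathbb{R}^d}e^{i\langle\xi,x\rangle}P_t(x)\,dx=e^{-tm(\xi)}$ (it exists, and it is positive). $L^1_{P_1}=\{v\in L^1_{\rm loc}(\mathbb{R}^d):\int_{\mathbb{R}^d}|v|P_1\,dx<\infty\}$; $u\in L^1_{\rm loc}([0,T);L^1_{P_1})$ means $\int_0^{T'}\int_{\mathbb{R}^d}|u(x,t)|P_1(x)\,dx\,dt<\infty$ for all $T'\in(0,T)$. Radon measures may be signed (elements of the dual of $C_c(\mathbb{R}^d)$). $C_c^\infty(\mathbb{R}^d\times[0,T))$ denotes smooth functions (up to $t=0$) with compact support in $\mathbb{R}^d\times[0,T)$. *)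

(* Defs.v *)
From HB Require Import structures.
From mathcomp Require Import all_boot all_order all_algebra.
From mathcomp Require Import all_classical all_reals all_analysis.

Set Implicit Arguments.
Unset Strict Implicit.
Unset Printing Implicit Defensive.

Import Order.TTheory GRing.Theory Num.Theory.
Import numFieldNormedType.Exports.

Local Open Scope classical_set_scope.
Local Open Scope ring_scope.

Definition measure_rV_display : measure_display -> measure_display.
Proof. exact. Qed.

(* The product sigma-algebra on row vectors, as in the library for [n.-tuple T];
   on ['rV[R]_d] it is the Borel sigma-algebra. *)
Section measurable_rV.
Context {disp} {T : sigmaRingType disp} (n : nat).

Let coord : 'I_n -> 'rV[T]_n -> T := fun i x => x ord0 i.

Let rV_set0 : g_sigma_preimage coord set0.
Proof. exact: sigma_algebra0. Qed.

Let rV_setC A : g_sigma_preimage coord A -> g_sigma_preimage coord (~` A).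
Proof. exact: sigma_algebraC. Qed.

Let rV_bigcup (F : _^nat) : (forall i, g_sigma_preimage coord (F i)) ->
  g_sigma_preimage coord (\bigcup_i (F i)).
Proof. exact: sigma_algebra_bigcup. Qed.

HB.instance Definition _ := @isMeasurable.Build (measure_rV_display disp)
  'rV[T]_n (g_sigma_preimage coord) rV_set0 rV_setC rV_bigcup.

Lemma measurable_coord (i : 'I_n) :
  measurable_fun [set: 'rV[T]_n] (fun x : 'rV[T]_n => x ord0 i).
Proof.
move=> _ Y mY; rewrite setTI; apply: sub_sigma_algebra => /=.
rewrite -bigcup_seq/=; exists i => /=; first by rewrite mem_index_enum.
by exists Y => //; rewrite setTI.
Qed.

Lemma measurable_fun_rV d1 (T1 : measurableType d1) (f : T1 -> 'rV[T]_n) :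
  (forall i, measurable_fun [set: T1] (fun x => f x ord0 i)) ->
  measurable_fun [set: T1] f.
Proof.
move=> mf _ A mA; rewrite setTI.
suff : g_sigma_preimage coord `<=` [set B | measurable (f @^-1` B)] by exact.
apply: smallest_sub.
  split => /=; first by rewrite preimage_set0.
    by move=> B /= mB; rewrite setTD preimage_setC; exact: measurableC.
  by move=> F mF /=; rewrite preimage_bigcup; exact: bigcupT_measurable.
rewrite -bigcup_seq => B [i _] [C mC <-] /=; rewrite setTI.
by have := mf i measurableT C mC; rewrite setTI.
Qed.

End measurable_rV.

Section lebesgue_rV_step.
Context {R : realType} {d : nat}.
Variable mu : {sigma_finite_measure set 'rV[R]_d -> \bar R}.

Definition rV_cons (z : R * 'rV[R]_d) : 'rV[R]_d.+1 :=
  \row_i (if unlift ord0 i is Some j then z.2 ord0 j else z.1).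

Lemma measurable_rV_cons : measurable_fun setT rV_cons.
Proof.
apply: measurable_fun_rV => i; rewrite /rV_cons.
under eq_fun do rewrite mxE.
case: (unlift ord0 i) => [j|]; last exact: measurable_fst.
apply: (measurableT_comp (measurable_coord j)); exact: measurable_snd.
Qed.

Let rV_uncons (x : 'rV[R]_d.+1) : R * 'rV[R]_d :=
  (x ord0 ord0, \row_j x ord0 (lift ord0 j)).

Let rV_consK : cancel rV_cons rV_uncons.
Proof.
case=> a v; rewrite /rV_uncons /rV_cons mxE unlift_none/=; congr pair.
by apply/rowP => j; rewrite !mxE liftK.
Qed.

Let rV_unconsK : cancel rV_uncons rV_cons.
Proof.
move=> x; apply/rowP => i; rewrite !mxE.
by case: unliftP => [j ->|->] //=; rewrite mxE.
Qed.

Let measurable_rV_uncons : measurable_fun setT rV_uncons.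
Proof.
apply/measurable_fun_pairP; split; first exact: (measurable_coord ord0).
apply: measurable_fun_rV => i.
rewrite [X in measurable_fun _ X](_ : _ = fun x : 'rV[R]_d.+1 => x ord0 (lift ord0 i)).
  exact: (measurable_coord (lift ord0 i)).
by apply/funext => x /=; rewrite mxE.
Qed.

Definition lebesgue_rV_step : set 'rV[R]_d.+1 -> \bar R :=
  pushforward (@lebesgue_measure R \x mu)%E rV_cons.

HB.instance Definition _ := Measure.copy lebesgue_rV_step
  (measure_function_pushforward__canonical__measure_function_Measure
     (@lebesgue_measure R \x mu)%E measurable_rV_cons).

Let sigma_finite_step : sigma_finite setT lebesgue_rV_step.
Proof.
have /sigma_finiteP[F [FT ndF mF]] := sigma_finiteT (@lebesgue_measure R).
have /sigma_finiteP[G [GT ndG mG]] := sigma_finiteT mu.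
exists (fun n => rV_uncons @^-1` (F n `*` G n)).
  apply/esym; rewrite -preimage_bigcup -[RHS](preimage_setT rV_uncons).
  congr (_ @^-1` _); rewrite -subTset => -[a v] _.
  have [n _ Fa] : (\bigcup_i F i) a by rewrite -FT.
  have [k _ Gv] : (\bigcup_i G i) v by rewrite -GT.
  exists (maxn n k) => //; split.
    by move: a Fa; exact/subsetPset/ndF/leq_maxl.
  by move: v Gv; exact/subsetPset/ndG/leq_maxr.
move=> n; have [mFn Fn] := mF n; have [mGn Gn] := mG n; split.
  rewrite -[X in measurable X]setTI; apply: measurable_rV_uncons => //.
  exact: measurableX.
rewrite /lebesgue_rV_step /pushforward -comp_preimage.
rewrite (_ : rV_uncons \o rV_cons = id); last first.
  by apply/funext => z; exact: rV_consK.
by rewrite preimage_id product_measure1E// lte_mul_pinfty// ge0_fin_numE.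
Qed.

HB.instance Definition _ :=
  Measure_isSigmaFinite.Build _ _ _ lebesgue_rV_step sigma_finite_step.

End lebesgue_rV_step.

Fixpoint lebesgue_rV (R : realType) (d : nat) :
    {sigma_finite_measure set 'rV[R]_d -> \bar R} :=
  match d with
  | 0 => dirac (0 : 'rV[R]_0)
  | d'.+1 => lebesgue_rV_step (lebesgue_rV R d')
  end.

Lemma lebesgue_rV_box (R : realType) (d : nat) (A : 'I_d -> set R) :
  (forall i, measurable (A i)) ->
  lebesgue_rV R d [set x : 'rV[R]_d | forall i, A i (x ord0 i)] =
    (\prod_(i < d) lebesgue_measure (A i))%E.
Proof.
elim: d A => [|d IH] A mA.
  by rewrite big_ord0 /= diracE mem_set// => -[].
pose X := [set x : 'rV[R]_d.+1 | forall i, A i (x ord0 i)].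
pose B := [set x : 'rV[R]_d | forall i : 'I_d, A (lift ord0 i) (x ord0 i)].
have E : rV_cons @^-1` X = A ord0 `*` B.
  apply/seteqP; split => -[a v] /=.
    move=> Aav; split=> [|i].
      by have := Aav ord0; rewrite /rV_cons mxE unlift_none.
    by have := Aav (lift ord0 i); rewrite /rV_cons mxE liftK.
  move=> [Aa Av] i; rewrite /rV_cons mxE.
  by case: unliftP => [j ->|->] //=; exact: Av.
have -> : lebesgue_rV R d.+1 X =
    (@lebesgue_measure R \x lebesgue_rV R d)%E (A ord0 `*` B) by rewrite -E.
rewrite product_measure1E; first by rewrite big_ord_recl -IH.
  exact: mA.
rewrite [X in measurable X](_ : _ =
    \bigcap_(i in setT) [set x : 'rV[R]_d | A (lift ord0 i) (x ord0 i)]).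
  apply: fin_bigcap_measurable => // i _.
  rewrite -[X in measurable X]setTI.
  exact: (measurable_coord i measurableT (mA _)).
by apply/seteqP; split => x /= Ax i => [_|]; exact: Ax.
Qed.

(* On ['rV[R]_d] the library's [`|x|] is the sup norm; the kernel conditions are
   stated with the Euclidean norm. *)
Definition dotv (R : realType) (d : nat) (x y : 'rV[R]_d) : R :=
  \sum_(i < d) x ord0 i * y ord0 i.

Definition enorm (R : realType) (d : nat) (x : 'rV[R]_d) : R :=
  Num.sqrt (dotv x x).

Record scale_function (R : realType) (phi : R -> R) : Prop := {
  scale_gt0 : forall r : R, 0 < r -> 0 < phi r ;
  scale_nondecreasing : forall r s : R, 0 < r -> r <= s -> phi r <= phi s }.

Record mixed_growth_kernel (R : realType) (d : nat) (K : 'rV[R]_d -> R) : Prop := {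
  kernel_measurable : measurable_fun setT K ;
  kernel_gt0_sym :
    {ae lebesgue_rV R d, forall x, 0 < K x /\ K x = K (- x)} ;
  kernel_levy :
    (\int[lebesgue_rV R d]_y (Num.min 1 (enorm y ^+ 2) * K y)%:E < +oo)%E ;
  kernel_scale : exists phi : R -> R,
    [/\ scale_function phi,
        exists2 C : R, 1 < C & forall x : 'rV[R]_d, x != 0 ->
          C^-1 / (enorm x ^+ d * phi (enorm x)) <= K x <=
          C / (enorm x ^+ d * phi (enorm x)) &
        exists l1 l2 b1 b2 : R,
          [/\ 0 < l1, 0 < l2, 0 < b1, b1 <= b2 &
            forall r s : R, 0 < r -> r <= s ->
              l1 * (s / r) `^ b1 <= phi s / phi r <= l2 * (s / r) `^ b2]] }.

Definition nonlocal_op (R : realType) (d : nat) (K u : 'rV[R]_d -> R)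
    (x : 'rV[R]_d) : R :=
  \int[lebesgue_rV R d]_y ((u x - (u (x + y) + u (x - y)) / 2) * K y).

Definition symbol (R : realType) (d : nat) (K : 'rV[R]_d -> R)
    (xi : 'rV[R]_d) : R :=
  \int[lebesgue_rV R d]_y ((1 - cos (dotv xi y)) * K y).

(* [heat_kernel K P] determines [P t] for every [t > 0].  The identity
   int e^{i<xi,x>} P_t(x) dx = e^{-t m(xi)} is split into real and imaginary
   parts. *)
Record heat_kernel (R : realType) (d : nat) (K : 'rV[R]_d -> R)
    (P : R -> 'rV[R]_d -> R) : Prop := {
  heat_continuous : forall t : R, 0 < t -> continuous (P t) ;
  heat_ge0 : forall t : R, 0 < t -> forall x, 0 <= P t x ;
  heat_mass : forall t : R, 0 < t ->
    (\int[lebesgue_rV R d]_x (P t x)%:E = 1)%E ;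
  heat_fourier_re : forall t : R, 0 < t -> forall xi,
    \int[lebesgue_rV R d]_x (cos (dotv xi x) * P t x) =
      expR (- (t * symbol K xi)) ;
  heat_fourier_im : forall t : R, 0 < t -> forall xi,
    \int[lebesgue_rV R d]_x (sin (dotv xi x) * P t x) = 0 }.

(* u \in L^1_loc([0,T); L^1_w); only the values of [u] on R^d x (0,T) matter. *)
Definition L1loc_weighted (R : realType) (d : nat) (T : R) (w : 'rV[R]_d -> R)
    (u : 'rV[R]_d * R -> R) : Prop :=
  measurable_fun (setT `*` `]0, T[) u /\
  forall T' : R, 0 < T' -> T' < T ->
    (\int[lebesgue_measure]_(t in `]0%R, T'[)
       \int[lebesgue_rV R d]_x (`|u (x, t)| * w x)%:E < +oo)%E.

Fixpoint Ck (R : realType) (V : normedModType R) (k : nat) (f : V -> R) : Prop :=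
  match k with
  | 0 => continuous f
  | k'.+1 => (forall x, differentiable f x) /\ forall v, Ck k' ('D_v f)
  end.

Definition smooth (R : realType) (V : normedModType R) (f : V -> R) : Prop :=
  forall k, Ck k f.

(* Elements of C_c^oo(R^d x [0,T)) are the restrictions to R^d x [0,T) of smooth
   functions on R^d x R; the values outside R^d x [0,T) are irrelevant, and only
   the support inside R^d x [0,T) is constrained. *)
Definition test_function (R : realType) (d : nat) (T : R)
    (theta : 'rV[R]_d * R -> R) : Prop :=
  smooth theta /\
  exists A : set ('rV[R]_d * R),
    [/\ compact A, A `<=` setT `*` `[0, T[ &
        forall z : 'rV[R]_d * R, 0 <= z.2 < T -> ~ A z -> theta z = 0].

Definition Cc (R : realType) (d : nat) (A : set 'rV[R]_d) (f : 'rV[R]_d -> R) :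
    Prop :=
  [/\ continuous f, compact A & forall x, ~ A x -> f x = 0].

(* Signed Radon measures are the elements of the dual of C_c(R^d): linear forms
   bounded in sup norm on the functions supported in a given compact set; [mu f]
   is the integral of [f] against the measure, relevant for [f] in C_c only. *)
Record radon_measure (R : realType) (d : nat) (mu : ('rV[R]_d -> R) -> R) :
    Prop := {
  radon_linear : forall (A B : set 'rV[R]_d) f g (a : R), Cc A f -> Cc B g ->
    mu (fun x => a * f x + g x) = a * mu f + mu g ;
  radon_bounded : forall A : set 'rV[R]_d, compact A ->
    exists C : R, forall f (M : R),
    Cc A f -> (forall x, `|f x| <= M) -> `|mu f| <= C * M }.

Definition weak_solution (R : realType) (d : nat) (K : 'rV[R]_d -> R) (T : R)
    (mu0 : ('rV[R]_d -> R) -> R) (u : 'rV[R]_d * R -> R) : Prop :=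
  forall theta, test_function T theta ->
    (\int[lebesgue_measure]_(t in `]0%R, T[) \int[lebesgue_rV R d]_x
       (u (x, t) * (derive1 (fun s => theta (x, s)) t -
                    nonlocal_op K (fun y => theta (y, t)) x))%:E =
     (- mu0 (fun x => theta (x, 0)))%:E)%E.

(* Main.v *)
From HB Require Import structures.
Require Import Defs.
From mathcomp Require Import all_boot all_order all_algebra.
From mathcomp Require Import all_classical all_reals all_analysis.
From mathcomp Require Import measurable_realfun ring lra.

Set Implicit Arguments.
Unset Strict Implicit.
Unset Printing Implicit Defensive.

Import Order.TTheory GRing.Theory Num.Theory.
Import numFieldNormedType.Exports.

Local Open Scope classical_set_scope.
Local Open Scope ring_scope.

(** The difference [omega] of two solutions satisfies the weak equation with zero
    initial datum, and its size is controlled only through integrability against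
    [P 1].  The proof has two halves.

    The first half replaces [P 1] by a weight [W] that can be estimated by hand.
    Let [k x = 1 / ((1 + |x|)^d * phi (1 + |x|))], the kernel without its
    singularity, and let [W] be the convolution of [k] with a smooth positive
    function of polynomial decay.  The polynomial growth of [phi] makes [k] a
    doubling function, stable under convolution, and it follows that [W] varies
    slowly and that the integral of [|W x - (W (x + y) + W (x - y)) / 2| * K y]
    in [y] is at most [C * W x] ([comparison_weight_exists]).  The heat kernel
    dominates [W] ([heat_kernel_ge_weight]), so that solutions are integrable
    against [W].  For this bound the semigroup is applied to nonnegative
    superpositions [Phi] of cosines with bounded frequencies, namely products of
    even powers of [sin x / x]; on them it acts by multiplying each frequency by a
    scalar.  If [b <= C h - L h] then the pairing of [h] with the flow of [Phi]
    grows at least at the rate given by the pairing of [b] ([pairing_growth]).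
    With [h = W] and [b = 0] the pairing of [W] is preserved up to a factor.  With
    [h] a bump supported in a small ball and [b = c W], which is possible because
    the bump gains mass from far away through the long jumps
    ([barrier_growth]), the mass that reaches the ball from the point [x] is at
    least of the order of [W x].  Letting [Phi] concentrate gives the bound for
    the heat kernel itself.

    The second half is an evolution estimate for the pairings
    [V x s = int omega z s * eta (z - x) dz] with the translates of a smooth bump
    [eta].  Remove from the kernel the jumps shorter than [del], which act on
    [eta] as a small error, and let [lam] be the mass of the remaining jumps.
    Testing with the translate of [eta] times a cutoff in time shows that
    [exp (lam s) * V x s] is the primitive of an average of [V] over the long
    jumps, up to the error ([exp_primitive], [damped_pairing_le]).  Now damp by
    [exp (- c s)] with [c = C + 1], take absolute values and integrate against
    [W].  The left-hand side carries the factor [lam + C + 1]; on the right-hand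
    side the jumps can be moved from [V] to [W] by reversibility, and the estimate
    on [W] bounds the result by the factor [lam + C] ([kfar_weight_le],
    [jump_average_le]).  What remains is bounded by the truncation error, which
    tends to [0] with [del]; hence [V] vanishes almost everywhere
    ([pairing_eq0_ae]).  As bumps approximate the indicators of boxes, countably
    many of them determine [omega], which therefore vanishes
    ([ae_eq0_of_bump_pairings]). *)

(** * Lebesgue measure on row vectors *)

Section rV_measurability.
Context {R : realType} {n : nat} {dT : measure_display} {T : measurableType dT}.
Implicit Types f g : T -> 'rV[R]_n.

Lemma measurable_fun_coord f (i : 'I_n) : measurable_fun setT f ->
  measurable_fun setT (fun x => f x ord0 i).
Proof. by move=> mf; exact: (measurableT_comp (measurable_coord i) mf). Qed.

Lemma measurable_fun_rVD f g : measurable_fun setT f ->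
  measurable_fun setT g -> measurable_fun setT (fun x => f x + g x).
Proof.
move=> mf mg; apply: measurable_fun_rV => i; under eq_fun do rewrite mxE.
by apply: measurable_funD; exact: measurable_fun_coord.
Qed.

Lemma measurable_fun_rVZ (c : R) f : measurable_fun setT f ->
  measurable_fun setT (fun x => c *: f x).
Proof.
move=> mf; apply: measurable_fun_rV => i; under eq_fun do rewrite mxE.
by apply: measurable_funM; [exact: measurable_cst|exact: measurable_fun_coord].
Qed.

Lemma measurable_fun_rVN f : measurable_fun setT f ->
  measurable_fun setT (fun x => - f x).
Proof.
by move=> mf; under eq_fun do rewrite -scaleN1r; exact: measurable_fun_rVZ.
Qed.

Lemma measurable_fun_rVB f g : measurable_fun setT f ->
  measurable_fun setT g -> measurable_fun setT (fun x => f x - g x).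
Proof. by move=> mf mg; apply: measurable_fun_rVD => //; exact: measurable_fun_rVN. Qed.

Lemma measurable_fun_dotv f g : measurable_fun setT f ->
  measurable_fun setT g -> measurable_fun setT (fun x => dotv (f x) (g x)).
Proof.
move=> mf mg; apply: measurable_sum => i.
by apply: measurable_funM; exact: measurable_fun_coord.
Qed.

Lemma measurable_fun_enorm f : measurable_fun setT f ->
  measurable_fun setT (fun x => enorm (f x)).
Proof.
move=> mf; apply: (measurableT_comp (f := @Num.sqrt R)); last exact: measurable_fun_dotv.
exact: (continuous_measurable_fun (@sqrt_continuous R)).
Qed.

End rV_measurability.

Section lebesgue_shift.
Context {R : realType}.
Local Open Scope ereal_scope.

Lemma lebesgue_measure_shift (a : R) (A : set R) : measurable A ->
  pushforward (@lebesgue_measure R) ((fun x => x + a)%R : _ -> measurableTypeR R) A =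
  lebesgue_measure A.
Proof.
move=> mA; apply/esym/lebesgue_measure_unique => //=; first exact: measurable_funD.
move=> ? _ [[u v] /= _ <-]; rewrite /pushforward.
rewrite (_ : _ @^-1` _ = `](u - a)%R, (v - a)%R]%classic); last first.
  by apply/seteqP; split => x /=; rewrite !in_itv/= ltrBlDr lerBrDr.
rewrite !lebesgue_measure_itv/= !lte_fin ltrD2r; case: ifP => // _.
by rewrite -!EFinB; congr EFin; ring.
Qed.

Lemma ge0_integral_shift1 (a : R) (f : R -> \bar R) :
  measurable_fun [set: R] f -> (forall x, 0 <= f x) ->
  \int[@lebesgue_measure R]_x f (x + a)%R = \int[@lebesgue_measure R]_x f x.
Proof.
move=> mf f0.
have mT : measurable_fun setT ((fun x : R => x + a)%R : _ -> measurableTypeR R).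
  exact: measurable_funD.
transitivity (\int[pushforward (@lebesgue_measure R)
    ((fun x => x + a)%R : _ -> measurableTypeR R)]_x f x).
  by rewrite ge0_integral_pushforward.
by apply: eq_measure_integral => //= A mA _; exact: lebesgue_measure_shift.
Qed.

Lemma ge0_integral_opp1 (f : R -> \bar R) :
  measurable_fun [set: R] f -> (forall x, 0 <= f x) ->
  \int[@lebesgue_measure R]_x f (- x)%R = \int[@lebesgue_measure R]_x f x.
Proof.
move=> mf f0.
have mT : measurable_fun setT ((fun x : R => - x)%R : _ -> measurableTypeR R).
  exact: measurable_funN.
transitivity (\int[pushforward (@lebesgue_measure R)
    ((fun x => - x)%R : _ -> measurableTypeR R)]_x f x).
  by rewrite ge0_integral_pushforward.
by apply: eq_measure_integral => //= A mA _; exact: lebesgue_measureN.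
Qed.

Lemma ge0_integral_rV_step d (f : 'rV[R]_d.+1 -> \bar R) :
  measurable_fun setT f -> (forall x, 0 <= f x) ->
  \int[lebesgue_rV R d.+1]_x f x =
  \int[@lebesgue_measure R]_t \int[lebesgue_rV R d]_v f (rV_cons (t, v)).
Proof.
move=> mf f0.
have mc := @measurable_rV_cons R d.
transitivity (\int[(@lebesgue_measure R \x lebesgue_rV R d)]_z f (rV_cons z)).
  by rewrite [LHS]ge0_integral_pushforward.
rewrite fubini_tonelli1//.
exact: (measurableT_comp mf mc).
Qed.

Lemma rV_consD d (t s : R) (v w : 'rV[R]_d) :
  (rV_cons (t, v) + rV_cons (s, w) = rV_cons (t + s, v + w))%R.
Proof. by apply/rowP => i; rewrite !mxE; case: unlift => [j|]//=; rewrite mxE. Qed.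

Lemma rV_consN d (t : R) (v : 'rV[R]_d) :
  (- rV_cons (t, v) = rV_cons (- t, - v))%R.
Proof. by apply/rowP => i; rewrite !mxE; case: unlift => [j|]//=; rewrite mxE. Qed.

Lemma rV_cons_surj d (x : 'rV[R]_d.+1) : exists t v, x = rV_cons (t, v).
Proof.
exists (x ord0 ord0), (\row_j x ord0 (lift ord0 j)); apply/rowP => i.
by rewrite !mxE; case: unliftP => [j ->|->] //=; rewrite mxE.
Qed.

Lemma measurable_rV_cons2 d (t : R) :
  measurable_fun setT (fun v : 'rV[R]_d => rV_cons (t, v)).
Proof.
apply: (measurableT_comp (@measurable_rV_cons R d)).
exact: measurable_fun_pair.
Qed.

(** Translation invariance, one coordinate at a time. *)
Lemma ge0_integral_rV_shift d (a : 'rV[R]_d) (f : 'rV[R]_d -> \bar R) :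
  measurable_fun setT f -> (forall x, 0 <= f x) ->
  \int[lebesgue_rV R d]_x f (x + a)%R = \int[lebesgue_rV R d]_x f x.
Proof.
elim: d a f => [|d IH] a f mf f0.
  by apply: eq_integral => x _; congr f; apply/rowP => -[].
have [s [w ->]] := rV_cons_surj a.
rewrite ge0_integral_rV_step//; last first.
  by apply: (measurableT_comp mf); apply: measurable_fun_rVD.
under eq_integral do under eq_integral do rewrite rV_consD.
have mfc t : measurable_fun setT (fun v : 'rV[R]_d => f (rV_cons (t, v))).
  exact: (measurableT_comp mf (measurable_rV_cons2 t)).
have mI : measurable_fun [set: R] (fun t => \int[lebesgue_rV R d]_v f (rV_cons (t, v))).
  apply: (measurable_fun_fubini_tonelli_F (fun z => f (rV_cons z)) _ _) => //.
  by apply: (measurableT_comp mf); exact: measurable_rV_cons.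
under eq_integral => t _ do rewrite (IH w (fun v => f (rV_cons (t + s, v)%R)))//.
by rewrite (ge0_integral_shift1 s mI) -?ge0_integral_rV_step// => t; exact: integral_ge0.
Qed.

Lemma ge0_integral_rV_opp d (f : 'rV[R]_d -> \bar R) :
  measurable_fun setT f -> (forall x, 0 <= f x) ->
  \int[lebesgue_rV R d]_x f (- x)%R = \int[lebesgue_rV R d]_x f x.
Proof.
elim: d f => [|d IH] f mf f0.
  by apply: eq_integral => x _; congr f; apply/rowP => -[].
rewrite ge0_integral_rV_step//; last first.
  by apply: (measurableT_comp mf); apply: measurable_fun_rVN.
under eq_integral do under eq_integral do rewrite rV_consN.
have mfc t : measurable_fun setT (fun v : 'rV[R]_d => f (rV_cons (t, v))).
  exact: (measurableT_comp mf (measurable_rV_cons2 t)).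
have mI : measurable_fun [set: R] (fun t => \int[lebesgue_rV R d]_v f (rV_cons (t, v))).
  apply: (measurable_fun_fubini_tonelli_F (fun z => f (rV_cons z)) _ _) => //.
  by apply: (measurableT_comp mf); exact: measurable_rV_cons.
under eq_integral => t _ do rewrite (IH (fun v => f (rV_cons (- t, v)%R)))//.
by rewrite (ge0_integral_opp1 mI) -?ge0_integral_rV_step// => t; exact: integral_ge0.
Qed.

End lebesgue_shift.

Section lebesgue_rV_balls.
Context {R : realType} {d : nat}.
Local Notation V := 'rV[R]_d.
Local Notation mu := (lebesgue_rV R d).
Local Open Scope ereal_scope.

Lemma measurable_rV_box (A : 'I_d -> set R) : (forall i, measurable (A i)) ->
  measurable [set x : V | forall i, A i (x ord0 i)].
Proof.
move=> mA; rewrite [X in measurable X](_ : _ =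
    \bigcap_(i in setT) [set x : V | A i (x ord0 i)]).
  apply: fin_bigcap_measurable => // i _.
  by rewrite -[X in measurable X]setTI; exact: (measurable_coord i measurableT (mA _)).
by apply/seteqP; split => x /= Ax i => [_|]; exact: Ax.
Qed.

Lemma lebesgue_rV_cube (a b : R) : (a <= b)%R ->
  mu [set x : V | forall i, `[a, b]%classic (x ord0 i)] = ((b - a) ^+ d)%:E.
Proof.
move=> ab; rewrite (lebesgue_rV_box (A := fun=> `[a, b]%classic))//.
rewrite (eq_bigr (fun=> (b - a)%:E)); last first.
  move=> i _; rewrite lebesgue_measure_itv/= lte_fin.
  by case: ltgtP ab => // -> _; rewrite subrr.
by rewrite prodEFin big_const_ord iter_mulr_1.
Qed.

End lebesgue_rV_balls.

(** * The Euclidean norm and measurability *)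

Section enorm_theory.
Context {R : realType} {d : nat}.
Implicit Types x y z : 'rV[R]_d.

Lemma dotvC x y : dotv x y = dotv y x.
Proof. by apply: eq_bigr => i _; rewrite mulrC. Qed.

Lemma dotvDr x y z : dotv x (y + z) = dotv x y + dotv x z.
Proof. by rewrite -big_split; apply: eq_bigr => i _; rewrite mxE mulrDr. Qed.

Lemma dotvZr (c : R) x y : dotv x (c *: y) = c * dotv x y.
Proof. by rewrite mulr_sumr; apply: eq_bigr => i _; rewrite mxE; ring. Qed.

Lemma dotvNr x y : dotv x (- y) = - dotv x y.
Proof. by rewrite -scaleN1r dotvZr mulN1r. Qed.

Lemma dotvBr x y z : dotv x (y - z) = dotv x y - dotv x z.
Proof. by rewrite dotvDr dotvNr. Qed.

Lemma dotvDl x y z : dotv (y + z) x = dotv y x + dotv z x.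
Proof. by rewrite dotvC dotvDr !(dotvC x). Qed.

Lemma dotvNl x y : dotv (- y) x = - dotv y x.
Proof. by rewrite dotvC dotvNr dotvC. Qed.

Lemma dotvBl x y z : dotv (y - z) x = dotv y x - dotv z x.
Proof. by rewrite dotvDl dotvNl. Qed.

Lemma dotvv_ge0 x : 0 <= dotv x x.
Proof. by apply: sumr_ge0 => i _; rewrite -expr2 sqr_ge0. Qed.

Lemma sqr_enorm x : enorm x ^+ 2 = dotv x x.
Proof. by rewrite sqr_sqrtr // dotvv_ge0. Qed.

Lemma enorm_ge0 x : 0 <= enorm x.
Proof. exact: sqrtr_ge0. Qed.

Lemma coord_le_enorm x i : `|x ord0 i| <= enorm x.
Proof.
rewrite -(ler_pXn2r (n := 2))// ?nnegrE ?enorm_ge0// sqr_enorm real_normK ?num_real//.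
rewrite /dotv (bigD1 i)//= -expr2 lerDl sumr_ge0// => j _.
by rewrite -expr2 sqr_ge0.
Qed.

Lemma enorm0 : enorm (0 : 'rV[R]_d) = 0.
Proof. by rewrite /enorm /dotv big1 ?sqrtr0// => i _; rewrite mxE mul0r. Qed.

Lemma enorm_eq0 x : enorm x = 0 -> x = 0.
Proof.
move=> x0; apply/rowP => i; rewrite mxE; apply/eqP; rewrite -normr_le0 -x0.
exact: coord_le_enorm.
Qed.

Lemma enorm_gt0 x : x != 0 -> 0 < enorm x.
Proof.
move=> x0; rewrite lt_neqAle enorm_ge0 andbT eq_sym.
by apply: contra x0 => /eqP/enorm_eq0 ->.
Qed.

Lemma enormN x : enorm (- x) = enorm x.
Proof. by rewrite /enorm dotvNr dotvC dotvNr opprK. Qed.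

Lemma enormB x y : enorm (x - y) = enorm (y - x).
Proof. by rewrite -enormN opprB. Qed.

Lemma sqr_enormD x y :
  enorm (x + y) ^+ 2 = enorm x ^+ 2 + 2 * dotv x y + enorm y ^+ 2.
Proof. by rewrite !sqr_enorm dotvDr !dotvDl (dotvC y x); ring. Qed.

Lemma sqr_enormB x y :
  enorm (x - y) ^+ 2 = enorm x ^+ 2 - 2 * dotv x y + enorm y ^+ 2.
Proof. by rewrite sqr_enormD dotvNr enormN mulrN. Qed.

Lemma dotv_le x y : `|dotv x y| <= enorm x * enorm y.
Proof.
have [->|y0] := eqVneq y 0.
  by rewrite enorm0 mulr0 /dotv big1 ?normr0// => i _; rewrite mxE mulr0.
rewrite -(ler_pXn2r (n := 2))// ?nnegrE ?mulr_ge0 ?enorm_ge0//.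
rewrite real_normK ?num_real// exprMn !sqr_enorm.
have yy : 0 < dotv y y by rewrite -sqr_enorm exprn_gt0 ?enorm_gt0.
have := dotvv_ge0 (dotv y y *: x - dotv x y *: y).
rewrite dotvBr !dotvBl !dotvZr !(dotvC _ x) !(dotvC _ y) !dotvZr (dotvC y x) => H.
rewrite -(ler_pM2l yy) -subr_ge0.
by apply: le_trans H _; rewrite le_eqVlt; apply/orP; left; apply/eqP; ring.
Qed.

Lemma enormD x y : enorm (x + y) <= enorm x + enorm y.
Proof.
rewrite -(ler_pXn2r (n := 2))// ?nnegrE ?addr_ge0 ?enorm_ge0// sqr_enormD sqrrD.
rewrite lerD2r lerD2l mulr_natl lerMn2r.
exact: le_trans (ler_norm _) (dotv_le x y).
Qed.

Lemma enormBD x y : enorm (x - y) <= enorm x + enorm y.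
Proof. by rewrite -(enormN y) enormD. Qed.

Lemma enorm_triB x y : enorm x - enorm y <= enorm (x + y).
Proof. by rewrite lerBlDr -[in leLHS](addrK y x) enormBD. Qed.

Lemma enorm_le_coord x (r : R) : (forall i, `|x ord0 i| <= r) -> enorm x <= Num.sqrt d%:R * r.
Proof.
move=> xr; have [d0|d_gt0] := posnP d.
  suff -> : x = 0 by rewrite enorm0 d0 sqrtr0 mul0r.
  by apply/rowP => i; case: i => m H; exfalso; rewrite d0 in H.
have r0 : 0 <= r by apply: le_trans (xr (Ordinal d_gt0)).
rewrite -(ler_pXn2r (n := 2))// ?nnegrE ?mulr_ge0 ?sqrtr_ge0 ?enorm_ge0//.
rewrite sqr_enorm exprMn sqr_sqrtr// -[d in d%:R]card_ord -sumr_const mulr_suml.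
apply: ler_sum => i _; rewrite mul1r -expr2 -real_normK ?num_real//.
by rewrite ler_pXn2r ?nnegrE.
Qed.

Lemma dotv_delta (N : R) (i : 'I_d) x : dotv (\row_j (N *+ (j == i))) x = N * x ord0 i.
Proof.
rewrite /dotv (bigD1 i)//= big1 ?addr0 ?mxE ?eqxx// => j ji.
by rewrite mxE (negbTE ji) mul0r.
Qed.

End enorm_theory.

Lemma countType_bigcup_measurable d (T : sigmaRingType d) (I : countType)
    (P : set I) (F : I -> set T) :
  (forall i, P i -> measurable (F i)) -> measurable (\bigcup_(i in P) F i).
Proof.
move=> mF; rewrite (_ : \bigcup_(i in P) F i =
    \bigcup_(k in [set k | exists2 i, P i & unpickle k = Some i])
      oapp F set0 (unpickle k)).
  by apply: bigcup_measurable => k [i Pi ->] /=; exact: mF.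
apply/seteqP; split => x.
  move=> [i Pi Fix]; exists (pickle i); last by rewrite pickleK.
  by exists i => //; rewrite pickleK.
by move=> [k [i Pi ->] /= Fix]; exists i.
Qed.

Ltac pos := solve [repeat (first [ assumption | done | apply: enorm_ge0
  | apply: sqr_ge0 | apply: mulr_gt0 | apply: mulr_ge0 | apply: exprn_gt0
  | apply: exprn_ge0 | apply: powR_gt0 | rewrite invr_gt0 | rewrite invr_ge0
  | apply: expR_gt0 | apply: addr_ge0 | apply: ltr_wpDr | apply: normr_ge0
  | apply: ltW ])].

Ltac rVring := solve [by apply/rowP => ?; rewrite !mxE; ring].

Section continuous_measurable.
Context {R : realType} {d : nat}.
Local Notation V := 'rV[R]_d.

(** A continuous function is the pointwise limit of the functions
    constant on the cells of the lattice of mesh 1/n, which take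
    countably many values. *)
Lemma continuous_measurable_rV (f : V -> R) : continuous f ->
  measurable_fun setT f.
Proof.
move=> cf.
pose cell (n : nat) (x : V) : 'rV[int]_d := \row_i Num.floor (n.+1%:R * x ord0 i).
pose pt (n : nat) (z : 'rV[int]_d) : V := \row_i ((z ord0 i)%:~R / n.+1%:R).
apply: (measurable_fun_cvg (h := fun n x => f (pt n (cell n x)))).
- move=> n _ Y mY; rewrite setTI.
  rewrite [X in measurable X](_ : _ = \bigcup_(z in [set z : 'rV[int]_d | Y (f (pt n z))])
      [set x : V | forall i, [set t : R | Num.floor (n.+1%:R * t) = z ord0 i] (x ord0 i)]).
    apply: countType_bigcup_measurable => z _.
    apply: (measurable_rV_box
      (A := fun i => [set t : R | Num.floor (n.+1%:R * t) = z ord0 i])) => i.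
    rewrite [X in measurable X](_ : _ = `[(z ord0 i)%:~R / n.+1%:R, ((z ord0 i + 1)%:~R / n.+1%:R)[%classic).
      exact: measurable_itv.
    apply/seteqP; split => t /=; rewrite in_itv/= ler_pdivrMr ?ltr0n// ltr_pdivlMr ?ltr0n// ![t * _]mulrC.
      by move=> <-; exact: floor_itv.
    by move/floor_def.
  apply/seteqP; split => x /=.
    by move=> Yx; exists (cell n x) => //= i; rewrite mxE.
  move=> [z /= Yz zx]; suff -> : cell n x = z by [].
  by apply/rowP => i; rewrite mxE zx.
- move=> x _; apply: (@cvg_comp _ _ _ (fun n => pt n (cell n x)) f _ _ _ _ (cf x)).
  apply/cvg_ballP => e e0; near=> n; split=> // i j.
  rewrite ord1 /ball/= (le_lt_trans _ (_ : n.+1%:R^-1 < e))//; last first.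
    near: n; exact: (near_infty_natSinv_lt (PosNum e0)).
  rewrite !mxE ler_norml.
  have n0 : (0 : R) < n.+1%:R by rewrite ltr0n.
  have /andP[H1 H2] : ((cell n x) ord0 j)%:~R <= n.+1%:R * x ord0 j < ((cell n x) ord0 j)%:~R + 1.
    by rewrite mxE; have := floor_itv (n.+1%:R * x ord0 j); rewrite intrD.
  have E : x ord0 j = (n.+1%:R * x ord0 j) / n.+1%:R by rewrite mulrC mulKf ?gt_eqF.
  apply/andP; split.
    apply: (@le_trans _ _ 0); first by rewrite oppr_le0 invr_ge0 ltW.
    by rewrite subr_ge0 ler_pdivrMr// [x 0 j * _]mulrC; move: H1; rewrite mxE.
  rewrite lerBlDr [in leLHS]E -{2}[n.+1%:R^-1]mul1r -mulrDl ler_pM2r ?invr_gt0// addrC.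
  by apply: ltW; move: H2; rewrite mxE.
Unshelve. all: by end_near. Qed.

End continuous_measurable.

Definition eball (R : realType) d (c : 'rV[R]_d) (r : R) : set 'rV[R]_d :=
  [set x | enorm (x - c) <= r].

Section lebesgue_rV_eballs.
Context {R : realType} {d : nat}.
Local Notation V := 'rV[R]_d.
Local Notation mu := (lebesgue_rV R d).

Lemma measurable_eball (c : V) (r : R) : measurable (eball c r).
Proof.
rewrite -[X in measurable X]setTI.
apply: (@measurable_fun_ler _ _ _ setT (fun x : V => enorm (x - c)) (cst r)) => //.
by apply: measurable_fun_enorm; exact: measurable_fun_rVB.
Qed.

Lemma measurable_eball_indic (c : V) (r : R) :
  measurable_fun setT (\1_(eball c r) : V -> R).
Proof. by apply: measurable_indic; exact: measurable_eball. Qed.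

Lemma eball0E (r : R) : eball 0 r = [set x : V | enorm x <= r].
Proof. by apply/seteqP; split => x /=; rewrite /eball/= subr0. Qed.

Lemma lebesgue_eball_shift (c : V) (r : R) : mu (eball c r) = mu (eball 0 r).
Proof.
have E c' : mu (eball c' r) = (\int[mu]_x (\1_(eball c' r) x)%:E)%E.
  by rewrite integral_indic ?setIT//; exact: measurable_eball.
rewrite !E.
rewrite -(ge0_integral_rV_shift c (f := fun x => (\1_(eball c r) x)%:E)).
- apply: eq_integral => x _; rewrite !indicE; congr ((_ : bool)%:R%:E).
  by apply/idP/idP; rewrite !inE /eball/= addrK subr0.
- apply/measurable_EFinP; exact: measurable_eball_indic.
- by move=> x; rewrite lee_fin.
Qed.

Lemma lebesgue_eball_lty (c : V) (r : R) : (mu (eball c r) < +oo)%E.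
Proof.
have rr : - `|r| <= `|r| by rewrite -subr_ge0 opprK addr_ge0.
rewrite lebesgue_eball_shift.
apply: (@le_lt_trans _ _ (mu [set x : V | forall i, `[- `|r|, `|r|]%classic (x ord0 i)])).
  apply: le_measure; rewrite ?inE.
  - exact: measurable_eball.
  - exact: (measurable_rV_box (A := fun=> `[- `|r|, `|r|]%classic)).
  - rewrite eball0E => x /= xr i; rewrite in_itv/= -ler_norml.
    by rewrite (le_trans (coord_le_enorm x i))// (le_trans xr)// ler_norm.
by rewrite lebesgue_rV_cube// ltry.
Qed.

(** A ball contains the cube with one corner at its centre. *)
Lemma lebesgue_eball_ge (c : V) (r : R) : 0 <= r ->
  (((r / (Num.sqrt d%:R + 1)) ^+ d)%:E <= mu (eball c r))%E.
Proof.
move=> r0; have s0 : 0 < Num.sqrt d%:R + 1 :> R by rewrite ltr_wpDl ?sqrtr_ge0.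
set a := r / _; have a0 : 0 <= a by rewrite divr_ge0// ltW.
rewrite lebesgue_eball_shift -[X in (X ^+ d)%:E]subr0 -lebesgue_rV_cube//.
apply: le_measure; rewrite ?inE.
- exact: (measurable_rV_box (A := fun=> `[0, a]%classic)).
- exact: measurable_eball.
- rewrite eball0E => x /= xa; apply: (@le_trans _ _ (Num.sqrt d%:R * a)).
    apply: enorm_le_coord => i; have := xa i; rewrite in_itv/= => /andP[? ?].
    by rewrite ger0_norm.
  rewrite /a mulrA ler_pdivrMr// mulrC ler_wpM2l// lerDl.
  exact: ler01.
Qed.

Lemma lebesgue_eball_gt0 (c : V) (r : R) : 0 < r -> (0 < mu (eball c r))%E.
Proof.
move=> r0; apply: lt_le_trans (lebesgue_eball_ge c (ltW r0)).
by rewrite lte_fin exprn_gt0// divr_gt0// ltr_wpDl ?sqrtr_ge0.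
Qed.

End lebesgue_rV_eballs.

Ltac mfun := solve [repeat (first [ assumption | done
  | exact: measurable_fst | exact: measurable_snd | exact: measurable_cst
  | exact: measurable_eball_indic
  | match goal with
    | |- measurable_fun _ (fun x => EFin _) => apply/measurable_EFinP
    | |- measurable_fun _ (EFin \o _) => apply/measurable_EFinP end
  | match goal with
    H : measurable_fun setT ?K |- measurable_fun _ (fun x => ?K _) =>
      apply: (measurableT_comp H) end
  | apply: measurable_fun_enorm | apply: measurable_fun_dotv
  | apply: measurable_fun_rVD | apply: measurable_fun_rVN
  | apply: measurable_fun_rVZ
  | apply: measurable_funM | apply: measurable_funD | apply: measurable_funN
  | apply: measurable_funX | apply: measurable_minr ])].

Section tonelli.
Local Open Scope ereal_scope.
Context d1 d2 (T1 : measurableType d1) (T2 : measurableType d2) (R : realType).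
Variable m1 : {sigma_finite_measure set T1 -> \bar R}.
Variable m2 : {sigma_finite_measure set T2 -> \bar R}.
Variable f : T1 -> T2 -> \bar R.
Hypothesis mf : measurable_fun setT (fun z : T1 * T2 => f z.1 z.2).
Hypothesis f0 : forall x y, 0 <= f x y.

Lemma tonelli : \int[m1]_x \int[m2]_y f x y = \int[m2]_y \int[m1]_x f x y.
Proof. by apply: (fubini_tonelli (fun z => f z.1 z.2)) => // z; exact: f0. Qed.

Lemma measurable_tonelli1 : measurable_fun setT (fun x => \int[m2]_y f x y).
Proof. by apply: (measurable_fun_fubini_tonelli_F (fun z => f z.1 z.2)) => // z; exact: f0. Qed.

Lemma measurable_tonelli2 : measurable_fun setT (fun y => \int[m1]_x f x y).
Proof. by apply: (measurable_fun_fubini_tonelli_G (fun z => f z.1 z.2)) => // z; exact: f0. Qed.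

End tonelli.
Arguments tonelli {d1 d2 T1 T2 R m1 m2} f _ _.
Arguments measurable_tonelli1 {d1 d2 T1 T2 R m2} f _ _.
Arguments measurable_tonelli2 {d1 d2 T1 T2 R m1} f _ _.

Section nonneg_real_integrals.
Context {dT : measure_display} {T : measurableType dT} {R : realType}.
Variable m : {measure set T -> \bar R}.
Implicit Types f g : T -> R.

Lemma ge0_integralZl_real (c : R) f : measurable_fun setT f ->
  (forall x, 0 <= f x) -> 0 <= c ->
  (\int[m]_x (c * f x)%:E = c%:E * \int[m]_x (f x)%:E)%E.
Proof.
move=> mf f0 c0; under eq_integral do rewrite EFinM.
rewrite ge0_integralZl//; first by apply/measurable_EFinP.
by move=> x _; rewrite lee_fin.
Qed.

Lemma ge0_le_integral_real f g : measurable_fun setT f -> measurable_fun setT g ->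
  (forall x, 0 <= f x) -> (forall x, f x <= g x) ->
  (\int[m]_x (f x)%:E <= \int[m]_x (g x)%:E)%E.
Proof.
move=> mf mg f0 fg; apply: ge0_le_integral => //.
- by move=> x _; rewrite lee_fin.
- by apply/measurable_EFinP.
- by apply/measurable_EFinP.
- by move=> x _; rewrite lee_fin.
Qed.

Lemma ge0_integralD_real f g : measurable_fun setT f -> measurable_fun setT g ->
  (forall x, 0 <= f x) -> (forall x, 0 <= g x) ->
  (\int[m]_x (f x + g x)%:E = \int[m]_x (f x)%:E + \int[m]_x (g x)%:E)%E.
Proof.
move=> mf mg f0 g0; under eq_integral do rewrite EFinD.
rewrite ge0_integralD//.
- by move=> x _; rewrite lee_fin.
- by apply/measurable_EFinP.
- by move=> x _; rewrite lee_fin.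
- by apply/measurable_EFinP.
Qed.

Lemma ge0_RintegralE f : (forall x, 0 <= f x) ->
  (\int[m]_x (f x)%:E < +oo)%E ->
  (\int[m]_x (f x)%:E)%E = (\int[m]_x f x)%:E.
Proof.
move=> f0 foo; rewrite /Rintegral fineK// ge0_fin_numE//.
by apply: integral_ge0 => x _; rewrite lee_fin.
Qed.

Lemma integrable_ge0 f : measurable_fun setT f -> (forall x, 0 <= f x) ->
  (\int[m]_x (f x)%:E < +oo)%E -> m.-integrable setT (EFin \o f).
Proof.
move=> mf f0 foo; apply/integrableP; split; first by apply/measurable_EFinP.
by under eq_integral do rewrite /= ger0_norm//.
Qed.

Lemma integrable_dominated f g : measurable_fun setT f ->
  measurable_fun setT g -> (forall x, `|f x| <= g x) ->
  (\int[m]_x (g x)%:E < +oo)%E -> m.-integrable setT (EFin \o f).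
Proof.
move=> mf mg fg goo; apply/integrableP; split; first by apply/measurable_EFinP.
apply: le_lt_trans goo; apply: ge0_le_integral_real => //.
exact: measurableT_comp.
Qed.

End nonneg_real_integrals.

(** * The weight *)

Section power_estimates.
Context {R : realFieldType}.
Implicit Types t u : R.

Lemma bernoulli_le t m : 0 <= t -> 1 + m%:R * (t - 1) <= t ^+ m.
Proof.
move=> t0; elim: m => [|m IH]; first by rewrite mul0r addr0 expr0.
rewrite exprS; apply: le_trans (ler_wpM2l t0 IH).
rewrite -subr_ge0 -[m.+1]addn1 natrD.
have -> : t * (1 + m%:R * (t - 1)) - (1 + (m%:R + 1%:R) * (t - 1)) = m%:R * (t - 1) ^+ 2.
  by ring.
by rewrite mulr_ge0// sqr_ge0.
Qed.

Lemma taylor2_exprn_le m : exists2 C : R, 0 <= C & forall t, 0 <= t <= 3 ->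
  t ^+ m <= 1 + m%:R * (t - 1) + C * (t - 1) ^+ 2.
Proof.
elim: m => [|m [C C0 IH]].
  by exists 0 => // t _; rewrite !mul0r !addr0 expr0.
exists (m%:R + 3 * C); first by rewrite addr_ge0// mulr_ge0.
move=> t /andP[t0 t3]; rewrite exprS.
apply: (le_trans (ler_wpM2l t0 (IH t _))); first by rewrite t0.
rewrite -subr_ge0 -[m.+1]addn1 natrD.
have -> : 1 + (m%:R + 1%:R) * (t - 1) + (m%:R + 3 * C) * (t - 1) ^+ 2 -
    t * (1 + m%:R * (t - 1) + C * (t - 1) ^+ 2) = C * ((3 - t) * (t - 1) ^+ 2) by ring.
by rewrite mulr_ge0// mulr_ge0 ?sqr_ge0// subr_ge0.
Qed.

(** The symmetric second difference of [u^-m] at [1] in the direction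
    [b] after a shift [a]: first-order terms in [b] cancel. *)
Lemma second_difference_expVn m : exists2 C : R, 0 <= C & forall a b s : R,
  0 <= a <= s -> b ^+ 2 <= s -> s <= 1 ->
  1 <= 3 * (1 + a + b) -> 1 <= 3 * (1 + a - b) ->
  `|(1 + a + b) ^- m + (1 + a - b) ^- m - 2| <= C * s.
Proof.
have [C C0 HC] := taylor2_exprn_le m.
exists (2 * m%:R + 4 * (3 * m%:R + 9 * C)); first by rewrite addr_ge0 ?mulr_ge0// addr_ge0 ?mulr_ge0.
move=> a b s /andP[a0 as_] bs s1 u1 v1.
have mm : (0 : R) <= m%:R by [].
have key u : 1 <= 3 * u -> 1 + m%:R * (1 - u) <= u ^- m /\
    u ^- m <= 1 + m%:R * (1 - u) + (3 * m%:R + 9 * C) * (1 - u) ^+ 2.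
  move=> u13; have u0 : 0 < u by lra.
  have uV : u * u^-1 = 1 by rewrite divff ?gt_eqF.
  have t0 : 0 < u^-1 by rewrite invr_gt0.
  have t3 : u^-1 <= 3 by rewrite -(ler_pM2l u0) uV mulrC.
  rewrite -exprVn; set t := u^-1 in uV t0 t3 *.
  have E : t - 1 = (1 - u) + t * (1 - u) ^+ 2.
    by apply: (mulfI (lt0r_neq0 u0)); rewrite mulrBr uV mulrDr mulrA uV; ring.
  have E2 : (t - 1) ^+ 2 = t ^+ 2 * (1 - u) ^+ 2.
    rewrite -exprMn; congr (_ ^+ 2); rewrite mulrBr mulr1 [t * u]mulrC uV; ring.
  have t29 : t ^+ 2 <= 9 by rewrite (_ : 9 = 3 ^+ 2); [rewrite ler_pXn2r// ?nnegrE// ltW|ring].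
  have sq := sqr_ge0 (1 - u).
  split.
    apply: le_trans (bernoulli_le m (ltW t0)); rewrite lerD2l ler_wpM2l// E lerDl.
    by rewrite mulr_ge0// ltW.
  apply: (le_trans (HC t _)); first by rewrite t3 ltW.
  have -> : 1 + m%:R * (t - 1) + C * (t - 1) ^+ 2 = 1 + m%:R * (1 - u) +
      (m%:R * t * (1 - u) ^+ 2 + C * t ^+ 2 * (1 - u) ^+ 2).
    by rewrite E2 E; ring.
  rewrite lerD2l mulrDl lerD//.
    by rewrite ler_wpM2r// mulrC ler_wpM2r.
  by rewrite ler_wpM2r// mulrC ler_wpM2r.
have [L1 U1] := key _ u1; have [L2 U2] := key _ v1.
set X := (1 + a + b) ^- m in L1 U1 *; set Y := (1 + a - b) ^- m in L2 U2 *.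
have a2 : a ^+ 2 <= s.
  rewrite expr2 (le_trans (ler_wpM2l a0 as_))// -[leRHS]mul1r ler_wpM2r//; lra.
have D0 : 0 <= 3 * m%:R + 9 * C by rewrite addr_ge0 ?mulr_ge0.
set D := 3 * m%:R + 9 * C in D0 U1 U2 *.
have ms : m%:R * a <= m%:R * s by rewrite ler_wpM2l.
have Da : D * a ^+ 2 <= D * s by rewrite ler_wpM2l.
have Db : D * b ^+ 2 <= D * s by rewrite ler_wpM2l.
have ma : 0 <= m%:R * a by rewrite mulr_ge0.
have s0 : 0 <= s by lra.
have Ds : 0 <= D * s by rewrite mulr_ge0.
have ms0 : 0 <= m%:R * s by rewrite mulr_ge0.
rewrite ler_norml; apply/andP; split; nra.
Qed.

End power_estimates.


Section rho.
Context {R : realType} {d : nat}.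
Local Notation V := 'rV[R]_d.
Variable m : nat.

Definition rho (x : V) : R := (1 + enorm x ^+ 2) ^- m.

Let Q (x : V) : R := 1 + enorm x ^+ 2.
Let Q_ge1 x : 1 <= Q x. Proof. by rewrite lerDl sqr_ge0. Qed.
Let Q_gt0 x : 0 < Q x. Proof. exact: lt_le_trans (Q_ge1 x). Qed.

Lemma rho_gt0 x : 0 < rho x.
Proof. by rewrite invr_gt0 exprn_gt0// Q_gt0. Qed.

Lemma rho_ge0 x : 0 <= rho x.
Proof. exact/ltW/rho_gt0. Qed.

Lemma rho_le1 x : rho x <= 1.
Proof. by rewrite invf_le1 ?exprn_gt0 ?Q_gt0// exprn_ege1// Q_ge1. Qed.

Lemma measurable_rho : measurable_fun setT rho.
Proof.
rewrite (_ : rho = fun x => (Q x) `^ (- m%:R)); last first.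
  by apply/funext => x; rewrite powRN powR_mulrn// ltW.
apply: (measurableT_comp (measurable_powR _)); rewrite /Q; mfun.
Qed.

(** Over a bounded distance [1 + |x|^2] changes by a bounded factor. *)
Lemma rho_harnack (r : R) : 0 <= r -> exists2 C : R, 0 < C & forall x x' : V,
  enorm (x - x') <= r -> rho x' <= C * rho x.
Proof.
move=> r0; exists ((2 + 2 * r ^+ 2) ^+ m); first by pos.
move=> x x' xr; rewrite /rho -/(Q x) -/(Q x') ler_pdivlMr ?exprn_gt0 ?Q_gt0// mulrC.
rewrite ler_pdivrMr ?exprn_gt0 ?Q_gt0// -exprMn; apply: lerXn2r; rewrite ?nnegrE; [exact/ltW/Q_gt0|by apply: mulr_ge0; pos|].
have xx' : enorm x <= enorm x' + r.
  by rewrite -[in leLHS](subrK x' x) addrC (le_trans (enormD _ _))// lerD2l.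
have x0 := enorm_ge0 x; have x'0 := enorm_ge0 x'.
have h : enorm x ^+ 2 <= (enorm x' + r) ^+ 2 by apply: lerXn2r; rewrite ?nnegrE ?addr_ge0.
have h1 := sqr_ge0 (enorm x' - r); have h2 := sqr_ge0 (r * enorm x').
have h3 : (enorm x' + r) ^+ 2 = 2 * enorm x' ^+ 2 + 2 * r ^+ 2 - (enorm x' - r) ^+ 2 by ring.
rewrite /Q (_ : (2 + 2 * r ^+ 2) * (1 + enorm x' ^+ 2) =
  2 + 2 * r ^+ 2 + 2 * enorm x' ^+ 2 + 2 * (r * enorm x') ^+ 2); last by ring.
rewrite h3 in h; lra.
Qed.

(** Dividing by [rho x] reduces the estimate to a second difference of [u^-m] at
    [1], taken along [(1 + |x + y|^2) / (1 + |x|^2)]: its first-order part in [y] is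
    odd and cancels. *)
Lemma rho_second_difference : exists2 C : R, 0 <= C & forall x y : V, enorm y <= 1 ->
  `|rho x - (rho (x + y) + rho (x - y)) / 2| <= C * enorm y ^+ 2 * rho x.
Proof.
have [C C0 HC] := @second_difference_expVn R m.
exists C => // x y y1.
have Qx := Q_gt0 x; have Qn : Q x != 0 by rewrite gt_eqF.
pose a := enorm y ^+ 2 / Q x; pose b := 2 * dotv x y / Q x.
have yy := enorm_ge0 y; have xx := enorm_ge0 x.
have Ep : Q (x + y) = Q x * (1 + a + b).
  by rewrite /Q sqr_enormD !mulrDr mulr1 /a /b !mulrA ![_ * _ / _]mulrAC divff// !mul1r /Q; ring.
have Em : Q (x - y) = Q x * (1 + a - b).
  by rewrite /Q sqr_enormB mulrBr !mulrDr mulr1 /a /b !mulrA ![_ * _ / _]mulrAC divff// !mul1r /Q; ring.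
have Q3 z : enorm z <= 1 -> Q x <= 3 * Q (x + z).
  move=> z1; have h : enorm x <= enorm (x + z) + 1.
    by rewrite -[in leLHS](addrK z x) (le_trans (enormBD _ _))// lerD2l.
  have xz := enorm_ge0 (x + z).
  have : enorm x ^+ 2 <= (enorm (x + z) + 1) ^+ 2.
    by apply: lerXn2r; rewrite ?nnegrE ?addr_ge0.
  have := sqr_ge0 (enorm (x + z) - 1); rewrite /Q; nra.
have Ha : 0 <= a <= enorm y ^+ 2.
  rewrite /a divr_ge0 ?sqr_ge0 ?(ltW Qx)//= ler_pdivrMr// ler_peMr ?sqr_ge0//.
have Hb : b ^+ 2 <= enorm y ^+ 2.
  rewrite -(real_normK (num_real b)); apply: lerXn2r; rewrite ?nnegrE//.
  rewrite /b !normrM normfV (gtr0_norm Qx) ler_pdivrMr// (ger0_norm (ler0n _ 2)).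
  have := dotv_le x y; set u := `|dotv x y| => Hu.
  have := sqr_ge0 (enorm x - 1); rewrite /Q => Hx.
  have : 2 * u <= 2 * (enorm x * enorm y) by rewrite ler_wpM2l.
  have : enorm y * (2 * enorm x) <= enorm y * (1 + enorm x ^+ 2) by rewrite ler_wpM2l//; nra.
  nra.
have s1 : enorm y ^+ 2 <= 1 by rewrite expr_le1.
have u1 : 1 <= 3 * (1 + a + b).
  by rewrite -(ler_pM2l Qx) mulr1 mulrCA -Ep Q3.
have v1 : 1 <= 3 * (1 + a - b).
  by rewrite -(ler_pM2l Qx) mulr1 mulrCA -Em Q3// enormN.
have := HC a b _ Ha Hb s1 u1 v1.
rewrite /rho -/(Q x) -/(Q (x + y)) -/(Q (x - y)) Ep Em !exprMn !invfM.
set X := (1 + a + b) ^- m; set Y := (1 + a - b) ^- m; set q := (Q x ^+ m)^-1 => H.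
have q0 : 0 < q by rewrite invr_gt0 exprn_gt0.
rewrite (_ : _ - _ = - (q / 2 * (X + Y - 2))); last by field.
rewrite normrN normrM gtr0_norm ?divr_gt0//.
have Cy : 0 <= C * enorm y ^+ 2 by rewrite mulr_ge0 ?sqr_ge0.
nra.
Qed.


End rho.

Section weight_profile.
Context {R : realType} {d : nat}.
Local Notation V := 'rV[R]_d.
Local Notation mu := (lebesgue_rV R d).
Variables (K : V -> R) (phi : R -> R) (CK l2 b2 : R).
Hypothesis mK : measurable_fun setT K.
Hypothesis K_ge0 : forall y, 0 <= K y.
Hypothesis K_levy : (\int[mu]_y (Num.min 1 (enorm y ^+ 2) * K y)%:E < +oo)%E.
Hypothesis sphi : scale_function phi.
Hypothesis CK_gt1 : 1 < CK.
Hypothesis K_bounds : forall x : V, x != 0 ->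
  CK^-1 / (enorm x ^+ d * phi (enorm x)) <= K x <=
  CK / (enorm x ^+ d * phi (enorm x)).
Hypothesis l2_gt0 : 0 < l2.
Hypothesis b2_gt0 : 0 < b2.
Hypothesis phi_growth : forall r s : R, 0 < r -> r <= s ->
  phi s / phi r <= l2 * (s / r) `^ b2.

Let phi0 : forall r : R, 0 < r -> 0 < phi r := scale_gt0 sphi.
Let phind : forall r s : R, 0 < r -> r <= s -> phi r <= phi s :=
  scale_nondecreasing sphi.

(** The size of the kernel at distance [1 + r]; the shift removes the
    singularity at the origin and keeps the behaviour at infinity. *)
Definition kprofile (r : R) : R := ((1 + r) ^+ d * phi (1 + r))^-1.
Definition kweight (x : V) : R := kprofile (enorm x).

Let p1 (r : R) : 0 <= r -> 0 < 1 + r. Proof. by move=> r0; rewrite ltr_wpDr. Qed.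

Lemma kprofile_gt0 r : 0 <= r -> 0 < kprofile r.
Proof. by move=> r0; rewrite invr_gt0 mulr_gt0 ?exprn_gt0 ?phi0// p1. Qed.

Lemma kweight_gt0 x : 0 < kweight x.
Proof. exact/kprofile_gt0/enorm_ge0. Qed.

Lemma kweight_ge0 x : 0 <= kweight x.
Proof. exact/ltW/kweight_gt0. Qed.

Lemma kprofile_le r s : 0 <= r -> r <= s -> kprofile s <= kprofile r.
Proof.
move=> r0 rs; have s0 := le_trans r0 rs.
rewrite lef_pV2 ?posrE ?mulr_gt0 ?exprn_gt0 ?phi0 ?p1//.
apply: ler_pM; [by rewrite exprn_ge0// ltW// p1|by rewrite ltW// phi0// p1| |].
  by apply: lerXn2r; rewrite ?nnegrE ?lerD2l// ?(ltW (p1 _)).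
by apply: phind; rewrite ?p1// lerD2l.
Qed.

Let growth (A r s : R) : 0 < r -> r <= s -> s <= A * r ->
  phi s <= l2 * A `^ b2 * phi r.
Proof.
move=> r0 rs sAr; have := phi_growth r0 rs.
rewrite ler_pdivrMr ?phi0// => H; apply: (le_trans H).
rewrite ler_wpM2r// ?(ltW (phi0 _))// ler_wpM2l// ?(ltW l2_gt0)//.
have s0 := lt_le_trans r0 rs.
have sr0 : 0 <= s / r by rewrite divr_ge0 ?ltW.
have srA : s / r <= A by rewrite ler_pdivrMr.
by apply: ge0_ler_powR; rewrite ?nnegrE// ?(ltW b2_gt0)//; exact: le_trans srA.
Qed.

Let inv_le (A B X Y : R) : 0 < X -> 0 < Y -> 0 < A -> Y <= A * X -> X^-1 <= A * Y^-1.
Proof.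
move=> X0 Y0 A0 H; rewrite ler_pdivlMr// mulrC ler_pdivrMr//.
Qed.

(** The upper growth bound on [phi] is what makes the profile doubling. *)
Lemma kprofile_doubling : exists2 D, 0 < D & forall r s, 0 <= r -> 0 <= s ->
  r <= 2 * s -> kprofile s <= D * kprofile r.
Proof.
exists (2 ^+ d * (l2 * 2 `^ b2)); first by rewrite !mulr_gt0 ?exprn_gt0 ?powR_gt0.
move=> r s r0 s0 rs.
have h0 : 0 <= r / 2 by rewrite divr_ge0.
apply: (le_trans (kprofile_le h0 _)); first by rewrite ler_pdivrMr// mulrC.
apply: inv_le => //; rewrite ?mulr_gt0 ?exprn_gt0 ?powR_gt0 ?phi0 ?p1//.
rewrite mulrACA -exprMn; apply: ler_pM.
- by rewrite exprn_ge0// ltW// p1.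
- by rewrite ltW// phi0// p1.
- by rewrite lerXn2r ?nnegrE ?mulr_ge0 ?(ltW (p1 _))//; lra.
- apply: growth; rewrite ?p1//; lra.
Qed.

(** Away from the origin [r] and [1 + r] are comparable, so doubling applies. *)
Lemma kernel_le_kweight (e : R) : 0 < e -> exists2 C, 0 < C & forall y,
  e <= enorm y -> K y <= C * kweight y.
Proof.
move=> e0; pose A := 1 + e^-1; have A0 : 0 < A by rewrite p1// invr_ge0 ltW.
exists (CK * (A ^+ d * (l2 * A `^ b2))).
  by rewrite !mulr_gt0 ?exprn_gt0 ?powR_gt0// (lt_trans ltr01).
move=> y ey; have y0 : 0 < enorm y by exact: lt_le_trans ey.
have yn0 : y != 0 by apply: contraTneq y0 => ->; rewrite enorm0 ltxx.
have /andP[_ H] := K_bounds yn0; apply: (le_trans H).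
rewrite -mulrA ler_wpM2l//; first by rewrite ltW// (lt_trans ltr01).
have h : 1 + enorm y <= A * enorm y.
  by rewrite /A mulrDl mul1r [leRHS]addrC lerD2r mulrC ler_pdivlMr// mul1r.
have y1 : 0 < 1 + enorm y by rewrite p1// ltW.
have [py py1] := (phi0 y0, phi0 y1).
apply: inv_le; try pos.
rewrite mulrACA -exprMn; apply: ler_pM.
- by rewrite exprn_ge0// ltW// p1// ltW.
- by rewrite ltW// phi0// p1// ltW.
- by apply: lerXn2r; rewrite ?nnegrE//; pos.
- by apply: growth => //; rewrite lerDr.
Qed.

Lemma kernel_ge_kweight y : y != 0 -> CK^-1 * kweight y <= K y.
Proof.
move=> yn0; have y0 := enorm_gt0 yn0.
have /andP[H _] := K_bounds yn0; apply: le_trans H.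
rewrite ler_wpM2l ?invr_ge0//; first by rewrite ltW// (lt_trans ltr01).
have y1 : 0 < 1 + enorm y by rewrite p1// ltW.
have [py py1] := (phi0 y0, phi0 y1).
rewrite lef_pV2 ?posrE; try pos.
apply: ler_pM; try pos.
  by apply: lerXn2r; rewrite ?nnegrE ?lerDr//; pos.
by apply: phind => //; rewrite lerDr.
Qed.

Lemma measurable_kweight : measurable_fun setT kweight.
Proof.
rewrite (_ : kweight = (fun r : R => kprofile (Num.max 0 r)) \o (@enorm R d)).
  apply: measurableT_comp; last exact: measurable_fun_enorm.
  apply: nonincreasing_measurable => // r s rs.
  have mx (t : R) : 0 <= Num.max 0 t by rewrite le_max lexx.
  by apply: kprofile_le => //; rewrite ge_max mx/= le_max rs orbT.
by apply/funext => x /=; rewrite (max_idPr _)// enorm_ge0.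
Qed.

Lemma kweight_le x : kweight x <= kprofile 0.
Proof. by apply: kprofile_le => //; exact: enorm_ge0. Qed.

(** Outside the unit ball the kernel is integrable; inside, the profile is
    bounded. *)
Lemma kweight_integral_lty : (\int[mu]_x (kweight x)%:E < +oo)%E.
Proof.
apply: (@le_lt_trans _ _ (\int[mu]_x ((kprofile 0 * \1_(eball 0 1) x)%:E +
    (CK * (Num.min 1 (enorm x ^+ 2) * K x))%:E))%E).
  apply: ge0_le_integral => //.
  - by move=> x _; rewrite lee_fin kweight_ge0.
  - by apply/measurable_EFinP; exact: measurable_kweight.
  - apply: emeasurable_funD; apply/measurable_EFinP.
      apply: measurable_funM => //; exact: measurable_eball_indic.
    do 2 apply: measurable_funM => //.
    apply: measurable_minr => //; apply: measurable_funX.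
    exact: measurable_fun_enorm.
  - move=> x _; rewrite -EFinD lee_fin indicE.
    have [x1|x1] := leP (enorm x) 1.
      rewrite mem_set ?eball0E// mulr1 -[leLHS]addr0 lerD ?kweight_le//.
      rewrite !mulr_ge0//; first by rewrite ltW// (lt_trans ltr01).
      by rewrite le_min ler01 sqr_ge0.
    have xn0 : x != 0 by apply: contraTneq x1 => ->; rewrite enorm0 -leNgt ler01.
    rewrite -[leLHS]add0r lerD//.
      by rewrite mulr_ge0// ltW// kprofile_gt0.
    have CK0 : 0 < CK by rewrite (lt_trans ltr01).
    rewrite (min_idPl _) ?mul1r ?exprn_ege1//; last exact: ltW.
    by rewrite -ler_pdivrMl// kernel_ge_kweight.
rewrite ge0_integralD//; last 4 first.
- by move=> x _; rewrite lee_fin mulr_ge0// ltW// kprofile_gt0.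
- apply/measurable_EFinP.
  apply: measurable_funM => //; exact: measurable_eball_indic.
- move=> x _; rewrite lee_fin !mulr_ge0//; first by rewrite ltW// (lt_trans ltr01).
  by rewrite le_min ler01 sqr_ge0.
- apply/measurable_EFinP; do 2 apply: measurable_funM => //.
  apply: measurable_minr => //; apply: measurable_funX.
  exact: measurable_fun_enorm.
apply: lte_add_pinfty.
  under eq_integral do rewrite EFinM.
  rewrite ge0_integralZl ?lee_fin ?(ltW (kprofile_gt0 _))//.
    rewrite integral_indic ?setIT//; last exact: measurable_eball.
    by rewrite lte_mul_pinfty ?lee_fin ?(ltW (kprofile_gt0 _))// lebesgue_eball_lty.
  apply/measurable_EFinP; exact: measurable_eball_indic.
under eq_integral do rewrite EFinM.
rewrite ge0_integralZl ?lee_fin//.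
- rewrite lte_mul_pinfty// lee_fin ltW// (lt_trans ltr01)//.
- apply/measurable_EFinP; apply: measurable_funM => //.
  apply: measurable_minr => //; apply: measurable_funX.
  exact: measurable_fun_enorm.
- by move=> x _; rewrite lee_fin mulr_ge0// le_min ler01 sqr_ge0.
- by rewrite ltW// (lt_trans ltr01).
Qed.

Lemma kweight_doubling : exists2 D : R, 0 < D & forall x y : V,
  enorm x <= 2 * enorm y -> kweight y <= D * kweight x.
Proof.
have [D D0 HD] := kprofile_doubling; exists D => // x y xy.
by apply: HD => //; exact: enorm_ge0.
Qed.

Lemma kweightN x : kweight (- x) = kweight x.
Proof. by rewrite /kweight enormN. Qed.

Let mkw := measurable_kweight.
Let kw0 := kweight_ge0.
Let kwT := kweight_integral_lty.

(** One of the two points in a convolution of radially decreasing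
    doubling functions is at distance at least half of the total. *)
Lemma kweight_conv_le : exists2 C : R, 0 < C & forall x : V,
  (\int[mu]_y (kweight (x - y) * kweight y)%:E <= (C * kweight x)%:E)%E.
Proof.
have [D D0 HD] := kweight_doubling.
set I := \int[mu]_y kweight y.
have I0 : 0 <= I by apply: Rintegral_ge0 => y _.
have IE : (\int[mu]_y (kweight y)%:E)%E = I%:E by exact: ge0_RintegralE.
exists (D * (I + I) + 1) => [|x]; first by apply: ltr_wpDl => //; pos.
have mkx : measurable_fun setT (fun y : V => kweight (x - y)) by mfun.
apply: (@le_trans _ _ (\int[mu]_y ((D * kweight x) * (kweight y + kweight (x - y)))%:E)%E).
  apply: ge0_le_integral_real => [| |y|y]; [by mfun|by mfun|by rewrite mulr_ge0|].
  have : enorm x <= enorm y + enorm (x - y) by rewrite -[in leLHS](subrK y x) addrC enormD.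
  have := HD x y; have := HD x (x - y); have := kw0 y; have := kw0 (x - y); have := kw0 x.
  have [xy|xy] := leP (enorm x) (2 * enorm y).
    move=> a b c _ /(_ isT) H _.
    rewrite mulrDr [leLHS]mulrC; apply: (@le_trans _ _ (D * kweight x * kweight (x - y))).
      by rewrite ler_wpM2r.
    by rewrite lerDr; apply: mulr_ge0 => //; apply: mulr_ge0 => //; exact: ltW.
  move=> a b c H _ E; have {}H := H _.
  apply: (@le_trans _ _ (D * kweight x * kweight y)).
    by rewrite ler_wpM2r// H//; lra.
  by rewrite mulrDr lerDl; apply: mulr_ge0 => //; apply: mulr_ge0 => //; exact: ltW.
rewrite ge0_integralZl_real; [|by mfun|by move=> y; exact: addr_ge0|by pos].
rewrite ge0_integralD_real//.
have -> : (\int[mu]_y (kweight (x - y))%:E)%E = I%:E.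
  rewrite -IE -(ge0_integral_rV_shift (- x) (f := fun y : V => (kweight y)%:E)); [|by mfun|by move=> y; rewrite lee_fin].
  by apply: eq_integral => y _; rewrite -kweightN opprB.
rewrite IE -EFinD -EFinM lee_fin mulrAC mulrDl lerDl; exact: mulr_ge0.
Qed.

Variable m : nat.
Hypothesis m_ge : d%:R + b2 <= m%:R.

(** The growth of [r^d * phi r] is at most polynomial, of degree [d + b2], which
    the exponent [m] exceeds. *)
Lemma rho_le_kweight : exists2 C : R, 0 < C & forall x : V, rho m x <= C * kweight x.
Proof.
exists (2 ^+ m * (l2 * phi 1)); first by rewrite !mulr_gt0 ?exprn_gt0 ?phi0.
move=> x; rewrite /rho /kweight /kprofile; set r := enorm x.
have r0 : 0 <= r by exact: enorm_ge0.
have h1 : 0 < 1 + r by rewrite p1.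
apply: inv_le; rewrite ?mulr_gt0 ?exprn_gt0 ?phi0//; first by rewrite ltr_wpDr ?sqr_ge0.
have H : phi (1 + r) <= l2 * (1 + r) `^ b2 * phi 1.
  by apply: growth => //; rewrite ?lerDl// mulr1.
apply: (le_trans (ler_wpM2l _ H)); first by rewrite exprn_ge0// ltW.
have -> : (1 + r) ^+ d * (l2 * (1 + r) `^ b2 * phi 1) =
   ((1 + r) ^+ d * (1 + r) `^ b2) * (l2 * phi 1) by ring.
have -> : 2 ^+ m * (l2 * phi 1) * (1 + r ^+ 2) ^+ m =
   (2 ^+ m * (1 + r ^+ 2) ^+ m) * (l2 * phi 1) by ring.
rewrite ler_wpM2r ?mulr_ge0 ?(ltW (phi0 _)) ?(ltW l2_gt0)// -exprMn.
rewrite -powR_mulrn ?(ltW h1)// -powRD; last by rewrite (gt_eqF h1) implybT.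
apply: (@le_trans _ _ ((1 + r) `^ m%:R)); first by rewrite ler_powR// lerDl.
rewrite powR_mulrn ?(ltW h1)//; apply: lerXn2r; rewrite ?nnegrE ?(ltW h1)//; first by pos.
rewrite -subr_ge0 (_ : _ - _ = (r - 2^-1) ^+ 2 + r ^+ 2 + 3 / 4); last by field.
by rewrite !addr_ge0// ?sqr_ge0// divr_ge0.
Qed.

End weight_profile.

Section weight.
Context {R : realType} {d : nat}.
Local Notation V := 'rV[R]_d.
Local Notation mu := (lebesgue_rV R d).
Variables (rh kw : V -> R) (Crk Ckk : R).
Hypothesis mrho : measurable_fun setT rh.
Hypothesis mkw : measurable_fun setT kw.
Hypothesis rho0 : forall x, 0 <= rh x.
Hypothesis rho_le1 : forall x, rh x <= 1.
Hypothesis kw0 : forall x, 0 <= kw x.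
Hypothesis kwN : forall x : V, kw (- x) = kw x.
Hypothesis kwT : (\int[mu]_x (kw x)%:E < +oo)%E.
Hypothesis Crk_gt0 : 0 < Crk.
Hypothesis rho_le_kw : forall x, rh x <= Crk * kw x.
Hypothesis Ckk_gt0 : 0 < Ckk.
Hypothesis kw_conv : forall x : V,
  (\int[mu]_y (kw (x - y) * kw y)%:E <= (Ckk * kw x)%:E)%E.

(** The convolution gives the weight the size of [kw] and the smoothness of [rh]:
    estimates for differences of [rh] pass under the integral, and integral
    estimates for [kw] pass through by associativity. *)
Definition weight (x : V) : R := \int[mu]_z (rh (x - z) * kw z).

Let mint (x : V) : measurable_fun setT (fun z : V => rh (x - z) * kw z).
Proof. by mfun. Qed.

Let int_ge0 (x z : V) : 0 <= rh (x - z) * kw z.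
Proof. by rewrite mulr_ge0. Qed.

Let int_lty (x : V) : (\int[mu]_z (rh (x - z) * kw z)%:E < +oo)%E.
Proof.
apply: le_lt_trans kwT; apply: ge0_le_integral_real => [||z|z]; [exact: mint|exact: mkw|exact: int_ge0|].
by rewrite ler_piMl.
Qed.

Lemma weightE x : (\int[mu]_z (rh (x - z) * kw z)%:E)%E = (weight x)%:E.
Proof. by apply: ge0_RintegralE; [exact: int_ge0|exact: int_lty]. Qed.

Let int_int (x : V) : mu.-integrable setT (EFin \o (fun z : V => rh (x - z) * kw z)).
Proof. by apply: integrable_ge0; [exact: mint|exact: int_ge0|exact: int_lty]. Qed.

Lemma weight_le_kweight : exists2 C : R, 0 < C & forall x : V, weight x <= C * kw x.
Proof.
exists (Crk * Ckk); first exact: mulr_gt0.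
move=> x; rewrite -lee_fin -weightE.
apply: (@le_trans _ _ (\int[mu]_y (Crk * (kw (x - y) * kw y))%:E)%E).
  apply: ge0_le_integral_real => [| |z|z]; [exact: mint|by mfun|exact: int_ge0|].
  by rewrite mulrA ler_wpM2r.
rewrite ge0_integralZl_real; [|by mfun|by move=> y; rewrite mulr_ge0|exact: ltW].
by rewrite -mulrA EFinM lee_pmul2l ?lte_fin.
Qed.

Lemma weight_ge0 x : 0 <= weight x.
Proof. by apply: Rintegral_ge0 => z _. Qed.

Lemma measurable_weight : measurable_fun setT weight.
Proof.
apply/measurable_EFinP; rewrite (_ : _ \o _ = fun x => (\int[mu]_z (rh (x - z) * kw z)%:E)%E).
  apply: (measurable_tonelli1 (fun x z : V => (rh (x - z) * kw z)%:E)).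
    by mfun.
  by move=> x z; rewrite lee_fin.
by apply/funext => x; rewrite weightE.
Qed.

Lemma weight_integral_lty : (\int[mu]_x (weight x)%:E < +oo)%E.
Proof.
have [C C0 HC] := weight_le_kweight.
apply: (@le_lt_trans _ _ (\int[mu]_x (C * kw x)%:E)%E).
  apply: ge0_le_integral_real => //; [exact: measurable_weight|by mfun|exact: weight_ge0].
rewrite ge0_integralZl_real//; last exact: ltW.
by rewrite lte_mul_pinfty// lee_fin ltW.
Qed.

Lemma weight_harnack (r C : R) : 0 < C ->
  (forall x x' : V, enorm (x - x') <= r -> rh x' <= C * rh x) ->
  forall x x' : V, enorm (x - x') <= r -> weight x' <= C * weight x.
Proof.
move=> C0 HC x x' xr.
rewrite -lee_fin EFinM -!weightE -ge0_integralZl_real//; last exact: ltW.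
apply: ge0_le_integral_real => [| |z|z]; [exact: mint|by mfun|exact: int_ge0|].
rewrite mulrA ler_wpM2r// HC//.
by rewrite (_ : x - z - (x' - z) = x - x')//; rVring.
Qed.

Lemma weight_second_difference (C : R) : 0 <= C ->
  (forall x y : V, enorm y <= 1 ->
    `|rh x - (rh (x + y) + rh (x - y)) / 2| <= C * enorm y ^+ 2 * rh x) ->
  forall x y : V, enorm y <= 1 ->
  `|weight x - (weight (x + y) + weight (x - y)) / 2| <= C * enorm y ^+ 2 * weight x.
Proof.
move=> C0 HC x y y1.
have E : weight x - (weight (x + y) + weight (x - y)) / 2 =
    \int[mu]_z ((rh (x - z) - (rh (x - z + y) + rh (x - z - y)) / 2) * kw z).
  have i1 := int_int x; have i2 := int_int (x + y); have i3 := int_int (x - y).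
  rewrite /weight mulrDl -(RintegralZr _ _ i2)// -(RintegralZr _ _ i3)//.
  have i2' := integrableZr measurableT 2^-1 i2.
  have i3' := integrableZr measurableT 2^-1 i3.
  rewrite -RintegralD// -RintegralB//; last exact: (integrableD measurableT i2' i3').
  apply: eq_Rintegral => z _.
  rewrite (_ : x + y - z = x - z + y); last by rVring.
  rewrite (_ : x - y - z = x - z - y); last by rVring.
  ring.
rewrite E.
have md : measurable_fun setT (fun z : V => (rh (x - z) - (rh (x - z + y) + rh (x - z - y)) / 2) * kw z) by mfun.
have bd z : `|(rh (x - z) - (rh (x - z + y) + rh (x - z - y)) / 2) * kw z| <=
    C * enorm y ^+ 2 * (rh (x - z) * kw z).
  by rewrite normrM (ger0_norm (kw0 z)) mulrA ler_wpM2r// HC.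
have Cy : 0 <= C * enorm y ^+ 2 by rewrite mulr_ge0 ?sqr_ge0.
have fin : (\int[mu]_z (C * enorm y ^+ 2 * (rh (x - z) * kw z))%:E < +oo)%E.
  by rewrite ge0_integralZl_real// lte_mul_pinfty// lee_fin.
have mb : measurable_fun setT (fun z : V => C * enorm y ^+ 2 * (rh (x - z) * kw z)) by mfun.
apply: (le_trans (le_normr_Rintegral _ _)) => //.
  exact: (integrable_dominated md mb bd fin).
rewrite -[leRHS]RintegralZl//; apply: le_Rintegral => //.
- apply: (@integrable_dominated _ _ _ _ _ _ _ mb) fin => [|z]; first exact: measurableT_comp.
  by rewrite normr_id.
- by apply: integrable_ge0 => // z; exact: mulr_ge0.
Qed.

(** A convolution of [kw] with itself is controlled by [kw]; convolving with [rh]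
    keeps the inequality. *)
Lemma weight_conv_le : exists2 C : R, 0 < C & forall x : V,
  (\int[mu]_y (weight (x - y) * kw y)%:E <= (C * weight x)%:E)%E /\
  (\int[mu]_y (weight (x + y) * kw y)%:E <= (C * weight x)%:E)%E.
Proof.
exists Ckk => // x.
have mw := measurable_weight.
have H : (\int[mu]_y (weight (x - y) * kw y)%:E <= (Ckk * weight x)%:E)%E.
  have -> : (\int[mu]_y (weight (x - y) * kw y)%:E =
     \int[mu]_y \int[mu]_z (rh (x - z) * kw (z - y) * kw y)%:E)%E.
    apply: eq_integral => y _; rewrite EFinM -weightE muleC -ge0_integralZl_real//.
    have mm : measurable_fun setT (fun z : V => (kw y * (rh (x - y - z) * kw z))%:E).
      apply/measurable_EFinP; apply: measurable_funM; first exact: measurable_cst.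
      exact: (mint (x - y)).
    rewrite -(ge0_integral_rV_shift (- y) mm); last by move=> z; rewrite lee_fin !mulr_ge0.
    apply: eq_integral => z _; congr EFin.
    rewrite (_ : x - y - (z - y) = x - z); last by rVring.
    by rewrite [LHS]mulrC.
  rewrite (tonelli (fun y z : V => (rh (x - z) * kw (z - y) * kw y)%:E)); last 2 first.
  - by mfun.
  - by move=> y z; rewrite lee_fin !mulr_ge0.
  rewrite EFinM -weightE -ge0_integralZl_real//; last exact: ltW.
  apply: ge0_le_integral => //.
  - by move=> z _; apply: integral_ge0 => y _; rewrite lee_fin !mulr_ge0.
  - apply: (measurable_tonelli2 (fun y z : V => (rh (x - z) * kw (z - y) * kw y)%:E)).
      by mfun.
    by move=> y z; rewrite lee_fin !mulr_ge0.
  - by mfun.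
  - move=> z _; under eq_integral do rewrite -mulrA.
    rewrite ge0_integralZl_real//; [|by mfun|by move=> y; exact: mulr_ge0].
    rewrite (_ : Ckk * _ = rh (x - z) * (Ckk * kw z)); last by ring.
    by rewrite EFinM lee_wpmul2l// lee_fin.
split; first exact: H.
apply: le_trans H.
rewrite -(ge0_integral_rV_opp (f := fun y : V => (weight (x - y) * kw y)%:E)); [|by mfun|by move=> y; rewrite lee_fin mulr_ge0// weight_ge0].
apply: ge0_le_integral_real => [| |y|y]; [by mfun|by mfun|by rewrite mulr_ge0// weight_ge0|].
by rewrite opprK kwN.
Qed.

End weight.

(** * The symbol of the operator *)

Section product_sigma_finite.
Context d1 d2 (T1 : measurableType d1) (T2 : measurableType d2) (R : realType).
Variable m1 : {sigma_finite_measure set T1 -> \bar R}.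
Variable m2 : {sigma_finite_measure set T2 -> \bar R}.

Lemma product_sigma_finite : sigma_finite setT (m1 \x m2)%E.
Proof.
have [F FT Foo] := sigma_finiteT m1; have [G GT Goo] := sigma_finiteT m2.
pose rect (n : nat) : set (T1 * T2) :=
  if unpickle n is Some (i, j) then F i `*` G j else set0.
exists rect => [|n].
  apply/esym; rewrite -subTset => -[x y] _.
  have [i _ Fx] : (\bigcup_i F i) x by rewrite -FT.
  have [j _ Gy] : (\bigcup_j G j) y by rewrite -GT.
  by exists (pickle (i, j)) => //; rewrite /rect pickleK.
rewrite /rect; case: (@unpickle (nat * nat)%type n) => [[i j]|]; last by rewrite measure0.
have [mF Fi] := Foo i; have [mG Gj] := Goo j; split; first exact: measurableX.
by rewrite product_measure1E// lte_mul_pinfty// ge0_fin_numE.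
Qed.

Definition product_sfm : {sigma_finite_measure set (T1 * T2)%type -> \bar R} :=
  HB.pack (m1 \x m2)%E (Measure_isSigmaFinite.Build _ _ _ (m1 \x m2)%E product_sigma_finite).

End product_sigma_finite.

Section sine_cosine_bounds.
Context {R : realType}.
Implicit Types x y : R.

Let sin_le0 x : 0 <= x -> sin x <= x.
Proof.
rewrite le_eqVlt => /predU1P[<-|x0]; first by rewrite sin0.
have [c _] : exists2 c, c \in `]0, x[%R & sin x - sin 0 = cos c * (x - 0).
  apply: (@MVT _ (@sin R) (@cos R)) => //.
  by apply: continuous_subspaceT; exact: continuous_sin.
rewrite sin0 !subr0 => ->; rewrite ler_piMl ?cos_le1//; exact: ltW.
Qed.

Lemma norm_sin_le x : `|sin x| <= `|x|.
Proof.
have H y : 0 <= y -> `|sin y| <= y.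
  move=> y0; rewrite ler_norml sin_le0// andbT.
  have [y1|y1] := lerP y 1.
    rewrite (le_trans _ (sin_ge0_pi _)) ?oppr_le0// y0/=.
    by rewrite (le_trans y1)// (le_trans _ (pi_ge2 _))// ler1n.
  by rewrite (le_trans _ (sin_geN1 y))// lerN2 ltW.
have [x0|x0] := leP 0 x; first by rewrite (ger0_norm x0) H.
rewrite -normrN -sinN -[leRHS]normrN (ger0_norm (x := - x)); first by apply: H; rewrite oppr_ge0 ltW.
by rewrite oppr_ge0 ltW.
Qed.

Lemma one_sub_cos_ge0 x : 0 <= 1 - cos x.
Proof. by rewrite subr_ge0 cos_le1. Qed.

Lemma one_sub_cos_le x : 1 - cos x <= x ^+ 2 / 2.
Proof.
have -> : cos x = 1 - (sin (x / 2) ^+ 2) *+ 2.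
  have -> : cos x = cos ((x / 2) *+ 2) by rewrite -[(_ / 2) *+ 2]mulr_natr divfK.
  rewrite cos_mulr2n cos2sin2; ring.
rewrite opprB addrCA subrr addr0 -mulr_natl.
have : sin (x / 2) ^+ 2 <= (x / 2) ^+ 2.
  rewrite -(real_normK (num_real (sin _))) -(real_normK (num_real (x / 2))).
  by apply: lerXn2r; rewrite ?nnegrE// norm_sin_le.
by rewrite exprMn; set s := sin _ ^+ 2; rewrite (_ : 2^-1 ^+ 2 = 4^-1 :> R); [lra|field].
Qed.

End sine_cosine_bounds.

Section kernel_symbol.
Context {R : realType} {d : nat}.
Local Notation V := 'rV[R]_d.
Local Notation mu := (lebesgue_rV R d).
Variable K : V -> R.
Hypothesis mK : measurable_fun setT K.
Hypothesis K_ge0 : forall y, 0 <= K y.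
Hypothesis K_levy : (\int[mu]_y (Num.min 1 (enorm y ^+ 2) * K y)%:E < +oo)%E.

Definition levy_mass : R := \int[mu]_y (Num.min 1 (enorm y ^+ 2) * K y).

Lemma min1_sqr_ge0 (y : V) : 0 <= Num.min 1 (enorm y ^+ 2).
Proof. by rewrite le_min ler01 sqr_ge0. Qed.

Lemma levy_massE :
  (\int[mu]_y (Num.min 1 (enorm y ^+ 2) * K y)%:E)%E = levy_mass%:E.
Proof. by apply: ge0_RintegralE => // y; rewrite mulr_ge0// min1_sqr_ge0. Qed.

Lemma levy_mass_ge0 : 0 <= levy_mass.
Proof. by apply: Rintegral_ge0 => y _; rewrite mulr_ge0// min1_sqr_ge0. Qed.

Lemma measurable_levy_integrand :
  measurable_fun setT (fun y : V => Num.min 1 (enorm y ^+ 2) * K y).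
Proof. by mfun. Qed.

Lemma one_sub_cos_dotv_le (xi y : V) :
  1 - cos (dotv xi y) <= 2 * (1 + enorm xi ^+ 2) * Num.min 1 (enorm y ^+ 2).
Proof.
have h : 0 <= enorm xi ^+ 2 by rewrite sqr_ge0.
have [y1|y1] := leP 1 (enorm y ^+ 2).
  by have := cos_geN1 (dotv xi y); lra.
apply: (le_trans (one_sub_cos_le _)).
have : dotv xi y ^+ 2 <= enorm xi ^+ 2 * enorm y ^+ 2.
  rewrite -exprMn -(real_normK (num_real (dotv xi y))).
  by apply: lerXn2r; rewrite ?nnegrE ?dotv_le// mulr_ge0 ?enorm_ge0.
have := sqr_ge0 (enorm y); nra.
Qed.

Lemma measurable_symbol_integrand (xi : V) :
  measurable_fun setT (fun y : V => (1 - cos (dotv xi y)) * K y).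
Proof.
apply: measurable_funM => //; apply: measurable_funB => //.
apply: (measurableT_comp (f := @cos R)); last by mfun.
exact: (continuous_measurable_fun (@continuous_cos R)).
Qed.

Let integrand_ge0 (xi y : V) : 0 <= (1 - cos (dotv xi y)) * K y.
Proof. by rewrite mulr_ge0// one_sub_cos_ge0. Qed.

Let integrand_le (xi : V) : (\int[mu]_y ((1 - cos (dotv xi y)) * K y)%:E <=
  (2 * (1 + enorm xi ^+ 2) * levy_mass)%:E)%E.
Proof.
have h : 0 <= enorm xi ^+ 2 by rewrite sqr_ge0.
rewrite EFinM -levy_massE -ge0_integralZl_real; last 3 first.
- exact: measurable_levy_integrand.
- by move=> y; rewrite mulr_ge0// min1_sqr_ge0.
- by rewrite mulr_ge0// addr_ge0.
apply: ge0_le_integral_real.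
- exact: measurable_symbol_integrand.
- apply: measurable_funM => //; exact: measurable_levy_integrand.
- exact: integrand_ge0.
- by move=> y; rewrite mulrA ler_wpM2r// one_sub_cos_dotv_le.
Qed.

Lemma symbolE (xi : V) :
  (\int[mu]_y ((1 - cos (dotv xi y)) * K y)%:E)%E = (symbol K xi)%:E.
Proof.
apply: ge0_RintegralE; first exact: integrand_ge0.
by apply: le_lt_trans (integrand_le _) _; rewrite ltry.
Qed.

Lemma symbol_ge0 (xi : V) : 0 <= symbol K xi.
Proof. by apply: Rintegral_ge0 => y _; exact: integrand_ge0. Qed.

(** [1 - cos] is quadratic near [0] and bounded, hence integrable against a kernel
    with a finite second moment near the origin and finite mass at infinity. *)
Lemma symbol_le (xi : V) : symbol K xi <= 2 * (1 + enorm xi ^+ 2) * levy_mass.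
Proof. by rewrite -lee_fin -symbolE. Qed.

Lemma measurable_symbol : measurable_fun setT (symbol K).
Proof.
apply/measurable_EFinP; rewrite (_ : _ \o _ =
  fun xi : V => (\int[mu]_y ((1 - cos (dotv xi y)) * K y)%:E)%E); last first.
  by apply/funext => xi /=; rewrite symbolE.
apply: (measurable_tonelli1 (fun xi y : V => ((1 - cos (dotv xi y)) * K y)%:E)).
  apply/measurable_EFinP; apply: measurable_funM; last first.
    by apply: (measurableT_comp mK); exact: measurable_snd.
  apply: measurable_funB => //.
  apply: (measurableT_comp (f := @cos R)); last by mfun.
  exact: (continuous_measurable_fun (@continuous_cos R)).
by move=> xi y; rewrite lee_fin; exact: integrand_ge0.
Qed.

End kernel_symbol.

(** Bounded superpositions of cosines.  The frequencies are carried by an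
    abstract measure space so that the class is closed under products. *)
Definition cosine_superposition (R : realType) d (Phi : 'rV[R]_d -> R) : Prop :=
  exists (dO : measure_display) (O : measurableType dO)
    (nu : {sigma_finite_measure set O -> \bar R}) (g : O -> R) (xi : O -> 'rV[R]_d)
    (B : R),
  [/\ measurable_fun setT g /\ measurable_fun setT xi,
      (forall w, 0 <= g w) /\ (\int[nu]_w (g w)%:E < +oo)%E,
      forall w, enorm (xi w) <= B,
      forall x, Phi x = \int[nu]_w (g w * cos (dotv (xi w) x)) &
      forall x, \int[nu]_w (g w * sin (dotv (xi w) x)) = 0].

Section cosine_superposition_closure.
Context {R : realType} {d : nat}.
Local Notation V := 'rV[R]_d.

Let mcos := continuous_measurable_fun (@continuous_cos R).
Let msin := continuous_measurable_fun (@continuous_sin R).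

(** A product of cosines is the average of the cosines of the sum and the
    difference of the frequencies; [bool] labels the two. *)
Lemma cosine_superpositionM (F G : V -> R) :
  cosine_superposition F -> cosine_superposition G ->
  cosine_superposition (fun x => F x * G x).
Proof.
case=> da [Om1 [n1 [g1 [x1 [BA [mgx1 gg1 xB1 FE sinA]]]]]].
have [mg1 mx1] := mgx1; have [g10 ig1] := gg1.
case=> db [Om2 [n2 [g2 [x2 [BB [mgx2 gg2 xB2 GE sinB]]]]]].
have [mg2 mx2] := mgx2; have [g20 ig2] := gg2.
pose nu := product_sfm n1 n2.
pose g (w : Om1 * Om2) := g1 w.1 * g2 w.2.
pose xi (w : Om1 * Om2) := x1 w.1 + x2 w.2.
have g0 w : 0 <= g w by rewrite mulr_ge0.
have mg : measurable_fun setT g by rewrite /g; mfun.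
have mxi : measurable_fun setT xi by rewrite /xi; mfun.
have ig : (\int[nu]_w (g w)%:E < +oo)%E.
  rewrite fubini_tonelli1; [|by mfun|by move=> w; rewrite lee_fin].
  rewrite /fubini_F /g /=.
  have -> : (\int[n1]_x \int[n2]_y (g1 x * g2 y)%:E =
      \int[n1]_x (fine (\int[n2]_y (g2 y)%:E) * g1 x)%:E)%E.
    apply: eq_integral => w _; rewrite ge0_integralZl_real// muleC EFinM fineK//.
    by rewrite ge0_fin_numE// integral_ge0// => y _; rewrite lee_fin.
  rewrite ge0_integralZl_real// ?fine_ge0// ?integral_ge0//; last first.
    by move=> y _; rewrite lee_fin.
  by rewrite lte_mul_pinfty// lee_fin fine_ge0// integral_ge0// => y _; rewrite lee_fin.
have bint (dd : measure_display) (O : measurableType dd)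
    (nn : {sigma_finite_measure set O -> \bar R}) (gg : O -> R) (f : O -> R) :
    measurable_fun setT gg -> (forall w, 0 <= gg w) -> (\int[nn]_w (gg w)%:E < +oo)%E ->
    measurable_fun setT f -> (forall w, `|f w| <= 1) ->
    nn.-integrable setT (EFin \o (fun w => gg w * f w)).
  move=> mgg gg0 ggT mf f1; apply: (integrable_dominated _ mgg _ ggT).
    exact: measurable_funM.
  by move=> w; rewrite normrM ger0_norm// ler_piMr.
have prodE (p1 : Om1 -> R) (p2 : Om2 -> R) : measurable_fun setT p1 -> measurable_fun setT p2 ->
    (forall w, `|p1 w| <= 1) -> (forall w, `|p2 w| <= 1) ->
    nu.-integrable setT (EFin \o (fun w => g w * (p1 w.1 * p2 w.2))) /\
    \int[nu]_w (g w * (p1 w.1 * p2 w.2)) =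
    (\int[n1]_w (g1 w * p1 w)) * (\int[n2]_w (g2 w * p2 w)).
  move=> mp1 mp2 p11 p21.
  have ii : nu.-integrable setT (EFin \o (fun w => g w * (p1 w.1 * p2 w.2))).
    apply: (bint _ _ _ g) => //; first by mfun.
    by move=> w; rewrite normrM -[leRHS]mul1r ler_pM.
  split=> //; rewrite /Rintegral -integral12_prod_meas1//.
  have i1 := bint _ _ n1 g1 p1 mg1 g10 ig1 mp1 p11.
  have i2 := bint _ _ n2 g2 p2 mg2 g20 ig2 mp2 p21.
  have -> : (\int[n1]_x fubini_F n2 (fun w => (g w * (p1 w.1 * p2 w.2))%:E) x =
     \int[n1]_x ((g1 x * p1 x) * \int[n2]_y (g2 y * p2 y))%:E)%E.
    apply: eq_integral => w _; rewrite /fubini_F /g/=.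
    rewrite EFinM /Rintegral fineK; last exact: integrable_fin_num.
    rewrite -integralZl//; apply: eq_integral => y _.
    by rewrite -EFinM; congr EFin; ring.
  by rewrite -RintegralZr.
have c1 x w : `|cos (dotv (x1 w) x)| <= 1 by exact: cos_max.
have c2 x w : `|cos (dotv (x2 w) x)| <= 1 by exact: cos_max.
have s1 x w : `|sin (dotv (x1 w) x)| <= 1 by exact: sin_max.
have s2 x w : `|sin (dotv (x2 w) x)| <= 1 by exact: sin_max.
have md1 x : measurable_fun setT (fun w => dotv (x1 w) x) by mfun.
have md2 x : measurable_fun setT (fun w => dotv (x2 w) x) by mfun.
have mc1 x := measurableT_comp mcos (md1 x).
have mc2 x := measurableT_comp mcos (md2 x).
have ms1 x := measurableT_comp msin (md1 x).
have ms2 x := measurableT_comp msin (md2 x).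
exists _, _, nu, g, xi, (BA + BB); split=> //.
- by move=> w; rewrite (le_trans (enormD _ _))// lerD.
- move=> x.
  have [i1 E1] := prodE _ _ (mc1 x) (mc2 x) (c1 x) (c2 x).
  have [i2 E2] := prodE _ _ (ms1 x) (ms2 x) (s1 x) (s2 x).
  transitivity (\int[nu]_w (g w * (cos (dotv (x1 w.1) x) * cos (dotv (x2 w.2) x)) -
     g w * (sin (dotv (x1 w.1) x) * sin (dotv (x2 w.2) x)))).
    by rewrite RintegralB// E1 E2 sinA mul0r subr0 FE GE.
  by apply: eq_Rintegral => w _; rewrite dotvDl cosD; ring.
- move=> x.
  have [i1 E1] := prodE _ _ (ms1 x) (mc2 x) (s1 x) (c2 x).
  have [i2 E2] := prodE _ _ (mc1 x) (ms2 x) (c1 x) (s2 x).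
  transitivity (\int[nu]_w (g w * (sin (dotv (x1 w.1) x) * cos (dotv (x2 w.2) x)) +
     g w * (cos (dotv (x1 w.1) x) * sin (dotv (x2 w.2) x)))).
    by apply: eq_Rintegral => w _; rewrite dotvDl sinD; ring.
  by rewrite RintegralD// E1 E2 sinA sinB mul0r mulr0 addr0.
Qed.

End cosine_superposition_closure.

(** * The operator as a Fourier multiplier *)

Section Rintegral_fubini.
Context {d1' d2' : measure_display} {T1 : measurableType d1'} {T2 : measurableType d2'} {R : realType}.
Variable m1 : {sigma_finite_measure set T1 -> \bar R}.
Variable m2 : {sigma_finite_measure set T2 -> \bar R}.
Variable f : T1 -> T2 -> R.
Hypothesis mf : measurable_fun setT (fun z : T1 * T2 => f z.1 z.2).
Hypothesis foo : (\int[m1]_x \int[m2]_y `|f x y|%:E < +oo)%E.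

Let F (z : T1 * T2) : \bar R := (f z.1 z.2)%:E.

Let mF : measurable_fun setT F. Proof. by apply/measurable_EFinP. Qed.

Lemma integrable_product : (m1 \x m2)%E.-integrable setT F.
Proof. by apply/(integrable12ltyP _ _ mF). Qed.

Let fine_le (a : \bar R) : (`|(fine a)%:E| <= `|a|)%E.
Proof. by case: a => [r| |] //=; rewrite ?normr0 ?leey. Qed.

Let mfine : measurable_fun setT (@fine R).
Proof. exact: fine_measurable. Qed.

Lemma integrable_Rintegral1 :
  m1.-integrable setT (EFin \o (fun x => \int[m2]_y f x y)).
Proof.
have iF := integrable_fubini_F integrable_product.
have mFF := measurable_int _ iF.
apply: (le_integrable measurableT _ _ iF) => [|x _]; last exact: fine_le.
by apply/measurable_EFinP; apply: (measurableT_comp mfine).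
Qed.

Let fine_ae dT (T : measurableType dT) (m : {measure set T -> \bar R}) (G : T -> \bar R) :
  m.-integrable setT G -> (\int[m]_x (fine (G x))%:E = \int[m]_x G x)%E.
Proof.
move=> iG; have mG := measurable_int _ iG.
apply: ae_eq_integral => //.
  by apply/measurable_EFinP; apply: (measurableT_comp mfine).
by apply: filterS (integrable_ae measurableT iG) => x H Dx; rewrite fineK// H.
Qed.

Lemma fine_fubini_F : (\int[m1]_x (\int[m2]_y f x y)%:E =
  \int[m1]_x \int[m2]_y (f x y)%:E)%E.
Proof. exact: (fine_ae (integrable_fubini_F integrable_product)). Qed.

End Rintegral_fubini.

Section Rintegral_fubini_swap.
Context {d1' d2' : measure_display} {T1 : measurableType d1'} {T2 : measurableType d2'} {R : realType}.
Variable m1 : {sigma_finite_measure set T1 -> \bar R}.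
Variable m2 : {sigma_finite_measure set T2 -> \bar R}.
Variable f : T1 -> T2 -> R.
Hypothesis mf : measurable_fun setT (fun z : T1 * T2 => f z.1 z.2).
Hypothesis foo : (\int[m1]_x \int[m2]_y `|f x y|%:E < +oo)%E.

Let mf' : measurable_fun setT (fun z : T2 * T1 => f z.2 z.1).
Proof. exact: (measurableT_comp mf (@measurable_swap _ _ T2 T1)). Qed.

Let foo' : (\int[m2]_y \int[m1]_x `|f x y|%:E < +oo)%E.
Proof.
rewrite -(tonelli (fun x y => `|f x y|%:E))//.
by apply/measurable_EFinP; exact: measurableT_comp.
Qed.

Lemma integrable_Rintegral2 :
  m2.-integrable setT (EFin \o (fun y => \int[m1]_x f x y)).
Proof. exact: (integrable_Rintegral1 (f := fun y x => f x y) mf' foo'). Qed.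

Lemma Rintegral_fubini :
  \int[m1]_x \int[m2]_y f x y = \int[m2]_y \int[m1]_x f x y.
Proof.
rewrite [LHS]/Rintegral [RHS]/Rintegral; congr fine.
rewrite (fine_fubini_F mf foo) (fine_fubini_F (f := fun y x => f x y) mf' foo').
exact: (Fubini (integrable_product mf foo)).
Qed.

End Rintegral_fubini_swap.

Section measurable_sections.
Context {d1' d2' d3' : measure_display} {T1 : measurableType d1'}
  {T2 : measurableType d2'} {U : measurableType d3'}.
Variable f : T1 -> T2 -> U.
Hypothesis mf : measurable_fun setT (fun z : T1 * T2 => f z.1 z.2).

Lemma measurable_sect1 x : measurable_fun setT (f x).
Proof. exact: (measurableT_comp mf (measurable_pair1 x)). Qed.

Lemma measurable_sect2 y : measurable_fun setT (f ^~ y).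
Proof. exact: (measurableT_comp mf (measurable_pair2 y)). Qed.

End measurable_sections.

Section integral_shift.
Context {R : realType} {d : nat}.
Local Notation V := 'rV[R]_d.
Local Notation mu := (lebesgue_rV R d).

Lemma integral_rV_shift (a : V) (f : V -> \bar R) : measurable_fun setT f ->
  (\int[mu]_x f (x + a)%R = \int[mu]_x f x)%E.
Proof.
move=> mf; rewrite [LHS]integralE [RHS]integralE; congr (_ - _)%E.
  rewrite -(ge0_integral_rV_shift a (f := f^\+%E)); last by move=> x; exact: funepos_ge0.
    by apply: eq_integral => x _; rewrite !funeposE.
  exact: measurable_funepos.
rewrite -(ge0_integral_rV_shift a (f := f^\-%E)); last by move=> x; exact: funeneg_ge0.
  by apply: eq_integral => x _; rewrite !funenegE.
exact: measurable_funeneg.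
Qed.

Lemma Rintegral_rV_shift (a : V) (f : V -> R) : measurable_fun setT f ->
  \int[mu]_x f (x + a) = \int[mu]_x f x.
Proof.
move=> mf; rewrite /Rintegral (integral_rV_shift a (f := EFin \o f))//.
by apply/measurable_EFinP.
Qed.

Lemma integrable_rV_shift (a : V) (f : V -> R) : mu.-integrable setT (EFin \o f) ->
  mu.-integrable setT (EFin \o (fun x => f (x + a))).
Proof.
move=> /integrableP[/measurable_EFinP mf foo]; apply/integrableP; split.
  by apply/measurable_EFinP; mfun.
move: foo; rewrite -(ge0_integral_rV_shift a)//.
by apply: measurableT_comp => //; apply/measurable_EFinP.
Qed.

End integral_shift.

Local Opaque cos sin expR enorm dotv.

Section fourier_multiplier.
Context {R : realType} {d : nat}.
Local Notation V := 'rV[R]_d.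
Local Notation mu := (lebesgue_rV R d).
Variable K : V -> R.
Hypothesis mK : measurable_fun setT K.
Hypothesis K_ge0 : forall y, 0 <= K y.
Hypothesis K_levy : (\int[mu]_y (Num.min 1 (enorm y ^+ 2) * K y)%:E < +oo)%E.

(** The second difference of [h] at [z], with the sign of the operator. *)
Definition sdiff (h : V -> R) (y z : V) : R := h z - (h (z + y) + h (z - y)) / 2.

Variable h : V -> R.
Hypothesis ih : mu.-integrable setT (EFin \o h).
Variable C : R.
Hypothesis C0 : 0 <= C.
Hypothesis sdiff_le : forall y,
  (\int[mu]_z `|sdiff h y z|%:E <= (C * Num.min 1 (enorm y ^+ 2))%:E)%E.

Let mh : measurable_fun setT h.
Proof. by apply/measurable_EFinP; exact: measurable_int ih. Qed.

Let mcos := continuous_measurable_fun (@continuous_cos R).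

Lemma measurable_sdiff : measurable_fun setT (fun w : V * V => sdiff h w.1 w.2).
Proof.
rewrite /sdiff; apply: measurable_funB; first by mfun.
apply: measurable_funM => //; apply: measurable_funD; last by mfun.
by mfun.
Qed.

Lemma measurable_sdiff_kernel :
  measurable_fun setT (fun w : V * V => sdiff h w.1 w.2 * K w.1).
Proof. by have md := measurable_sdiff; apply: measurable_funM => //; mfun. Qed.

Lemma sdiff_kernel_lty (f : V -> V -> R) : (forall y z, `|f y z| <= 1) ->
  measurable_fun setT (fun w : V * V => f w.1 w.2) ->
  (\int[mu]_y \int[mu]_z `|sdiff h y z * K y * f y z|%:E < +oo)%E.
Proof.
move=> f1 mff.
apply: (@le_lt_trans _ _ (\int[mu]_y (C * (Num.min 1 (enorm y ^+ 2) * K y))%:E)%E); last first.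
  rewrite ge0_integralZl_real//; last 2 first.
  - exact: measurable_levy_integrand.
  - by move=> y; rewrite mulr_ge0// min1_sqr_ge0.
  by rewrite (levy_massE K_ge0 K_levy) -EFinM ltry.
have md := measurable_sdiff.
apply: ge0_le_integral => //.
- by move=> y _; apply: integral_ge0 => z _; rewrite lee_fin.
- apply: (measurable_tonelli1 (fun y z : V => `|sdiff h y z * K y * f y z|%:E)).
    apply/measurable_EFinP; apply: measurableT_comp => //.
    by apply: measurable_funM; [exact: measurable_sdiff_kernel|exact: mff].
  by move=> y z; rewrite lee_fin.
- apply/measurable_EFinP; apply: measurable_funM => //.
  exact: measurable_levy_integrand.
- move=> y _; apply: (@le_trans _ _ (\int[mu]_z (K y * `|sdiff h y z|)%:E)%E).
    have m1 : measurable_fun setT (fun z : V => sdiff h y z).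
      exact: (measurable_sect1 (f := sdiff h) md).
    have m2 : measurable_fun setT (fun z : V => f y z).
      exact: (measurable_sect1 mff).
    apply: ge0_le_integral_real => //.
    + by apply: measurableT_comp => //; apply: measurable_funM => //; apply: measurable_funM.
    + by apply: measurable_funM => //; exact: measurableT_comp.
    + move=> z; rewrite !normrM (ger0_norm (K_ge0 y)) -[leRHS]mulr1 ler_pM// ?mulr_ge0//.
      by rewrite mulrC.
  rewrite ge0_integralZl_real//; last first.
    apply: measurableT_comp => //.
    exact: (measurable_sect1 (f := sdiff h) md).
  have -> : C * (Num.min 1 (enorm y ^+ 2) * K y) = K y * (C * Num.min 1 (enorm y ^+ 2)) by ring.
  by rewrite EFinM lee_wpmul2l ?lee_fin.
Qed.

Lemma sdiff_kernel_lty1 :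
  (\int[mu]_y \int[mu]_z `|sdiff h y z * K y|%:E < +oo)%E.
Proof.
under eq_integral do under eq_integral do rewrite -[_ * K _]mulr1.
by apply: (@sdiff_kernel_lty (fun _ _ => 1)) => [y z|]; [rewrite normr1|exact: measurable_cst].
Qed.

Lemma ae_integrable_sdiff_kernel :
  {ae mu, forall z, mu.-integrable setT (EFin \o (fun y => sdiff h y z * K y))}.
Proof.
exact: (ae_integrable2 (integrable_product measurable_sdiff_kernel sdiff_kernel_lty1)).
Qed.

Lemma integrable_nonlocal_op : mu.-integrable setT (EFin \o nonlocal_op K h).
Proof.
exact: (integrable_Rintegral2 measurable_sdiff_kernel sdiff_kernel_lty1).
Qed.

(** Translating the variable moves the second difference onto the cosine, whose
    second difference is a multiple of itself. *)
Lemma sdiff_cos (xi x y : V) :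
  \int[mu]_z (sdiff h y z * cos (dotv xi (x - z))) =
  (1 - cos (dotv xi y)) * \int[mu]_z (h z * cos (dotv xi (x - z))).
Proof.
have mc : measurable_fun setT (fun z : V => cos (dotv xi (x - z))).
  by apply: (measurableT_comp mcos); mfun.
have mc' a : measurable_fun setT (fun z : V => cos (dotv xi (x - z) + a)).
  by apply: (measurableT_comp mcos); mfun.
have ihc a : mu.-integrable setT (EFin \o (fun z => h z * cos (dotv xi (x - z) + a))).
  have /integrableP[_ hoo] := ih.
  apply: (@integrable_dominated _ _ _ _ _ (fun z => `|h z|)) => //.
  - exact: measurable_funM.
  - exact: measurableT_comp.
  - by move=> z; rewrite normrM; exact: (ler_piMr (normr_ge0 _) (cos_max _)).
have i0 := ihc 0; have ip := ihc (dotv xi y); have im := ihc (- dotv xi y).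
have E0 : \int[mu]_z (h z * cos (dotv xi (x - z))) = \int[mu]_z (h z * cos (dotv xi (x - z) + 0)).
  by apply: eq_Rintegral => z _; rewrite addr0.
have Ep : \int[mu]_z (h (z + y) * cos (dotv xi (x - z))) =
    \int[mu]_z (h z * cos (dotv xi (x - z) + dotv xi y)).
  rewrite -[RHS](Rintegral_rV_shift y); last exact: measurable_funM.
  apply: eq_Rintegral => z _; congr (_ * cos _).
  by rewrite -dotvDr; congr dotv; rVring.
have Em : \int[mu]_z (h (z - y) * cos (dotv xi (x - z))) =
    \int[mu]_z (h z * cos (dotv xi (x - z) - dotv xi y)).
  rewrite -[RHS](Rintegral_rV_shift (- y)); last exact: measurable_funM.
  apply: eq_Rintegral => z _; congr (_ * cos _).
  by rewrite -dotvBr; congr dotv; rVring.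
have ip' : mu.-integrable setT (EFin \o (fun z => h (z + y) * cos (dotv xi (x - z)))).
  apply: eq_integrable (integrable_rV_shift y ip) => // z _ /=; congr (_ * cos _)%:E.
  by rewrite -dotvDr; congr dotv; rVring.
have im' : mu.-integrable setT (EFin \o (fun z => h (z - y) * cos (dotv xi (x - z)))).
  apply: eq_integrable (integrable_rV_shift (- y) im) => // z _ /=; congr (_ * cos _)%:E.
  by rewrite -dotvBr; congr dotv; rVring.
have i0' : mu.-integrable setT (EFin \o (fun z => h z * cos (dotv xi (x - z)))).
  by apply: eq_integrable i0 => // z _ /=; rewrite addr0.
have ipm : mu.-integrable setT (EFin \o (fun z => h (z + y) * cos (dotv xi (x - z)) +
    h (z - y) * cos (dotv xi (x - z)))).
  exact: (integrableD measurableT ip' im').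
have ipm2 : mu.-integrable setT (EFin \o (fun z => 2^-1 * (h (z + y) * cos (dotv xi (x - z)) +
    h (z - y) * cos (dotv xi (x - z))))).
  exact: (integrableZl measurableT 2^-1 ipm).
have ipp : mu.-integrable setT (EFin \o (fun z => h z * cos (dotv xi (x - z) + dotv xi y) +
    h z * cos (dotv xi (x - z) - dotv xi y))).
  exact: (integrableD measurableT ip im).
transitivity (\int[mu]_z (h z * cos (dotv xi (x - z)) -
   2^-1 * (h (z + y) * cos (dotv xi (x - z)) + h (z - y) * cos (dotv xi (x - z))))).
  by apply: eq_Rintegral => z _; rewrite /sdiff; field.
rewrite RintegralB// RintegralZl// RintegralD// Ep Em -RintegralD//.
have -> : \int[mu]_z (h z * cos (dotv xi (x - z) + dotv xi y) +
    h z * cos (dotv xi (x - z) - dotv xi y)) =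
    (2 * cos (dotv xi y)) * \int[mu]_z (h z * cos (dotv xi (x - z))).
  rewrite -RintegralZl//; apply: eq_Rintegral => z _.
  by rewrite cosD cosB; ring.
by field.
Qed.

(** Integrate the identity for second differences against the kernel; the order of
    integration can be exchanged since the second differences of [h] have mass at
    most [C min (1, |y|^2)]. *)
Lemma fourier_multiplier (xi x : V) :
  symbol K xi * \int[mu]_z (h z * cos (dotv xi (x - z))) =
  \int[mu]_z (nonlocal_op K h z * cos (dotv xi (x - z))).
Proof.
have mc : measurable_fun setT (fun z : V => cos (dotv xi (x - z))).
  by apply: (measurableT_comp mcos); mfun.
have md := measurable_sdiff.
have mff : measurable_fun setT (fun w : V * V => cos (dotv xi (x - w.2))).
  by apply: (measurableT_comp mcos); mfun.
have foo := @sdiff_kernel_lty (fun _ z => cos (dotv xi (x - z))) (fun _ _ => cos_max _) mff.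
have mfull : measurable_fun setT (fun w : V * V => sdiff h w.1 w.2 * K w.1 * cos (dotv xi (x - w.2))).
  by apply: measurable_funM; [exact: measurable_sdiff_kernel|exact: mff].
have Fub := @Rintegral_fubini _ _ _ _ _ mu mu (fun y z => sdiff h y z * K y * cos (dotv xi (x - z))) mfull foo.
transitivity (\int[mu]_y \int[mu]_z (sdiff h y z * K y * cos (dotv xi (x - z)))).
  have isym : mu.-integrable setT (EFin \o (fun y => (1 - cos (dotv xi y)) * K y)).
    apply: integrable_ge0; [exact: measurable_symbol_integrand| |].
      by move=> y; rewrite mulr_ge0// one_sub_cos_ge0.
    by rewrite (symbolE mK K_ge0 K_levy) ltry.
  rewrite /symbol mulrC -(RintegralZl _ measurableT isym).
  apply: eq_Rintegral => y _.
  have isd : mu.-integrable setT (EFin \o (fun z => sdiff h y z * cos (dotv xi (x - z)))).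
    apply: (@integrable_dominated _ _ _ _ _ (fun z => `|sdiff h y z|)).
    - by apply: measurable_funM; [exact: (measurable_sect1 (f := sdiff h) md)|exact: mc].
    - apply: measurableT_comp; first by [].
      exact: (measurable_sect1 (f := sdiff h) md).
    - by move=> z; rewrite normrM; exact: (ler_piMr (normr_ge0 _) (cos_max _)).
    - by apply: le_lt_trans (sdiff_le y) _; rewrite ltry.
  transitivity (K y * \int[mu]_z (sdiff h y z * cos (dotv xi (x - z)))).
    by rewrite sdiff_cos; ring.
  rewrite -(RintegralZl _ measurableT isd); apply: eq_Rintegral => z _; ring.
rewrite Fub.
rewrite /Rintegral; congr fine; apply: ae_eq_integral.
- exact: measurableT.
- apply: (measurable_int mu).
  exact: (integrable_Rintegral2 mfull foo).
- apply/measurable_EFinP; apply: measurable_funM; last exact: mc.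
  by apply/measurable_EFinP; exact: (measurable_int _ integrable_nonlocal_op).
apply: filterS ae_integrable_sdiff_kernel => z iz _; congr EFin.
by rewrite -[RHS](RintegralZr _ measurableT iz).
Qed.

End fourier_multiplier.

Local Opaque symbol nonlocal_op.

(** * The flow of a superposition of cosines *)

Section smoothed_heat_flow.
Context {R : realType} {d : nat}.
Local Notation V := 'rV[R]_d.
Local Notation mu := (lebesgue_rV R d).
Variable K : V -> R.
Hypothesis mK : measurable_fun setT K.
Hypothesis K_ge0 : forall y, 0 <= K y.
Hypothesis K_levy : (\int[mu]_y (Num.min 1 (enorm y ^+ 2) * K y)%:E < +oo)%E.
Context {dO : measure_display} {Om : measurableType dO}.
Variables (nu : {sigma_finite_measure set Om -> \bar R}) (g : Om -> R)
  (xi : Om -> V) (B : R).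
Hypothesis mg : measurable_fun setT g.
Hypothesis mxi : measurable_fun setT xi.
Hypothesis g_ge0 : forall w, 0 <= g w.
Hypothesis g_lty : (\int[nu]_w (g w)%:E < +oo)%E.
Hypothesis xi_le : forall w, enorm (xi w) <= B.

(** The image of the superposition of cosines under the semigroup with
    symbol [symbol K]. *)
Definition cosheat (t : R) (x : V) : R :=
  \int[nu]_w (g w * (expR (- (t * symbol K (xi w))) * cos (dotv (xi w) x))).

Let sy w := symbol K (xi w).
Let M := 2 * (1 + B ^+ 2) * levy_mass K.

Let mcos := continuous_measurable_fun (@continuous_cos R).

Let mfine : measurable_fun setT (@fine R). Proof. exact: fine_measurable. Qed.

Let sy_ge0 w : 0 <= sy w. Proof. exact: symbol_ge0. Qed.

Let sy_le w : sy w <= M.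
Proof.
apply: (le_trans (symbol_le mK K_ge0 K_levy _)).
rewrite ler_wpM2r ?(levy_mass_ge0 K_ge0)// ler_wpM2l// lerD2l.
by apply: lerXn2r; rewrite ?nnegrE ?xi_le ?enorm_ge0// (le_trans (enorm_ge0 _) (xi_le w)).
Qed.

Let msy : measurable_fun setT sy.
Proof. exact: (measurableT_comp (measurable_symbol mK K_ge0 K_levy) mxi). Qed.

Let mexp (t : R) : measurable_fun setT (fun w => expR (- (t * sy w))).
Proof.
apply: (measurableT_comp (continuous_measurable_fun (@continuous_expR R))).
by apply: measurable_funN; apply: measurable_funM; [exact: measurable_cst|exact: msy].
Qed.

Let exp_le1 (t : R) w : 0 <= t -> expR (- (t * sy w)) <= 1.
Proof. by move=> t0; rewrite expR_le1 oppr_le0; exact: mulr_ge0. Qed.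

Let int_le (t : R) w (a : R) : 0 <= t ->
  `|g w * (expR (- (t * sy w)) * cos a)| <= g w.
Proof.
move=> t0; rewrite !normrM (ger0_norm (g_ge0 w)) (ger0_norm (expR_ge0 _)).
apply: ler_piMr; first exact: g_ge0.
apply: mulr_ile1; [exact: expR_ge0|exact: normr_ge0|exact: exp_le1|exact: cos_max].
Qed.

Let mint dT (T : measurableType dT) (t : R) (p : T -> Om) (q : T -> V) :
  measurable_fun setT p -> measurable_fun setT q ->
  measurable_fun setT (fun z => g (p z) * (expR (- (t * sy (p z))) * cos (dotv (xi (p z)) (q z)))).
Proof.
move=> mp mq; apply: measurable_funM; first exact: measurableT_comp.
apply: measurable_funM.
  exact: (measurableT_comp (mexp t) mp).
apply: (measurableT_comp mcos); apply: measurable_fun_dotv => //.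
exact: measurableT_comp.
Qed.

Lemma integrable_cosheat (t : R) (x : V) : 0 <= t ->
  nu.-integrable setT (EFin \o (fun w => g w * (expR (- (t * sy w)) * cos (dotv (xi w) x)))).
Proof.
move=> t0; apply: (integrable_dominated _ mg _ g_lty).
  by apply: (@mint _ _ t id (cst x)); [exact: measurable_id|exact: measurable_cst].
by move=> w; exact: int_le.
Qed.

Let gT := \int[nu]_w g w.
Let ig : nu.-integrable setT (EFin \o g). Proof. exact: integrable_ge0. Qed.

Lemma cosheatN (t : R) (x : V) : cosheat t (- x) = cosheat t x.
Proof. by apply: eq_Rintegral => w _; rewrite dotvNr cosN. Qed.

Lemma measurable_cosheat (t : R) : 0 <= t -> measurable_fun setT (cosheat t).
Proof.
move=> t0; pose f (x : V) (w : Om) := g w * (expR (- (t * sy w)) * cos (dotv (xi w) x)).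
have fg0 x w : 0 <= f x w + g w.
  by have := int_le w (dotv (xi w) x) t0; rewrite ler_norml => /andP[+ _]; rewrite -subr_ge0 opprK.
have -> : cosheat t = fun x => fine (\int[nu]_w (f x w + g w)%:E) - gT.
  apply/funext => x; rewrite -[fine _]/(\int[nu]_w (f x w + g w)).
  by rewrite (RintegralD measurableT (integrable_cosheat x t0) ig) addrK.
apply: measurable_funB; last exact: measurable_cst.
apply: (measurableT_comp mfine).
apply: (measurable_tonelli1 (fun (x : V) w => (f x w + g w)%:E)).
  apply/measurable_EFinP; apply: measurable_funD; last by mfun.
  by apply: (@mint _ _ t snd fst); [exact: measurable_snd|exact: measurable_fst].
by move=> x w; rewrite lee_fin.
Qed.

(** Convolving with a probability density that has the characteristic function
    [exp (- tau m)] multiplies each frequency by that factor. *)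
Lemma cosheat_conv (p : V -> R) (tau s : R) (x : V) :
  measurable_fun setT p -> (forall y, 0 <= p y) -> (\int[mu]_y (p y)%:E = 1)%E ->
  (forall z, \int[mu]_y (cos (dotv z y) * p y) = expR (- (tau * symbol K z))) ->
  (forall z, \int[mu]_y (sin (dotv z y) * p y) = 0) -> 0 <= s ->
  \int[mu]_y (p y * cosheat s (x - y)) = cosheat (tau + s) x.
Proof.
move=> mp p0 p1 pcos psin s0.
have plty : (\int[mu]_y (p y)%:E < +oo)%E by rewrite p1 ltry.
have ip : mu.-integrable setT (EFin \o p) by exact: integrable_ge0.
pose f (y : V) (w : Om) := p y * (g w * (expR (- (s * sy w)) * cos (dotv (xi w) (x - y)))).
have mf : measurable_fun setT (fun z : V * Om => f z.1 z.2).
  apply: measurable_funM; first by mfun.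
  by apply: (@mint _ _ s snd (fun z : V * Om => x - z.1)); mfun.
have foo : (\int[mu]_y \int[nu]_w `|f y w|%:E < +oo)%E.
  apply: (@le_lt_trans _ _ (\int[mu]_y (gT * p y)%:E)%E); last first.
    rewrite ge0_integralZl_real//; first by rewrite p1 mule1 ltry.
    by apply: Rintegral_ge0 => w _.
  apply: ge0_le_integral; first exact: measurableT.
  - by move=> y _; apply: integral_ge0 => w _; rewrite lee_fin; exact: normr_ge0.
  - apply: (measurable_tonelli1 (fun y w => `|f y w|%:E)).
      by apply/measurable_EFinP; apply: measurableT_comp.
    by move=> y w; rewrite lee_fin; exact: normr_ge0.
  - by mfun.
  - move=> y _; rewrite mulrC EFinM -(ge0_RintegralE g_ge0 g_lty) -ge0_integralZl_real//.
    apply: ge0_le_integral_real; [| | |move=> w].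
    + by apply: measurableT_comp; [exact: normr_measurable|exact: (measurable_sect1 mf)].
    + by apply: measurable_funM.
    + by move=> w; exact: normr_ge0.
    + rewrite /f normrM (ger0_norm (p0 y)) ler_wpM2l//; exact: int_le.
transitivity (\int[mu]_y \int[nu]_w f y w).
  apply: eq_Rintegral => y _; rewrite /cosheat.
  by rewrite -(RintegralZl _ measurableT (integrable_cosheat (x - y) s0)).
rewrite (Rintegral_fubini mf foo); apply: eq_Rintegral => w _.
have icos : mu.-integrable setT (EFin \o (fun y => cos (dotv (xi w) y) * p y)).
  apply: (integrable_dominated _ mp _ plty).
    by apply: measurable_funM; [apply: (measurableT_comp mcos); mfun|exact: mp].
  move=> y; rewrite normrM (ger0_norm (p0 y)); apply: ler_piMl; [exact: p0|exact: cos_max].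
have isin : mu.-integrable setT (EFin \o (fun y => sin (dotv (xi w) y) * p y)).
  apply: (integrable_dominated _ mp _ plty).
    apply: measurable_funM; last exact: mp.
    by apply: (measurableT_comp (continuous_measurable_fun (@continuous_sin R))); mfun.
  move=> y; rewrite normrM (ger0_norm (p0 y)); apply: ler_piMl; [exact: p0|exact: sin_max].
pose a := g w * expR (- (s * sy w)).
transitivity (\int[mu]_y ((a * cos (dotv (xi w) x)) * (cos (dotv (xi w) y) * p y) +
   (a * sin (dotv (xi w) x)) * (sin (dotv (xi w) y) * p y))).
  by apply: eq_Rintegral => y _; rewrite /f /a dotvBr cosB; ring.
rewrite (RintegralD measurableT (integrableZl measurableT _ icos) (integrableZl measurableT _ isin)).
rewrite (RintegralZl _ measurableT icos) (RintegralZl _ measurableT isin) pcos psin mulr0 addr0.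
by rewrite /a -/(sy w) mulrDl opprD expRD; ring.
Qed.

Section duality.
Variable h : V -> R.
Hypothesis ih : mu.-integrable setT (EFin \o h).
Variable x : V.

Let mh : measurable_fun setT h.
Proof. by apply/measurable_EFinP; exact: measurable_int ih. Qed.

Let h_lty : (\int[mu]_z `|h z|%:E < +oo)%E.
Proof. by move/integrableP : ih => [_]. Qed.

Let q (w : Om) : R := \int[mu]_z (h z * cos (dotv (xi w) (x - z))).

Let ihc w : mu.-integrable setT (EFin \o (fun z => h z * cos (dotv (xi w) (x - z)))).
Proof.
apply: (@integrable_dominated _ _ _ _ _ (fun z => `|h z|)) => //.
- by apply: measurable_funM; [exact: mh|apply: (measurableT_comp mcos); mfun].
- exact: measurableT_comp.
- by move=> z; rewrite normrM; exact: (ler_piMr (normr_ge0 _) (cos_max _)).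
Qed.

Let hT := \int[mu]_z `|h z|.

Let q_le w : `|q w| <= hT.
Proof.
apply: (le_trans (le_normr_Rintegral measurableT (ihc w))).
apply: le_Rintegral; [exact: measurableT|exact: (integrable_norm (ihc w))|exact: (integrable_norm ih)|].
by move=> z _; rewrite normrM; exact: (ler_piMr (normr_ge0 _) (cos_max _)).
Qed.

Let f (t : R) (z : V) (w : Om) := h z * (g w * (expR (- (t * sy w)) * cos (dotv (xi w) (x - z)))).

Let mf (t : R) : measurable_fun setT (fun p : V * Om => f t p.1 p.2).
Proof.
apply: measurable_funM; first by mfun.
by apply: (@mint _ _ t snd (fun z : V * Om => x - z.1)); mfun.
Qed.

Let f_lty (t : R) : 0 <= t -> (\int[mu]_z \int[nu]_w `|f t z w|%:E < +oo)%E.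
Proof.
move=> t0; apply: (@le_lt_trans _ _ (\int[mu]_z (gT * `|h z|)%:E)%E); last first.
  rewrite ge0_integralZl_real; [|exact: measurableT_comp|by move=> z; exact: normr_ge0|].
    by rewrite lte_mul_pinfty// lee_fin Rintegral_ge0.
  by apply: Rintegral_ge0 => w _.
apply: ge0_le_integral; first exact: measurableT.
- by move=> y _; apply: integral_ge0 => w _; rewrite lee_fin; exact: normr_ge0.
- apply: (measurable_tonelli1 (fun y w => `|f t y w|%:E)).
    by apply/measurable_EFinP; apply: measurableT_comp; [exact: normr_measurable|exact: mf].
  by move=> y w; rewrite lee_fin; exact: normr_ge0.
- by apply/measurable_EFinP; apply: measurable_funM; [exact: measurable_cst|exact: measurableT_comp].
- move=> y _; rewrite mulrC EFinM -(ge0_RintegralE g_ge0 g_lty) -ge0_integralZl_real//.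
  apply: ge0_le_integral_real; [| | |move=> w].
  + by apply: measurableT_comp; [exact: normr_measurable|exact: (measurable_sect1 (mf t))].
  + by apply: measurable_funM; [exact: measurable_cst|exact: mg].
  + by move=> w; exact: normr_ge0.
  + rewrite /f normrM ler_wpM2l//; exact: int_le.
Qed.

Lemma integrable_cosheat_pairing (t : R) : 0 <= t ->
  mu.-integrable setT (EFin \o (fun z => h z * cosheat t (x - z))).
Proof.
move=> t0; apply: eq_integrable (integrable_Rintegral1 (mf t) (f_lty t0)) => // z _ /=.
by rewrite /cosheat -(RintegralZl _ measurableT (integrable_cosheat (x - z) t0)).
Qed.

Lemma cosheat_pairing (t : R) : 0 <= t ->
  \int[mu]_z (h z * cosheat t (x - z)) =
  \int[nu]_w (g w * (expR (- (t * sy w)) * q w)).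
Proof.
move=> t0; transitivity (\int[mu]_z \int[nu]_w f t z w).
  apply: eq_Rintegral => z _; rewrite /cosheat.
  by rewrite -(RintegralZl _ measurableT (integrable_cosheat (x - z) t0)).
rewrite (Rintegral_fubini (mf t) (f_lty t0)); apply: eq_Rintegral => w _.
rewrite mulrA -(RintegralZl _ measurableT (ihc w)).
by apply: eq_Rintegral => z _; rewrite /f; ring.
Qed.

Let mq : measurable_fun setT q.
Proof.
have mF : measurable_fun setT (fun p : V * Om => h p.1 * cos (dotv (xi p.2) (x - p.1))).
  apply: measurable_funM; first by mfun.
  apply: (measurableT_comp mcos); apply: measurable_fun_dotv; last by mfun.
  exact: (measurableT_comp mxi measurable_snd).
have -> : q = fun w => \int[mu]_z (h z * cos (dotv (xi w) (x - z)) + `|h z|) - hT.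
  by apply/funext => w; rewrite (RintegralD measurableT (ihc w) (integrable_norm ih)) addrK.
apply: measurable_funB; last exact: measurable_cst.
apply: (measurableT_comp mfine).
apply: (measurable_tonelli2 (fun z w => (h z * cos (dotv (xi w) (x - z)) + `|h z|)%:E)).
  apply/measurable_EFinP; apply: measurable_funD; first exact: mF.
  by apply: measurableT_comp; [exact: normr_measurable|mfun].
move=> z w; rewrite lee_fin -[`|h z|]opprK subr_ge0.
have : `|h z * cos (dotv (xi w) (x - z))| <= `|h z|.
  by rewrite normrM; exact: (ler_piMr (normr_ge0 _) (cos_max _)).
by rewrite ler_norml => /andP[].
Qed.

Variables (C : R).

(** [exp (C t)] times the pairing of [h] with the flow, written on the frequency
    side, where the dependence on [t] is explicit. *)
Definition growth_pairing (t : R) : R :=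
  \int[nu]_w (g w * q w * expR (t * (C - sy w))).
Local Notation alpha := growth_pairing.

Lemma growth_pairingE (t : R) : 0 <= t -> alpha t = expR (C * t) * \int[mu]_z (h z * cosheat t (x - z)).
Proof.
move=> t0; rewrite cosheat_pairing// -RintegralZl; [|exact: measurableT|].
  apply: eq_Rintegral => w _; rewrite mulrBr expRD [C * t]mulrC; ring.
apply: (@integrable_dominated _ _ _ _ _ (fun w => hT * g w)).
- by apply: measurable_funM => //; apply: measurable_funM; [exact: mexp|exact: mq].
- by apply: measurable_funM.
- move=> w; rewrite !normrM (ger0_norm (g_ge0 w)) (ger0_norm (expR_ge0 _)) mulrC.
  apply: ler_wpM2r; first exact: g_ge0.
  apply: (le_trans _ (q_le w)); apply: ler_piMl; [exact: normr_ge0|exact: exp_le1].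
- rewrite ge0_integralZl_real//; last by apply: Rintegral_ge0 => z _; exact: normr_ge0.
  by rewrite lte_mul_pinfty// lee_fin; apply: Rintegral_ge0 => z _; exact: normr_ge0.
Qed.

Let kk (w : Om) := C - sy w.
Let KK := `|C| + M.

Let kk_le w : `|kk w| <= KK.
Proof.
apply: (le_trans (ler_normB _ _)); rewrite lerD2l ger0_norm; [exact: sy_le|exact: sy_ge0].
Qed.

Let mkk : measurable_fun setT kk.
Proof. by apply: measurable_funB; [exact: measurable_cst|exact: msy]. Qed.

Let hT0 : 0 <= hT. Proof. by apply: Rintegral_ge0 => z _; exact: normr_ge0. Qed.
Let KK0 : 0 <= KK.
Proof.
apply: addr_ge0; first exact: normr_ge0.
apply: mulr_ge0; last exact: levy_mass_ge0.
by rewrite mulr_ge0// addr_ge0// sqr_ge0.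
Qed.

Let expk_le (T t : R) w : `|t| <= T -> expR (t * kk w) <= expR (T * KK).
Proof.
move=> tT; rewrite ler_expR (le_trans (ler_norm _))// normrM.
by apply: ler_pM; [exact: normr_ge0|exact: normr_ge0|exact: tT|exact: kk_le].
Qed.

Let mexpk (t : R) : measurable_fun setT (fun w => expR (t * kk w)).
Proof.
apply: (measurableT_comp (continuous_measurable_fun (@continuous_expR R))).
by apply: measurable_funM; [exact: measurable_cst|exact: mkk].
Qed.

Let dominated_lty (c : R) : 0 <= c -> (\int[nu]_w (c * g w)%:E < +oo)%E.
Proof. by move=> c0; rewrite ge0_integralZl_real// lte_mul_pinfty// lee_fin. Qed.

Let absF (e : R) w : `|g w * q w * e| <= g w * (hT * `|e|).
Proof.
rewrite !normrM (ger0_norm (g_ge0 w)) -mulrA; apply: ler_wpM2l; first exact: g_ge0.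
by apply: ler_wpM2r; [exact: normr_ge0|exact: q_le].
Qed.

Lemma integrable_growth_pairing (t : R) :
  nu.-integrable setT (EFin \o (fun w => g w * q w * expR (t * kk w))).
Proof.
apply: (@integrable_dominated _ _ _ _ _ (fun w => hT * expR (`|t| * KK) * g w)).
- by apply: measurable_funM; [exact: measurable_funM|exact: mexpk].
- by apply: measurable_funM.
- move=> w; apply: (le_trans (absF _ w)); rewrite mulrC.
  apply: ler_wpM2r; first exact: g_ge0.
  apply: ler_wpM2l; first exact: hT0.
  by rewrite ger0_norm ?expR_ge0//; exact: expk_le.
- by apply: dominated_lty; rewrite mulr_ge0// expR_ge0.
Qed.

(** Frequencies are bounded, so differentiation under the integral is dominated. *)
Lemma growth_pairing_derive (T t : R) : 0 <= T -> `|t| < T ->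
  is_derive t 1 alpha (\int[nu]_w (g w * q w * (kk w * expR (t * kk w)))).
Proof.
move=> T0 tT; pose F (s : R) w := g w * q w * expR (s * kk w).
have dF (s : R) w : is_derive s 1 (F ^~ w) (g w * q w * (kk w * expR (s * kk w))).
  have H : is_derive s 1 (fun s : R => expR (s * kk w)) (kk w * expR (s * kk w)).
    rewrite mulrC; apply: (@is_derive1_comp _ expR (fun s : R => s * kk w)).
    by apply: is_derive_eq; rewrite /GRing.scale/=; ring.
  by apply: is_derive_eq.
have It : `]- T, T[%classic t by rewrite /= in_itv/= -ltr_norml.
have G0 w : 0 <= hT * (KK * expR (T * KK)) * g w.
  by rewrite mulr_ge0// mulr_ge0// mulr_ge0// expR_ge0.
have iG : nu.-integrable setT (EFin \o (fun w => hT * (KK * expR (T * KK)) * g w)).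
  apply: integrable_ge0 => //; first exact: measurable_funM.
  by apply: dominated_lty; rewrite mulr_ge0// mulr_ge0// expR_ge0.
have iF (s : R) : `]- T, T[%classic s -> nu.-integrable setT (EFin \o F s).
  by move=> _; exact: integrable_growth_pairing.
have derF (s : R) w : `]- T, T[%classic s -> setT w -> derivable (F ^~ w) s 1.
  by move=> _ _; exact: (@ex_derive _ _ _ _ _ _ _ (dF s w)).
have ubF (s : R) w : `]- T, T[%classic s -> setT w ->
    `|partial1of2 F s w| <= hT * (KK * expR (T * KK)) * g w.
  rewrite /= in_itv/= -ltr_norml => sT _; rewrite partial1of2E.
  rewrite (@derive_val _ _ _ _ _ _ _ (dF s w)).
  apply: (le_trans (absF _ w)); rewrite mulrC.
  apply: ler_wpM2r; first exact: g_ge0.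
  apply: ler_wpM2l; first exact: hT0.
  rewrite normrM; apply: ler_pM; [exact: normr_ge0|exact: normr_ge0|exact: kk_le|].
  rewrite ger0_norm ?expR_ge0//; apply: expk_le; exact: ltW.
have D := derivable_under_integral measurableT It iF derF G0 iG ubF.
have DE := differentiation_under_integral measurableT It iF derF G0 iG ubF.
apply: DeriveDef; first exact: D.
rewrite -derive1E DE; apply: eq_Rintegral => w _.
by rewrite -[LHS]/(partial1of2 F t w) partial1of2E (@derive_val _ _ _ _ _ _ _ (dF t w)).
Qed.

End duality.

Let pairing (h : V -> R) (x : V) (t : R) := \int[mu]_z (h z * cosheat t (x - z)).

(** If [b <= C h - L h] then [exp (C t) <h, Phi_t>] grows at least at the rate
    [exp (C t) <b, Phi_t>]. *)
Lemma pairing_growth (h b : V -> R) (x : V) (Cs C t kappa : R) :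
  mu.-integrable setT (EFin \o h) -> mu.-integrable setT (EFin \o b) -> 0 <= Cs ->
  (forall y, (\int[mu]_z `|sdiff h y z|%:E <= (Cs * Num.min 1 (enorm y ^+ 2))%:E)%E) ->
  (forall z, b z <= C * h z - nonlocal_op K h z) ->
  (forall (s : R) y, 0 <= s -> 0 <= cosheat s y) -> 0 < t ->
  (forall s : R, 0 < s < t -> kappa <= expR (C * s) * \int[mu]_z (b z * cosheat s (x - z))) ->
  \int[mu]_z (h z * cosheat 0 (x - z)) + kappa * t <=
  expR (C * t) * \int[mu]_z (h z * cosheat t (x - z)).
Proof.
move=> ih ib Cs0 Hs Hb P0 t0 Hk.
have t1 : 0 <= t + 1 by rewrite addr_ge0// ltW.
have tt s : 0 <= s <= t -> `|s| < t + 1.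
  by move=> /andP[s0 st]; rewrite ger0_norm// (le_lt_trans st)// ltrDl.
have der s : 0 <= s <= t -> is_derive s 1 (growth_pairing h x C)
    (\int[nu]_w (g w * (\int[mu]_z (h z * cos (dotv (xi w) (x - z)))) *
      ((C - sy w) * expR (s * (C - sy w))))).
  by move=> st; apply: (growth_pairing_derive ih x C t1); exact: tt.
have iL := integrable_nonlocal_op mK K_ge0 K_levy ih Cs0 Hs.
have derE s : 0 <= s -> \int[nu]_w (g w * (\int[mu]_z (h z * cos (dotv (xi w) (x - z)))) *
      ((C - sy w) * expR (s * (C - sy w)))) =
    expR (C * s) * (C * pairing h x s - pairing (nonlocal_op K h) x s).
  move=> s0; rewrite mulrBr mulrCA -(growth_pairingE ih x C s0) -(growth_pairingE iL x C s0).
  have i1 := integrable_growth_pairing ih x C s.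
  have i2 := integrable_growth_pairing iL x C s.
  rewrite /growth_pairing -(RintegralZl _ measurableT i1).
  rewrite -(RintegralB measurableT (integrableZl measurableT C i1) i2).
  apply: eq_Rintegral => w _.
  rewrite -(fourier_multiplier mK K_ge0 K_levy ih Cs0 Hs) -/(sy w).
  ring.
have dh s : 0 <= s <= t -> derivable (growth_pairing h x C) s 1.
  by move=> st; exact: (@ex_derive _ _ _ _ _ _ _ (der s st)).
have [c] := MVT (f := growth_pairing h x C) (df := fun s =>
    \int[nu]_w (g w * (\int[mu]_z (h z * cos (dotv (xi w) (x - z)))) *
      ((C - sy w) * expR (s * (C - sy w))))) t0
    (fun s => fun st : s \in `]0, t[ => der s (subset_itv_oo_cc st))
    (derivable_within_continuous (fun s => fun st : s \in `[0, t] => dh s st)).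
rewrite in_itv/= => /andP[c0 ct]; rewrite subr0 => E.
have c0' := ltW c0; have t0' := ltW t0.
rewrite -(growth_pairingE ih x C t0') -[X in X + _ <= _]mul1r -{1}expR0 -{1}(mulr0 C).
rewrite -(growth_pairingE ih x C (lexx 0)) -lerBrDl E ler_wpM2r// derE//.
apply: (le_trans (Hk c _)); first by rewrite c0.
rewrite ler_wpM2l ?expR_ge0//.
have j1 := integrable_cosheat_pairing ih x c0'.
have j2 := integrable_cosheat_pairing iL x c0'.
rewrite /pairing -(RintegralZl _ measurableT j1).
rewrite -(RintegralB measurableT (integrableZl measurableT C j1) j2).
apply: le_Rintegral; [exact: measurableT|exact: (integrable_cosheat_pairing ib x c0')| |].
  exact: (integrableB measurableT (integrableZl measurableT C j1) j2).
by move=> z _; rewrite mulrA -mulrBl ler_wpM2r// P0.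
Qed.

End smoothed_heat_flow.

(** * Concentrated superpositions of cosines *)

Section fundamental_theorem.
Context {R : realType}.
Local Notation leb := (@lebesgue_measure R).

Lemma integral_is_derive (F f : R -> R) (a b : R) : a < b -> continuous f ->
  (forall x : R, is_derive x 1 F (f x)) ->
  (\int[leb]_(x in `[a, b]) (f x)%:E = (F b - F a)%:E)%E.
Proof.
move=> ab cf dF.
have derF (x : R) : derivable F x 1 by exact: (@ex_derive _ _ _ _ _ _ _ (dF x)).
have cF : continuous F.
  by move=> x; apply: differentiable_continuous; exact/derivable1_diffP.
rewrite EFinB; apply: continuous_FTC2 => //.
- exact: continuous_subspaceT.
- split.
  + by move=> x _; exact: derF.
  + exact/cvg_at_right_filter/cF.
  + exact/cvg_at_left_filter/cF.
- by move=> x _; rewrite derive1E (@derive_val _ _ _ _ _ _ _ (dF x)).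
Qed.

Lemma Rintegral_is_derive (F f : R -> R) (a b : R) : a < b -> continuous f ->
  (forall x : R, is_derive x 1 F (f x)) ->
  \int[leb]_(x in `[a, b]) f x = F b - F a.
Proof. by move=> ab cf dF; rewrite /Rintegral (integral_is_derive ab cf dF). Qed.

End fundamental_theorem.

Section sinc.
Context {R : realType}.
Local Notation leb := (@lebesgue_measure R).

Definition sinc (a : R) : R := if a == 0 then 1 else sin a / a.

Lemma norm_sinc_le1 a : `|sinc a| <= 1.
Proof.
rewrite /sinc; case: eqVneq => [_|a0]; first by rewrite normr1.
by rewrite normrM normfV ler_pdivrMr ?normr_gt0// mul1r norm_sin_le.
Qed.

Lemma norm_sinc_le a : a != 0 -> `|sinc a| <= `|a|^-1.
Proof.
move=> a0; rewrite /sinc (negbTE a0) normrM normfV.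
by apply: ler_piMl; [rewrite invr_ge0|exact: sin_max].
Qed.

Let sin_ge (a : R) : 0 < a -> a <= 1 -> a / 2 <= sin a.
Proof.
move=> a0 a1.
have [c] : exists2 c, c \in `]0, a[%R & sin a - sin 0 = cos c * (a - 0).
  apply: (@MVT _ (@sin R) (@cos R)) => //.
  by apply: continuous_subspaceT; exact: continuous_sin.
rewrite in_itv/= sin0 !subr0 => /andP[c0 ca] ->.
have := one_sub_cos_le c; have : c ^+ 2 <= 1 by rewrite expr_le1 ?ltW// (lt_le_trans ca).
by nra.
Qed.

Lemma sinc_ge a : `|a| <= 1 -> 2^-1 <= sinc a.
Proof.
rewrite /sinc; case: eqVneq => [_ _|a0 a1]; first by rewrite invf_le1 ?ler1n.
have [ap|an] := ltP 0 a.
  by rewrite ler_pdivlMr// mulrC sin_ge// -(ger0_norm (ltW ap)).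
have an' : 0 < - a by rewrite oppr_gt0 lt_neqAle a0.
rewrite -mulrNN -invrN -sinN ler_pdivlMr// mulrC sin_ge//.
by rewrite -(ler0_norm an).
Qed.

Let is_derive_mulr (a s : R) : is_derive s 1 (fun s : R => s * a) a.
Proof. by apply: is_derive_eq; rewrite /GRing.scale/=; ring. Qed.

Let mulr_continuous (a : R) : continuous (fun s : R => s * a).
Proof. by move=> s; apply: cvgM; [exact: cvg_id|exact: cvg_cst]. Qed.

Lemma integral_cos_sinc a : \int[leb]_(s in `[-1, 1]) (2^-1 * cos (s * a)) = sinc a.
Proof.
have N11 : -1 < 1 :> R by lra.
have cf : continuous (fun s : R => 2^-1 * cos (s * a)).
  move=> s; apply: cvgM; first exact: cvg_cst.
  exact: (continuous_comp (@mulr_continuous a s) (@continuous_cos R _)).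
rewrite /sinc; case: eqVneq => [a0|a0].
  have dF (s : R) : is_derive s 1 (fun s : R => s * 2^-1) (2^-1 * cos (s * a)).
    by rewrite a0 mulr0 cos0 mulr1; exact: is_derive_mulr.
  by rewrite (Rintegral_is_derive N11 cf dF) -mulrBl opprK divff.
suff dF (s : R) : is_derive s 1 (fun s : R => sin (s * a) * (2 * a)^-1) (2^-1 * cos (s * a)).
  by rewrite (Rintegral_is_derive N11 cf dF) mulN1r mul1r sinN; field.
have -> : 2^-1 * cos (s * a) = (2 * a)^-1 * (cos (s * a) * a) by field.
have H : is_derive s 1 (fun s : R => sin (s * a)) (cos (s * a) * a).
  apply: (@is_derive1_comp _ sin (fun s : R => s * a)); exact: is_derive_mulr.
by apply: is_derive_eq; rewrite /GRing.scale/=; ring.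
Qed.

Lemma integral_sin_sinc a : \int[leb]_(s in `[-1, 1]) (2^-1 * sin (s * a)) = 0.
Proof.
have N11 : -1 < 1 :> R by lra.
have cf : continuous (fun s : R => 2^-1 * sin (s * a)).
  move=> s; apply: cvgM; first exact: cvg_cst.
  exact: (continuous_comp (@mulr_continuous a s) (@continuous_sin R _)).
have [a0|a0] := eqVneq a 0.
  rewrite /Rintegral integral0_eq// => s _.
  by rewrite a0 mulr0 sin0 mulr0.
suff dF (s : R) : is_derive s 1 (fun s : R => cos (s * a) * - (2 * a)^-1) (2^-1 * sin (s * a)).
  by rewrite (Rintegral_is_derive N11 cf dF) mulN1r mul1r cosN subrr.
have -> : 2^-1 * sin (s * a) = - (2 * a)^-1 * (- sin (s * a) * a) by field.
have H : is_derive s 1 (fun s : R => cos (s * a)) (- sin (s * a) * a).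
  apply: (@is_derive1_comp _ cos (fun s : R => s * a)); exact: is_derive_mulr.
by apply: is_derive_eq; rewrite /GRing.scale/=; ring.
Qed.

End sinc.

Section mollifier.
Context {R : realType} {d : nat}.
Local Notation V := 'rV[R]_d.
Local Notation mu := (lebesgue_rV R d).
Local Notation leb := (@lebesgue_measure R).

Let clamp (s : R) : R := Num.max (-1) (Num.min s 1).

Let mclamp : measurable_fun [set: measurableTypeR R] (clamp : measurableTypeR R -> R).
Proof.
apply: measurable_maxr; first exact: measurable_cst.
by apply: measurable_minr; [exact: measurable_id|exact: measurable_cst].
Qed.

(** [sin a / a] is the mean of [cos (s a)] over [-1 <= s <= 1]. *)
Lemma cosine_superposition_sinc (zeta : V) :
  cosine_superposition (fun x => sinc (dotv zeta x)).
Proof.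
pose g (s : measurableTypeR R) : R := 2^-1 * \1_(`[-1, 1]%classic : set R) s.
have H (f : R -> R) (e : R) :
    \int[leb]_(s in `[-1, 1]) (2^-1 * f s) = e ->
    \int[leb]_s (g s * f (clamp s)) = e.
  move=> <-; rewrite /Rintegral; congr fine.
  rewrite [RHS]integral_mkcond; apply: eq_integral => s _; rewrite patchE /g indicE.
  case: ifPn => [sI|_]; last by rewrite mulr0 mul0r.
  rewrite mulr1; congr (_ * f _)%:E; rewrite /clamp.
  by move: sI; rewrite inE /= in_itv/= => /andP[s1 s2]; rewrite min_l// max_r.
have I_lty : (leb (`[(-1)%R, 1%R]%classic : set R) < +oo)%E.
  by rewrite lebesgue_measure_itv/=; case: ifP; rewrite ?ltry.
have mI : measurable_fun [set: measurableTypeR R] (\1_(`[-1, 1]%classic : set R) : measurableTypeR R -> R).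
  by apply: measurable_indic.
exists _, (measurableTypeR R), (@lebesgue_measure R), g, (fun s => clamp s *: zeta), (enorm zeta).
split.
- split; first by apply: measurable_funM; [exact: measurable_cst|exact: mI].
  apply: measurable_fun_rV => i.
  rewrite [X in measurable_fun _ X](_ : _ = fun s : measurableTypeR R => clamp s * zeta ord0 i).
    by apply: measurable_funM; [exact: mclamp|exact: measurable_cst].
  by apply/funext => s; rewrite mxE.
- split; first by move=> s; rewrite mulr_ge0// indicE.
  rewrite ge0_integralZl_real//.
  by rewrite integral_indic// setIT lte_mul_pinfty//; exact: I_lty.
- move=> s; rewrite -[leRHS]mul1r.
  have c1 : `|clamp s| <= 1.
    by rewrite ler_norml /clamp le_max lexx/= ge_max ge_min lexx orbT andbT; lra.
  rewrite -(ler_pXn2r (n := 2))// ?nnegrE ?mulr_ge0 ?enorm_ge0//.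
  rewrite exprMn !sqr_enorm dotvZr dotvC dotvZr mulrA -expr2 ler_wpM2r ?dotvv_ge0//.
  by rewrite expr1n -(real_normK (num_real (clamp s))) expr_le1.
- move=> x; rewrite -integral_cos_sinc; apply/esym.
  rewrite -[RHS](H (fun s => cos (s * dotv zeta x)) _ erefl).
  by apply: eq_Rintegral => s _; rewrite dotvC dotvZr [dotv x zeta]dotvC.
- move=> x; rewrite -[RHS](H (fun s => sin (s * dotv zeta x)) _ (integral_sin_sinc _)).
  by apply: eq_Rintegral => s _; rewrite dotvC dotvZr [dotv x zeta]dotvC.
Qed.

Lemma cosine_superposition1 : cosine_superposition (fun _ : V => 1).
Proof.
have -> : (fun _ : V => 1) = (fun x : V => sinc (dotv 0 x)).
  by apply/funext => x; rewrite /sinc -(subrr 0) dotvBl subrr eqxx.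
exact: cosine_superposition_sinc.
Qed.

Lemma cosine_superpositionX (F : V -> R) n :
  cosine_superposition F -> cosine_superposition (fun x => F x ^+ n).
Proof.
move=> hF; elim: n => [|n IH]; first exact: cosine_superposition1.
have -> : (fun x => F x ^+ n.+1) = (fun x => F x * F x ^+ n).
  by apply/funext => x; rewrite exprS.
exact: cosine_superpositionM.
Qed.

Lemma cosine_superposition_prod (I : Type) (s : seq I) (F : I -> V -> R) :
  (forall i, cosine_superposition (F i)) ->
  cosine_superposition (fun x => \prod_(i <- s) F i x).
Proof.
move=> hF; elim: s => [|i s IH].
  have -> : (fun x => \prod_(i <- [::]) F i x) = (fun _ : V => 1).
    by apply/funext => x; rewrite big_nil.
  exact: cosine_superposition1.
have -> : (fun x => \prod_(j <- i :: s) F j x) = (fun x => F i x * \prod_(j <- s) F j x).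
  by apply/funext => x; rewrite big_cons.
exact: cosine_superpositionM.
Qed.

End mollifier.

(** A bump whose mass [b] in the ball of radius [r] exceeds its values outside
    that ball by the factor [e^-1]. *)
Record mollifier (R : realType) (d : nat) (r e b : R) (Phi : 'rV[R]_d -> R) : Prop := {
  moll_eps : 0 <= e ;
  moll_cos : cosine_superposition Phi ;
  moll_ge0 : forall x, 0 <= Phi x ;
  moll_le1 : forall x, Phi x <= 1 ;
  moll_mass_gt0 : 0 < b ;
  moll_mass : (\int[lebesgue_rV R d]_x (\1_(eball 0 r) x * Phi x)%:E = b%:E)%E ;
  moll_tail : forall x, r <= enorm x -> Phi x <= e * b }.

Section mollifier_existence.
Context {R : realType} {d : nat}.
Local Notation V := 'rV[R]_d.
Local Notation mu := (lebesgue_rV R d).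

Lemma measurable_cosine_superposition (F : V -> R) : cosine_superposition F ->
  measurable_fun setT F.
Proof.
case=> dO [Om [nu [g [xi [B [[mg mxi] [g0 gT] xiB FE _]]]]]].
have H0 : (\int[mu]_y (Num.min 1 (enorm y ^+ 2) * cst (0 : R) y)%:E < +oo)%E.
  by under eq_integral do rewrite /cst mulr0; rewrite integral0 ltry.
have := measurable_cosheat (@measurable_cst _ _ V R setT 0) (fun=> lexx 0) H0 mg mxi g0 gT (lexx 0).
congr (measurable_fun _ _); apply/funext => x; rewrite FE /cosheat.
by apply: eq_Rintegral => w _; rewrite mul0r oppr0 expR0 mul1r.
Qed.

Hypothesis d_gt0 : (0 < d)%N.

Let coordv (N : R) (i : 'I_d) : V := \row_j (N *+ (j == i)).

Let dotv_coord N i (x : V) : dotv (coordv N i) x = N * x ord0 i.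
Proof. exact: dotv_delta. Qed.

(* The exponent is even for the sign, and [2 d] so that the decay [N^(-2 d)] away
   from the origin beats the mass near it, of the order of [N^-d]. *)
Let Phi (N : R) (x : V) : R := \prod_(i < d) sinc (N * x ord0 i) ^+ (2 * d).

Let sinc2_ge0 (a : R) : 0 <= sinc a ^+ (2 * d).
Proof. by rewrite exprM exprn_ge0// sqr_ge0. Qed.

Let sinc2_le1 (a : R) : sinc a ^+ (2 * d) <= 1.
Proof.
rewrite exprM -(real_normK (num_real (sinc a))) -exprM exprn_ile1//.
exact: norm_sinc_le1.
Qed.

Let Phi_cos N : cosine_superposition (Phi N).
Proof.
apply: cosine_superposition_prod => i; apply: cosine_superpositionX.
have -> : (fun x : V => sinc (N * x ord0 i)) = (fun x => sinc (dotv (coordv N i) x)).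
  by apply/funext => x; rewrite dotv_coord.
exact: cosine_superposition_sinc.
Qed.

Let Phi_ge0 N x : 0 <= Phi N x.
Proof. by apply: prodr_ge0 => i _. Qed.

Let Phi_le1 N x : Phi N x <= 1.
Proof.
by apply: prodr_ile1 => i _; rewrite sinc2_ge0 sinc2_le1.
Qed.

Let s : R := Num.sqrt d%:R.
Let s_gt0 : 0 < s. Proof. by rewrite sqrtr_gt0 ltr0n. Qed.

Let Phi_center N x : 0 < N -> enorm x <= N^-1 -> (2^-1) ^+ (2 * d * d) <= Phi N x.
Proof.
move=> N0 xN; rewrite exprM -[in X in _ ^+ X <= _](card_ord d) -prodr_const.
apply: ler_prod => i _; rewrite exprn_ge0 ?invr_ge0//=.
suff H : 2^-1 <= sinc (N * x ord0 i).
  by apply: lerXn2r; rewrite ?nnegrE ?invr_ge0//; apply: le_trans H; rewrite invr_ge0.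
apply: sinc_ge; rewrite normrM (gtr0_norm N0) -ler_pdivlMl// mulr1.
exact: le_trans (coord_le_enorm x i) xN.
Qed.

Let Phi_tail N r x : 0 < N -> 0 < r -> r <= enorm x -> Phi N x <= ((s / r) ^+ (2 * d)) * N^-1 ^+ (2 * d).
Proof.
move=> N0 r0 rx.
have [i xi] : exists i, r / s <= `|x ord0 i|.
  apply: contrapT => /forallNP H.
  suff : enorm x < r by rewrite ltNge rx.
  pose m := \big[Num.max/0]_i `|x ord0 i|.
  have m0 : 0 <= m by exact: bigmax_ge_id.
  have ms : m < r / s.
    apply: bigmax_lt => [|i _]; first by rewrite divr_gt0.
    by rewrite ltNge; apply/negP; exact: H.
  apply: (@le_lt_trans _ _ (s * m)); last by rewrite mulrC -ltr_pdivlMr.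
  by apply: enorm_le_coord => i; exact: (le_bigmax _ (fun i => `|x ord0 i|)).
have xi0 : 0 < `|x ord0 i| by apply: lt_le_trans xi; rewrite divr_gt0.
rewrite /Phi (bigD1 i)//= -exprMn.
apply: (@le_trans _ _ (sinc (N * x ord0 i) ^+ (2 * d) * 1)).
  apply: ler_wpM2l; first exact: sinc2_ge0.
  by apply: prodr_ile1 => j _; rewrite sinc2_ge0 sinc2_le1.
rewrite mulr1 exprM -(real_normK (num_real (sinc _))) -exprM.
apply: lerXn2r; rewrite ?nnegrE ?mulr_ge0 ?invr_ge0//; try exact: ltW.
have a0 : N * x ord0 i != 0 by apply: mulf_neq0; [rewrite gt_eqF|rewrite -normr_gt0].
apply: (le_trans (norm_sinc_le a0)); rewrite normrM (gtr0_norm N0) invfM mulrC.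
apply: ler_wpM2r; first by rewrite invr_ge0 ltW.
by rewrite -[s / r]invrK invf_div lef_pV2 ?posrE ?divr_gt0.
Qed.

(** High powers of [sinc] decay fast enough that the mass of the bump near the
    origin dominates its values away from it. *)
Lemma mollifier_exists (r e : R) : 0 < r -> 0 < e -> exists Phi : V -> R,
  exists b : R, mollifier r e b Phi.
Proof.
move=> r0 e0.
pose c : R := (2^-1) ^+ (2 * d * d) * (s + 1)^-1 ^+ d.
have s1 : 0 < s + 1 by rewrite addr_gt0.
have c0 : 0 < c by rewrite mulr_gt0// exprn_gt0// invr_gt0.
pose q := (s / r) ^+ (2 * d).
have q0 : 0 < q by rewrite exprn_gt0// divr_gt0.
pose N : R := 1 + r^-1 + q / (e * c).
have qec : 0 < q / (e * c) by rewrite divr_gt0// mulr_gt0.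
have rV0 : 0 < r^-1 by rewrite invr_gt0.
have N1 : 1 <= N by rewrite /N -addrA lerDl addr_ge0// ltW.
have N0 : 0 < N by exact: lt_le_trans N1.
have Nr : N^-1 <= r.
  by rewrite -[r]invrK lef_pV2 ?posrE// /N [1 + _]addrC -addrA lerDl addr_ge0// ltW.
have mPhi := measurable_cosine_superposition (Phi_cos N).
have m1 : measurable_fun setT (fun x => \1_(eball 0 r) x * Phi N x).
  by apply: measurable_funM; [exact: measurable_eball_indic|exact: mPhi].
have I0 a x : 0 <= \1_(eball 0 a) x * Phi N x by rewrite mulr_ge0// indicE.
have lty : (\int[mu]_x (\1_(eball 0 r) x * Phi N x)%:E < +oo)%E.
  apply: (@le_lt_trans _ _ (\int[mu]_x (\1_(eball (0 : V) r) x)%:E)%E).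
    apply: ge0_le_integral_real => //; first exact: measurable_eball_indic.
    by move=> x; rewrite -[leRHS]mulr1; apply: ler_wpM2l; rewrite ?indicE//; exact: Phi_le1.
  rewrite integral_indic; [|exact: measurableT|exact: measurable_eball].
  by rewrite setIT; exact: lebesgue_eball_lty.
pose b := \int[mu]_x (\1_(eball 0 r) x * Phi N x).
have bE : (\int[mu]_x (\1_(eball 0 r) x * Phi N x)%:E = b%:E)%E by exact: ge0_RintegralE.
have cb : c * N^-1 ^+ d <= b.
  rewrite -lee_fin -bE.
  apply: (@le_trans _ _ (\int[mu]_x ((2^-1) ^+ (2 * d * d) * \1_(eball (0 : V) N^-1) x)%:E)%E).
    rewrite ge0_integralZl_real; [|exact: measurable_eball_indic|by move=> x; rewrite indicE|by rewrite exprn_ge0// invr_ge0].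
    rewrite integral_indic; [|exact: measurableT|exact: measurable_eball].
    rewrite setIT /c -mulrA EFinM lee_wpmul2l ?lee_fin ?exprn_ge0 ?invr_ge0//.
    rewrite -exprMn mulrC; apply: lebesgue_eball_ge.
    by rewrite invr_ge0 ltW.
  apply: ge0_le_integral_real => //.
  - by apply: measurable_funM; [exact: measurable_cst|exact: measurable_eball_indic].
  - move=> x; rewrite !indicE; case: (boolP (x \in eball 0 N^-1)) => [|_]; last first.
      by rewrite mulr0 mulr_ge0.
    rewrite inE eball0E /= => xN; rewrite mem_set; last first.
      by rewrite eball0E /=; exact: le_trans xN Nr.
    by rewrite mulr1 mul1r; exact: Phi_center.
exists (Phi N), b; split => //; first exact: ltW.
  by apply: lt_le_trans cb; rewrite mulr_gt0// exprn_gt0// invr_gt0.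
move=> x rx; apply: (le_trans (Phi_tail N0 r0 rx)).
have -> : N^-1 ^+ (2 * d) = N^-1 ^+ d * N^-1 ^+ d by rewrite -exprD addnn mul2n.
rewrite -/q mulrCA mulrC [q * _]mulrC.
have Nd : N^-1 ^+ d <= N^-1 by apply: ler_iXnr; rewrite ?invr_ge0 ?(ltW N0)// invf_le1.
have VN0 : 0 <= N^-1 by rewrite invr_ge0 ltW.
apply: (@le_trans _ _ (e * (c * N^-1 ^+ d))); last by rewrite ler_pM2l.
rewrite mulrA; apply: ler_wpM2r; first by rewrite exprn_ge0.
apply: (@le_trans _ _ (N^-1 * q)); first by apply: ler_wpM2r => //; exact: ltW.
have ec0 : 0 < e * c by exact: mulr_gt0.
rewrite (ler_pdivrMl _ _ N0) -(ler_pdivrMr _ _ ec0) /N lerDr.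
by rewrite addr_ge0// ltW.
Qed.

End mollifier_existence.

(** * A barrier that gains mass from the long jumps *)

Section sdiff_mass.
Context {R : realType} {d : nat}.
Local Notation V := 'rV[R]_d.
Local Notation mu := (lebesgue_rV R d).

(** All translates of a nonnegative function have the same mass. *)
Lemma integral_sdiff_ge0_le (h : V -> R) : measurable_fun setT h ->
  (forall x, 0 <= h x) -> (\int[mu]_x (h x)%:E < +oo)%E -> forall y : V,
  (\int[mu]_z `|sdiff h y z|%:E <= (2 * \int[mu]_x h x)%:E)%E.
Proof.
move=> mh h0 hlty y; have HE := ge0_RintegralE h0 hlty.
have ms (v : V) : measurable_fun setT (fun z : V => h (z + v)) by mfun.
have ms2 : measurable_fun setT (fun z : V => h (z + y) + h (z - y)).
  by apply: measurable_funD; exact: ms.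
have sh (v : V) : (\int[mu]_z (h (z + v))%:E = (\int[mu]_x h x)%:E)%E.
  rewrite -HE; apply: (ge0_integral_rV_shift v (f := fun z => (h z)%:E)).
    by apply/measurable_EFinP.
  by move=> z; rewrite lee_fin h0.
have b2 : (\int[mu]_z (2^-1 * (h (z + y) + h (z - y)))%:E = (\int[mu]_x h x)%:E)%E.
  rewrite ge0_integralZl_real//; last by move=> z; rewrite addr_ge0// h0.
  rewrite ge0_integralD_real; [|exact: ms|exact: ms|by move=> z; exact: h0|by move=> z; exact: h0].
  by rewrite !sh -EFinD -EFinM; congr EFin; field.
apply: (@le_trans _ _ (\int[mu]_z (h z + 2^-1 * (h (z + y) + h (z - y)))%:E)%E).
  apply: ge0_le_integral_real => //.
  - apply: measurableT_comp; first exact: normr_measurable.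
    apply: measurable_funB => //; exact: measurable_funM.
  - by apply: measurable_funD => //; exact: measurable_funM.
  - move=> z; have := h0 z; have := h0 (z + y); have := h0 (z - y).
    by move=> *; rewrite /sdiff ler_norml; apply/andP; split; lra.
rewrite ge0_integralD_real//; last 2 first.
- exact: measurable_funM.
- by move=> z; rewrite mulr_ge0// addr_ge0// h0.
by rewrite b2 HE -EFinD lee_fin mulrDl mul1r.
Qed.

End sdiff_mass.

Section barrier.
Context {R : realType} {d : nat}.
Local Notation V := 'rV[R]_d.
Local Notation mu := (lebesgue_rV R d).

Let ppart (t : R) := Num.max t 0.

Let ppart_ge0 t : 0 <= ppart t. Proof. by rewrite /ppart le_max lexx orbT. Qed.
Let ppart_ge t : t <= ppart t. Proof. by rewrite /ppart le_max lexx. Qed.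
Let ppartM t : ppart t * t = ppart t ^+ 2.
Proof. by rewrite /ppart; case: leP => _; rewrite ?mul0r ?expr0n ?expr2. Qed.

Variable r : R.

(** The square of the positive part of [r^2 - |x|^2]: its second differences are
    quadratic, and they are small where the function itself is small. *)
Definition barrier (x : V) : R := ppart (r ^+ 2 - enorm x ^+ 2) ^+ 2.

Hypotheses (r_gt0 : 0 < r) (r_le1 : r <= 1).

Let q (x : V) := r ^+ 2 - enorm x ^+ 2.
Let s (x : V) := ppart (q x).

Lemma barrier_ge0 x : 0 <= barrier x. Proof. exact: sqr_ge0. Qed.

Let s_le_sqr x : s x <= r ^+ 2.
Proof. by rewrite /s /ppart ge_max sqr_ge0 andbT /q lerBlDr lerDl sqr_ge0. Qed.

Let s_le1 x : s x <= 1.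
Proof. by apply: (le_trans (s_le_sqr x)); rewrite expr_le1// ltW. Qed.

Let s_ge0 x : 0 <= s x. Proof. exact: ppart_ge0. Qed.

Lemma barrier_le1 x : barrier x <= 1.
Proof. by rewrite expr_le1 ?s_le1. Qed.

Let s_out x : r <= enorm x -> s x = 0.
Proof.
move=> x1; apply/max_r; rewrite /q subr_le0.
by apply: lerXn2r; rewrite ?nnegrE ?enorm_ge0// ltW.
Qed.

Lemma barrier_out x : r <= enorm x -> barrier x = 0.
Proof. by move=> x1; rewrite /barrier -/(q x) -/(s x) s_out// expr0n. Qed.

Lemma barrier_le_indic x : barrier x <= \1_(eball 0 r) x.
Proof.
rewrite indicE; case: (boolP (x \in _)) => [_|]; first exact: barrier_le1.
move=> /negP; rewrite inE eball0E /= => /negP; rewrite -ltNge => x1.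
by rewrite barrier_out// ltW.
Qed.

Lemma measurable_barrier : measurable_fun setT barrier.
Proof.
apply: measurable_funX; apply: measurable_maxr; last exact: measurable_cst.
by apply: measurable_funB; [exact: measurable_cst|mfun].
Qed.

Lemma barrier_integral_lty : (\int[mu]_x (barrier x)%:E < +oo)%E.
Proof.
apply: (@le_lt_trans _ _ (\int[mu]_x (\1_(eball (0 : V) r) x)%:E)%E).
  apply: ge0_le_integral_real; [exact: measurable_barrier|exact: measurable_eball_indic| |].
    exact: barrier_ge0.
  exact: barrier_le_indic.
rewrite integral_indic; [|exact: measurableT|exact: measurable_eball].
by rewrite setIT; exact: lebesgue_eball_lty.
Qed.

Lemma integrable_barrier : mu.-integrable setT (EFin \o barrier).
Proof.
exact: (integrable_ge0 measurable_barrier barrier_ge0 barrier_integral_lty).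
Qed.

Let qD x y : q (x + y) = q x - 2 * dotv x y - enorm y ^+ 2.
Proof. by rewrite /q sqr_enormD; ring. Qed.
Let qB x y : q (x - y) = q x + 2 * dotv x y - enorm y ^+ 2.
Proof. by rewrite /q sqr_enormB; ring. Qed.

Let sq_ge (w t : R) : 0 <= w -> 2 * w * t - w ^+ 2 <= ppart t ^+ 2.
Proof.
move=> w0; have := ppart_ge t; have := sqr_ge0 (ppart t - w).
rewrite sqrrB; nra.
Qed.

Let sq_le (x : V) t : ppart t ^+ 2 <= (s x + (t - q x)) ^+ 2.
Proof.
have [t0|t0] := leP t 0; first by rewrite {1}/ppart (max_r t0) expr0n/= sqr_ge0.
have tE : ppart t = t by exact: (max_l (ltW t0)).
rewrite tE; apply: lerXn2r; rewrite ?nnegrE; first exact: ltW.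
- by rewrite addrCA addr_ge0 ?(ltW t0)// subr_ge0 ppart_ge.
- by rewrite addrCA lerDl subr_ge0 ppart_ge.
Qed.

(** The square of the positive part is convex, hence above its tangent at [s x], and
    in the second difference the terms linear in [y] cancel.  The bound vanishes with
    [s x], which is what lets the barrier absorb it. *)
Lemma sdiff_barrier_sup (y x : V) : sdiff barrier y x <= 2 * s x * enorm y ^+ 2.
Proof.
have := sq_ge (q (x + y)) (s_ge0 x); have := sq_ge (q (x - y)) (s_ge0 x).
have := ppartM (q x); rewrite -/(s x) /sdiff /barrier -!/(q _) -!/(s _) (qB x y) (qD x y) => E.
nra.
Qed.

Let sdiff_barrier_inf (y x : V) : enorm x <= 2 -> enorm y <= 1 ->
  - (25 * enorm y ^+ 2) <= sdiff barrier y x.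
Proof.
move=> x2 y1; have y0 := enorm_ge0 y; have x0 := enorm_ge0 x.
have := sq_le x (q (x + y)); have := sq_le x (q (x - y)).
have := dotv_le x y; rewrite ler_norml => /andP[dl dr].
have xy : enorm x * enorm y <= 2 * enorm y by rewrite ler_wpM2r.
have yy : enorm y ^+ 2 <= enorm y by rewrite expr2 ler_piMl.
have D2 : (2 * dotv x y + enorm y ^+ 2) ^+ 2 <= 25 * enorm y ^+ 2.
  rewrite (_ : 25 * _ = (5 * enorm y) ^+ 2); last by ring.
  rewrite -[leLHS](real_normK (num_real _)); apply: lerXn2r; rewrite ?nnegrE ?mulr_ge0//.
  by rewrite ler_norml; apply/andP; split; nra.
have E2 : (2 * dotv x y - enorm y ^+ 2) ^+ 2 <= 25 * enorm y ^+ 2.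
  rewrite (_ : 25 * _ = (5 * enorm y) ^+ 2); last by ring.
  rewrite -[leLHS](real_normK (num_real _)); apply: lerXn2r; rewrite ?nnegrE ?mulr_ge0//.
  by rewrite ler_norml; apply/andP; split; nra.
rewrite /sdiff /barrier -!/(q _) -!/(s _) (qB x y) (qD x y) => H1 H2.
have s0 := s_ge0 x; have e0 := sqr_ge0 (enorm y); have := mulr_ge0 s0 e0.
move: H1 H2 D2 E2; rewrite -/(s x).
set sx := s x; set e := enorm y ^+ 2; set dd := dotv x y; set qq := q x; set p1 := s (x - y); set p2 := s (x + y).
move=> H1 H2 D2 E2 se; nra.
Qed.

Lemma sdiff_barrier_le (y x : V) : `|sdiff barrier y x| <= 25 * Num.min 1 (enorm y ^+ 2).
Proof.
have b0 := barrier_ge0; have b1 := barrier_le1.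
have := b0 x; have := b0 (x + y); have := b0 (x - y).
have := b1 x; have := b1 (x + y); have := b1 (x - y).
have [y1|y1] := leP 1 (enorm y ^+ 2).
  by move=> *; rewrite /sdiff ler_norml; apply/andP; split; lra.
have y1' : enorm y <= 1.
  by rewrite -(ler_pXn2r (n := 2))// ?nnegrE ?enorm_ge0// expr1n ltW.
have [x2|x2] := leP (enorm x) 2.
  move=> *; rewrite ler_norml (sdiff_barrier_inf x2 y1')/=.
  apply: (le_trans (sdiff_barrier_sup y x)).
  by apply: ler_wpM2r; [exact: sqr_ge0|have := s_le1 x; lra].
move=> _ _ _ _ _ _; rewrite /sdiff !barrier_out ?add0r ?mul0r ?subr0 ?normr0.
- by rewrite normrN normr0 mulr_ge0// sqr_ge0.
- by have := enorm_triB x (- y); rewrite enormN; move: r_le1; lra.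
- by have := enorm_triB x y; move: r_le1; lra.
- move: r_le1; lra.
Qed.

Lemma integral_sdiff_barrier : exists2 Cs : R, 0 <= Cs & forall y : V,
  (\int[mu]_z `|sdiff barrier y z|%:E <= (Cs * Num.min 1 (enorm y ^+ 2))%:E)%E.
Proof.
pose H := \int[mu]_x barrier x.
have HE := ge0_RintegralE barrier_ge0 barrier_integral_lty; rewrite -/H in HE.
have H0 : 0 <= H by apply: Rintegral_ge0 => x _; exact: barrier_ge0.
pose B := fine (mu (eball (0 : V) 2)).
have B0 : 0 <= B by rewrite fine_ge0.
have BE : (\int[mu]_x (\1_(eball (0 : V) 2) x)%:E)%E = B%:E.
  rewrite integral_indic; [|exact: measurableT|exact: measurable_eball].
  rewrite setIT /B fineK// ge0_fin_numE//; exact: lebesgue_eball_lty.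
have mb := measurable_barrier.
have md (y : V) : measurable_fun setT (fun z : V => sdiff barrier y z).
  exact: (measurable_sect1 (f := sdiff barrier) (measurable_sdiff integrable_barrier)).
have mnd (y : V) : measurable_fun setT (fun z : V => `|sdiff barrier y z|).
  by apply: measurableT_comp; [exact: normr_measurable|exact: md].
have mI := @measurable_eball_indic R d 0 2.
exists (25 * B + 2 * H) => [|y]; first by rewrite addr_ge0// mulr_ge0.
have [y1|y1] := leP 1 (enorm y ^+ 2).
  apply: (le_trans (integral_sdiff_ge0_le measurable_barrier barrier_ge0 barrier_integral_lty y)).
  by rewrite -/H lee_fin mulr1 lerDr mulr_ge0.
apply: (@le_trans _ _ (\int[mu]_z (25 * enorm y ^+ 2 * \1_(eball (0 : V) 2) z)%:E)%E).
  apply: ge0_le_integral_real => //; first exact: measurable_funM.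
  move=> z; rewrite indicE; case: (boolP (z \in _)) => [_|].
    rewrite mulr1; apply: (le_trans (sdiff_barrier_le y z)).
    by rewrite ler_pM2l// ge_min lexx orbT.
  move=> /negP; rewrite inE eball0E /= => /negP; rewrite -ltNge => z2.
  have y1' : enorm y <= 1.
    by rewrite -(ler_pXn2r (n := 2))// ?nnegrE ?enorm_ge0// expr1n ltW.
  rewrite /sdiff !barrier_out ?add0r ?mul0r ?subr0 ?normr0 ?mulr0//.
  - by rewrite normrN normr0.
  - by have := enorm_triB z (- y); rewrite enormN; move: r_le1; lra.
  - by have := enorm_triB z y; move: r_le1; lra.
  - move: r_le1; lra.
have e0 := sqr_ge0 (enorm y).
rewrite ge0_integralZl_real//; last by rewrite mulr_ge0.
rewrite BE -EFinM lee_fin.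
by have := mulr_ge0 H0 e0; nra.
Qed.

Variable K : V -> R.
Hypothesis mK : measurable_fun setT K.
Hypothesis K_ge0 : forall y, 0 <= K y.
Hypothesis K_levy : (\int[mu]_y (Num.min 1 (enorm y ^+ 2) * K y)%:E < +oo)%E.
Variables (kw : V -> R) (a D kw0 kw1 : R).
Hypothesis a_gt0 : 0 < a.
Hypothesis kw_le_K : forall y, y != 0 -> a * kw y <= K y.
Hypothesis kw_doubling : forall x y : V, enorm y <= 2 * enorm x -> kw x <= D * kw y.
Hypothesis D_gt0 : 0 < D.
Hypothesis kw_ge0 : forall x, 0 <= kw x.
Hypothesis kw_le : forall x, kw x <= kw0.
Hypothesis kw1_gt0 : 0 < kw1.
Hypothesis kw_ge : forall x, enorm x <= 1 -> kw1 <= kw x.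

Let M := levy_mass K.
Let M0 : 0 <= M. Proof. exact: levy_mass_ge0. Qed.
Let vol := fine (mu (eball (0 : V) (r / 2))).
Let vol0 : 0 < vol.
Proof.
by rewrite fine_gt0// lebesgue_eball_lty andbT; apply: lebesgue_eball_gt0; rewrite divr_gt0.
Qed.

Let integrable_levy : mu.-integrable setT (EFin \o (fun y => Num.min 1 (enorm y ^+ 2) * K y)).
Proof.
apply: integrable_ge0 => //; first exact: measurable_levy_integrand.
by move=> y; rewrite mulr_ge0// min1_sqr_ge0.
Qed.

Let integrable_sdiffK (z : V) : mu.-integrable setT (EFin \o (fun y => sdiff barrier y z * K y)).
Proof.
have ms := measurable_sdiff integrable_barrier.
apply: (@integrable_dominated _ _ _ _ _ (fun y => 25 * (Num.min 1 (enorm y ^+ 2) * K y))).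
- by apply: measurable_funM => //; exact: (measurable_sect2 (f := sdiff barrier) ms).
- by apply: measurable_funM => //; exact: measurable_levy_integrand.
- move=> y; rewrite normrM (ger0_norm (K_ge0 y)) mulrA.
  by apply: ler_wpM2r => //; exact: sdiff_barrier_le.
- rewrite ge0_integralZl_real//; last 2 first.
  + exact: measurable_levy_integrand.
  + by move=> y; rewrite mulr_ge0// min1_sqr_ge0.
  by rewrite (levy_massE K_ge0 K_levy) -EFinM ltry.
Qed.

Let sdiff_le_min (y z : V) : sdiff barrier y z <= 2 * s z * Num.min 1 (enorm y ^+ 2).
Proof.
have [y1|y1] := leP 1 (enorm y ^+ 2); last exact: sdiff_barrier_sup.
have := barrier_ge0 (z + y); have := barrier_ge0 (z - y).
rewrite /sdiff {3}/barrier -/(q z) -/(s z); have := s_ge0 z; have := s_le1 z; nra.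
Qed.

Let nonlocal_le (z : V) : nonlocal_op K barrier z <= 2 * s z * M.
Proof.
rewrite /M /levy_mass -(RintegralZl _ measurableT integrable_levy).
apply: le_Rintegral; [exact: measurableT|exact: integrable_sdiffK|exact: (integrableZl measurableT _ integrable_levy)|].
move=> y _; rewrite mulrA; apply: ler_wpM2r; [exact: K_ge0|exact: sdiff_le_min].
Qed.

(* On the ball of radius [r/2] the barrier is at least [(3/4 r^2)^2 = 9/16 r^4], and
   half of it enters the average of the two opposite jumps. *)
Let c1 : R := 9 / 32 * r ^+ 4 * (a / D * vol).
Let c1_gt0 : 0 < c1.
Proof.
rewrite mulr_gt0//; first by rewrite mulr_gt0// exprn_gt0.
by rewrite mulr_gt0// divr_gt0.
Qed.

(** Away from the origin the jumps into the ball of radius [r/2] lower the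
   nonlocal operator by a multiple of the jump density. *)
Let nonlocal_far (z : V) : 3 / 4 * r <= enorm z ->
  nonlocal_op K barrier z <= 32 * s z * M - c1 * kw z.
Proof.
move=> z1; pose A := eball (- z) (r / 2).
have mA : measurable_fun setT (\1_A : V -> R) by exact: measurable_eball_indic.
have zA y : y \in A -> enorm (z + y) <= r / 2.
  by rewrite inE /A /eball /= opprK addrC.
have yA y : y \in A -> enorm z <= enorm y + r / 2 /\ enorm y <= enorm z + r / 2.
  move=> /zA zy; have := enorm_triB z y; have := enorm_triB y z.
  by rewrite [y + z]addrC; split; lra.
have s0 := s_ge0 z; have r20 := sqr_ge0 r.
have min_A y : y \in A -> r ^+ 2 / 16 <= Num.min 1 (enorm y ^+ 2).
  move=> yinA; have [h1 h2] := yA _ yinA.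
  have r21 : r ^+ 2 <= 1 by rewrite expr_le1// ltW.
  rewrite le_min; apply/andP; split; first by lra.
  have -> : r ^+ 2 / 16 = (r / 4) ^+ 2 by field.
  apply: lerXn2r; rewrite ?nnegrE ?enorm_ge0//; last by lra.
  by rewrite divr_ge0// ltW.
have sdiffA y : sdiff barrier y z <= 32 * s z * Num.min 1 (enorm y ^+ 2) - 9 / 32 * r ^+ 4 * \1_A y.
  rewrite indicE; case: (boolP (y \in A)) => [yinA|_]; last first.
    rewrite mulr0 subr0; apply: (le_trans (sdiff_le_min y z)).
    by apply: ler_wpM2r; [exact: min1_sqr_ge0|lra].
  rewrite mulr1; have [h1 h2] := yA _ yinA.
  have m16 := min_A _ yinA.
  have zy := zA _ yinA; have zy0 := enorm_ge0 (z + y).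
  have q34 : 3 / 4 * r ^+ 2 <= s (z + y).
    apply: le_trans (ppart_ge _); rewrite /q.
    have : enorm (z + y) ^+ 2 <= (r / 2) ^+ 2 by apply: lerXn2r; rewrite ?nnegrE// divr_ge0// ltW.
    by rewrite expr_div_n; lra.
  have s2 : 9 / 16 * r ^+ 4 <= barrier (z + y).
    rewrite /barrier -/(q _) -/(s _) (_ : 9 / 16 * r ^+ 4 = (3 / 4 * r ^+ 2) ^+ 2); last by field.
    by apply: lerXn2r; [rewrite nnegrE; apply: mulr_ge0; [lra|exact: sqr_ge0]|rewrite nnegrE; exact: s_ge0|exact: q34].
  have sz2 : barrier z <= s z * r ^+ 2.
    by rewrite /barrier -/(q _) -/(s _) expr2; apply: ler_wpM2l; [exact: s_ge0|exact: s_le_sqr].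
  have := barrier_ge0 (z - y); rewrite /sdiff.
  by have := ler_wpM2l s0 m16; have := mulr_ge0 s0 r20; lra.
have kwA y : a / D * kw z * \1_A y <= \1_A y * K y.
  rewrite indicE; case: (boolP (y \in A)) => [yinA|_]; last by rewrite mulr0 mul0r.
  have [h1 h2] := yA _ yinA; rewrite mulr1 mul1r.
  have y0 : y != 0 by apply: contraTneq h1 => ->; rewrite enorm0 -ltNge; move: r_gt0; lra.
  apply: le_trans (kw_le_K y0); rewrite -mulrA ler_pM2l// mulrC ler_pdivrMr// mulrC.
  by apply: kw_doubling; lra.
have mAK : measurable_fun setT (fun y => \1_A y * K y) by exact: measurable_funM.
have AK0 y : 0 <= \1_A y * K y by rewrite mulr_ge0// indicE.
have iAK : mu.-integrable setT (EFin \o (fun y => \1_A y * K y)).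
  apply: (@integrable_dominated _ _ _ _ _ (fun y => 16 / r ^+ 2 * (Num.min 1 (enorm y ^+ 2) * K y))).
  - exact: mAK.
  - by apply: measurable_funM => //; exact: measurable_levy_integrand.
  - move=> y; rewrite ger0_norm// mulrA; apply: ler_wpM2r => //.
    rewrite indicE; case: (boolP (y \in A)) => [yinA|_]; last first.
      by rewrite mulr_ge0 ?divr_ge0// min1_sqr_ge0.
    have r2 : 0 < r ^+ 2 by rewrite exprn_gt0.
    by rewrite -ler_pdivrMl ?divr_gt0// invf_div mulr1; exact: min_A.
  - rewrite ge0_integralZl_real//; last 3 first.
    + exact: measurable_levy_integrand.
    + by move=> y; rewrite mulr_ge0// min1_sqr_ge0.
    + by rewrite divr_ge0.
    by rewrite (levy_massE K_ge0 K_levy) -EFinM ltry.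
have volA : (\int[mu]_y (\1_A y)%:E)%E = vol%:E.
  have <- : mu (eball (- z) (r / 2)) = vol%:E.
    rewrite lebesgue_eball_shift /vol fineK// ge0_fin_numE//; exact: lebesgue_eball_lty.
  rewrite integral_indic; [by rewrite setIT|exact: measurableT|exact: measurable_eball].
have low : a / D * kw z * vol <= \int[mu]_y (\1_A y * K y).
  rewrite -lee_fin -ge0_RintegralE//; last first.
    move/integrableP : iAK => [_]; apply: le_lt_trans.
    by apply: ge0_le_integral_real => //; [exact: measurableT_comp|move=> y; exact: ler_norm].
  rewrite EFinM -volA -ge0_integralZl_real//; last first.
    by rewrite mulr_ge0// divr_ge0// ltW.
  apply: ge0_le_integral_real => //; first exact: measurable_funM.
  by move=> y; rewrite mulr_ge0// ?indicE// mulr_ge0// divr_ge0// ltW.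
have iL := integrableZl measurableT (32 * s z) integrable_levy.
have iR := integrableZl measurableT (9 / 32 * r ^+ 4) iAK.
apply: (@le_trans _ _ (32 * s z * M - 9 / 32 * r ^+ 4 * \int[mu]_y (\1_A y * K y))); last first.
  rewrite lerD2l lerN2 /c1 -(mulrA (9 / 32 * r ^+ 4)) [a / D * vol * _]mulrAC.
  by apply: ler_wpM2l; [apply: mulr_ge0; [lra|exact: exprn_ge0 (ltW r_gt0)]|exact: low].
rewrite /M /levy_mass -(RintegralZl _ measurableT integrable_levy).
rewrite -(RintegralZl _ measurableT iAK) -(RintegralB measurableT iL iR).
apply: le_Rintegral; [exact: measurableT|exact: integrable_sdiffK|exact: (integrableB measurableT iL iR)|].
move=> y _; apply: (@le_trans _ _ ((32 * s z * Num.min 1 (enorm y ^+ 2) - 9 / 32 * r ^+ 4 * \1_A y) * K y)).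
  by apply: ler_wpM2r; [exact: K_ge0|exact: sdiffA].
by rewrite mulrBl !mulrA.
Qed.

(** Near the origin the bump dominates its image under the operator; elsewhere
    [C s^2 - 32 M s] is at least [- 256 M^2 / C] and is absorbed by the jumps. *)
Lemma barrier_growth : exists C0 c : R, 0 < c /\ forall C z, C0 <= C ->
  c * kw z <= C * barrier z - nonlocal_op K barrier z.
Proof.
pose k := c1 * kw1 / 2; have k0 : 0 < k by rewrite divr_gt0// mulr_gt0.
have kw00 : 0 <= kw0 by exact: le_trans (kw_le 0).
have c10 := c1_gt0.
have t1 : 0 <= 256 * M ^+ 2 / k by apply: divr_ge0; [apply: mulr_ge0; [lra|exact: sqr_ge0]|exact: ltW].
have t2 : 0 <= 256 / (49 * r ^+ 4) * (2 * M + c1 / 2 * kw0).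
  have c20 : 0 <= c1 / 2 by apply: divr_ge0; [exact: ltW|lra].
  apply: mulr_ge0; first by apply: divr_ge0; [lra|apply: mulr_ge0; [lra|exact: exprn_ge0 (ltW r_gt0)]].
  apply: addr_ge0; last exact: mulr_ge0 c20 kw00.
  by apply: mulr_ge0; [lra|exact: M0].
exists (256 * M ^+ 2 / k + 256 / (49 * r ^+ 4) * (2 * M + c1 / 2 * kw0)), (c1 / 2).
split=> [|C z HC]; first by rewrite divr_gt0.
have s0 := s_ge0 z; have s1 := s_le1 z; have m0 := M0.
have kz := kw_ge0 z; have kz0 := kw_le z.
rewrite {1}/barrier -/(q z) -/(s z).
have [z34|z34] := leP (3 / 4 * r) (enorm z).
  have Lf := nonlocal_far z34.
  have C0 : 0 <= C by lra.
  have [z1|z1] := leP r (enorm z).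
    move: Lf; rewrite s_out// mulr0 mul0r expr0n/= mulr0 !sub0r => Lf.
    by have := mulr_ge0 (ltW c10) kz; lra.
  have kk := kw_ge (le_trans (ltW z1) r_le1).
  have kC : 256 * M ^+ 2 <= k * C by rewrite [k * C]mulrC -ler_pdivrMr//; lra.
  have : 0 <= C * s z ^+ 2 - 32 * M * s z + k.
    rewrite -(pmulr_rge0 _ k0).
    have -> : k * (C * s z ^+ 2 - 32 * M * s z + k) =
        (16 * M * s z - k) ^+ 2 + (k * C - 256 * M ^+ 2) * s z ^+ 2 by ring.
    apply: addr_ge0; first exact: sqr_ge0.
    by apply: mulr_ge0; [rewrite subr_ge0; exact: kC|exact: sqr_ge0].
  have : c1 * kw1 <= c1 * kw z by rewrite ler_pM2l.
  rewrite /k; move: Lf; set t := s z => Lf; lra.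
have Ln := nonlocal_le z.
have s7 : 7 / 16 * r ^+ 2 <= s z.
  apply: le_trans (ppart_ge _); rewrite /q.
  have : enorm z ^+ 2 <= (3 / 4 * r) ^+ 2.
    by apply: lerXn2r; rewrite ?nnegrE ?enorm_ge0 ?mulr_ge0// ltW.
  by rewrite exprMn; lra.
have HC2 : 256 / (49 * r ^+ 4) * (2 * M + c1 / 2 * kw0) <= C by lra.
have : c1 * kw z <= c1 * kw0 by rewrite ler_pM2l.
have : 49 / 256 * r ^+ 4 <= s z ^+ 2.
  rewrite (_ : 49 / 256 * r ^+ 4 = (7 / 16 * r ^+ 2) ^+ 2 :> R); last by field.
  by apply: lerXn2r; [rewrite nnegrE; apply: mulr_ge0; [lra|exact: sqr_ge0]|rewrite nnegrE; exact: s_ge0|exact: s7].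
have : s z * M <= M by rewrite ler_piMl.
have C0 : 0 <= C by lra.
move: Ln; set t := s z => Ln h1 h2 h3.
have : C * (49 / 256 * r ^+ 4) <= C * t ^+ 2 by rewrite ler_wpM2l.
have HC3 : 2 * M + c1 / 2 * kw0 <= C * (49 / 256 * r ^+ 4).
  have r4 : 0 < 49 / 256 * r ^+ 4 by apply: mulr_gt0; [lra|exact: exprn_gt0].
  rewrite -ler_pdivrMr//; apply: le_trans HC2; rewrite mulrC.
  by rewrite (_ : (49 / 256 * r ^+ 4)^-1 = 256 / (49 * r ^+ 4))//; field; exact: lt0r_neq0.
lra.
Qed.

End barrier.

(** * The operator acting on the weight *)

Section weight_kernel_bounds.
Context {R : realType} {d : nat}.
Local Notation V := 'rV[R]_d.
Local Notation mu := (lebesgue_rV R d).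
Variables (K kw W : V -> R) (Cr Cv C1 : R).
Hypothesis mK : measurable_fun setT K.
Hypothesis K0 : forall y, 0 <= K y.
Hypothesis K_levy : (\int[mu]_y (Num.min 1 (enorm y ^+ 2) * K y)%:E < +oo)%E.
Hypothesis mkw : measurable_fun setT kw.
Hypothesis kw0 : forall y, 0 <= kw y.
Hypothesis mW : measurable_fun setT W.
Hypothesis W0 : forall x, 0 < W x.
Hypothesis WT : (\int[mu]_x (W x)%:E < +oo)%E.
Hypothesis Cr0 : 0 <= Cr.
Hypothesis Wsd : forall x y : V, enorm y <= 1 ->
  `|W x - (W (x + y) + W (x - y)) / 2| <= Cr * enorm y ^+ 2 * W x.
Hypothesis Cv0 : 0 < Cv.
Hypothesis HCv : forall x : V,
  (\int[mu]_y (W (x - y) * kw y)%:E <= (Cv * W x)%:E)%E /\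
  (\int[mu]_y (W (x + y) * kw y)%:E <= (Cv * W x)%:E)%E.
Hypothesis C10 : 0 < C1.
Hypothesis HC1 : forall y, 1 <= enorm y -> K y <= C1 * kw y.

Let le1 (y : V) : enorm y ^+ 2 < 1 -> enorm y <= 1.
Proof. by move=> y1; rewrite -(ler_pXn2r (n := 2))// ?nnegrE ?enorm_ge0// expr1n ltW. Qed.

Let ge1 (y : V) : 1 <= enorm y ^+ 2 -> 1 <= enorm y.
Proof. by move=> y1; rewrite -(ler_pXn2r (n := 2))// ?nnegrE ?enorm_ge0// expr1n. Qed.

(** Small jumps cost a second difference of the weight, and the large ones are
    absorbed by the convolution estimate. *)
Lemma weight_sdiff_kernel : exists2 C : R, 0 <= C & forall x : V,
  (\int[mu]_y (`|sdiff W y x| * K y)%:E <= (C * W x)%:E)%E.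
Proof.
pose M := levy_mass K; have M0 : 0 <= M by exact: levy_mass_ge0.
exists ((Cr + 1) * M + C1 * Cv) => [|x].
  by rewrite addr_ge0// mulr_ge0 ?addr_ge0// ltW.
have mWp : measurable_fun setT (fun y : V => W (x + y) * kw y) by mfun.
have mWm : measurable_fun setT (fun y : V => W (x - y) * kw y) by mfun.
have mWk : measurable_fun setT (fun y : V => W (x - y) * kw y + W (x + y) * kw y).
  exact: measurable_funD.
have ml := measurable_levy_integrand mK.
have l0 (y : V) : 0 <= Num.min 1 (enorm y ^+ 2) * K y by rewrite mulr_ge0// min1_sqr_ge0.
have Wx := ltW (W0 x).
have w1 y : 0 <= W (x - y) * kw y by rewrite mulr_ge0// ltW.
have w2 y : 0 <= W (x + y) * kw y by rewrite mulr_ge0// ltW.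
apply: (@le_trans _ _ (\int[mu]_y ((Cr + 1) * W x * (Num.min 1 (enorm y ^+ 2) * K y) +
    C1 / 2 * (W (x - y) * kw y + W (x + y) * kw y))%:E)%E).
  apply: ge0_le_integral_real.
  + apply: measurable_funM => //; apply: measurableT_comp; first exact: normr_measurable.
    apply: measurable_funB; first exact: measurable_cst.
    by apply: measurable_funM; [apply: measurable_funD; mfun|exact: measurable_cst].
  + by apply: measurable_funD; exact: measurable_funM.
  + by move=> y; rewrite mulr_ge0.
  + move=> y; have [y1|y1] := leP 1 (enorm y ^+ 2).
      have Ky := HC1 (ge1 y1); have Ky0 := K0 y.
      have := ltW (W0 (x + y)); have := ltW (W0 (x - y)) => h1 h2.
      have : `|sdiff W y x| <= W x + (W (x - y) + W (x + y)) / 2.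
        by rewrite /sdiff ler_norml; apply/andP; split; lra.
      move=> /(ler_wpM2r Ky0) h; apply: (le_trans h).
      have h3 := ler_wpM2l h1 Ky; have h4 := ler_wpM2l h2 Ky.
      have h5 := mulr_ge0 Wx Ky0; have h6 := mulr_ge0 Cr0 h5.
      rewrite -/kw in h3 h4 *; lra.
    have h := Wsd x (le1 y1); rewrite -/(sdiff W y x) in h.
    have h2 := ler_wpM2r (K0 y) h.
    apply: (le_trans h2).
    have h3 : 0 <= W x * (enorm y ^+ 2 * K y) by rewrite mulr_ge0// mulr_ge0// sqr_ge0.
    have h4 : 0 <= C1 / 2 * (W (x - y) * kw y + W (x + y) * kw y).
      by apply: mulr_ge0; [apply: divr_ge0; [exact: ltW|lra]|exact: addr_ge0].
    lra.
rewrite ge0_integralD_real.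
+ rewrite ge0_integralZl_real//; last by rewrite mulr_ge0// addr_ge0.
  rewrite (levy_massE K0 K_levy) ge0_integralZl_real//; last 2 first.
  * by move=> y; exact: addr_ge0.
  * by apply: divr_ge0 => //; exact: ltW.
  rewrite ge0_integralD_real//; have [h1 h2] := HCv x.
  apply: (@le_trans _ (\bar R) ((Cr + 1) * W x * M + C1 / 2 * (Cv * W x + Cv * W x))%:E).
    rewrite EFinD (EFinM _ M) (EFinM (C1 / 2)) EFinD.
    apply: leeD => //; apply: lee_wpmul2l; first by rewrite lee_fin; apply: divr_ge0 => //; exact: ltW.
    exact: leeD.
  rewrite lee_fin (_ : _ + _ = ((Cr + 1) * M + C1 * Cv) * W x)//; by field.
+ exact: measurable_funM.
+ exact: measurable_funM.
+ by move=> y; rewrite mulr_ge0// mulr_ge0// addr_ge0.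
+ by move=> y; apply: mulr_ge0; [apply: divr_ge0 => //; exact: ltW|exact: addr_ge0].
Qed.

(** Small jumps are controlled pointwise by the weight, large ones by its total
    mass. *)
Lemma weight_sdiff_mass : exists2 C : R, 0 <= C & forall y : V,
  (\int[mu]_x `|sdiff W y x|%:E <= (C * Num.min 1 (enorm y ^+ 2))%:E)%E.
Proof.
pose I := \int[mu]_x W x.
have W0' x : 0 <= W x by exact: ltW.
have IE := ge0_RintegralE W0' WT; rewrite -/I in IE.
have I0 : 0 <= I by apply: Rintegral_ge0 => x _.
exists ((Cr + 2) * I) => [|y]; first by rewrite mulr_ge0// addr_ge0.
have [y1|y1] := leP 1 (enorm y ^+ 2).
  apply: (le_trans (integral_sdiff_ge0_le mW W0' WT y)); rewrite -/I lee_fin mulr1.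
  by apply: ler_wpM2r => //; rewrite lerDr.
apply: (@le_trans _ _ (\int[mu]_z (Cr * enorm y ^+ 2 * W z)%:E)%E).
  apply: ge0_le_integral_real => //.
  + apply: measurableT_comp; first exact: normr_measurable.
    apply: measurable_funB => //; apply: measurable_funM => //.
    by apply: measurable_funD; mfun.
  + exact: measurable_funM.
  + move=> z; exact: (Wsd z (le1 y1)).
rewrite ge0_integralZl_real//; last by rewrite mulr_ge0// sqr_ge0.
rewrite IE -EFinM lee_fin mulrAC; apply: ler_wpM2r; first exact: sqr_ge0.
by apply: ler_wpM2r => //; rewrite lerDl.
Qed.

End weight_kernel_bounds.

(** What the comparison argument uses of the weight: it varies slowly, the
    nonlocal operator is bounded on it in the pointwise weighted sense, and it
    is dominated by the jumps of a compactly supported bump. *)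
Record comparison_weight (R : realType) (d : nat) (K W : 'rV[R]_d -> R) : Prop := {
  cw_measurable : measurable_fun setT W ;
  cw_gt0 : forall x, 0 < W x ;
  cw_integral_lty : (\int[lebesgue_rV R d]_x (W x)%:E < +oo)%E ;
  cw_harnack : forall r : R, 0 <= r -> exists2 C : R, 0 < C &
    forall x x' : 'rV[R]_d, enorm (x - x') <= r -> W x' <= C * W x ;
  cw_sdiff_kernel : exists2 C : R, 0 <= C & forall x : 'rV[R]_d,
    (\int[lebesgue_rV R d]_y (`|sdiff W y x| * K y)%:E <= (C * W x)%:E)%E ;
  cw_sdiff_mass : exists2 C : R, 0 <= C & forall y : 'rV[R]_d,
    (\int[lebesgue_rV R d]_x `|sdiff W y x|%:E <= (C * Num.min 1 (enorm y ^+ 2))%:E)%E ;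
  cw_barrier : forall r : R, 0 < r -> r <= 1 -> exists C0 c : R, 0 < c /\
    forall (C : R) (z : 'rV[R]_d), C0 <= C ->
      c * W z <= C * barrier r z - nonlocal_op K (barrier r) z }.

(** The weight is the convolution of the shifted kernel profile with a negative
    power of [1 + |x|^2] of an exponent larger than [d + b2]. *)
Lemma comparison_weight_exists (R : realType) (d : nat) (K : 'rV[R]_d -> R) :
  mixed_growth_kernel K -> (forall y, 0 <= K y) ->
  exists W : 'rV[R]_d -> R, comparison_weight K W.
Proof.
case=> mK _ K_levy [phi [sphi [CK CK1 Kb] [l1 [l2 [b1 [b2 [l10 l20 b10 b12 gr]]]]]]] K0.
have b20 : 0 < b2 by exact: lt_le_trans b12.
have growth (r s : R) : 0 < r -> r <= s -> phi s / phi r <= l2 * (s / r) `^ b2.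
  by move=> r0 rs; case/andP: (gr r s r0 rs).
pose kw := kweight phi : 'rV[R]_d -> R.
pose m := Num.bound (d%:R + b2).
have m_ge : d%:R + b2 <= m%:R by apply/ltW/archi_boundP; rewrite addr_ge0// ltW.
pose rh := rho m : 'rV[R]_d -> R.
have mkw : measurable_fun setT kw by exact: measurable_kweight sphi.
have mrh : measurable_fun setT rh by exact: measurable_rho.
have kw0 x : 0 <= kw x by exact/ltW/(kweight_gt0 sphi).
have rh0 x : 0 <= rh x by exact: rho_ge0.
have rh1 x : rh x <= 1 by exact: rho_le1.
have kwT := kweight_integral_lty mK K0 K_levy sphi CK1 Kb.
have kwN x : kw (- x) = kw x by exact: kweightN.
have [Crk Crk0 HCrk] := rho_le_kweight sphi l20 b20 growth m_ge.
have [Ckk Ckk0 HCkk] := kweight_conv_le mK K0 K_levy sphi CK1 Kb l20 b20 growth.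
have [D D0 HD] := @kweight_doubling R d phi l2 b2 sphi l20 b20 growth.
pose W := weight rh kw.
have mW : measurable_fun setT W by exact: measurable_weight.
have WT : (\int[lebesgue_rV R d]_x (W x)%:E < +oo)%E.
  exact: (weight_integral_lty mrh mkw rh0 rh1 kw0 kwT Crk0 HCrk Ckk0 HCkk).
have W0 x : 0 < W x.
  have [C C0 HC] := rho_harnack (d := d) m (@ler01 R).
  have k1 : 0 < @kprofile R d phi 1 by apply: (kprofile_gt0 sphi); exact: ler01.
  pose c := C^-1 * rh x * @kprofile R d phi 1.
  have rhx : 0 < rh x by exact: rho_gt0.
  have c0 : 0 < c by apply: mulr_gt0 => //; apply: mulr_gt0 => //; rewrite invr_gt0.
  rewrite -lte_fin -(weightE mrh mkw rh0 rh1 kw0 kwT).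
  apply: (@lt_le_trans _ _ (\int[lebesgue_rV R d]_z (c * \1_(eball (0 : 'rV[R]_d) 1) z)%:E)%E).
    rewrite ge0_integralZl_real; [|exact: measurable_eball_indic|by move=> z; rewrite indicE|exact: ltW].
    rewrite integral_indic; [|exact: measurableT|exact: measurable_eball].
    by rewrite setIT mule_gt0//; exact: lebesgue_eball_gt0.
  have mI := @measurable_eball_indic R d 0 1.
  apply: ge0_le_integral_real.
  - exact: measurable_funM.
  - by mfun.
  - by move=> z; rewrite mulr_ge0 ?indicE// ltW.
  - move=> z; rewrite indicE; case: (boolP (z \in _)) => [|_]; last first.
      by rewrite mulr0 mulr_ge0.
    rewrite inE eball0E /= => z1; rewrite mulr1 /c; apply: ler_pM => //.
    + by rewrite mulr_ge0// invr_ge0 ltW.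
    + exact: ltW.
    + rewrite ler_pdivrMl//; apply: HC.
      by rewrite (_ : x - z - x = - z) ?enormN//; rVring.
    + exact: (kprofile_le sphi (enorm_ge0 z) z1).
have [Cr Cr0 HCr] := @rho_second_difference R d m.
have Wsd := weight_second_difference mrh mkw rh0 rh1 kw0 kwT Cr0 HCr.
have [Cv Cv0 HCv] := weight_conv_le mrh mkw rh0 rh1 kw0 kwN kwT Ckk0 HCkk.
have [C1 C10 HC1] : exists2 C, 0 < C & forall y : 'rV[R]_d, 1 <= enorm y -> K y <= C * kw y.
  exact: (kernel_le_kweight sphi CK1 Kb l20 b20 growth ltr01).
exists W; split => //.
- move=> r r0; have [C C0 HC] := rho_harnack (d := d) m r0.
  exists C => //; exact: (weight_harnack mrh mkw rh0 rh1 kw0 kwT C0 HC).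
- exact: (weight_sdiff_kernel mK K0 K_levy mkw kw0 mW W0 Cr0 Wsd Cv0 HCv C10 HC1).
- exact: (weight_sdiff_mass mW W0 WT Cr0 Wsd).
- move=> r r0 r1; have CK0 : 0 < CK^-1 by rewrite invr_gt0 (lt_trans ltr01).
  have k1 : 0 < @kprofile R d phi 1 by apply: (kprofile_gt0 sphi); exact: ler01.
  have H1 x : enorm x <= 1 -> @kprofile R d phi 1 <= kw x.
    by move=> x1; exact: (kprofile_le sphi (enorm_ge0 x) x1).
  have [C0 [c [c0 HB]]] := barrier_growth r0 r1 mK K0 K_levy CK0
    (fun y => @kernel_ge_kweight R d K phi CK sphi CK1 Kb y) (fun x y => HD y x) D0 kw0
    (kweight_le sphi) k1 H1.
  have [Cw Cw0 HCw] := weight_le_kweight mrh mkw rh0 rh1 kw0 kwT Crk0 HCrk Ckk0 HCkk.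
  exists C0, (c / Cw); split; first by rewrite divr_gt0.
  move=> C z /(HB _ z); apply: le_trans.
  rewrite -mulrA; apply: ler_wpM2l; first exact: ltW.
  by rewrite ler_pdivrMl//; exact: HCw.
Qed.

(** * The lower bound for the heat kernel *)

Section mollified_integrals.
Context {R : realType} {d : nat}.
Local Notation V := 'rV[R]_d.
Local Notation mu := (lebesgue_rV R d).
Variables (r e b : R) (Phi : V -> R).
Hypothesis mPhi : mollifier r e b Phi.

Let mPhi' : measurable_fun setT Phi.
Proof. exact: measurable_cosine_superposition (moll_cos mPhi). Qed.

Let Phi0 := moll_ge0 mPhi.
Let b0 : 0 <= b. Proof. exact: ltW (moll_mass_gt0 mPhi). Qed.

Let I (z : V) : R := \1_(eball (0 : V) r) z * Phi z.
Let I0 z : 0 <= I z. Proof. by rewrite mulr_ge0// indicE. Qed.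
Let mI : measurable_fun setT I.
Proof. by apply: measurable_funM; [exact: measurable_eball_indic|exact: mPhi']. Qed.

Let I_shift (x : V) : (\int[mu]_z (I (x - z))%:E = b%:E)%E.
Proof.
rewrite -(moll_mass mPhi) -(ge0_integral_rV_opp (f := fun z => (I z)%:E)); first last.
- by move=> z; rewrite lee_fin.
- by apply/measurable_EFinP.
rewrite -(ge0_integral_rV_shift (- x) (f := fun z => (I (- z))%:E)); first last.
- by move=> z; rewrite lee_fin.
- by apply/measurable_EFinP; mfun.
by apply: eq_integral => z _; congr (I _)%:E; rVring.
Qed.

Let mIx (x : V) : measurable_fun setT (fun z : V => I (x - z)).
Proof. by mfun. Qed.

Let iI (x : V) : mu.-integrable setT (EFin \o (fun z : V => I (x - z))).
Proof.
by apply: integrable_ge0; [exact: mIx|move=> z; exact: I0|rewrite I_shift ltry].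
Qed.

Let RI (x : V) : \int[mu]_z I (x - z) = b.
Proof. by rewrite /Rintegral I_shift. Qed.

Lemma integrable_mollified (p : V -> R) (x : V) : measurable_fun setT p ->
  (forall z, 0 <= p z) -> (\int[mu]_z (p z)%:E < +oo)%E ->
  mu.-integrable setT (EFin \o (fun z => p z * Phi (x - z))).
Proof.
move=> mp p0 plty; apply: (integrable_dominated _ mp _ plty).
  by apply: measurable_funM => //; mfun.
move=> z; rewrite ger0_norm ?mulr_ge0//; apply: ler_piMr => //.
exact: moll_le1 mPhi _.
Qed.

(** Inside the ball [p] is bounded by [A]; outside, the mollifier is a small
    multiple of its mass. *)
Lemma mollified_le (p : V -> R) (x : V) (A : R) : measurable_fun setT p ->
  (forall z, 0 <= p z) -> (\int[mu]_z (p z)%:E < +oo)%E ->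
  (forall z, enorm (x - z) <= r -> p z <= A) -> 0 <= A ->
  \int[mu]_z (p z * Phi (x - z)) <= A * b + e * b * \int[mu]_z p z.
Proof.
move=> mp p0 plty pA A0.
have ip := integrable_ge0 mp p0 plty.
have i1 := integrableZl measurableT A (iI x); have i2 := integrableZl measurableT (e * b) ip.
have eb : 0 <= e * b by exact: mulr_ge0 (moll_eps mPhi) b0.
rewrite -{1}(RI x) -(RintegralZl _ measurableT (iI x)) -(RintegralZl _ measurableT ip).
rewrite -(RintegralD measurableT i1 i2).
apply: le_Rintegral; [exact: measurableT|exact: integrable_mollified|exact: (integrableD measurableT i1 i2)|].
move=> z _; rewrite /I indicE; case: (boolP (_ \in _)) => [|].
  rewrite inE eball0E /= => xz; rewrite mul1r -[leLHS]addr0; apply: lerD.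
    by apply: ler_wpM2r; [exact: Phi0|exact: pA].
  by rewrite mulr_ge0.
move=> /negP; rewrite inE eball0E /= => /negP; rewrite -ltNge => xz.
rewrite mul0r mulr0 add0r mulrC; apply: ler_wpM2r => //.
exact: moll_tail mPhi _ (ltW xz).
Qed.

Lemma mollified_ge (p : V -> R) (x : V) (a : R) : measurable_fun setT p ->
  (forall z, 0 <= p z) -> (\int[mu]_z (p z)%:E < +oo)%E ->
  (forall z, enorm (x - z) <= r -> a <= p z) ->
  a * b <= \int[mu]_z (p z * Phi (x - z)).
Proof.
move=> mp p0 plty pa; rewrite -(RI x) -(RintegralZl _ measurableT (iI x)).
apply: le_Rintegral; [exact: measurableT|exact: (integrableZl measurableT a (iI x))|exact: integrable_mollified|].
move=> z _; rewrite /I indicE; case: (boolP (_ \in _)) => [|_].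
  rewrite inE eball0E /= => xz; rewrite mul1r.
  by apply: ler_wpM2r; [exact: Phi0|exact: pa].
by rewrite mul0r mulr0 mulr_ge0.
Qed.

End mollified_integrals.

Section heat_flow.
Context {R : realType} {d : nat}.
Local Notation V := 'rV[R]_d.
Local Notation mu := (lebesgue_rV R d).
Variables (K W : V -> R) (P : R -> V -> R).
Hypothesis mK : measurable_fun setT K.
Hypothesis K_ge0 : forall y, 0 <= K y.
Hypothesis K_levy : (\int[mu]_y (Num.min 1 (enorm y ^+ 2) * K y)%:E < +oo)%E.
Hypothesis hP : heat_kernel K P.
Hypothesis hW : comparison_weight K W.

Lemma measurable_heat (t : R) : 0 < t -> measurable_fun setT (P t).
Proof. by move=> t0; exact: continuous_measurable_rV (heat_continuous hP t0). Qed.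

Lemma heat_integral_lty (t : R) : 0 < t -> (\int[mu]_x (P t x)%:E < +oo)%E.
Proof. by move=> t0; rewrite (heat_mass hP t0) ltry. Qed.

Let W_ge0 x : 0 <= W x. Proof. exact: ltW (cw_gt0 hW x). Qed.

Lemma integrable_weight : mu.-integrable setT (EFin \o W).
Proof. exact: integrable_ge0 (cw_measurable hW) W_ge0 (cw_integral_lty hW). Qed.

Lemma integrable_weight_sdiff (x : V) :
  mu.-integrable setT (EFin \o (fun y => sdiff W y x * K y)).
Proof.
have ms := measurable_sdiff integrable_weight.
have [C C0 HC] := cw_sdiff_kernel hW.
have mx : measurable_fun setT (fun y => sdiff W y x).
  exact: (measurable_sect2 (f := sdiff W) ms).
apply: (@integrable_dominated _ _ _ _ _ (fun y => `|sdiff W y x| * K y)).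
- exact: measurable_funM.
- by apply: measurable_funM => //; apply: measurableT_comp; [exact: normr_measurable|exact: mx].
- by move=> y; rewrite normrM (ger0_norm (K_ge0 y)).
- by apply: le_lt_trans (HC x) _; rewrite ltry.
Qed.

Lemma weight_nonlocal_le : exists2 C : R, 0 <= C & forall x, nonlocal_op K W x <= C * W x.
Proof.
have [C C0 HC] := cw_sdiff_kernel hW; exists C => // x.
have i1 := integrable_weight_sdiff x.
apply: (@le_trans _ _ (\int[mu]_y `|sdiff W y x * K y|)).
  apply: le_Rintegral; [exact: measurableT|exact: i1|exact: integrable_norm i1|].
  by move=> y _; exact: ler_norm.
rewrite -lee_fin -ge0_RintegralE; [|by move=> y; exact: normr_ge0|].
  rewrite (eq_integral (fun y => (`|sdiff W y x| * K y)%:E)); first exact: HC.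
  by move=> y _; rewrite normrM (ger0_norm (K_ge0 y)).
by move/integrableP : i1 => [_].
Qed.

(** The mollified semigroup, with the comparison of the flows of the bump and of
    the weight; the constant does not depend on the mollifier. *)
Lemma heat_flow_comparison (r : R) : 0 < r -> r <= 1 -> exists2 c : R, 0 < c &
  forall Phi : V -> R, cosine_superposition Phi -> (forall x, 0 <= Phi x) ->
  exists F : R -> V -> R,
  [/\ forall x, F 0 x = Phi x,
      forall (t : R) x, 0 <= t -> 0 <= F t x,
      forall (t : R) (x : V), F t (- x) = F t x,
      forall (tau s : R) (x : V), 0 < tau -> 0 <= s ->
        mu.-integrable setT (EFin \o (fun y => P tau y * F s (x - y))) /\
        \int[mu]_y (P tau y * F s (x - y)) = F (tau + s) x &
      forall x : V, c * \int[mu]_z (W z * Phi (x - z)) <=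
        \int[mu]_z (barrier r z * F 2^-1 (x - z))].
Proof.
move=> r0 r1.
have [C0 [cb [cb0 Hb]]] := cw_barrier hW r0 r1.
have [CL CL0 HL] := weight_nonlocal_le.
have [Cs Cs0 HCs] := cw_sdiff_mass hW.
have [Cb Cb0 HCb] := @integral_sdiff_barrier R d r r0 r1.
pose C : R := `|C0| + CL.
exists (cb / 2 * expR (- (C * 2^-1))).
  by apply: mulr_gt0; [apply: divr_gt0 => //; lra|exact: expR_gt0].
move=> Phi [dO [Om [nu [g [xi [B [[mg mxi] [g0 gT] xiB PhiE _]]]]]]] Phi0.
pose F := cosheat K nu g xi.
have F0E x : F 0 x = Phi x.
  rewrite PhiE /F /cosheat; apply: eq_Rintegral => w _.
  by rewrite mul0r oppr0 expR0 mul1r.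
have mF (s : R) : 0 <= s -> measurable_fun setT (F s).
  by move=> s0; exact: (measurable_cosheat mK K_ge0 K_levy mg mxi g0 gT s0).
have conv (tau s : R) (x : V) : 0 < tau -> 0 <= s ->
    \int[mu]_y (P tau y * F s (x - y)) = F (tau + s) x.
  move=> t0 s0.
  exact: (cosheat_conv mK K_ge0 K_levy mg mxi g0 gT x (measurable_heat t0)
    (heat_ge0 hP t0) (heat_mass hP t0) (heat_fourier_re hP t0) (heat_fourier_im hP t0) s0).
have iconv (tau s : R) (x : V) : 0 < tau -> 0 <= s ->
    mu.-integrable setT (EFin \o (fun y => P tau y * F s (x - y))).
  move=> t0 s0.
  have ip := integrable_ge0 (measurable_heat t0) (heat_ge0 hP t0) (heat_integral_lty t0).
  exact: (integrable_cosheat_pairing mK K_ge0 K_levy mg mxi g0 gT ip x s0).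
have Fge0 (t : R) x : 0 <= t -> 0 <= F t x.
  rewrite le_eqVlt => /predU1P[<-|t0]; first by rewrite F0E.
  rewrite -[t]addr0 -conv//; apply: Rintegral_ge0 => y _.
  by rewrite F0E; apply: mulr_ge0; [exact: (heat_ge0 hP t0)|exact: Phi0].
exists F; split => //.
  by move=> t x; exact: cosheatN.
  by move=> tau s x t0 s0; split; [exact: iconv|exact: conv].
move=> x.
pose I0 := \int[mu]_z (W z * F 0 (x - z)).
have I0E : \int[mu]_z (W z * Phi (x - z)) = I0.
  by apply: eq_Rintegral => z _; rewrite F0E.
rewrite I0E.
have izero : mu.-integrable setT (EFin \o (fun _ : V => 0 : R)).
  apply: (eq_integrable measurableT (cst 0%E)) => //; exact: integrable0.
have C00 : 0 <= C by rewrite addr_ge0.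
have Wgrow z : (fun _ : V => 0 : R) z <= C * W z - nonlocal_op K W z.
  rewrite subr_ge0; apply: (le_trans (HL z)); apply: ler_wpM2r; first exact: W_ge0.
  by rewrite lerDr.
have W_s (s : R) : 0 < s -> I0 <= expR (C * s) * \int[mu]_z (W z * F s (x - z)).
  move=> s0; rewrite -[leLHS]addr0 -[in leLHS](mul0r s).
  apply: (pairing_growth mK K_ge0 K_levy mg mxi g0 gT xiB integrable_weight izero Cs0 HCs Wgrow Fge0 s0).
  move=> t _; apply: mulr_ge0; first exact: expR_ge0.
  by apply: Rintegral_ge0 => z _; rewrite mul0r; exact: lexx.
have icW : mu.-integrable setT (EFin \o (fun z => cb * W z)).
  exact: (integrableZl measurableT cb integrable_weight).
have bgrow z : cb * W z <= C * barrier r z - nonlocal_op K (barrier r) z.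
  apply: Hb; apply: (le_trans (ler_norm _)); by rewrite lerDl.
have h2 : (0 : R) < 2^-1 by rewrite invr_gt0.
have := @pairing_growth R d K mK K_ge0 K_levy _ _ nu g xi B mg mxi g0 gT xiB
  (barrier r) (fun z => cb * W z) x Cb C 2^-1 (cb * I0) (integrable_barrier r0 r1) icW Cb0 HCb bgrow Fge0 h2.
have Hk (s : R) : 0 < s < 2^-1 ->
    cb * I0 <= expR (C * s) * \int[mu]_z (cb * W z * F s (x - z)).
  move=> /andP[s0 _]; have iWs := integrable_cosheat_pairing mK K_ge0 K_levy mg mxi g0 gT integrable_weight x (ltW s0).
  rewrite (_ : \int[mu]_z (cb * W z * F s (x - z)) = cb * \int[mu]_z (W z * F s (x - z))).
    by rewrite mulrCA ler_pM2l//; exact: W_s.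
  by rewrite -(RintegralZl _ measurableT iWs); apply: eq_Rintegral => z _; rewrite mulrA.
move=> /(_ Hk) H.
rewrite mulrAC expRN ler_pdivrMr ?expR_gt0// mulrC [in leRHS]mulrC.
apply: le_trans H; rewrite mulrCA mulrA -[leLHS]add0r; apply: lerD.
  apply: Rintegral_ge0 => z _; apply: mulr_ge0; first exact: barrier_ge0.
  exact: Fge0.
by rewrite le_eqVlt; apply/orP; left; apply/eqP; ring.
Qed.

End heat_flow.

Lemma le_of_le_add_mul (R : realType) (a b k : R) : 0 <= k ->
  (forall eta : R, 0 < eta -> a <= b + k * eta) -> a <= b.
Proof.
move=> k0 H; apply/ler_addgt0Pr => e e0.
have k1 : 0 < k + 1 by rewrite ltr_wpDl.
have ek : 0 < e / (k + 1) by rewrite divr_gt0.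
apply: (le_trans (H _ ek)); rewrite lerD2l mulrA ler_pdivrMr// mulrC ler_pM2l//.
by rewrite lerDl.
Qed.

Lemma continuous_enorm_ball (R : realType) (d : nat) (f : 'rV[R]_d -> R) (x : 'rV[R]_d)
  (eps : R) : continuous f -> 0 < eps -> exists2 rho : R, 0 < rho &
  forall z, enorm (x - z) <= rho -> `|f x - f z| <= eps.
Proof.
move=> cf eps0.
have /cvgrPdist_le/(_ _ eps0) := cf x.
move=> /nbhs_ballP[del /= del0 Hdel].
exists (del / 2) => [|z xz]; first by rewrite divr_gt0.
apply: Hdel; rewrite -ball_normE /=.
suff h : `|x - z| <= del / 2 by apply: (le_lt_trans h); lra.
have d2 : 0 <= del / 2 by apply: divr_ge0; [exact: ltW|lra].
rewrite -[del / 2]/((NngNum d2)%:num) [`|_|]mx_normrE; apply: bigmax_le => //= i _.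
rewrite (ord1 i.1); apply: le_trans xz; exact: coord_le_enorm.
Qed.

Section heat_kernel_lower_bound.
Context {R : realType} {d : nat}.
Local Notation V := 'rV[R]_d.
Local Notation mu := (lebesgue_rV R d).
Hypothesis d_gt0 : (0 < d)%N.
Variables (K W : V -> R) (P : R -> V -> R).
Hypothesis mK : measurable_fun setT K.
Hypothesis K_ge0 : forall y, 0 <= K y.
Hypothesis K_levy : (\int[mu]_y (Num.min 1 (enorm y ^+ 2) * K y)%:E < +oo)%E.
Hypothesis hP : heat_kernel K P.
Hypothesis hW : comparison_weight K W.

Let P0 (t : R) : 0 < t -> forall x, 0 <= P t x.
Proof. by move=> t0; exact: (heat_ge0 hP t0). Qed.

Let mP (t : R) : 0 < t -> measurable_fun setT (P t).
Proof. by move=> t0; exact: (measurable_heat hP t0). Qed.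

Let PT (t : R) : 0 < t -> (\int[mu]_x (P t x)%:E < +oo)%E.
Proof. by move=> t0; exact: (heat_integral_lty hP t0). Qed.

Let P1 (t : R) : 0 < t -> \int[mu]_x P t x = 1.
Proof. by move=> t0; rewrite /Rintegral (heat_mass hP t0). Qed.

Let half_gt0 : (0 : R) < 2^-1. Proof. by rewrite invr_gt0. Qed.
Let quarter_gt0 : (0 : R) < 4^-1. Proof. by rewrite invr_gt0. Qed.

Let mI (c : V) (rho : R) := @measurable_eball_indic R d c rho.

Let mass_in (t : R) (c : V) (rho : R) : R := \int[mu]_y (\1_(eball c rho) y * P t y).

Let integrable_mass (t : R) (c : V) (rho : R) : 0 < t ->
  mu.-integrable setT (EFin \o (fun y => \1_(eball c rho) y * P t y)).
Proof.
move=> t0; apply: (integrable_dominated _ (mP t0) _ (PT t0)).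
  by apply: measurable_funM; [exact: mI|exact: mP].
move=> y; rewrite ger0_norm; last by apply: mulr_ge0; [rewrite indicE|exact: P0].
by apply: ler_piMl; [exact: P0|rewrite indicE lern1; case: (_ \in _)].
Qed.

Section flow.
Variables (r e b : R) (Phi : V -> R) (F : R -> V -> R).
Hypothesis mPhi : mollifier r e b Phi.
Hypothesis F0 : forall x, F 0 x = Phi x.
Hypothesis Fge0 : forall (t : R) x, 0 <= t -> 0 <= F t x.
Hypothesis Fconv : forall (tau s : R) (x : V), 0 < tau -> 0 <= s ->
  mu.-integrable setT (EFin \o (fun y => P tau y * F s (x - y))) /\
  \int[mu]_y (P tau y * F s (x - y)) = F (tau + s) x.

Let flowE (t : R) (x : V) : 0 < t -> F t x = \int[mu]_z (P t z * Phi (x - z)).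
Proof.
move=> t0; rewrite -[t in LHS]addr0 -(proj2 (Fconv x t0 (lexx 0))).
by apply: eq_Rintegral => z _; rewrite F0.
Qed.

Lemma flow_le (t eta : R) (x : V) : 0 < t -> 0 <= eta ->
  (forall z, enorm (x - z) <= r -> P t z <= P t x + eta) ->
  F t x <= (P t x + eta + e) * b.
Proof.
move=> t0 eta0 H; rewrite flowE//.
have A0 : 0 <= P t x + eta by apply: addr_ge0 => //; exact: P0.
have := mollified_le mPhi (mP t0) (P0 t0) (PT t0) H A0.
by rewrite (P1 t0) mulr1 -mulrDl.
Qed.

Lemma flow_ge (t a : R) (x : V) : 0 < t ->
  (forall z, enorm (x - z) <= r -> a <= P t z) -> a * b <= F t x.
Proof.
by move=> t0 H; rewrite flowE//; exact: (mollified_ge mPhi (mP t0) (P0 t0) (PT t0) H).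
Qed.

(** The semigroup property, keeping only the part of the path that is near [c] at
    time [tau]. *)
Lemma flow_conv_ge (tau s a rho : R) (x c : V) : 0 < tau -> 0 <= s ->
  (forall y, enorm (y - c) <= rho -> a <= F s (x - y)) ->
  a * mass_in tau c rho <= F (tau + s) x.
Proof.
move=> t0 s0 H; have [ic <-] := Fconv x t0 s0.
rewrite -(RintegralZl _ measurableT (integrable_mass c rho t0)).
apply: le_Rintegral; [exact: measurableT|exact: (integrableZl measurableT a (integrable_mass c rho t0))|exact: ic|].
move=> y _; rewrite indicE; case: (boolP (_ \in _)) => [|_].
  rewrite inE /eball /= => yc; rewrite mul1r mulrC.
  by apply: ler_wpM2l; [exact: P0|exact: H].
by rewrite mul0r mulr0; apply: mulr_ge0; [exact: P0|exact: Fge0].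
Qed.

End flow.

(** At time [1/4] the density is bounded below on some ball, and by symmetry on the
    opposite ball; the two quarters compose to a path from the origin to itself. *)
Lemma heat_origin_gt0 : 0 < P 2^-1 0.
Proof.
have [y0 Py0] : exists y0, 0 < P 4^-1 y0.
  apply: contrapT => /forallNP H.
  have Z x : P 4^-1 x = 0.
    apply/eqP; rewrite eq_le P0// andbT leNgt; apply/negP; exact: H.
  have := heat_mass hP quarter_gt0.
  rewrite integral0_eq => [|x _]; last by rewrite Z.
  by move=> /esym/eqP; rewrite onee_eq0.
pose p := P 4^-1 y0; rewrite -/p in Py0.
have p2 : 0 < p / 2 by rewrite divr_gt0.
have [rho rho0 Hrho] := continuous_enorm_ball y0 (heat_continuous hP quarter_gt0) p2.
have rho2 : 0 < rho / 2 by rewrite divr_gt0.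
pose v := fine (mu (eball y0 (rho / 2))).
have v0 : 0 < v.
  by rewrite fine_gt0// lebesgue_eball_lty andbT; exact: lebesgue_eball_gt0.
have P_ge z : enorm (y0 - z) <= rho -> p / 2 <= P 4^-1 z.
  by move=> /Hrho; rewrite ler_norml => /andP[_ h]; rewrite /p in h *; lra.
have mass_ge : p / 2 * v <= mass_in 4^-1 y0 (rho / 2).
  have -> : v = \int[mu]_y \1_(eball y0 (rho / 2)) y.
    rewrite /Rintegral integral_indic; [by rewrite setIT|exact: measurableT|exact: measurable_eball].
  have iI : mu.-integrable setT (EFin \o \1_(eball y0 (rho / 2))).
    apply: integrable_ge0; [exact: mI|by move=> y; rewrite indicE|].
    rewrite integral_indic; [|exact: measurableT|exact: measurable_eball].
    by rewrite setIT; exact: lebesgue_eball_lty.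
  rewrite -(RintegralZl _ measurableT iI).
  apply: le_Rintegral; [exact: measurableT|exact: (integrableZl measurableT _ iI)|exact: integrable_mass|].
  move=> y _; rewrite mulrC indicE; case: (boolP (_ \in _)) => [|_]; last by rewrite !mul0r.
  rewrite inE /eball /= => yc; rewrite !mul1r; apply: P_ge.
  by rewrite enormB; apply: (le_trans yc); lra.
suff H : p / 2 * (p / 2 * v) <= P 2^-1 0.
  by apply: lt_le_trans H; apply: mulr_gt0 => //; exact: mulr_gt0.
apply: (@le_of_le_add_mul _ _ _ 2) => // eta eta0.
have [rh rh0 Hrh] := continuous_enorm_ball 0 (heat_continuous hP half_gt0) eta0.
pose r := Num.min (rho / 2) rh.
have r0 : 0 < r by rewrite lt_min rho2.
have [Phi [b mPhi]] := @mollifier_exists R d d_gt0 r eta r0 eta0.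
have b0 := moll_mass_gt0 mPhi.
have [_ _ /(_ Phi (moll_cos mPhi) (moll_ge0 mPhi))[F [F0 Fge0 FN Fconv _]]] :=
  heat_flow_comparison mK K_ge0 K_levy hP hW ltr01 (lexx 1).
rewrite -(ler_pM2r b0).
have up : F 2^-1 0 <= (P 2^-1 0 + eta + eta) * b.
  apply: (flow_le mPhi F0 Fconv half_gt0 (ltW eta0)) => z zr.
  have zrh : enorm (0 - z) <= rh by apply: (le_trans zr); rewrite ge_min lexx orbT.
  by have := Hrh z zrh; rewrite ler_norml => /andP[h _]; lra.
have low : p / 2 * b * mass_in 4^-1 y0 (rho / 2) <= F 2^-1 0.
  have -> : F 2^-1 0 = F (4^-1 + 4^-1) 0 by congr (F _ _); field.
  apply: (flow_conv_ge Fge0 Fconv quarter_gt0 (ltW quarter_gt0)) => y yc.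
  rewrite sub0r FN; apply: (flow_ge mPhi F0 Fconv quarter_gt0) => z yz; apply: P_ge.
  have zr : enorm (y - z) <= rho / 2 by apply: (le_trans yz); rewrite ge_min lexx.
  rewrite (_ : y0 - z = (y0 - y) + (y - z)); last by rVring.
  by apply: (le_trans (enormD _ _)); rewrite enormB; lra.
have h : p / 2 * (p / 2 * v) * b <= p / 2 * b * mass_in 4^-1 y0 (rho / 2).
  rewrite mulrAC; apply: ler_wpM2l mass_ge; apply: mulr_ge0; exact: ltW.
apply: (le_trans h); apply: (le_trans low); apply: (le_trans up).
by rewrite -addrA -mulr2n mulr_natl.
Qed.

(** The heat kernel at time 1 dominates the weight: half a unit of time carries
    mass of the order of the weight into a small ball around the point, and the
    other half spreads it. *)
Lemma heat_kernel_ge_weight : exists2 c : R, 0 < c & forall x, c * W x <= P 1 x.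
Proof.
pose a := P 2^-1 0; have a0 : 0 < a := heat_origin_gt0.
have a2 : 0 < a / 2 by rewrite divr_gt0.
have [rho rho0 Hrho] := continuous_enorm_ball 0 (heat_continuous hP half_gt0) a2.
have P_ge z : enorm z <= rho -> a / 2 <= P 2^-1 z.
  move=> zr; have : enorm (0 - z) <= rho by rewrite sub0r enormN.
  by move=> /Hrho; rewrite ler_norml => /andP[_ h]; rewrite /a in h *; lra.
(* The mass is carried within [2 r] of its target and the mollifier adds [r]; the
   sum has to stay below [rho]. *)
pose r := Num.min 1 (rho / 3).
have r0 : 0 < r by rewrite lt_min ltr01 divr_gt0.
have r1 : r <= 1 by rewrite ge_min lexx.
have rrho : r <= rho / 3 by rewrite ge_min lexx orbT.
have [c c0 Hflow] := heat_flow_comparison mK K_ge0 K_levy hP hW r0 r1.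
have [CH CH0 HCH] := cw_harnack hW (ltW r0).
have W0 x : 0 <= W x by exact: ltW (cw_gt0 hW x).
have mb : measurable_fun setT (barrier r : V -> R) by exact: measurable_barrier.
have b_ge0 := @barrier_ge0 R d r.
have b_lty := @barrier_integral_lty R d r r0 r1.
have b_int := @integrable_barrier R d r r0 r1.
pose H := \int[mu]_z barrier r (z : V).
have H0 : 0 <= H by apply: Rintegral_ge0 => z _; exact: b_ge0.
(* First half: the barrier lives in a ball of radius [r], and the mollifier enlarges
   the ball by [r]. *)
have stepA x : c / CH * W x <= mass_in 2^-1 x (2 * r).
  apply: (@le_of_le_add_mul _ _ _ H) => // eta eta0.
  have [Phi [b mPhi]] := @mollifier_exists R d d_gt0 r eta r0 eta0.
  have b0 := moll_mass_gt0 mPhi.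
  have [F [F0 Fge0 FN Fconv Hc]] := Hflow Phi (moll_cos mPhi) (moll_ge0 mPhi).
  rewrite -(ler_pM2r b0).
  have low : W x / CH * b <= \int[mu]_z (W z * Phi (x - z)).
    apply: (mollified_ge mPhi (cw_measurable hW) W0 (cw_integral_lty hW)) => z xz.
    by rewrite ler_pdivrMr// mulrC; apply: HCH; rewrite enormB.
  apply: (@le_trans _ _ (c * \int[mu]_z (W z * Phi (x - z)))).
    have -> : c / CH * W x * b = c * (W x / CH * b) by ring.
    by apply: ler_wpM2l; [exact: ltW|exact: low].
  apply: (le_trans (Hc x)).
  have mPh := measurable_cosine_superposition (moll_cos mPhi).
  pose f (z y : V) := barrier r z * (P 2^-1 y * Phi (x - z - y)).
  have mf : measurable_fun setT (fun w : V * V => f w.1 w.2).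
    have mPp := mP half_gt0; apply: measurable_funM; first by mfun.
    by apply: measurable_funM; mfun.
  have f_le z y : `|f z y| <= barrier r z * P 2^-1 y.
    rewrite ger0_norm; last first.
      apply: mulr_ge0; first exact: b_ge0.
      by apply: mulr_ge0; [exact: P0|exact: (moll_ge0 mPhi)].
    apply: ler_wpM2l; first exact: b_ge0.
    by apply: ler_piMr; [exact: P0|exact: (moll_le1 mPhi)].
  have foo : (\int[mu]_z \int[mu]_y `|f z y|%:E < +oo)%E.
    apply: (@le_lt_trans _ _ (\int[mu]_z (barrier r z)%:E)%E) => //.
    apply: ge0_le_integral; first exact: measurableT.
    - by move=> z _; apply: integral_ge0 => y _; rewrite lee_fin.
    - apply: (measurable_tonelli1 (fun z y => `|f z y|%:E)).
        by apply/measurable_EFinP; apply: measurableT_comp; [exact: normr_measurable|exact: mf].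
      by move=> z y; rewrite lee_fin.
    - by apply/measurable_EFinP.
    - move=> z _; apply: (@le_trans _ _ (\int[mu]_y (barrier r z * P 2^-1 y)%:E)%E).
        apply: ge0_le_integral_real.
        + by apply: measurableT_comp; [exact: normr_measurable|exact: (measurable_sect1 mf)].
        + by apply: measurable_funM; [exact: measurable_cst|exact: mP].
        + by move=> y; exact: normr_ge0.
        + by move=> y; exact: f_le.
      rewrite ge0_integralZl_real; [|exact: mP|exact: P0|exact: b_ge0].
      by rewrite (heat_mass hP half_gt0) mule1.
  have -> : \int[mu]_z (barrier r z * F 2^-1 (x - z)) = \int[mu]_z \int[mu]_y f z y.
    apply: eq_Rintegral => z _.
    rewrite -[2^-1 in LHS]addr0 -(proj2 (Fconv 2^-1 0 (x - z) half_gt0 (lexx 0))).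
    rewrite -(RintegralZl _ measurableT (proj1 (Fconv 2^-1 0 (x - z) half_gt0 (lexx 0)))).
    by apply: eq_Rintegral => y _; rewrite F0.
  rewrite (Rintegral_fubini mf foo).
  have iQ := integrable_mass x (2 * r) half_gt0.
  have iP := integrable_ge0 (mP half_gt0) (P0 half_gt0) (PT half_gt0).
  have j1 := integrableZl measurableT b iQ.
  have j2 := integrableZl measurableT (eta * b * H) iP.
  apply: (@le_trans _ _ (\int[mu]_y (b * (\1_(eball x (2 * r)) y * P 2^-1 y) + eta * b * H * P 2^-1 y))).
    apply: le_Rintegral; [exact: measurableT|exact: (integrable_Rintegral2 mf foo)|exact: (integrableD measurableT j1 j2)|].
    move=> y _.
    have -> : \int[mu]_z f z y = P 2^-1 y * \int[mu]_z (barrier r z * Phi (x - y - z)).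
      rewrite -(RintegralZl _ measurableT (integrable_mollified mPhi (x - y) mb b_ge0 b_lty)).
      apply: eq_Rintegral => z _; rewrite /f mulrCA; congr (_ * (_ * Phi _)).
      by rVring.
    rewrite (_ : b * _ + _ = P 2^-1 y * (\1_(eball x (2 * r)) y * b + eta * b * H)); last by ring.
    apply: ler_wpM2l; first exact: P0.
    apply: (mollified_le mPhi mb b_ge0 b_lty); last by rewrite indicE.
    move=> z xyz; rewrite indicE; case: (boolP (_ \in _)) => [_|].
      exact: barrier_le1.
    move=> /negP; rewrite inE /eball /= => /negP; rewrite -ltNge => yx.
    rewrite barrier_out//.
    have := enormD (x - y - z) z; rewrite subrK enormB; lra.
  rewrite (RintegralD measurableT j1 j2) (RintegralZl _ measurableT iQ) (RintegralZl _ measurableT iP).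
  rewrite (P1 half_gt0) mulr1 -/(mass_in _ _ _) le_eqVlt; apply/orP; left; apply/eqP; ring.
have stepB x : a / 2 * mass_in 2^-1 x (2 * r) <= P 1 x.
  apply: (@le_of_le_add_mul _ _ _ 2) => // eta eta0.
  have [rh rh0 Hrh] := continuous_enorm_ball x (heat_continuous hP ltr01) eta0.
  pose r2 := Num.min r rh; have r20 : 0 < r2 by rewrite lt_min r0.
  have [Phi [b mPhi]] := @mollifier_exists R d d_gt0 r2 eta r20 eta0.
  have b0 := moll_mass_gt0 mPhi.
  have [F [F0 Fge0 FN Fconv _]] := Hflow Phi (moll_cos mPhi) (moll_ge0 mPhi).
  rewrite -(ler_pM2r b0).
  have up : F 1 x <= (P 1 x + eta + eta) * b.
    apply: (flow_le mPhi F0 Fconv ltr01 (ltW eta0)) => z zr.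
    have zrh : enorm (x - z) <= rh by apply: (le_trans zr); rewrite ge_min lexx orbT.
    by have := Hrh z zrh; rewrite ler_norml => /andP[h _]; lra.
  have low : a / 2 * b * mass_in 2^-1 x (2 * r) <= F 1 x.
    have -> : F 1 x = F (2^-1 + 2^-1) x by congr (F _ _); field.
    apply: (flow_conv_ge Fge0 Fconv half_gt0 (ltW half_gt0)) => y yc.
    apply: (flow_ge mPhi F0 Fconv half_gt0) => z yz; apply: P_ge.
    have zr : enorm (x - y - z) <= r by apply: (le_trans yz); rewrite ge_min lexx.
    have := enormBD (x - y) (x - y - z); rewrite subKr.
    by rewrite [enorm (x - y)]enormB; lra.
  rewrite mulrAC; apply: (le_trans low); apply: (le_trans up).
  by rewrite -addrA -mulr2n mulr_natl.
exists (a / 2 * (c / CH)); first by apply: mulr_gt0 => //; exact: divr_gt0.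
move=> x; rewrite -mulrA; apply: le_trans (stepB x).
by apply: ler_wpM2l; [exact: ltW|exact: stepA].
Qed.

End heat_kernel_lower_bound.

(** * Smooth functions *)

Section smooth_closure.
Context {R : realType} {V : normedModType R}.
Implicit Types f g : V -> R.

Lemma Ck_pred k f : Ck k.+1 f -> Ck k f.
Proof.
elim: k f => [|k IH] f [df Df]; first by move=> x; exact: differentiable_continuous.
by split=> // v; apply: IH; exact: Df.
Qed.

Lemma Ck_cst k (c : R) : Ck k (fun _ : V => c).
Proof.
elim: k c => [|k IH] c; first by move=> x; exact: cvg_cst.
split=> [x|v]; first exact: differentiable_cst.
have -> : 'D_v (fun _ : V => c) = (fun=> 0) by apply/funext => x; exact: derive_cst.
exact: IH.
Qed.

Lemma CkD k f g : Ck k f -> Ck k g -> Ck k (fun x => f x + g x).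
Proof.
elim: k f g => [|k IH] f g; first by move=> cf cg x; apply: cvgD; [exact: cf|exact: cg].
move=> [df Df] [dg Dg]; split=> [x|v].
  exact: (differentiableD (df x) (dg x)).
have -> : 'D_v (fun x => f x + g x) = (fun x => 'D_v f x + 'D_v g x).
  apply/funext => x; exact: (deriveD (diff_derivable (df x)) (diff_derivable (dg x))).
by apply: IH; [exact: Df|exact: Dg].
Qed.

Lemma CkM k f g : Ck k f -> Ck k g -> Ck k (fun x => f x * g x).
Proof.
elim: k f g => [|k IH] f g; first by move=> cf cg x; apply: cvgM; [exact: cf|exact: cg].
move=> kf kg; have [df Df] := kf; have [dg Dg] := kg; split=> [x|v].
  exact: (differentiableM (df x) (dg x)).
have -> : 'D_v (fun x => f x * g x) = (fun x => f x * 'D_v g x + g x * 'D_v f x).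
  apply/funext => x; exact: (deriveM (diff_derivable (df x)) (diff_derivable (dg x))).
by apply: CkD; apply: IH; [exact: Ck_pred|exact: Dg|exact: Ck_pred|exact: Df].
Qed.

Lemma Ck_prod k (I : Type) (s : seq I) (F : I -> V -> R) :
  (forall i, Ck k (F i)) -> Ck k (fun x => \prod_(i <- s) F i x).
Proof.
move=> kF; elim: s => [|i s IH].
  by under eq_fun do rewrite big_nil; exact: Ck_cst.
by under eq_fun do rewrite big_cons; exact: CkM.
Qed.

Lemma Ck_linear k f (ell : {linear V -> R}) : f = ell -> continuous f -> Ck k f.
Proof.
move=> fE cf; have df x : differentiable f x by rewrite fE; apply: linear_differentiable; rewrite -fE.
case: k => [//|k]; split=> // v.
have -> : 'D_v f = (fun=> f v); last exact: Ck_cst.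
by apply/funext => x; rewrite deriveE// fE diff_lin// -fE.
Qed.

Lemma Ck_comp (h : nat -> R -> R) f k j :
  (forall i (x : R), is_derive x 1 (h i) (h i.+1 x)) -> (forall k, Ck k f) ->
  Ck k (fun x => h j (f x)).
Proof.
move=> dh kf.
have dh' i (x : R) : differentiable (h i) x.
  by apply/derivable1_diffP; exact: (@ex_derive _ _ _ _ _ _ _ (dh i x)).
have [df Df] := kf 1%N.
have dc i x : differentiable (fun x => h i (f x)) x.
  by apply: (@differentiable_comp _ _ _ _ f (h i)).
elim: k j => [|k IH] j; first by move=> x; apply: differentiable_continuous.
split=> // v.
have -> : 'D_v (fun x => h j (f x)) = (fun x => h j.+1 (f x) * 'D_v f x).
  apply/funext => x; rewrite !deriveE//.
  rewrite (_ : 'd (fun x => h j (f x)) x = 'd (h j) (f x) \o 'd f x :> (V -> R)); last exact: diff_comp.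
  by rewrite /= diff1E// derive1E (@derive_val _ _ _ _ _ _ _ (dh j (f x))) /GRing.scale /= mulrC.
apply: CkM; first exact: IH.
have [_] := kf k.+1; exact.
Qed.

End smooth_closure.

Section smooth_coordinates.
Context {R : realType} {d : nat}.
Local Notation V := 'rV[R]_d.

Let coord (i : 'I_d) (z : V * R) : R := z.1 ord0 i.

Let coord_linear i : linear (coord i).
Proof. by move=> c x y; rewrite /coord /= !mxE. Qed.

HB.instance Definition _ i := GRing.isLinear.Build R (V * R)%type R _ (coord i) (coord_linear i).

Lemma Ck_coord k i : Ck k (fun z : V * R => z.1 ord0 i).
Proof.
apply: (@Ck_linear _ _ _ _ (coord i)) => // z.
apply: (@continuous_comp _ _ _ fst (fun x : V => x ord0 i)); first exact: cvg_fst.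
exact: coord_continuous.
Qed.

Let time (z : V * R) : R := z.2.

Let time_linear : linear time.
Proof. by move=> c x y. Qed.

HB.instance Definition _ := GRing.isLinear.Build R (V * R)%type R _ time time_linear.

Lemma Ck_time k : Ck k (fun z : V * R => z.2).
Proof. by apply: (@Ck_linear _ _ _ _ time) => // z; exact: cvg_snd. Qed.

End smooth_coordinates.

Section flat_functions.
Context {R : realType}.
Implicit Types p : {poly R}.

(** The functions [p(1/x) exp(-1/x)], extended by [0] to the left half-line;
    the family is closed under differentiation. *)
Definition flat p (x : R) : R := if 0 < x then p.[x^-1] * expR (- x^-1) else 0.

Lemma flat_le0 p x : x <= 0 -> flat p x = 0.
Proof. by rewrite /flat leNgt => /negbTE ->. Qed.

Lemma flat1_ge0 x : 0 <= flat 1 x.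
Proof. by rewrite /flat; case: ifP => // _; rewrite hornerC mul1r expR_ge0. Qed.

Lemma flat1_le1 x : flat 1 x <= 1.
Proof.
rewrite /flat; case: ifP => // x0; rewrite hornerC mul1r -expR0 ler_expR.
by rewrite oppr_le0 invr_ge0 ltW.
Qed.

Let pow_exp_le (t : R) n : 0 <= t -> t ^+ n * expR (- t) <= n%:R ^+ n.
Proof.
case: n => [|n] t0.
  by rewrite !expr0 mul1r -expR0 ler_expR oppr_le0.
have n0 : (0 : R) < n.+1%:R by rewrite ltr0n.
rewrite expRN ler_pdivrMr ?expR_gt0//.
have -> : expR t = expR (t / n.+1%:R) ^+ n.+1.
  by rewrite -expRM_natl mulrC divfK// gt_eqF.
rewrite -exprMn; apply: lerXn2r; rewrite ?nnegrE ?mulr_ge0 ?expR_ge0 ?(ltW n0)//.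
rewrite mulrC -ler_pdivrMr//; apply: le_trans (expR_ge1Dx _).
by rewrite lerDr.
Qed.

(** Each monomial is dominated by the exponential. *)
Lemma poly_exp_bound p : exists2 C : R, 0 <= C & forall t, 0 <= t -> `|p.[t] * expR (- t)| <= C.
Proof.
exists (\sum_(i < size p) `|p`_i| * i%:R ^+ i) => [|t t0].
  by apply: sumr_ge0 => i _; rewrite mulr_ge0// exprn_ge0.
rewrite horner_coef mulr_suml; apply: (le_trans (ler_norm_sum _ _ _)).
apply: ler_sum => i _; rewrite -mulrA normrM; apply: ler_wpM2l => //.
by rewrite ger0_norm ?mulr_ge0 ?exprn_ge0 ?expR_ge0// pow_exp_le.
Qed.

Lemma flat_bound p : exists2 C : R, 0 <= C & forall x, `|flat p x| <= C.
Proof.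
have [C C0 HC] := poly_exp_bound p; exists C => // x; rewrite /flat.
by case: ifP => [x0|_]; rewrite ?normr0// HC// invr_ge0 ltW.
Qed.

Let flat_sqr_bound p : exists2 C : R, 0 <= C & forall x, `|flat p x| <= C * x ^+ 2.
Proof.
have [C C0 HC] := poly_exp_bound (p * 'X^2); exists C => // x; rewrite /flat.
case: ifP => [x0|_]; last by rewrite normr0 mulr_ge0// sqr_ge0.
have xV : 0 <= x^-1 by rewrite invr_ge0 ltW.
have := HC _ xV; rewrite hornerM hornerXn mulrAC normrM (ger0_norm (exprn_ge0 2 xV)).
by rewrite exprVn ler_pdivrMr ?exprn_gt0.
Qed.

(** The derivative of [p(1/x) exp(-1/x)] is [(p(u) - p'(u)) u^2 exp(-u)] with
    [u = 1/x]. *)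
Definition flat_deriv p : {poly R} := 'X^2 * (p - p^`()).

(** At the origin the quotient is bounded by [C |x|], as [flat p x] is
    quadratically small. *)
Lemma is_derive_flat p (x : R) : is_derive x 1 (flat p) (flat (flat_deriv p) x).
Proof.
have [x0|x0|x0] := ltgtP x 0.
- rewrite [flat _ x]flat_le0 ?(ltW x0)//.
  have E : \forall y \near x, cst 0 y = flat p y.
    near=> y; rewrite flat_le0//; apply: ltW; near: y; exact: lt_nbhsl.
  by apply: (near_eq_is_derive E); exact: is_derive_cst.
- have xn : x != 0 by rewrite gt_eqF.
  have E : \forall y \near x, p.[y^-1] * expR (- y^-1) = flat p y.
    near=> y; rewrite /flat ifT//; near: y; exact: lt_nbhsr.
  apply: (near_eq_is_derive E).
  have dV : is_derive x 1 (fun y : R => y^-1) (- x ^- 2).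
    have := @is_deriveV R id x 1 1 xn (is_derive_id x 1).
    by move=> H; apply: is_derive_eq; rewrite /GRing.scale /= mulr1.
  have dp : is_derive x 1 (fun y : R => p.[y^-1]) (p^`().[x^-1] * - x ^- 2).
    apply: (@is_derive1_comp _ (horner p) (fun y : R => y^-1)).
  have de : is_derive x 1 (fun y : R => expR (- y^-1)) (expR (- x^-1) * x ^- 2).
    apply: (@is_derive1_comp _ expR (fun y : R => - y^-1)).
    by apply: is_derive_eq; rewrite opprK.
  apply: is_derive_eq; rewrite /flat x0 /flat_deriv hornerM hornerXn hornerD hornerN /GRing.scale /=.
  by rewrite exprVn; ring.
- rewrite x0 [flat _ 0]flat_le0//.
  have [C C0 HC] := flat_sqr_bound p.
  have f0 : flat p 0 = 0 by rewrite flat_le0.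
  suff H : h^-1 *: ((flat p \o shift 0) (h *: 1) - flat p 0) @[h --> 0^'] --> (0 : R).
    by apply: DeriveDef; [apply: cvgP H|apply: cvg_lim H].
  have c1 : 0 < C + 1 by rewrite ltr_wpDl.
  apply/cvgr0Pnorm_le => e e0; near=> h.
  have hn : h != 0 by near: h; exact: nbhs_dnbhs_neq.
  have he : `|h| <= e / (C + 1) by near: h; apply: dnbhs0_le; rewrite divr_gt0.
  rewrite f0 subr0 /= /shift /= addr0 /GRing.scale /= mulr1 normrM normfV ler_pdivrMl ?normr_gt0//.
  apply: (le_trans (HC h)); rewrite -(real_normK (num_real h)) expr2 mulrCA.
  apply: ler_wpM2l => //; rewrite mulrC.
  apply: (@le_trans _ _ (`|h| * (C + 1))); last by rewrite -ler_pdivlMr.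
  by apply: ler_wpM2l; [exact: normr_ge0|rewrite lerDl].
Unshelve. all: by end_near. Qed.

End flat_functions.

Section derivative_bounds.
Context {R : realType}.
Implicit Types h dh : R -> R.

Let cont h dh : (forall x : R, is_derive x 1 h (dh x)) -> continuous h.
Proof.
move=> H x; apply: differentiable_continuous; apply/derivable1_diffP.
exact: (@ex_derive _ _ _ _ _ _ _ (H x)).
Qed.

Let mvt h dh (a b : R) : (forall x : R, is_derive x 1 h (dh x)) -> a <= b ->
  exists2 c, a <= c <= b & h b - h a = dh c * (b - a).
Proof.
move=> H ab; have [c] := @MVT_segment R h dh a b ab (fun x _ => H x) (continuous_subspaceT (cont H)).
by rewrite in_itv/= => cab E; exists c.
Qed.

Lemma lipschitz_of_derive h dh (L : R) : (forall x : R, is_derive x 1 h (dh x)) ->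
  (forall x, `|dh x| <= L) -> forall a b, `|h b - h a| <= L * `|b - a|.
Proof.
move=> H HL; have K a b : a <= b -> `|h b - h a| <= L * `|b - a|.
  by move=> ab; have [c _ ->] := mvt H ab; rewrite normrM ler_wpM2r.
move=> a b; have [ab|ba] := leP a b; first exact: K.
by rewrite distrC [`|b - a|]distrC; apply: K; exact: ltW.
Qed.

(** The mean value theorem on both sides of [a], and then for the first derivative. *)
Lemma second_difference_of_derive h dh ddh (M : R) :
  (forall x : R, is_derive x 1 h (dh x)) -> (forall x : R, is_derive x 1 dh (ddh x)) ->
  (forall x, `|ddh x| <= M) -> forall a t, `|h a - (h (a + t) + h (a - t)) / 2| <= M * t ^+ 2.
Proof.
move=> H H2 HM; have M0 : 0 <= M by exact: le_trans (HM 0).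
have K a t : 0 <= t -> `|h a - (h (a + t) + h (a - t)) / 2| <= M * t ^+ 2.
  move=> t0; have [|c1 /andP[c1l c1r] E1] := @mvt h dh a (a + t) H; first by rewrite lerDl.
  have [|c2 /andP[c2l c2r] E2] := @mvt h dh (a - t) a H; first by rewrite gerBl.
  have -> : h a - (h (a + t) + h (a - t)) / 2 = (dh c2 - dh c1) * t / 2.
    have -> : h (a + t) = h a + dh c1 * t by rewrite -(subrK (h a) (h (a + t))) E1; ring.
    have -> : h (a - t) = h a - dh c2 * t.
      by rewrite -[h (a - t)]opprK -[- h (a - t)](addKr (h a)) E2; ring.
    by field.
  rewrite !normrM (ger0_norm t0) (ger0_norm (x := 2^-1)) ?invr_ge0//.
  have L := lipschitz_of_derive H2 HM c1 c2.
  have d : `|c2 - c1| <= 2 * t by rewrite ler_norml; apply/andP; split; lra.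
  have := ler_wpM2l M0 d => d2.
  rewrite ler_pdivrMr// expr2 -!mulrA [M * _]mulrA [t * (_)]mulrC !mulrA.
  by apply: ler_wpM2r => //; lra.
move=> a t; have [t0|t0] := leP 0 t; first exact: K.
have := K a (- t); rewrite opprK sqrrN [h (a - t) + _]addrC; apply; lra.
Qed.

End derivative_bounds.

(** Bounded Lipschitz functions with quadratically bounded second differences
    form a class closed under products. *)
Definition bounded_sdiff (R : realType) (d : nat) (f : 'rV[R]_d -> R) : Prop :=
  exists A L M : R, [/\ forall x, `|f x| <= A,
    forall x y, `|f (x + y) - f x| <= L * enorm y &
    forall x y, `|sdiff f y x| <= M * enorm y ^+ 2].

Section bounded_sdiff.
Context {R : realType} {d : nat}.
Local Notation V := 'rV[R]_d.

Lemma bounded_sdiff_cst (c : R) : bounded_sdiff (fun _ : V => c).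
Proof.
exists `|c|, 0, 0; split=> [x|x y|x y] //; first by rewrite subrr normr0 mul0r.
by rewrite /sdiff (_ : c - _ = 0) ?normr0 ?mul0r//; field.
Qed.

Lemma bounded_sdiffM (f g : V -> R) : bounded_sdiff f -> bounded_sdiff g ->
  bounded_sdiff (fun x => f x * g x).
Proof.
move=> [A [L [M [fA fL fM]]]] [A' [L' [M' [gA gL gM]]]].
have A0 : 0 <= A by exact: le_trans (fA 0).
have A'0 : 0 <= A' by exact: le_trans (gA 0).
exists (A * A'), (A * L' + A' * L), (A * M' + A' * M + L * L'); split=> [x|x y|x y].
- by rewrite normrM ler_pM.
- have -> : f (x + y) * g (x + y) - f x * g x =
    f (x + y) * (g (x + y) - g x) + g x * (f (x + y) - f x) by ring.
  rewrite mulrDl -[A * _ * _]mulrA -[A' * _ * _]mulrA; apply: (le_trans (ler_normD _ _)).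
  by rewrite !normrM; apply: lerD; apply: ler_pM.
- have -> : sdiff (fun x => f x * g x) y x = f x * sdiff g y x + g x * sdiff f y x -
    ((f (x + y) - f x) * (g (x + y) - g x) + (f (x - y) - f x) * (g (x - y) - g x)) / 2.
    by rewrite /sdiff; field.
  have -> : (A * M' + A' * M + L * L') * enorm y ^+ 2 =
    (A * (M' * enorm y ^+ 2) + A' * (M * enorm y ^+ 2)) + L * (L' * enorm y ^+ 2) by ring.
  apply: (le_trans (ler_normB _ _)); apply: lerD.
    by apply: (le_trans (ler_normD _ _)); rewrite !normrM; apply: lerD; apply: ler_pM.
  have E : L * (L' * enorm y ^+ 2) = (L * enorm y) * (L' * enorm y) by ring.
  have h1 : `|(f (x + y) - f x) * (g (x + y) - g x)| <= L * (L' * enorm y ^+ 2).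
    by rewrite E normrM; apply: ler_pM.
  have h2 : `|(f (x - y) - f x) * (g (x - y) - g x)| <= L * (L' * enorm y ^+ 2).
    by rewrite E normrM -(enormN y); apply: ler_pM.
  have := ler_normD ((f (x + y) - f x) * (g (x + y) - g x)) ((f (x - y) - f x) * (g (x - y) - g x)).
  move=> h3; rewrite normrM (ger0_norm (x := 2^-1)) ?invr_ge0// ler_pdivrMr//.
  by apply: (le_trans h3); lra.
Qed.

Lemma bounded_sdiff_prod (I : Type) (s : seq I) (F : I -> V -> R) :
  (forall i, bounded_sdiff (F i)) -> bounded_sdiff (fun x => \prod_(i <- s) F i x).
Proof.
move=> HF; elim: s => [|i s IH].
  by under eq_fun do rewrite big_nil; exact: bounded_sdiff_cst.
by under eq_fun do rewrite big_cons; exact: bounded_sdiffM.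
Qed.

Lemma bounded_sdiff_coord (h dh ddh : R -> R) (A L M m a : R) (i : 'I_d) :
  (forall x : R, is_derive x 1 h (dh x)) -> (forall x : R, is_derive x 1 dh (ddh x)) ->
  (forall x, `|h x| <= A) -> (forall x, `|dh x| <= L) -> (forall x, `|ddh x| <= M) ->
  bounded_sdiff (fun x : V => h (m * x ord0 i + a)).
Proof.
move=> H H2 hA hL hM.
have L0 : 0 <= L by exact: le_trans (hL 0).
have M0 : 0 <= M by exact: le_trans (hM 0).
exists A, (L * `|m|), (M * m ^+ 2); split=> [x //|x y|x y].
  apply: (le_trans (lipschitz_of_derive H hL _ _)); rewrite -mulrA; apply: ler_wpM2l => //.
  rewrite mxE (_ : m * (x ord0 i + y ord0 i) + a - (m * x ord0 i + a) = m * y ord0 i); last by ring.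
  by rewrite normrM; apply: ler_wpM2l => //; exact: coord_le_enorm.
have := second_difference_of_derive H H2 hM (m * x ord0 i + a) (m * y ord0 i).
rewrite /sdiff !mxE.
rewrite (_ : m * (x ord0 i + y ord0 i) + a = m * x ord0 i + a + m * y ord0 i); last by ring.
rewrite (_ : m * (x ord0 i - y ord0 i) + a = m * x ord0 i + a - m * y ord0 i); last by ring.
move=> h3; apply: (le_trans h3); rewrite exprMn mulrA; apply: ler_wpM2l.
  by rewrite mulr_ge0// sqr_ge0.
rewrite -(real_normK (num_real (y ord0 i))); apply: lerXn2r; rewrite ?nnegrE ?enorm_ge0//.
exact: coord_le_enorm.
Qed.

End bounded_sdiff.

(** * Bumps in space and cutoffs in time *)

Section bump.
Context {R : realType} {d : nat}.
Local Notation V := 'rV[R]_d.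
Local Notation mu := (lebesgue_rV R d).

(** Smooth approximation, as [n] grows, of the indicator of an open box. *)
Definition bump (n : R) (a b z : V) : R :=
  \prod_(i < d) (flat 1 (n * (z ord0 i - a ord0 i)) * flat 1 (n * (b ord0 i - z ord0 i))).

Lemma bump_ge0 n a b z : 0 <= bump n a b z.
Proof. by apply: prodr_ge0 => i _; rewrite mulr_ge0// flat1_ge0. Qed.

Lemma bump_le1 n a b z : bump n a b z <= 1.
Proof.
apply: prodr_ile1 => i _; rewrite mulr_ge0 ?flat1_ge0//=.
by rewrite mulr_ile1 ?flat1_ge0 ?flat1_le1.
Qed.

Lemma bump_neq0 n a b z : 0 < n -> bump n a b z != 0 ->
  forall i, a ord0 i < z ord0 i < b ord0 i.
Proof.
move=> n0 bz i; apply: contra_neqT bz; rewrite negb_and -!leNgt => H.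
apply/eqP/prodf_eq0; exists i => //; rewrite mulf_eq0; apply/orP.
case/orP: H => H; [left|right]; apply/eqP/flat_le0; rewrite pmulr_rle0// subr_le0.
all: exact: H.
Qed.

Lemma bump_out n a b : 0 < n -> exists2 rho : R, 0 <= rho &
  forall z, rho < enorm z -> bump n a b z = 0.
Proof.
move=> n0; pose A := enorm a + enorm b.
have A0 : 0 <= A by rewrite addr_ge0// enorm_ge0.
exists (Num.sqrt d%:R * A) => [|z]; first by rewrite mulr_ge0// sqrtr_ge0.
apply: contraTeq => bz; rewrite -leNgt; apply: enorm_le_coord => i.
have /andP[h1 h2] := bump_neq0 n0 bz i.
have := coord_le_enorm a i; have := coord_le_enorm b i.
have := enorm_ge0 a; have := enorm_ge0 b.
rewrite !ler_norml => ? ? /andP[? ?] /andP[? ?]; rewrite /A; apply/andP; split; lra.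
Qed.

Lemma bump_shift n a b z x : bump n a b (z - x) = bump n (a + x) (b + x) z.
Proof.
by apply: eq_bigr => i _; rewrite !mxE; congr (flat _ (_ * _) * flat _ (_ * _)); ring.
Qed.

Lemma continuous_bump n a b : continuous (bump n a b).
Proof.
have fc : continuous (flat (1 : {poly R})).
  move=> x; apply: differentiable_continuous; apply/derivable1_diffP.
  exact: (@ex_derive _ _ _ _ _ _ _ (is_derive_flat 1 x)).
have cc i (z : V) : (fun z : V => z ord0 i) @ z --> z ord0 i by exact: coord_continuous.
have caff (m c : R) i : continuous (fun z : V => m * (z ord0 i + c)).
  apply: (@CkM R V 0%N (fun=> m)); first exact: (@Ck_cst R V 0%N).
  apply: (@CkD R V 0%N (fun z : V => z ord0 i)); last exact: (@Ck_cst R V 0%N).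
  by move=> z; exact: cc.
have comp (g : V -> R) : continuous g -> continuous (fun z => flat 1 (g z)).
  by move=> cg z; apply: (@continuous_comp _ _ _ g (flat 1)); [exact: cg|exact: fc].
apply: (@Ck_prod R V 0%N) => i; apply: (@CkM R V 0%N); apply: comp; first exact: caff.
have -> : (fun z : V => n * (b ord0 i - z ord0 i)) = (fun z => - n * (z ord0 i + - b ord0 i)).
  by apply/funext => z; ring.
exact: caff.
Qed.

Lemma measurable_bump n a b : measurable_fun setT (bump n a b).
Proof. exact: continuous_measurable_rV (@continuous_bump n a b). Qed.

Lemma bounded_sdiff_bump n a b : bounded_sdiff (bump n a b).
Proof.
have [A _ HA] := flat_bound (1 : {poly R}).
have [L _ HL] := flat_bound (flat_deriv (1 : {poly R})).
have [M _ HM] := flat_bound (flat_deriv (flat_deriv (1 : {poly R}))).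
apply: bounded_sdiff_prod => i; apply: bounded_sdiffM.
  have := @bounded_sdiff_coord R d _ _ _ _ _ _ n (- n * a ord0 i) i (is_derive_flat 1) (is_derive_flat _) HA HL HM.
  by congr bounded_sdiff; apply/funext => z; congr flat; ring.
have := @bounded_sdiff_coord R d _ _ _ _ _ _ (- n) (n * b ord0 i) i (is_derive_flat 1) (is_derive_flat _) HA HL HM.
by congr bounded_sdiff; apply/funext => z; congr flat; ring.
Qed.

End bump.

Section flat_limits.
Context {R : realType}.

Lemma flat_cvg (p : {poly R}) (x : R) : 0 < x -> flat p (n.+1%:R * x) @[n --> \oo] --> p.[0].
Proof.
move=> x0; rewrite (_ : (fun n => _) = fun n : nat => p.[(n.+1%:R)^-1 * x^-1] * expR (- (n.+1%:R^-1 * x^-1))); last first.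
  by apply/funext => n; rewrite /flat ifT ?invfM// mulr_gt0.
have c0 : (n.+1%:R)^-1 * x^-1 @[n --> \oo] --> (0 : R).
  rewrite -(mul0r x^-1); apply: cvgM; last exact: cvg_cst.
  exact: cvg_harmonic.
have h1 : p.[(n.+1%:R)^-1 * x^-1] @[n --> \oo] --> p.[0].
  apply: (cvg_comp _ _ c0); exact: continuous_horner.
have h2 : expR (- ((n.+1%:R)^-1 * x^-1)) @[n --> \oo] --> expR (- (0 : R)).
  by apply: (cvg_comp _ _ (cvgN c0)); exact: continuous_expR.
rewrite oppr0 expR0 in h2; rewrite -[X in _ --> X]mulr1; exact: cvgM h1 h2.
Qed.

End flat_limits.

Section cutoff.
Context {R : realType}.

(** As [n] grows, the cutoff in time tends to [exp(lam s) (b - s)] on [s < b]. *)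
Definition cutoff (lam n b s : R) : R := expR (lam * s) * ((b - s) * flat 1 (n * (b - s))).

(** The factor [(b - s) * flat 1 (n * (b - s))] has the derivative
    [- (flat 1 + flat 'X) (n * (b - s))], because [x * (flat 1)' x = flat 'X x]. *)
Definition cutoff_deriv (lam n b s : R) : R :=
  lam * cutoff lam n b s - expR (lam * s) * (flat 1 (n * (b - s)) + flat 'X (n * (b - s))).

Let flat_derivX (x : R) : x * flat (flat_deriv 1) x = flat 'X x.
Proof.
rewrite /flat; case: ifP => x0; last by rewrite mulr0.
rewrite /flat_deriv derivC subr0 mulr1 hornerXn hornerX mulrA expr2 mulrA.
by rewrite divff ?mul1r// gt_eqF.
Qed.

Lemma is_derive_cutoff lam n b (s : R) : is_derive s 1 (cutoff lam n b) (cutoff_deriv lam n b s).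
Proof.
have de : is_derive s 1 (fun s : R => expR (lam * s)) (expR (lam * s) * lam).
  apply: (@is_derive1_comp _ expR (fun s : R => lam * s)).
  by apply: is_derive_eq; rewrite /GRing.scale /= mulr1.
have df : is_derive s 1 (fun s : R => flat 1 (n * (b - s))) (flat (flat_deriv 1) (n * (b - s)) * - n).
  apply: (@is_derive1_comp _ (flat 1) (fun s : R => n * (b - s))); first exact: is_derive_flat.
  by apply: is_derive_eq; rewrite /GRing.scale /=; ring.
apply: is_derive_eq; rewrite /cutoff_deriv -flat_derivX /cutoff /GRing.scale /=.
by ring.
Qed.

Lemma cutoff_out lam n b s : 0 < n -> b <= s -> cutoff lam n b s = 0.
Proof.
by move=> n0 bs; rewrite /cutoff flat_le0 ?mulr0// pmulr_rle0// subr_le0.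
Qed.

Lemma cutoff_deriv_out lam n b s : 0 < n -> b <= s -> cutoff_deriv lam n b s = 0.
Proof.
move=> n0 bs; rewrite /cutoff_deriv cutoff_out// !flat_le0 ?addr0 ?mulr0 ?subr0//.
all: by rewrite pmulr_rle0// subr_le0.
Qed.

(** The bounds are uniform in [n], as required for dominated convergence. *)
Lemma cutoff_bound lam b : exists2 C : R, 0 <= C & forall n s, 0 <= s -> s <= b ->
  `|cutoff lam n b s| <= C /\ `|cutoff_deriv lam n b s| <= C.
Proof.
have [CX CX0 HX] := flat_bound ('X : {poly R}).
pose E := expR (`|lam| * `|b|); have E0 : 0 <= E by exact: expR_ge0.
exists (`|lam| * (E * `|b|) + E * `|b| + E * (1 + CX)) => [|n s s0 sb].
  by rewrite !addr_ge0// !mulr_ge0// addr_ge0.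
have b0 : 0 <= b by exact: le_trans sb.
have e1 : `|expR (lam * s)| <= E.
  rewrite ger0_norm ?expR_ge0// ler_expR; apply: (le_trans (ler_norm _)); rewrite normrM.
  by apply: ler_wpM2l => //; rewrite !ger0_norm.
have f1 : `|flat 1 (n * (b - s))| <= 1 by rewrite ger0_norm ?flat1_ge0// flat1_le1.
have c1 : `|cutoff lam n b s| <= E * `|b|.
  rewrite /cutoff !normrM; apply: ler_pM => //.
  rewrite -[leRHS]mulr1; apply: ler_pM => //; rewrite !ger0_norm ?subr_ge0// gerBl//.
have t1 : 0 <= `|lam| * (E * `|b|) by rewrite !mulr_ge0.
have t2 : 0 <= E * (1 + CX) by rewrite mulr_ge0// addr_ge0.
have t3 : 0 <= E * `|b| by rewrite mulr_ge0.
split; first by lra.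
apply: (le_trans (ler_normB _ _)).
have : `|lam * cutoff lam n b s| <= `|lam| * (E * `|b|) by rewrite normrM ler_wpM2l.
have : `|expR (lam * s) * (flat 1 (n * (b - s)) + flat 'X (n * (b - s)))| <= E * (1 + CX).
  rewrite normrM; apply: ler_pM => //; apply: (le_trans (ler_normD _ _)); exact: lerD.
lra.
Qed.

Lemma cutoff_cvg lam b s : s < b ->
  cutoff lam n.+1%:R b s @[n --> \oo] --> expR (lam * s) * (b - s).
Proof.
move=> sb; rewrite /cutoff; apply: cvgM; first exact: cvg_cst.
rewrite -[X in _ --> X]mulr1; apply: cvgM; first exact: cvg_cst.
have bs : 0 < b - s by rewrite subr_gt0.
by have := @flat_cvg R 1 _ bs; rewrite hornerC.
Qed.

Lemma cutoff_deriv_cvg lam b s : s < b ->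
  cutoff_deriv lam n.+1%:R b s @[n --> \oo] -->
  lam * (expR (lam * s) * (b - s)) - expR (lam * s).
Proof.
move=> sb; have bs : 0 < b - s by rewrite subr_gt0.
rewrite /cutoff_deriv; apply: cvgB.
  by apply: cvgM; [exact: cvg_cst|exact: cutoff_cvg].
rewrite -[X in _ --> X]mulr1; apply: cvgM; first exact: cvg_cst.
rewrite -[X in _ --> X]addr0; apply: cvgD.
  by have := @flat_cvg R 1 _ bs; rewrite hornerC.
by have := @flat_cvg R 'X _ bs; rewrite hornerX.
Qed.

End cutoff.

(** Only compactness of the support at nonnegative times matters, and there the
    cutoff vanishes for [s >= b]. *)
Lemma test_function_bump_cutoff (R : realType) (d : nat) (T lam n m b : R)
  (x y : 'rV[R]_d) : 0 < n -> 0 < m -> b < T ->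
  test_function T (fun z : 'rV[R]_d * R => bump m x y z.1 * cutoff lam n b z.2).
Proof.
move=> n0 m0 bT; split.
- pose h j : R -> R := flat (iter j flat_deriv 1).
  have dh i (t : R) : is_derive t 1 (h i) (h i.+1 t) by exact: is_derive_flat.
  have dexp (i : nat) (t : R) : is_derive t 1 (@expR R) (@expR R t) by exact: is_derive_expR.
  move=> k; apply: CkM.
    apply: Ck_prod => i; apply: CkM.
      apply: (@Ck_comp _ _ h _ k 0 dh) => j; apply: CkM; first exact: Ck_cst.
      by apply: CkD; [exact: Ck_coord|exact: Ck_cst].
    apply: (@Ck_comp _ _ h _ k 0 dh) => j; apply: CkM; first exact: Ck_cst.
    apply: CkD; first exact: Ck_cst.
    under eq_fun do rewrite -mulN1r.
    by apply: CkM; [exact: Ck_cst|exact: Ck_coord].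
  have Ckb j : Ck j (fun z : 'rV[R]_d * R => b - z.2).
    apply: CkD; first exact: Ck_cst.
    under eq_fun do rewrite -mulN1r.
    by apply: CkM; [exact: Ck_cst|exact: Ck_time].
  apply: CkM.
    apply: (@Ck_comp _ _ (fun=> expR) _ k 0 dexp) => j.
    by apply: CkM; [exact: Ck_cst|exact: Ck_time].
  apply: CkM; first exact: Ckb.
  apply: (@Ck_comp _ _ h _ k 0 dh) => j; apply: CkM; first exact: Ck_cst.
  exact: Ckb.
- exists ([set z : 'rV[R]_d | forall i, `[x ord0 i, y ord0 i]%classic (z ord0 i)] `*` `[0, b]%classic).
  split.
  + apply: compact_setX; last exact: segment_compact.
    by apply: (@rV_compact R d (fun i => `[x ord0 i, y ord0 i]%classic)) => i; exact: segment_compact.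
  + move=> z [_ /=]; rewrite in_itv/= => /andP[z0 zb]; split => //=.
    by rewrite in_itv/= z0 (le_lt_trans zb).
  + move=> z /andP[z0 zT] H; apply/eqP; rewrite mulf_eq0.
    apply: contraPT H; rewrite negb_or => /andP[h1 h2]; apply; split=> /=.
      move=> i; rewrite /= in_itv/=; have /andP[l1 l2] := bump_neq0 m0 h1 i.
      by rewrite !ltW.
    rewrite in_itv/= z0/= leNgt; apply: contra h2 => bz; rewrite cutoff_out//.
    exact: ltW.
Qed.

(** * Truncation of the kernel *)

Section measurable_section_integral.
Context {d1 d2 : measure_display} {T1 : measurableType d1} {T2 : measurableType d2}
  {R : realType}.
Variables (m : {sigma_finite_measure set T2 -> \bar R}) (f : T1 -> T2 -> R).
Hypothesis mf : measurable_fun setT (fun z : T1 * T2 => f z.1 z.2).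

Lemma measurable_integral_EFin : measurable_fun setT (fun x => \int[m]_y (f x y)%:E)%E.
Proof.
pose F (z : T1 * T2) : \bar R := (f z.1 z.2)%:E.
have mF : measurable_fun setT F by apply/measurable_EFinP.
rewrite [X in measurable_fun _ X](_ : _ = fun x => (\int[m]_y (F^\+ (x, y)) - \int[m]_y (F^\- (x, y)))%E); last first.
  apply/funext => x; rewrite integralE; congr (_ - _)%E.
    by apply: eq_integral => y _; rewrite !funeposE.
  by apply: eq_integral => y _; rewrite !funenegE.
apply: emeasurable_funB.
  apply: (measurable_tonelli1 (fun x y => F^\+%E (x, y))).
    by rewrite (_ : (fun z => _) = F^\+%E); [exact: measurable_funepos|apply/funext => -[]].
  by move=> x y; exact: funepos_ge0.
apply: (measurable_tonelli1 (fun x y => F^\-%E (x, y))).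
  by rewrite (_ : (fun z => _) = F^\-%E); [exact: measurable_funeneg|apply/funext => -[]].
by move=> x y; exact: funeneg_ge0.
Qed.

Lemma measurable_Rintegral : measurable_fun setT (fun x => \int[m]_y f x y).
Proof. exact: (measurableT_comp (fine_measurable measurableT) measurable_integral_EFin). Qed.

End measurable_section_integral.
Arguments measurable_integral_EFin {d1 d2 T1 T2 R} m {f} mf.
Arguments measurable_Rintegral {d1 d2 T1 T2 R} m {f} mf.

Section truncated_kernel.
Context {R : realType} {d : nat}.
Local Notation V := 'rV[R]_d.
Local Notation mu := (lebesgue_rV R d).
Variables (K W : V -> R).
Hypothesis mK : measurable_fun setT K.
Hypothesis K_ge0 : forall y, 0 <= K y.
Hypothesis K_levy : (\int[mu]_y (Num.min 1 (enorm y ^+ 2) * K y)%:E < +oo)%E.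
Hypothesis hW : comparison_weight K W.

Definition kfar (del : R) (y : V) : R := \1_(~` eball 0 del) y * K y.
Definition knear (del : R) (y : V) : R := \1_(eball 0 del) y * K y.

Lemma kfar_ge0 del y : 0 <= kfar del y.
Proof. by rewrite mulr_ge0// indicE. Qed.

Lemma knear_ge0 del y : 0 <= knear del y.
Proof. by rewrite mulr_ge0// indicE. Qed.

Lemma kfarDnear del y : K y = kfar del y + knear del y.
Proof.
rewrite /kfar /knear !indicE in_setC; case: (_ \in _) => /=; by rewrite ?mul0r ?mul1r ?add0r ?addr0.
Qed.

Lemma measurable_knear del : measurable_fun setT (knear del).
Proof. by apply: measurable_funM; [exact: measurable_eball_indic|exact: mK]. Qed.

Lemma measurable_kfar del : measurable_fun setT (kfar del).
Proof.
apply: measurable_funM => //; apply: measurable_indic; apply: measurableC.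
exact: measurable_eball.
Qed.

Section radius.
Variable del : R.
Hypotheses (del0 : 0 < del) (del1 : del <= 1).

Let del2 : 0 < del ^+ 2. Proof. by rewrite exprn_gt0. Qed.

Lemma kfar_lty : (\int[mu]_y (kfar del y)%:E < +oo)%E.
Proof.
apply: (@le_lt_trans _ _ (\int[mu]_y (del ^- 2 * (Num.min 1 (enorm y ^+ 2) * K y))%:E)%E).
  apply: ge0_le_integral_real.
  - exact: measurable_kfar.
  - by apply: measurable_funM => //; exact: measurable_levy_integrand.
  - by move=> y; exact: kfar_ge0.
  - move=> y; rewrite mulrA; apply: ler_wpM2r => //; rewrite indicE.
    case: (boolP (y \in _)) => [|_]; last by rewrite mulr_ge0 ?invr_ge0 ?(ltW del2)// min1_sqr_ge0.
    rewrite inE /= eball0E /= => /negP; rewrite -ltNge => ydel.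
    rewrite -ler_pdivrMl ?invr_gt0// invrK mulr1 le_min expr_le1 ?(ltW del0)// del1/=.
    by apply: lerXn2r; rewrite ?nnegrE ?enorm_ge0 ?ltW.
rewrite ge0_integralZl_real; last 3 first.
- exact: measurable_levy_integrand.
- by move=> y; rewrite mulr_ge0// min1_sqr_ge0.
- by rewrite invr_ge0 ltW.
by rewrite (levy_massE K_ge0 K_levy) -EFinM ltry.
Qed.

Definition kfar_mass : R := \int[mu]_y kfar del y.
Definition knear_mass : R := \int[mu]_y (enorm y ^+ 2 * knear del y).

Lemma kfar_massE : (\int[mu]_y (kfar del y)%:E = kfar_mass%:E)%E.
Proof. by apply: ge0_RintegralE; [exact: kfar_ge0|exact: kfar_lty]. Qed.

Lemma kfar_mass_ge0 : 0 <= kfar_mass.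
Proof. by apply: Rintegral_ge0 => y _; exact: kfar_ge0. Qed.

Lemma measurable_knear_sqr : measurable_fun setT (fun y => enorm y ^+ 2 * knear del y).
Proof. by apply: measurable_funM; [by mfun|exact: measurable_knear]. Qed.

Lemma knear_sqr_le y : enorm y ^+ 2 * knear del y <= Num.min 1 (enorm y ^+ 2) * K y.
Proof.
rewrite /knear mulrA; apply: ler_wpM2r => //; rewrite indicE.
case: (boolP (y \in _)) => [|_]; last by rewrite mulr0 min1_sqr_ge0.
rewrite inE eball0E /= => yd; rewrite mulr1 le_min lexx andbT expr_le1 ?enorm_ge0//.
exact: le_trans del1.
Qed.

Lemma knear_sqr_ge0 y : 0 <= enorm y ^+ 2 * knear del y.
Proof. by rewrite mulr_ge0 ?sqr_ge0// knear_ge0. Qed.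

Lemma knear_sqr_lty : (\int[mu]_y (enorm y ^+ 2 * knear del y)%:E < +oo)%E.
Proof.
apply: le_lt_trans K_levy; apply: ge0_le_integral_real.
- exact: measurable_knear_sqr.
- exact: measurable_levy_integrand.
- exact: knear_sqr_ge0.
- exact: knear_sqr_le.
Qed.

Lemma knear_massE : (\int[mu]_y (enorm y ^+ 2 * knear del y)%:E = knear_mass%:E)%E.
Proof. by apply: ge0_RintegralE; [exact: knear_sqr_ge0|exact: knear_sqr_lty]. Qed.

Let W_ge0 x : 0 <= W x. Proof. exact: ltW (cw_gt0 hW x). Qed.
Let mW := cw_measurable hW.

(** The transition kernel of large jumps moves the weight by a bounded factor,
    with a bound that exceeds the jump rate by a constant independent of the
    truncation. *)
Lemma kfar_weight_le (C : R) : (forall x : V,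
    (\int[mu]_y (`|sdiff W y x| * K y)%:E <= (C * W x)%:E)%E) -> forall x,
  (\int[mu]_y (kfar del y * ((W (x + y) + W (x - y)) / 2))%:E <= ((kfar_mass + C) * W x)%:E)%E.
Proof.
move=> HC x.
have msd := measurable_sect2 (f := sdiff W) (measurable_sdiff (integrable_weight hW)) x.
have msdK : measurable_fun setT (fun y => `|sdiff W y x| * K y).
  by apply: measurable_funM => //; apply: measurableT_comp; [exact: normr_measurable|exact: msd].
apply: (@le_trans _ _ (\int[mu]_y (W x * kfar del y + `|sdiff W y x| * K y)%:E)%E).
  apply: ge0_le_integral_real.
  - apply: measurable_funM; first exact: measurable_kfar.
    by apply: measurable_funM => //; apply: measurable_funD; mfun.
  - by apply: measurable_funD => //; apply: measurable_funM => //; exact: measurable_kfar.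
  - by move=> y; rewrite mulr_ge0 ?kfar_ge0// divr_ge0// addr_ge0.
  - move=> y; have := ler_norm (- sdiff W y x); rewrite normrN => h.
    have h1 : (W (x + y) + W (x - y)) / 2 <= W x + `|sdiff W y x| by move: h; rewrite /sdiff; lra.
    have kf := kfar_ge0 del y; have kn := knear_ge0 del y.
    apply: (le_trans (ler_wpM2l kf h1)); rewrite mulrDr [W x * _]mulrC lerD2l mulrC.
    by apply: ler_wpM2l => //; rewrite (kfarDnear del) lerDl.
rewrite ge0_integralD_real//; last 3 first.
- by apply: measurable_funM => //; exact: measurable_kfar.
- by move=> y; rewrite mulr_ge0// kfar_ge0.
- by move=> y; rewrite mulr_ge0.
rewrite ge0_integralZl_real; [|exact: measurable_kfar|exact: kfar_ge0|exact: W_ge0].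
rewrite kfar_massE mulrDl EFinD -EFinM [W x * _]mulrC.
by apply: leeD; [exact: lexx|exact: HC].
Qed.

End radius.

(** The truncation error vanishes with the radius. *)
Lemma knear_mass_small (e : R) : 0 < e -> exists2 del : R, 0 < del <= 1 & knear_mass del <= e.
Proof.
move=> e0; pose f (n : nat) (y : V) : R := enorm y ^+ 2 * knear n.+1%:R^-1 y.
have d0 n : 0 < (n.+1%:R)^-1 :> R by rewrite invr_gt0 ltr0n.
have d1 n : (n.+1%:R)^-1 <= 1 :> R by rewrite invf_le1 ?ltr0n// ler1n.
have ilevy : mu.-integrable setT (EFin \o (fun y => Num.min 1 (enorm y ^+ 2) * K y)).
  apply: integrable_ge0 => //; first exact: measurable_levy_integrand.
  by move=> y; rewrite mulr_ge0// min1_sqr_ge0.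
have cf : {ae mu, forall y, setT y -> (f n y)%:E @[n --> \oo] --> (0 : \bar R)}.
  apply: aeW => y _; have [y0|y0] := eqVneq y 0.
    rewrite (_ : (fun n => _) = fun=> 0%:E); first exact: cvg_cst.
    by apply/funext => n; rewrite /f y0 enorm0 expr0n mul0r.
  have ey := enorm_gt0 y0.
  apply: cvg_near_cst; near=> n; congr EFin.
  rewrite /f /knear indicE memNset ?mul0r ?mulr0// eball0E /=; apply/negP; rewrite -ltNge.
  rewrite -[ltRHS]invrK ltf_pV2 ?posrE ?ltr0n ?invr_gt0//.
  have h : (enorm y)^-1 < n%:R by near: n; exact: nbhs_infty_gtr.
  by apply: (lt_le_trans h); rewrite ler_nat.
have df : {ae mu, forall y n, setT y -> (`|(f n y)%:E| <= (Num.min 1 (enorm y ^+ 2) * K y)%:E)%E}.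
  apply: aeW => y n _; rewrite lee_fin ger0_norm; last exact: knear_sqr_ge0.
  exact: knear_sqr_le.
have mf n : measurable_fun setT (fun y => (f n y)%:E).
  by apply/measurable_EFinP; exact: measurable_knear_sqr.
have [_ _ H] := @dominated_convergence _ _ _ mu setT measurableT _ _ _ mf (@measurable_cst _ _ _ _ _ 0%E) cf ilevy df.
have HE : (fun n => \int[mu]_(y in setT) (f n y)%:E)%E = EFin \o (fun n : nat => knear_mass n.+1%:R^-1).
  by apply/funext => n; rewrite /= -knear_massE.
rewrite HE integral_cst// mul0e in H.
have /fine_cvgP[_ /cvgr0Pnorm_le/(_ _ e0)[N _ HN]] := H.
exists N.+1%:R^-1; first by rewrite d0 d1.
by apply: le_trans (HN N _) => //=; exact: ler_norm.
Unshelve. all: by end_near. Qed.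

End truncated_kernel.

Section profile.
Context {R : realType} {d : nat}.
Local Notation V := 'rV[R]_d.
Local Notation mu := (lebesgue_rV R d).
Variables (K W : V -> R).
Hypothesis mK : measurable_fun setT K.
Hypothesis K_ge0 : forall y, 0 <= K y.
Hypothesis K_levy : (\int[mu]_y (Num.min 1 (enorm y ^+ 2) * K y)%:E < +oo)%E.
Hypothesis hW : comparison_weight K W.

Let W_ge0 x : 0 <= W x. Proof. exact: ltW (cw_gt0 hW x). Qed.
Let mW := cw_measurable hW.

Lemma indic_eball_le_weight (c : V) (rho : R) : exists2 A : R, 0 <= A &
  forall z, \1_(eball c rho) z <= A * W z.
Proof.
have [C C0 HC] := cw_harnack hW (normr_ge0 rho).
exists (C / W c) => [|z]; first by rewrite divr_ge0// ltW.
rewrite indicE; case: (boolP (z \in _)) => [|_]; last by rewrite mulr_ge0// divr_ge0// ltW.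
rewrite inE /eball /= => zc; rewrite mulrAC ler_pdivlMr ?(cw_gt0 hW)// mul1r.
by apply: HC; apply: (le_trans zc); exact: ler_norm.
Qed.

Variables (eta : V -> R) (c : V) (rho M : R).
Hypothesis meta : measurable_fun setT eta.
Hypothesis eta_ge0 : forall z, 0 <= eta z.
Hypothesis eta_le1 : forall z, eta z <= 1.
Hypothesis eta_out : forall z, rho < enorm (z - c) -> eta z = 0.
Hypothesis M_ge0 : 0 <= M.
Hypothesis eta_sdiff : forall y z, `|sdiff eta y z| <= M * enorm y ^+ 2.

Lemma profile_le_indic (rho' : R) z : rho <= rho' -> eta z <= \1_(eball c rho') z.
Proof.
move=> rr; rewrite indicE; case: (boolP (z \in _)) => [_|]; first exact: eta_le1.
move=> /negP; rewrite inE /eball /= => /negP; rewrite -ltNge => zc.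
by rewrite eta_out// (le_lt_trans rr).
Qed.

Let mavg : measurable_fun setT (fun p : V * V => (eta (p.1 + p.2) + eta (p.1 - p.2)) / 2).
Proof. by apply: measurable_funM => //; apply: measurable_funD; mfun. Qed.

Let msd : measurable_fun setT (fun p : V * V => sdiff eta p.2 p.1).
Proof. by apply: measurable_funB; [mfun|exact: mavg]. Qed.

Let avg_ge0 (z y : V) : 0 <= (eta (z + y) + eta (z - y)) / 2.
Proof. by rewrite divr_ge0// addr_ge0. Qed.

Let avg_le1 (z y : V) : (eta (z + y) + eta (z - y)) / 2 <= 1.
Proof. by have := eta_le1 (z + y); have := eta_le1 (z - y); lra. Qed.

Section radius.
Variable del : R.
Hypotheses (del0 : 0 < del) (del1 : del <= 1).

Definition far_average (z : V) : R :=
  \int[mu]_y (kfar K del y * ((eta (z + y) + eta (z - y)) / 2)).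
Definition near_difference (z : V) : R :=
  \int[mu]_y (sdiff eta y z * knear K del y).

Let mkf := measurable_kfar mK del.
Let mkn := measurable_knear mK del.
Let kf0 := kfar_ge0 K_ge0 del.
Let kn0 := knear_ge0 K_ge0 del.

Let mfar : measurable_fun setT (fun p : V * V => kfar K del p.2 * ((eta (p.1 + p.2) + eta (p.1 - p.2)) / 2)).
Proof. by apply: measurable_funM; [mfun|exact: mavg]. Qed.

Let mnear : measurable_fun setT (fun p : V * V => sdiff eta p.2 p.1 * knear K del p.2).
Proof. by apply: measurable_funM; [exact: msd|mfun]. Qed.

Let ikf : mu.-integrable setT (EFin \o kfar K del).
Proof. exact: (integrable_ge0 mkf kf0 (kfar_lty mK K_ge0 K_levy del0 del1)). Qed.

Let mfarz (z : V) : measurable_fun setT (fun y : V => kfar K del y * ((eta (z + y) + eta (z - y)) / 2)).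
Proof. exact: (measurable_sect1 (f := fun z y : V => kfar K del y * ((eta (z + y) + eta (z - y)) / 2)) mfar z). Qed.

Let mnearz (z : V) : measurable_fun setT (fun y : V => sdiff eta y z * knear K del y).
Proof. exact: (measurable_sect1 (f := fun z y : V => sdiff eta y z * knear K del y) mnear z). Qed.

Let ifar (z : V) : mu.-integrable setT (EFin \o (fun y => kfar K del y * ((eta (z + y) + eta (z - y)) / 2))).
Proof.
apply: (integrable_dominated (mfarz z) mkf _ (kfar_lty mK K_ge0 K_levy del0 del1)).
move=> y; rewrite ger0_norm; last exact: mulr_ge0 (kf0 y) (avg_ge0 z y).
exact: (ler_piMr (kf0 y) (avg_le1 z y)).
Qed.

Let near_le y z : `|sdiff eta y z * knear K del y| <=
  M * \1_(eball c (rho + 1)) z * (enorm y ^+ 2 * knear K del y).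
Proof.
rewrite normrM (ger0_norm (kn0 y)) [leRHS]mulrA.
rewrite /knear !indicE; case: (boolP (y \in _)) => [|_]; last by rewrite !mul0r !mulr0.
rewrite inE eball0E /= => yd; rewrite !mul1r; apply: ler_wpM2r => //.
case: (boolP (z \in _)) => [_|]; first by rewrite mulr1; exact: eta_sdiff.
move=> /negP; rewrite inE /eball /= => /negP; rewrite -ltNge => zc.
have y1 : enorm y <= 1 := le_trans yd del1.
rewrite mulr0 mul0r /sdiff !eta_out ?add0r ?mul0r ?subr0 ?normr0//.
- by rewrite normrN normr0.
- by have := enorm_triB (z - c) (- y); rewrite enormN (_ : z - c - y = z - y - c); [lra|rVring].
- by have := enorm_triB (z - c) y; rewrite (_ : z - c + y = z + y - c); [lra|rVring].
- lra.
Qed.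

Let inear (z : V) : mu.-integrable setT (EFin \o (fun y => sdiff eta y z * knear K del y)).
Proof.
apply: (integrable_dominated (mnearz z) _ (near_le ^~ z)).
  by apply: measurable_funM => //; exact: measurable_knear_sqr.
rewrite ge0_integralZl_real; last 3 first.
- exact: measurable_knear_sqr.
- exact: knear_sqr_ge0.
- by rewrite mulr_ge0// indicE.
by rewrite (knear_massE mK K_ge0 K_levy del1) -EFinM ltry.
Qed.

Lemma measurable_far_average : measurable_fun setT far_average.
Proof. exact: (measurable_Rintegral mu mfar). Qed.

Lemma measurable_near_difference : measurable_fun setT near_difference.
Proof. exact: (measurable_Rintegral mu mnear). Qed.

(** The long jumps have finite mass, so for them the second difference can be
    expanded. *)
Lemma nonlocal_op_split z : nonlocal_op K eta z =
  kfar_mass K del * eta z - far_average z + near_difference z.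
Proof.
have i1 := integrableZl measurableT (eta z) ikf.
have i12 := integrableB measurableT i1 (ifar z).
rewrite /kfar_mass mulrC -(RintegralZl _ measurableT ikf) /far_average.
rewrite -(RintegralB measurableT i1 (ifar z)) /near_difference -(RintegralD measurableT i12 (inear z)).
apply: eq_Rintegral => y _; rewrite /= {1}(kfarDnear K del y) /sdiff; ring.
Qed.

Lemma far_average_ge0 z : 0 <= far_average z.
Proof. by apply: Rintegral_ge0 => y _; rewrite mulr_ge0. Qed.

Lemma near_difference_le z :
  `|near_difference z| <= M * knear_mass K del * \1_(eball c (rho + 1)) z.
Proof.
have iks : mu.-integrable setT (EFin \o (fun y => enorm y ^+ 2 * knear K del y)).
  apply: integrable_ge0; [exact: measurable_knear_sqr|exact: knear_sqr_ge0|].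
  exact: (knear_sqr_lty mK K_ge0 K_levy del1).
apply: (le_trans (le_normr_Rintegral measurableT (inear z))).
rewrite mulrAC -(RintegralZl _ measurableT iks).
apply: le_Rintegral; [exact: measurableT|exact: (integrable_norm (inear z))|exact: (integrableZl measurableT _ iks)|].
by move=> y _; exact: near_le.
Qed.

Lemma far_average_le_weight : exists2 A : R, 0 <= A & forall z, far_average z <= A * W z.
Proof.
have [A A0 HA] := indic_eball_le_weight c rho.
have [C C0 HC] := cw_sdiff_kernel hW.
exists (A * (kfar_mass K del + C)) => [|z].
  by rewrite mulr_ge0// addr_ge0// kfar_mass_ge0.
rewrite -lee_fin -ge0_RintegralE; last 2 first.
- by move=> y; rewrite mulr_ge0.
- apply: le_lt_trans (kfar_lty mK K_ge0 K_levy del0 del1).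
  apply: ge0_le_integral_real; [exact: mfarz|exact: mkf|by move=> y; rewrite mulr_ge0|].
  by move=> y; exact: (ler_piMr (kf0 y) (avg_le1 z y)).
apply: (@le_trans _ _ (\int[mu]_y (A * (kfar K del y * ((W (z + y) + W (z - y)) / 2)))%:E)%E).
  apply: ge0_le_integral_real.
  - exact: mfarz.
  - apply: measurable_funM => //; apply: measurable_funM => //; apply: measurable_funM => //.
    by apply: measurable_funD; mfun.
  - by move=> y; rewrite mulr_ge0.
  - move=> y; rewrite [leRHS]mulrCA; apply: ler_wpM2l => //.
    have h u : eta u <= A * W u by apply: le_trans (HA u); exact: profile_le_indic.
    by have := h (z + y); have := h (z - y); lra.
rewrite ge0_integralZl_real//; last 2 first.
- apply: measurable_funM => //; apply: measurable_funM => //.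
  by apply: measurable_funD; mfun.
- by move=> y; rewrite mulr_ge0// divr_ge0// addr_ge0.
rewrite -mulrA EFinM; apply: lee_wpmul2l => //.
exact: (kfar_weight_le mK K_ge0 K_levy hW del0 del1 HC).
Qed.

End radius.

Lemma measurable_nonlocal_profile : measurable_fun setT (nonlocal_op K eta).
Proof.
rewrite (_ : nonlocal_op K eta = fun z => kfar_mass K 1 * eta z - far_average 1 z + near_difference 1 z).
  apply: measurable_funD; last exact: measurable_near_difference.
  by apply: measurable_funB; [exact: measurable_funM|exact: measurable_far_average].
by apply/funext => z; exact: (nonlocal_op_split ltr01 (lexx 1)).
Qed.

(** The long jumps spread the profile over space with a density of the order of the
    weight. *)
Lemma nonlocal_profile_le_weight : exists2 A : R, 0 <= A & forall z, `|nonlocal_op K eta z| <= A * W z.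
Proof.
have [A1 A10 H1] := indic_eball_le_weight c rho.
have [A2 A20 H2] := indic_eball_le_weight c (rho + 1).
have [A3 A30 H3] := far_average_le_weight ltr01 (lexx 1).
have k0 := kfar_mass_ge0 K_ge0 1.
have n0 : 0 <= knear_mass K 1 by apply: Rintegral_ge0 => y _; exact: knear_sqr_ge0.
exists (kfar_mass K 1 * A1 + A3 + M * knear_mass K 1 * A2) => [|z].
  by rewrite !addr_ge0// !mulr_ge0.
rewrite (nonlocal_op_split ltr01 (lexx 1)) !mulrDl -[kfar_mass K 1 * A1 * _]mulrA -[M * _ * A2 * _]mulrA.
apply: (le_trans (ler_normD _ _)); apply: lerD.
  apply: (le_trans (ler_normB _ _)); apply: lerD.
    rewrite ger0_norm ?mulr_ge0//; apply: ler_wpM2l => //.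
    by apply: le_trans (H1 z); exact: profile_le_indic.
  by rewrite ger0_norm; [exact: H3|exact: far_average_ge0].
have nd := near_difference_le (lexx 1) z; apply: (le_trans nd).
by apply: ler_wpM2l; [exact: mulr_ge0|exact: H2].
Qed.

Let mfarz del (z : V) : measurable_fun setT (fun y : V => kfar K del y * ((eta (z + y) + eta (z - y)) / 2)).
Proof.
apply: measurable_funM; first exact: measurable_kfar.
exact: (measurable_sect1 (f := fun z y : V => (eta (z + y) + eta (z - y)) / 2) mavg z).
Qed.

Section slice.
Variable w : V -> R.
Hypothesis mw : measurable_fun setT w.
Hypothesis w_lty : (\int[mu]_z (`|w z| * W z)%:E < +oo)%E.

Lemma integrable_slice (f : V -> R) (A : R) : measurable_fun setT f -> 0 <= A ->
  (forall z, `|f z| <= A * W z) -> mu.-integrable setT (EFin \o (fun z => w z * f z)).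
Proof.
move=> mf A0 fA.
have mnw : measurable_fun setT (fun z => `|w z|) by exact: measurableT_comp.
apply: (@integrable_dominated _ _ _ _ _ (fun z => A * (`|w z| * W z))).
- exact: measurable_funM.
- by apply: measurable_funM => //; exact: measurable_funM.
- by move=> z; rewrite normrM mulrCA; exact: ler_wpM2l.
- rewrite ge0_integralZl_real//; first by rewrite lte_mul_pinfty// lee_fin.
    exact: measurable_funM.
  by move=> z; rewrite mulr_ge0.
Qed.

Let v (y : V) : R := \int[mu]_z (w z * eta (z + y)).

Variable del : R.
Hypotheses (del0 : 0 < del) (del1 : del <= 1).

(** Against a function of weighted finite mass, the damped operator amounts to an
    average over the large jumps, up to the truncation error. *)
Lemma damped_pairing_le :
  (`|\int[mu]_z (w z * (kfar_mass K del * eta z - nonlocal_op K eta z))|%:E <=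
   \int[mu]_y (kfar K del y * ((`|v y| + `|v (- y)|) / 2))%:E +
   (M * knear_mass K del)%:E * \int[mu]_z (`|w z| * \1_(eball c (rho + 1)) z)%:E)%E.
Proof.
have [A A0 HA] := far_average_le_weight del0 del1.
have [A2 A20 H2] := indic_eball_le_weight c (rho + 1).
have n0 : 0 <= knear_mass K del by apply: Rintegral_ge0 => y _; exact: knear_sqr_ge0.
have mfa := measurable_far_average del; have mnd := measurable_near_difference del.
have ifa : mu.-integrable setT (EFin \o (fun z => w z * far_average del z)).
  apply: (integrable_slice mfa A0) => z; rewrite ger0_norm; [exact: HA|exact: far_average_ge0].
have inda : mu.-integrable setT (EFin \o (fun z => w z * near_difference del z)).
  apply: (@integrable_slice _ (M * knear_mass K del * A2) mnd); first by rewrite !mulr_ge0.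
  move=> z; apply: (le_trans (near_difference_le del1 z)).
  by rewrite -[leRHS]mulrA; apply: ler_wpM2l; [exact: mulr_ge0|exact: H2].
have -> : \int[mu]_z (w z * (kfar_mass K del * eta z - nonlocal_op K eta z)) =
    \int[mu]_z (w z * far_average del z) - \int[mu]_z (w z * near_difference del z).
  rewrite -(RintegralB measurableT ifa inda); apply: eq_Rintegral => z _.
  by rewrite (nonlocal_op_split del0 del1); ring.
apply: (@le_trans _ (\bar R) (`|\int[mu]_z (w z * far_average del z)| +
   `|\int[mu]_z (w z * near_difference del z)|)%:E); first by rewrite lee_fin ler_normB.
rewrite EFinD; apply: leeD.
  pose f (z y : V) := w z * (kfar K del y * ((eta (z + y) + eta (z - y)) / 2)).
  have mf : measurable_fun setT (fun p : V * V => f p.1 p.2).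
    apply: measurable_funM; first by mfun.
    by apply: measurable_funM; [apply: (measurableT_comp (measurable_kfar mK del)); exact: measurable_snd|exact: mavg].
  have kf0 := kfar_ge0 K_ge0 del; have mkf := measurable_kfar mK del.
  have f_ge0 (z y : V) : 0 <= kfar K del y * ((eta (z + y) + eta (z - y)) / 2) by rewrite mulr_ge0.
  have foo : (\int[mu]_z \int[mu]_y `|f z y|%:E < +oo)%E.
    have mnw : measurable_fun setT (fun z => `|w z|) by exact: measurableT_comp.
    apply: (@le_lt_trans _ _ (\int[mu]_z (A * (`|w z| * W z))%:E)%E); last first.
      rewrite ge0_integralZl_real//; first by rewrite lte_mul_pinfty// lee_fin.
        exact: measurable_funM.
      by move=> z; rewrite mulr_ge0.
    apply: ge0_le_integral; first exact: measurableT.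
    - by move=> z _; apply: integral_ge0 => y _; rewrite lee_fin.
    - apply: (measurable_tonelli1 (fun z y : V => `|f z y|%:E)).
        by apply/measurable_EFinP; apply: measurableT_comp; [exact: normr_measurable|exact: mf].
      by move=> z y; rewrite lee_fin.
    - by apply/measurable_EFinP; apply: measurable_funM => //; exact: measurable_funM.
    - move=> z _; under eq_integral do rewrite /f normrM (ger0_norm (f_ge0 _ _)).
      rewrite ge0_integralZl_real; last 3 first.
      + exact: mfarz.
      + exact: f_ge0.
      + exact: normr_ge0.
      rewrite ge0_RintegralE; last 2 first.
      + exact: f_ge0.
      + apply: le_lt_trans (kfar_lty mK K_ge0 K_levy del0 del1).
        apply: ge0_le_integral_real; [exact: mfarz|exact: mkf|exact: f_ge0|].
        by move=> y; exact: (ler_piMr (kf0 y) (avg_le1 z y)).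
      by rewrite -EFinM lee_fin mulrCA; apply: ler_wpM2l => //; exact: HA.
  have sE z : w z * far_average del z = \int[mu]_y f z y.
    rewrite /far_average -(RintegralZl _ measurableT)//.
    apply: (integrable_dominated (mfarz del z) mkf _ (kfar_lty mK K_ge0 K_levy del0 del1)).
    by move=> y; rewrite (ger0_norm (f_ge0 z y)); exact: (ler_piMr (kf0 y) (avg_le1 z y)).
  have -> : \int[mu]_z (w z * far_average del z) = \int[mu]_z \int[mu]_y f z y.
    by apply: eq_Rintegral => z _; exact: sE.
  rewrite (Rintegral_fubini mf foo).
  have ig := integrable_Rintegral2 mf foo.
  have ieta (y : V) : mu.-integrable setT (EFin \o (fun z => w z * eta (z + y))).
    have [A' A'0 HA'] := indic_eball_le_weight (c - y) rho.
    apply: (integrable_slice _ A'0); first by mfun.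
    move=> z; rewrite ger0_norm//; apply: le_trans (HA' z).
    rewrite (_ : \1_(eball (c - y) rho) z = \1_(eball c rho) (z + y)).
      exact: profile_le_indic.
    rewrite !indicE; congr ((_ : bool)%:R); apply/idP/idP; rewrite !inE /eball /=.
      by rewrite (_ : z - (c - y) = z + y - c)//; rVring.
    by rewrite (_ : z - (c - y) = z + y - c)//; rVring.
  have vE y : \int[mu]_z f z y = kfar K del y * ((v y + v (- y)) / 2).
    have i2 := integrableD measurableT (ieta y) (ieta (- y)).
    rewrite /v -(RintegralD measurableT (ieta y) (ieta (- y))) mulrA mulrAC.
    rewrite -(RintegralZl _ measurableT i2); apply: eq_Rintegral => z _; rewrite /f /=; ring.
  have mv : measurable_fun setT v.
    apply: (measurable_Rintegral mu (f := fun y z => w z * eta (z + y))).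
    by apply: measurable_funM; mfun.
  apply: (@le_trans _ (\bar R) (\int[mu]_y `|\int[mu]_z f z y|)%:E).
    by rewrite lee_fin; exact: le_normr_Rintegral.
  rewrite -ge0_RintegralE; [|by move=> y; exact: normr_ge0|by move/integrableP : ig => []].
  apply: ge0_le_integral_real.
  - by apply: measurableT_comp; [exact: normr_measurable|apply/measurable_EFinP; exact: measurable_int ig].
  - apply: measurable_funM => //; apply: measurable_funM => //.
    by apply: measurable_funD; apply: measurableT_comp => //; mfun.
  - by move=> y; exact: normr_ge0.
  - move=> y; rewrite vE normrM (ger0_norm (kf0 y)); apply: ler_wpM2l => //.
    rewrite normrM (ger0_norm (x := 2^-1)) ?invr_ge0//; apply: ler_wpM2r; first by rewrite invr_ge0.
    exact: ler_normD.
have mI := @measurable_eball_indic R d c (rho + 1).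
have mnw : measurable_fun setT (fun z => `|w z|) by exact: measurableT_comp.
apply: (@le_trans _ (\bar R) (\int[mu]_z `|w z * near_difference del z|)%:E).
  by rewrite lee_fin; exact: le_normr_Rintegral.
rewrite -ge0_RintegralE; [|by move=> y; exact: normr_ge0|by move/integrableP : inda => []].
rewrite -ge0_integralZl_real; last 3 first.
- exact: measurable_funM.
- by move=> z; rewrite mulr_ge0// indicE.
- exact: mulr_ge0.
apply: ge0_le_integral_real.
- apply: measurableT_comp => //; exact: measurable_funM.
- by apply: measurable_funM => //; exact: measurable_funM.
- by move=> z; exact: normr_ge0.
- move=> z; rewrite normrM mulrCA; apply: ler_wpM2l => //; exact: near_difference_le.
Qed.

End slice.

End profile.

(** * Integration of the weak equation in time *)

Section time_integration.
Context {R : realType}.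
Local Notation TR := (measurableTypeR R).
Local Notation leb := (@lebesgue_measure R).

Lemma measurable_expRM (a : R) : measurable_fun [set: TR] (fun s : TR => expR (a * s)).
Proof.
apply: (measurableT_comp (continuous_measurable_fun (@continuous_expR R))).
exact: measurable_funM (measurable_cst _) (@measurable_id _ _ _).
Qed.

Let measurable_of_is_derive (f g : R -> R) : (forall s : R, is_derive s 1 f (g s)) ->
  measurable_fun [set: TR] (f : TR -> R).
Proof.
move=> df; apply: continuous_measurable_fun => s; apply: differentiable_continuous.
by apply/derivable1_diffP; exact: (@ex_derive _ _ _ _ _ _ _ (df s)).
Qed.

Lemma measurable_cutoff (lam n b : R) : measurable_fun [set: TR] (cutoff lam n b : TR -> R).
Proof. exact: (measurable_of_is_derive (is_derive_cutoff lam n b)). Qed.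

Lemma measurable_cutoff_deriv (lam n b : R) :
  measurable_fun [set: TR] (cutoff_deriv lam n b : TR -> R).
Proof.
have mflat (r : {poly R}) : measurable_fun [set: TR] (fun s : TR => flat r (n * (b - s))).
  apply: (measurableT_comp (f := flat r) (measurable_of_is_derive (is_derive_flat r))).
  apply: measurable_funM; first exact: measurable_cst.
  by apply: measurable_funB; [exact: measurable_cst|exact: measurable_id].
apply: measurable_funB; first by apply: measurable_funM; [exact: measurable_cst|exact: measurable_cutoff].
by apply: measurable_funM; [exact: measurable_expRM|apply: measurable_funD; exact: mflat].
Qed.

(** The indicator of [s <= b] as a number; written symmetrically in the two times
    so that it serves as a kernel in iterated integrals. *)
Definition upto (b s : R) : R := (s <= b)%R%:R.

Let uptoE b s : upto b s = \1_(`]-oo, b]%classic : set R) s.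
Proof.
rewrite /upto indicE; congr (nat_of_bool _)%:R; apply/idP/idP; rewrite inE /= in_itv/=; exact.
Qed.

Lemma measurable_upto (b : R) : measurable_fun [set: TR] (upto b : TR -> R).
Proof.
rewrite (_ : upto b = \1_(`]-oo, b]%classic : set R)); last by apply/funext => s; exact: uptoE.
by apply: measurable_indic; exact: measurable_itv.
Qed.

Lemma measurable_upto2 : measurable_fun [set: TR * TR] (fun p : TR * TR => upto p.1 p.2).
Proof.
rewrite (_ : (fun p => _) = \1_([set p : TR * TR | p.2 <= p.1])); last first.
  apply/funext => p; rewrite /upto indicE; congr (nat_of_bool _)%:R.
  by apply/idP/idP; rewrite inE.
apply: measurable_indic; rewrite -[X in measurable X]setTI.
apply: (@measurable_fun_ler _ _ _ setT (fun p : TR * TR => p.2 : R) (fun p => p.1 : R)) => //.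
  exact: measurable_snd.
exact: measurable_fst.
Qed.

Lemma upto01 b s : 0 <= upto b s <= 1.
Proof. by rewrite /upto; case: (s <= b); rewrite ?lexx ler01. Qed.

Lemma Rintegral_upto (f : R -> R) (b : R) :
  \int[leb]_(s in `]-oo, b]) f s = \int[leb]_s (f s * upto b s).
Proof.
rewrite /Rintegral; congr fine; rewrite [LHS]integral_mkcond; apply: eq_integral => s _.
rewrite patchE uptoE indicE; case: (s \in _); by rewrite ?mulr1 ?mulr0.
Qed.

Lemma integral_upto_itv (s b : R) : s <= b ->
  (\int[leb]_t (upto b t * upto t s)%:E = (b - s)%:E)%E.
Proof.
move=> sb.
have mI : measurable (`[s, b]%classic : set TR) by exact: measurable_itv.
rewrite (eq_integral (fun t : TR => (\1_(`[s, b]%classic : set R) t)%:E)); last first.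
  move=> t _; rewrite /upto indicE -natrM mulnb; congr (nat_of_bool _)%:R%:E.
  by apply/idP/idP; rewrite inE /= in_itv/= andbC.
rewrite integral_indic// setIT.
have E : leb (`[s, b]%classic : set R) = (b - s)%:E.
  by rewrite lebesgue_measure_itv/= lte_fin; case: ltgtP sb => // -> _; rewrite subrr.
exact: E.
Qed.

(** Lebesgue differentiation of the primitive. *)
Lemma eq0_of_integral_upto (g : TR -> R) (S : R) : leb.-integrable setT (EFin \o g) ->
  (forall b, 0 < b < S -> \int[leb]_s (g s * upto b s) = 0) ->
  {ae leb, forall s, 0 < s < S -> g s = 0}.
Proof.
move=> ig H.
have ib y : leb.-integrable `]-oo, y] (EFin \o g).
  by apply: integrableS ig => //; exact: measurable_itv.
have loc : locally_integrable [set: R] g.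
  by apply: open_integrable_locally ig; exact: openT.
have := FTC1Ny ib loc; apply: filterS; first exact: (ae_filter_ringOfSetsType leb).
move=> s [dF <-] s0S.
rewrite derive1E.
have E : \forall x \near s, (fun x => \int[leb]_(t in `]-oo, x]) g t) x = cst 0 x.
  move/andP: s0S => [s0 sS]; near=> x; rewrite Rintegral_upto H//.
  have h1 : 0 < x by near: x; exact: lt_nbhsr.
  have h2 : x < S by near: x; exact: lt_nbhsl.
  by rewrite h1 h2.
by rewrite (near_eq_derive _ E) derive_cst.
Unshelve. all: by end_near. Qed.

Section identity.
Variables (lam S : R) (f h : TR -> R).
Hypothesis if_ : leb.-integrable setT (EFin \o f).
Hypothesis ih : leb.-integrable setT (EFin \o h).
Hypothesis f_out : forall s : TR, ~~ (0 < s < S) -> f s = 0.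
Hypothesis h_out : forall s : TR, ~~ (0 < s < S) -> h s = 0.
Hypothesis weak : forall (b : R) (n : nat), 0 < b < S ->
  \int[leb]_s (cutoff_deriv lam n.+1%:R b s * f s - cutoff lam n.+1%:R b s * h s) = 0.

Let p (s : TR) : R := expR (lam * s) * f s.
Let q (s : TR) : R := expR (lam * s) * (lam * f s - h s).

Let mf : measurable_fun setT f. Proof. by apply/measurable_EFinP; exact: measurable_int if_. Qed.
Let mh : measurable_fun setT h. Proof. by apply/measurable_EFinP; exact: measurable_int ih. Qed.

Let mexp := measurable_expRM lam.

Let exp_le (u : TR -> R) s : (forall s : TR, ~~ (0 < s < S) -> u s = 0) ->
  `|expR (lam * s) * u s| <= expR (`|lam| * S) * `|u s|.
Proof.
move=> u0; have [sI|sI] := boolP (0 < s < S); last by rewrite u0// normr0 !mulr0 normr0.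
have /andP[s0 sS] := sI; rewrite normrM (ger0_norm (expR_ge0 _)); apply: ler_wpM2r => //.
rewrite ler_expR; apply: (le_trans (ler_norm _)); rewrite normrM (gtr0_norm s0).
by apply: ler_wpM2l => //; exact: ltW.
Qed.

Let iexp (u : TR -> R) : (forall s : TR, ~~ (0 < s < S) -> u s = 0) ->
  leb.-integrable setT (EFin \o u) -> leb.-integrable setT (EFin \o (fun s => expR (lam * s) * u s)).
Proof.
move=> u0 iu; have mu' : measurable_fun setT u by apply/measurable_EFinP; exact: measurable_int iu.
have mnu : measurable_fun setT (fun s => `|u s|) by exact: measurableT_comp.
apply: (@integrable_dominated _ _ _ _ _ (fun s => expR (`|lam| * S) * `|u s|)).
- exact: measurable_funM.
- exact: measurable_funM.
- by move=> s; exact: exp_le.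
- rewrite ge0_integralZl_real// ?expR_ge0//.
  by move/integrableP : iu => [_ iu]; rewrite lte_mul_pinfty// lee_fin expR_ge0.
Qed.

Let ip : leb.-integrable setT (EFin \o p). Proof. exact: iexp. Qed.

Let iq : leb.-integrable setT (EFin \o q).
Proof.
apply: iexp; last exact: (integrableB measurableT (integrableZl measurableT lam if_) ih).
by move=> s sI; rewrite f_out// h_out// mulr0 subr0.
Qed.

Let mq : measurable_fun setT q. Proof. by apply/measurable_EFinP; exact: measurable_int iq. Qed.
Let mp : measurable_fun setT p. Proof. by apply/measurable_EFinP; exact: measurable_int ip. Qed.

Let q_out s : s <= 0 -> q s = 0.
Proof. by move=> s0; rewrite /q f_out ?h_out ?mulr0 ?subr0 ?mulr0// negb_and -leNgt s0. Qed.

Let primitive_q (t : TR) : R := \int[leb]_s (q s * upto t s).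

(* Integrating [primitive_q] up to [b] and exchanging the integrals gives the weight
   [max (b - s) 0], which is the one produced by the limit of the cutoffs. *)
Let Fq (b : R) (t s : TR) : R := upto b t * (q s * upto t s).

Let mFq b : measurable_fun setT (fun z : TR * TR => Fq b z.1 z.2).
Proof.
apply: measurable_funM.
  exact: (measurableT_comp (measurable_upto b) measurable_fst).
apply: measurable_funM; last exact: measurable_upto2.
exact: (measurableT_comp mq measurable_snd).
Qed.

Let Fq_lty b : (\int[leb]_t \int[leb]_s `|Fq b t s|%:E < +oo)%E.
Proof.
rewrite (tonelli (fun t s => `|Fq b t s|%:E)); last 2 first.
- by apply/measurable_EFinP; apply: measurableT_comp; [exact: normr_measurable|exact: mFq].
- by move=> t s; rewrite lee_fin.
apply: (@le_lt_trans _ _ (\int[leb]_s (`|b| * `|q s|)%:E)%E); last first.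
  move/integrableP : iq => [_ iq']; rewrite ge0_integralZl_real//.
    by rewrite lte_mul_pinfty// lee_fin.
  exact: measurableT_comp.
apply: ge0_le_integral => //.
- by move=> s _; apply: integral_ge0 => t _; rewrite lee_fin.
- apply: (measurable_tonelli2 (fun t s => `|Fq b t s|%:E)).
    by apply/measurable_EFinP; apply: measurableT_comp; [exact: normr_measurable|exact: mFq].
  by move=> t s; rewrite lee_fin.
- by apply/measurable_EFinP; apply: measurable_funM => //; exact: measurableT_comp.
- move=> s _.
  have E t : `|Fq b t s| = `|q s| * (upto b t * upto t s).
    have /andP[u0 _] := upto01 b t; have /andP[v0 _] := upto01 t s.
    by rewrite /Fq !normrM (ger0_norm u0) (ger0_norm v0); ring.
  under eq_integral do rewrite E.
  have m1 : measurable_fun setT (fun t : TR => upto b t * upto t s).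
    apply: measurable_funM; first exact: measurable_upto.
    exact: (measurable_sect2 (f := fun t s : TR => upto t s) measurable_upto2).
  rewrite ge0_integralZl_real//; last first.
    move=> t; have /andP[u0 _] := upto01 b t; have /andP[v0 _] := upto01 t s.
    exact: mulr_ge0.
  have [s0|s0] := leP s 0; first by rewrite q_out// normr0 mul0e mulr0.
  rewrite mulrC EFinM; apply: lee_wpmul2l => //.
  have [sb|bs] := leP s b.
    by rewrite integral_upto_itv// lee_fin; have := ler_norm b; lra.
  rewrite integral0_eq => [|t _]; first by rewrite lee_fin.
  rewrite /upto; case: leP => [tb|]; rewrite ?mul0r// leNgt (le_lt_trans tb bs)/= mulr0//.
Qed.

Let iupto (u : TR -> R) (b : R) : leb.-integrable setT (EFin \o u) ->
  leb.-integrable setT (EFin \o (fun s => u s * upto b s)).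
Proof.
move=> iu; have mu' : measurable_fun setT u by apply/measurable_EFinP; exact: measurable_int iu.
apply: (@integrable_dominated _ _ _ _ _ (fun s => `|u s|)).
- by apply: measurable_funM => //; exact: measurable_upto.
- exact: measurableT_comp.
- move=> s; have /andP[v0 v1] := upto01 b s.
  by rewrite normrM (ger0_norm v0); apply: ler_piMr.
- by move/integrableP : iu => [_].
Qed.

Let primitiveE b t : primitive_q t * upto b t = \int[leb]_s Fq b t s.
Proof. by rewrite /primitive_q mulrC -(RintegralZl _ measurableT (iupto t iq)). Qed.

Let iterated b : \int[leb]_t (primitive_q t * upto b t) = \int[leb]_s (q s * Num.max (b - s) 0).
Proof.
transitivity (\int[leb]_t \int[leb]_s Fq b t s); first by apply: eq_Rintegral => t _; exact: primitiveE.
rewrite (Rintegral_fubini (mFq b) (Fq_lty b)); apply: eq_Rintegral => s _.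
have m1 : measurable_fun setT (fun t : TR => upto b t * upto t s).
  apply: measurable_funM; first exact: measurable_upto.
  exact: (measurable_sect2 (f := fun t s : TR => upto t s) measurable_upto2).
have u0 t : 0 <= upto b t * upto t s.
  by have /andP[? _] := upto01 b t; have /andP[? _] := upto01 t s; exact: mulr_ge0.
have uE : (\int[leb]_t (upto b t * upto t s)%:E = (Num.max (b - s) 0)%:E)%E.
  have [sb|bs] := leP s b; first by rewrite integral_upto_itv// max_l// subr_ge0.
  rewrite max_r; last by rewrite subr_le0 ltW.
  rewrite integral0_eq// => t _; rewrite /upto.
  by case: leP => [tb|]; rewrite ?mul0r// leNgt (le_lt_trans tb bs)/= mulr0.
have iu : leb.-integrable setT (EFin \o (fun t => upto b t * upto t s)).
  by apply: integrable_ge0 => //; rewrite uE ltry.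
transitivity (\int[leb]_t (q s * (upto b t * upto t s))).
  by apply: eq_Rintegral => t _; rewrite /Fq mulrCA.
by rewrite (RintegralZl _ measurableT iu) /Rintegral uE.
Qed.

Let limit_identity b : 0 < b < S ->
  \int[leb]_s (p s * upto b s) = \int[leb]_s (q s * Num.max (b - s) 0).
Proof.
move=> bI; have /andP[b0 bS] := bI.
have [C C0 HC] := cutoff_bound lam b.
pose F n (s : TR) : R := cutoff_deriv lam n.+1%:R b s * f s - cutoff lam n.+1%:R b s * h s.
pose L (s : TR) : R := q s * Num.max (b - s) 0 - p s * upto b s.
have mFn n : measurable_fun setT (F n).
  apply: measurable_funB; apply: measurable_funM => //; first exact: measurable_cutoff_deriv.
  exact: measurable_cutoff.
have mD : measurable_fun setT (fun s => C * (`|f s| + `|h s|)).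
  by apply: measurable_funM => //; apply: measurable_funD; exact: measurableT_comp.
have dom n s : `|F n s| <= C * (`|f s| + `|h s|).
  rewrite mulrDr /F; have [sI|sI] := boolP (0 < s < S); last first.
    by rewrite f_out// h_out// !mulr0 subr0 normr0 mulr0 addr0.
  have /andP[s0 sS] := sI; apply: (le_trans (ler_normB _ _)).
  rewrite (normrM (cutoff_deriv _ _ _ _)) (normrM (cutoff _ _ _ _)).
  have [sb|bs] := leP s b.
    by have [h1 h2] := HC n.+1%:R s (ltW s0) sb; apply: lerD; apply: ler_wpM2r.
  rewrite cutoff_out ?cutoff_deriv_out ?(ltW bs)// normr0 !mul0r addr0.
  by rewrite addr_ge0// mulr_ge0.
have D_lty : (\int[leb]_s (C * (`|f s| + `|h s|))%:E < +oo)%E.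
  rewrite ge0_integralZl_real//; last by apply: measurable_funD; exact: measurableT_comp.
  rewrite lte_mul_pinfty// ge0_integralD_real//; last 2 first.
  - exact: measurableT_comp.
  - exact: measurableT_comp.
  by move/integrableP : if_ => [_ ?]; move/integrableP : ih => [_ ?]; exact: lte_add_pinfty.
have iD : leb.-integrable setT (EFin \o (fun s => C * (`|f s| + `|h s|))).
  by apply: integrable_ge0 => // s; rewrite mulr_ge0// addr_ge0.
have iF n : leb.-integrable setT (EFin \o F n).
  exact: (integrable_dominated (mFn n) mD (dom n) D_lty).
have mL : measurable_fun setT L.
  apply: measurable_funB; apply: measurable_funM => //; last exact: measurable_upto.
  apply: measurable_maxr; last exact: measurable_cst.
  by apply: measurable_funB; [exact: measurable_cst|exact: measurable_id].
have neb : {ae leb, forall s : TR, s != b}.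
  exists [set b]; split => //; first exact: lebesgue_measure_set1.
  by move=> s /= /negP; rewrite negbK => /eqP.
have cF : {ae leb, forall s : TR, setT s -> (F n s)%:E @[n --> \oo] --> (L s)%:E}.
  suff cF' : forall s : TR, s != b -> (F n s)%:E @[n --> \oo] --> (L s)%:E.
    by case: neb => A [mA A0 sA]; exists A; split=> // s /= ns; apply: sA => /= sb; apply: ns => _; exact: cF'.
  move=> s sb; have [sI|sI] := boolP (0 < s < S); last first.
    have -> : (fun n => (F n s)%:E) = fun=> (L s)%:E.
      by apply/funext => n; rewrite /F /L /q /p f_out// h_out// !(mulr0, mul0r, subr0).
    exact: cvg_cst.
  case: (ltgtP s b) sb => // [sb _|bs _]; last first.
    have -> : (fun n => (F n s)%:E) = fun=> (L s)%:E.
      apply/funext => n; rewrite /F /L /upto leNgt bs max_r ?subr_le0 ?(ltW bs)//.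
      by rewrite cutoff_out ?cutoff_deriv_out ?(ltW bs)// !(mulr0, mul0r, subr0).
    exact: cvg_cst.
  apply: cvg_EFin; first exact: nearW.
  rewrite /F /L /upto (ltW sb) max_l ?subr_ge0 ?(ltW sb)// mulr1.
  have -> : q s * (b - s) - p s =
      (lam * (expR (lam * s) * (b - s)) - expR (lam * s)) * f s - expR (lam * s) * (b - s) * h s.
    by rewrite /q /p; ring.
  apply: cvgB; apply: cvgM; try exact: cvg_cst.
    exact: cutoff_deriv_cvg.
  exact: cutoff_cvg.
have df : {ae leb, forall s n, setT s -> (`|(F n s)%:E| <= (C * (`|f s| + `|h s|))%:E)%E}.
  by apply: aeW => s n _; rewrite lee_fin; exact: dom.
have mF' n : measurable_fun setT (fun s => (F n s)%:E) by exact/measurable_EFinP.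
have mL' : measurable_fun setT (fun s => (L s)%:E) by exact/measurable_EFinP.
have [iL _ H] := @dominated_convergence _ _ _ leb setT measurableT _ _ _ mF' mL' cF iD df.
have L0 : \int[leb]_s L s = 0.
  rewrite /Rintegral; suff -> : (\int[leb]_s (L s)%:E = 0)%E by [].
  rewrite (_ : (fun n => _) = fun=> 0%E) in H; last first.
    apply/funext => n; rewrite -[LHS]fineK; last exact: (integrable_fin_num measurableT (iF n)).
    by congr EFin; exact: weak.
  by apply/esym; apply: (cvg_unique _ (@cvg_cst _ _ _ _ _) H).
have i1 : leb.-integrable setT (EFin \o (fun s => q s * Num.max (b - s) 0)).
  apply: eq_integrable (integrableD measurableT iL (iupto b ip)) => // s _ /=.
  by rewrite /L -EFinD subrK.
move: L0; rewrite (RintegralB measurableT i1 (iupto b ip)) => /eqP.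
by rewrite subr_eq0 => /eqP.
Qed.

(** The cutoffs tend to [exp (lam s) (b - s)] on [s < b].  In the limit the integral
    of [exp (lam s) f s] up to [b] is an iterated integral up to [b] of the other
    term, for every [b]; Lebesgue differentiation recovers the integrands. *)
Lemma exp_primitive : {ae leb, forall s : TR, 0 < s < S ->
  expR (lam * s) * f s = \int[leb]_t (expR (lam * t) * (lam * f t - h t) * upto s t)}.
Proof.
pose g (t : TR) : R := p t - primitive_q t * upto S t.
have iS : leb.-integrable setT (EFin \o (fun t => primitive_q t * upto S t)).
  apply: eq_integrable (integrable_Rintegral1 (mFq S) (Fq_lty S)) => // t _ /=.
  by rewrite primitiveE.
have ig : leb.-integrable setT (EFin \o g) by exact: (integrableB measurableT ip iS).
suff H : forall b, 0 < b < S -> \int[leb]_s (g s * upto b s) = 0.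
  have := eq0_of_integral_upto ig H; apply: filterS; first exact: (ae_filter_ringOfSetsType leb).
  move=> s Hs sI; have /andP[s0 sS] := sI.
  by have := Hs sI; rewrite /g /upto (ltW sS) mulr1 => /eqP; rewrite subr_eq0 => /eqP.
move=> b bI; have /andP[b0 bS] := bI.
have iSb : leb.-integrable setT (EFin \o (fun t => primitive_q t * upto b t)).
  apply: eq_integrable (integrable_Rintegral1 (mFq b) (Fq_lty b)) => // t _ /=.
  by rewrite primitiveE.
transitivity (\int[leb]_s (p s * upto b s - primitive_q s * upto b s)).
  apply: eq_Rintegral => s _; rewrite /g mulrBl.
  suff -> : primitive_q s * upto S s * upto b s = primitive_q s * upto b s by [].
  rewrite /upto; case: (leP s b) => sb; last by rewrite !mulr0.
  by rewrite (le_trans sb (ltW bS)) !mulr1.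
by rewrite (RintegralB measurableT (iupto b ip) iSb) (limit_identity bI) iterated subrr.
Qed.

End identity.

End time_integration.

Section damped_time.
Context {R : realType}.
Local Notation TR := (measurableTypeR R).
Local Notation leb := (@lebesgue_measure R).

Lemma upto_le (b s : R) : s <= b -> upto b s = 1.
Proof. by rewrite /upto => ->. Qed.

Lemma upto_gt (b s : R) : b < s -> upto b s = 0.
Proof. by rewrite /upto leNgt => ->. Qed.

Lemma exp_tail_le (a t S : R) : 0 < a ->
  (\int[leb]_s (expR (- a * s) * (upto S s * upto s t))%:E <= (a^-1 * expR (- a * t))%:E)%E.
Proof.
move=> a0; have [tS|St] := ltP t S; last first.
  have neb : {ae leb, forall s : TR, s != S}.
    exists [set S]; split => //; first exact: lebesgue_measure_set1.
    by move=> s /= /negP; rewrite negbK => /eqP.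
  rewrite (_ : (\int[leb]_s _ = 0)%E).
    by rewrite lee_fin mulr_ge0 ?expR_ge0// invr_ge0 ltW.
  rewrite (ae_eq_integral (cst 0%E)) ?integral_cst ?mul0e//.
  - apply/measurable_EFinP; apply: measurable_funM; first exact: measurable_expRM.
    apply: measurable_funM; first exact: measurable_upto.
    exact: (measurable_sect2 (f := fun s t : TR => upto s t) measurable_upto2 t).
  - case: neb => A [mA A0 sA]; exists A; split=> // s /= ns; apply: sA => /= sb; apply: ns => _.
    rewrite /upto; case: (leP s S) => [sS|]; last by rewrite mul0r mulr0.
    case: (leP t s) => [ts|]; last by rewrite !mulr0.
    by move: sb; rewrite eq_le sS (le_trans St ts).
pose F (s : R) := - a^-1 * expR (- a * s).
have dF (s : R) : is_derive s 1 F (expR (- a * s)).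
  have d1 : is_derive s 1 (fun s : R => - a * s) (- a).
    by apply: is_derive_eq; rewrite /GRing.scale/=; ring.
  have d2 : is_derive s 1 (fun s : R => expR (- a * s)) (expR (- a * s) * - a).
    by apply: (@is_derive1_comp _ expR (fun s : R => - a * s)).
  by apply: is_derive_eq; rewrite /GRing.scale/=; field; rewrite gt_eqF.
have ce : continuous (fun s : R => expR (- a * s)).
  move=> s; apply: (continuous_comp (f := fun s : R => - a * s)); last exact: continuous_expR.
  by apply: cvgM; [exact: cvg_cst|exact: cvg_id].
have := integral_is_derive tS ce dF.
rewrite integral_mkcond => E.
have -> : (\int[leb]_s (expR (- a * s) * (upto S s * upto s t))%:E = (F S - F t)%:E)%E.
  rewrite -E; apply: eq_integral.
  move=> s _; rewrite patchE /upto; case: ifPn.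
    by rewrite inE /= in_itv/= => /andP[-> ->]; rewrite !mulr1.
  move=> /negP; rewrite inE /= in_itv/= => /negP; rewrite negb_and => /orP[] /negbTE ->;
    by rewrite ?mul0r ?mulr0.
rewrite lee_fin /F.
have h1 := expR_ge0 (- a * S); have h2 : 0 < a^-1 by rewrite invr_gt0.
have := mulr_ge0 (ltW h2) h1; lra.
Qed.

(** Damping in time at a rate exceeding the loss rate turns the evolution
    identity into a stationary inequality. *)
Lemma damped_time_le (lam c S : R) (f h : TR -> R) : 0 <= lam -> 0 < c ->
  leb.-integrable setT (EFin \o f) -> leb.-integrable setT (EFin \o h) ->
  (forall s : TR, ~~ (0 < s < S) -> f s = 0) -> (forall s : TR, ~~ (0 < s < S) -> h s = 0) ->
  (forall (b : R) (n : nat), 0 < b < S ->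
    \int[leb]_s (cutoff_deriv lam n.+1%:R b s * f s - cutoff lam n.+1%:R b s * h s) = 0) ->
  ((lam + c)%:E * \int[leb]_s (expR (- c * s) * `|f s|)%:E <=
   \int[leb]_t (expR (- c * t) * `|lam * f t - h t|)%:E)%E.
Proof.
move=> lam0 c0 if_ ih f_out h_out weak.
have a0 : 0 < lam + c by lra.
have mf : measurable_fun setT f by apply/measurable_EFinP; exact: measurable_int if_.
have mh : measurable_fun setT h by apply/measurable_EFinP; exact: measurable_int ih.
have mnf : measurable_fun setT (fun s => `|f s|) by exact: measurableT_comp.
pose q (t : TR) : R := expR (lam * t) * `|lam * f t - h t|.
have q_ge0 t : 0 <= q t by rewrite mulr_ge0 ?expR_ge0.
have mq : measurable_fun setT q.
  apply: measurable_funM; first exact: measurable_expRM.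
  by apply: measurableT_comp => //; apply: measurable_funB => //; exact: measurable_funM.
pose k (s t : TR) : R := expR (- (lam + c) * s) * (upto S s * upto s t).
have k_ge0 s t : 0 <= k s t.
  have /andP[? _] := upto01 S s; have /andP[? _] := upto01 s t.
  by rewrite mulr_ge0 ?expR_ge0// mulr_ge0.
have mk : measurable_fun setT (fun p : TR * TR => k p.1 p.2).
  apply: measurable_funM.
    exact: (measurableT_comp (measurable_expRM _) measurable_fst).
  apply: measurable_funM; last exact: measurable_upto2.
  exact: (measurableT_comp (measurable_upto S) measurable_fst).
have mkq : measurable_fun setT (fun p : TR * TR => k p.1 p.2 * q p.2).
  by apply: measurable_funM => //; exact: (measurableT_comp mq measurable_snd).
have mkqE : measurable_fun setT (fun p : TR * TR => (k p.1 p.2 * q p.2)%:E).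
  by apply/measurable_EFinP.
have kq0 s t : (0 <= (k s t * q t)%:E)%E by rewrite lee_fin mulr_ge0.
have step1 : (\int[leb]_s (expR (- c * s) * `|f s|)%:E <=
    \int[leb]_s \int[leb]_t (k s t * q t)%:E)%E.
  apply: ae_ge0_le_integral.
  - exact: measurableT.
  - by move=> s _; rewrite lee_fin mulr_ge0 ?expR_ge0.
  - by apply/measurable_EFinP; apply: measurable_funM => //; exact: measurable_expRM.
  - by move=> s _; apply: integral_ge0 => t _; exact: kq0.
  - exact: (measurable_tonelli1 (fun s t => (k s t * q t)%:E)).
  have := @exp_primitive R lam S f h if_ ih f_out h_out weak.
  suff H (s : TR) : (0 < s < S -> expR (lam * s) * f s =
      \int[leb]_t (expR (lam * t) * (lam * f t - h t) * upto s t)) ->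
      ((expR (- c * s) * `|f s|)%:E <= \int[leb]_t (k s t * q t)%:E)%E.
    by move=> [A [mA A0 sA]]; exists A; split=> // s /= ns; apply: sA => /= Hs; apply: ns => _; exact: H.
  have [sI Hs|sI _] := boolP (0 < s < S); last first.
    by rewrite f_out// normr0 mulr0; apply: integral_ge0 => t _; exact: kq0.
  have /andP[s0 sS] := sI.
  have mqs : measurable_fun setT (fun t : TR => q t * upto s t).
    apply: measurable_funM => //; exact: measurable_upto.
  have u0 t := (andP (upto01 s t)).1.
  have uS : upto S s = 1 by rewrite /upto (ltW sS).
  rewrite (eq_integral (fun t : TR => (expR (- (lam + c) * s) * (q t * upto s t))%:E)); last first.
    by move=> t _; rewrite /k uS mul1r -mulrA [q t * _]mulrC.
  rewrite ge0_integralZl_real ?expR_ge0//; last by move=> t; rewrite mulr_ge0// u0.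
  have -> : expR (- c * s) * `|f s| = expR (- (lam + c) * s) * `|expR (lam * s) * f s|.
    by rewrite normrM (ger0_norm (expR_ge0 _)) mulrA -expRD; congr (expR _ * _); ring.
  rewrite EFinM; apply: lee_wpmul2l; first by rewrite lee_fin expR_ge0.
  rewrite (Hs isT).
  have iqs : leb.-integrable setT (EFin \o (fun t : TR => expR (lam * t) * (lam * f t - h t) * upto s t)).
    have mn : measurable_fun setT (fun t => lam * f t - h t).
      by apply: measurable_funB => //; exact: measurable_funM.
    apply: (@integrable_dominated _ _ _ _ _ (fun t : TR => expR (lam * s) * (`|lam| * `|f t| + `|h t|))).
    - apply: measurable_funM; last exact: measurable_upto.
      by apply: measurable_funM => //; exact: measurable_expRM.
    - apply: measurable_funM => //; apply: measurable_funD; first by apply: measurable_funM.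
      exact: measurableT_comp.
    - move=> t; have [ts|st] := leP t s; last first.
        by rewrite upto_gt// mulr0 normr0 !(mulr_ge0, addr_ge0, expR_ge0).
      rewrite upto_le// mulr1 normrM (ger0_norm (expR_ge0 _)).
      apply: ler_pM; [exact: expR_ge0|exact: normr_ge0|by rewrite ler_expR; exact: ler_wpM2l|].
      by apply: (le_trans (ler_normB _ _)); rewrite normrM.
    - have mnh : measurable_fun setT (fun s => `|h s|) by exact: measurableT_comp.
      rewrite ge0_integralZl_real ?expR_ge0//; last first.
        by apply: measurable_funD => //; exact: measurable_funM.
      rewrite lte_mul_pinfty ?lee_fin ?expR_ge0// ge0_integralD_real//; last exact: measurable_funM.
      move/integrableP : if_ => [_ f_lty]; move/integrableP : ih => [_ h_lty].
      apply: lte_add_pinfty => //; rewrite ge0_integralZl_real//.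
      by rewrite lte_mul_pinfty// lee_fin.
  apply: (@le_trans _ (\bar R) (\int[leb]_t `|expR (lam * t) * (lam * f t - h t) * upto s t|)%:E).
    by rewrite lee_fin; exact: (le_normr_Rintegral measurableT iqs).
  rewrite -ge0_RintegralE; [|by move=> y; exact: normr_ge0|by move/integrableP : iqs => []].
  apply: ge0_le_integral_real => //.
  - by apply: measurableT_comp => //; apply/measurable_EFinP; exact: measurable_int iqs.
  - by move=> t; rewrite !normrM (ger0_norm (expR_ge0 _)) (ger0_norm (u0 t)).
apply: (@le_trans _ _ ((lam + c)%:E * \int[leb]_s \int[leb]_t (k s t * q t)%:E)%E).
  by apply: lee_wpmul2l => //; rewrite lee_fin ltW.
rewrite (tonelli (fun s t => (k s t * q t)%:E))//.
have mk2 t : measurable_fun setT (k ^~ t) := measurable_sect2 (f := k) mk t.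
rewrite -ge0_integralZl//; last 3 first.
- by apply: (measurable_tonelli2 (fun s t => (k s t * q t)%:E)).
- by move=> t _; apply: integral_ge0 => s _; exact: kq0.
- by rewrite lee_fin ltW.
apply: ge0_le_integral.
- exact: measurableT.
- move=> t _; apply: mule_ge0; first by rewrite lee_fin ltW.
  by apply: integral_ge0 => s _; exact: kq0.
- apply: measurable_funeM.
  by apply: (measurable_tonelli2 (fun s t => (k s t * q t)%:E)).
- apply/measurable_EFinP; apply: measurable_funM; first exact: measurable_expRM.
  by apply: measurableT_comp => //; apply: measurable_funB => //; exact: measurable_funM.
- move=> t _; under eq_integral do rewrite mulrC.
  rewrite ge0_integralZl_real//.
  apply: (@le_trans _ _ ((lam + c)%:E * ((q t)%:E * ((lam + c)^-1 * expR (- (lam + c) * t))%:E))%E).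
    apply: lee_wpmul2l; first by rewrite lee_fin ltW.
    apply: lee_wpmul2l; first by rewrite lee_fin.
    exact: exp_tail_le.
  rewrite -!EFinM lee_fin /q.
  have -> : expR (- c * t) = expR (lam * t) * expR (- (lam + c) * t).
    by rewrite -expRD; congr expR; ring.
  move: (expR (lam * t)) (expR (- (lam + c) * t)) `|_| => e1 e2 z.
  rewrite [leLHS](_ : _ = e1 * e2 * z); first exact: lexx.
  by field; exact: lt0r_neq0.
Qed.

End damped_time.

(** * Averages over the jumps in the weighted mean *)

(** The excess of [C + 1] over [C] in the damping rate is what bounds [X]. *)
Lemma ereal_absorb (R : realType) (X Z : \bar R) (lam C m : R) :
  X \is a fin_num -> Z \is a fin_num ->
  ((lam + (C + 1))%:E * X <= (lam + C)%:E * X + m%:E * Z)%E -> fine X <= m * fine Z.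
Proof. by case: X Z => [x| |] [z| |]//= _ _; rewrite -!EFinM -EFinD lee_fin => h; lra. Qed.

Lemma ereal_eq0_of_small (R : realType) (X : \bar R) (k : R) : (0 <= X)%E ->
  X \is a fin_num -> 0 <= k -> (forall e : R, 0 < e -> fine X <= k * e) -> X = 0%E.
Proof.
case: X => [x| |]//=; rewrite lee_fin => x0 _ k0 H; congr EFin; apply/eqP; rewrite eq_le x0 andbT.
by apply: (le_of_le_add_mul k0) => e e0; rewrite add0r; exact: H.
Qed.

Section jump_transport.
Context {R : realType} {d : nat}.
Local Notation V := 'rV[R]_d.
Local Notation mu := (lebesgue_rV R d).
Local Open Scope ereal_scope.
Variables (W k : V -> R) (U : V -> \bar R) (L : V -> V).
Hypotheses (mW : measurable_fun setT W) (W_ge0 : forall x, (0 <= W x)%R).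
Hypotheses (mk : measurable_fun setT k) (k_ge0 : forall x, (0 <= k x)%R).
Hypotheses (mU : measurable_fun setT U) (U_ge0 : forall x, 0 <= U x).
Hypothesis mL : measurable_fun setT L.


(** Jumps are reversible with respect to the Lebesgue measure: the average can be
    moved from the function to the weight. *)
Lemma jump_transport :
  \int[mu]_x ((W x)%:E * \int[mu]_y ((k y)%:E * U (x + L y)%R)) =
  \int[mu]_x (U x * \int[mu]_y (k y * W (x - L y)%R)%:E).
Proof.
have kE0 y : 0 <= (k y)%:E by rewrite lee_fin.
have WE0 x : 0 <= (W x)%:E by rewrite lee_fin.
have mkE : measurable_fun setT (fun y => (k y)%:E) by apply/measurable_EFinP.
have mWE : measurable_fun setT (fun y => (W y)%:E) by apply/measurable_EFinP.
have mk2 : measurable_fun setT (fun p : V * V => (k p.2)%:E) := measurableT_comp mkE measurable_snd.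
have mL2 : measurable_fun setT (fun p : V * V => L p.2) := measurableT_comp mL measurable_snd.
have mx : measurable_fun setT (fun p : V * V => p.1 : V) := measurable_fst.
have mU2 : measurable_fun setT (fun p : V * V => U (p.1 + L p.2)%R).
  by apply: (measurableT_comp mU); exact: measurable_fun_rVD.
have mW2 : measurable_fun setT (fun p : V * V => (W (p.1 - L p.2)%R)%:E).
  by apply: (measurableT_comp mWE); exact: measurable_fun_rVB.
have mkU : measurable_fun setT (fun p : V * V => (k p.2)%:E * U (p.1 + L p.2)%R).
  exact: emeasurable_funM.
have mA : measurable_fun setT (fun p : V * V => (W p.1)%:E * ((k p.2)%:E * U (p.1 + L p.2)%R)).
  by apply: emeasurable_funM => //; exact: (measurableT_comp mWE measurable_fst).
have mB : measurable_fun setT (fun p : V * V => U p.1 * (k p.2 * W (p.1 - L p.2)%R)%:E).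
  apply: emeasurable_funM; first exact: (measurableT_comp mU measurable_fst).
  by under eq_fun do rewrite EFinM; exact: emeasurable_funM.
transitivity (\int[mu]_x \int[mu]_y ((W x)%:E * ((k y)%:E * U (x + L y)%R))).
  apply: eq_integral => x _; rewrite ge0_integralZl//.
  - exact: (measurable_sect1 (f := fun x y : V => (k y)%:E * U (x + L y)%R) mkU x).
  - by move=> y _; exact: mule_ge0.
rewrite (tonelli (fun x y : V => (W x)%:E * ((k y)%:E * U (x + L y)%R)))//; last first.
  by move=> x y; rewrite !mule_ge0.
transitivity (\int[mu]_y \int[mu]_x (U x * (k y * W (x - L y)%R)%:E)).
  apply: eq_integral => y _.
  rewrite -(ge0_integral_rV_shift (L y) (f := fun x : V => U x * (k y * W (x - L y)%R)%:E)).
  - by apply: eq_integral => x _; rewrite addrK EFinM muleCA muleA muleC.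
  - exact: (measurable_sect2 (f := fun x y : V => U x * (k y * W (x - L y)%R)%:E) mB y).
  - by move=> x; rewrite mule_ge0// lee_fin mulr_ge0.
rewrite -(tonelli (fun x y : V => U x * (k y * W (x - L y)%R)%:E))//; last first.
  by move=> x y; rewrite mule_ge0// lee_fin mulr_ge0.
apply: eq_integral => x _; rewrite ge0_integralZl//.
- apply/measurable_EFinP; apply: measurable_funM => //.
  by apply: (measurableT_comp mW); apply: measurable_fun_rVB => //; exact: measurable_cst.
- by move=> y _; rewrite lee_fin mulr_ge0.
Qed.

End jump_transport.

Section weighted_comparison.
Context {R : realType} {d : nat}.
Local Notation V := 'rV[R]_d.
Local Notation mu := (lebesgue_rV R d).
Local Open Scope ereal_scope.
Variables (W : V -> R) (U A B Y : V -> \bar R).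
Hypotheses (mW : measurable_fun setT W) (W_ge0 : forall x, (0 <= W x)%R).
Hypotheses (mU : measurable_fun setT U) (U_ge0 : forall x, 0 <= U x).
Hypotheses (mA : measurable_fun setT A) (A_ge0 : forall x, 0 <= A x).
Hypotheses (mB : measurable_fun setT B) (B_ge0 : forall x, 0 <= B x).
Hypotheses (mY : measurable_fun setT Y) (Y_ge0 : forall x, 0 <= Y x).

Let WE0 x : 0 <= (W x)%:E. Proof. by rewrite lee_fin. Qed.

Let mprod (F : V -> \bar R) : measurable_fun setT F -> measurable_fun setT (fun x => (W x)%:E * F x).
Proof. by move=> mF; apply: emeasurable_funM => //; exact/measurable_EFinP. Qed.

Lemma weighted_integral_le (a h m : R) : (0 <= a)%R -> (0 <= h)%R -> (0 <= m)%R ->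
  (forall x, a%:E * U x <= h%:E * (A x + B x) + m%:E * Y x) ->
  a%:E * \int[mu]_x ((W x)%:E * U x) <=
  h%:E * (\int[mu]_x ((W x)%:E * A x) + \int[mu]_x ((W x)%:E * B x)) +
  m%:E * \int[mu]_x ((W x)%:E * Y x).
Proof.
rewrite -[(0 <= a)%R]lee_fin -[(0 <= h)%R]lee_fin -[(0 <= m)%R]lee_fin => a0 h0 m0 H.
have WU0 x : 0 <= (W x)%:E * U x by exact: (mule_ge0 (WE0 x) (U_ge0 x)).
have WA0 x : 0 <= (W x)%:E * A x by exact: (mule_ge0 (WE0 x) (A_ge0 x)).
have WB0 x : 0 <= (W x)%:E * B x by exact: (mule_ge0 (WE0 x) (B_ge0 x)).
have WY0 x : 0 <= (W x)%:E * Y x by exact: (mule_ge0 (WE0 x) (Y_ge0 x)).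
have mS : measurable_fun setT (fun x => (W x)%:E * A x + (W x)%:E * B x).
  by apply: emeasurable_funD; exact: mprod.
have S0 x : 0 <= (W x)%:E * A x + (W x)%:E * B x by exact: adde_ge0.
rewrite -(ge0_integralD mu measurableT (fun x _ => WA0 x) (mprod mA) (fun x _ => WB0 x) (mprod mB)).
rewrite -(ge0_integralZl mu measurableT (mprod mU) (fun x _ => WU0 x) a0).
rewrite -(ge0_integralZl mu measurableT mS (fun x _ => S0 x) h0).
rewrite -(ge0_integralZl mu measurableT (mprod mY) (fun x _ => WY0 x) m0).
have hS0 x : 0 <= h%:E * ((W x)%:E * A x + (W x)%:E * B x) by exact: mule_ge0.
have mY0 x : 0 <= m%:E * ((W x)%:E * Y x) by exact: mule_ge0.
have mhS := measurable_funeM h%:E mS; have mmY := measurable_funeM m%:E (mprod mY).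
rewrite -(ge0_integralD mu measurableT (fun x _ => hS0 x) mhS (fun x _ => mY0 x) mmY).
apply: ge0_le_integral; first exact: measurableT.
- by move=> x _; exact: mule_ge0.
- exact: (measurable_funeM a%:E (mprod mU)).
- exact: emeasurable_funD.
move=> x _; rewrite muleCA; apply: (le_trans (lee_wpmul2l (WE0 x) (H x))).
rewrite ge0_muleDr; last 2 first.
- by apply: mule_ge0 => //; exact: adde_ge0.
- exact: mule_ge0.
by rewrite muleCA (muleCA _ m%:E) ge0_muleDr.
Qed.

Variable k : V -> R.
Hypotheses (mk : measurable_fun setT k) (k_ge0 : forall x, (0 <= k x)%R).

(** A weight that the average jump increases by at most a factor [b] also bounds
    the average jump of any function, in the weighted mean. *)
Lemma jump_average_le (b : R) : (0 <= b)%R ->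
  (forall x, \int[mu]_y (k y * ((W (x + y) + W (x - y)) / 2))%:E <= (b * W x)%:E) ->
  (2^-1)%:E * (\int[mu]_x ((W x)%:E * \int[mu]_y ((k y)%:E * U (x - y)%R)) +
               \int[mu]_x ((W x)%:E * \int[mu]_y ((k y)%:E * U (x + y)%R))) <=
  b%:E * \int[mu]_x ((W x)%:E * U x).
Proof.
rewrite -[(0 <= b)%R]lee_fin => b0 HC.
have mopp : measurable_fun setT (-%R : V -> V) by apply: measurable_fun_rVN; exact: measurable_id.
have mid : measurable_fun setT (id : V -> V) by exact: measurable_id.
rewrite (jump_transport mW W_ge0 mk k_ge0 mU U_ge0 mopp) (jump_transport mW W_ge0 mk k_ge0 mU U_ge0 mid).
have kW0 (L : V -> V) x y : (0 <= k y * W (x - L y))%R by exact: mulr_ge0.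
have mB2 (L : V -> V) : measurable_fun setT L -> measurable_fun setT (fun p : V * V => (k p.2 * W (p.1 - L p.2))%R).
  move=> mL; apply: measurable_funM; first exact: (measurableT_comp mk measurable_snd).
  apply: (measurableT_comp mW); apply: measurable_fun_rVB; first exact: measurable_fst.
  exact: (measurableT_comp mL measurable_snd).
have mBx (L : V -> V) x : measurable_fun setT L -> measurable_fun setT (fun y => (k y * W (x - L y))%R).
  by move=> mL; exact: (measurable_sect1 (f := fun x y : V => (k y * W (x - L y))%R) (mB2 L mL) x).
have mD (L : V -> V) : measurable_fun setT L ->
    measurable_fun setT (fun x => U x * \int[mu]_y (k y * W (x - L y)%R)%:E).
  move=> mL; apply: emeasurable_funM; first exact: mU.
  apply: (measurable_tonelli1 (fun x y : V => (k y * W (x - L y))%:E)).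
    by apply/measurable_EFinP; exact: mB2.
  by move=> x y; rewrite lee_fin; exact: kW0.
have D0 (L : V -> V) x : 0 <= \int[mu]_y (k y * W (x - L y)%R)%:E.
  by apply: integral_ge0 => y _; rewrite lee_fin; exact: kW0.
have UD0 (L : V -> V) x : 0 <= U x * \int[mu]_y (k y * W (x - L y)%R)%:E.
  exact: (mule_ge0 (U_ge0 x) (D0 L x)).
rewrite -(ge0_integralD mu measurableT (fun x _ => UD0 -%R x) (mD -%R mopp) (fun x _ => UD0 id x) (mD id mid)).
have h0 : 0 <= (2^-1)%:E :> \bar R by rewrite lee_fin invr_ge0.
have mS := emeasurable_funD (mD -%R mopp) (mD id mid).
have S0 x := adde_ge0 (UD0 -%R x) (UD0 id x).
rewrite -(ge0_integralZl mu measurableT mS (fun x _ => S0 x) h0).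
have WU0 x : 0 <= (W x)%:E * U x by exact: (mule_ge0 (WE0 x) (U_ge0 x)).
rewrite -(ge0_integralZl mu measurableT (mprod mU) (fun x _ => WU0 x) b0).
apply: ge0_le_integral; first exact: measurableT.
- by move=> x _; exact: (mule_ge0 h0 (S0 x)).
- exact: (measurable_funeM _ mS).
- exact: (measurable_funeM _ (mprod mU)).
move=> x _; rewrite -(ge0_muleDr _ (D0 -%R x) (D0 id x)) muleCA.
rewrite [leRHS](_ : _ = U x * (b%:E * (W x)%:E)); last by rewrite muleA muleC.
apply: (lee_wpmul2l (U_ge0 x)).
rewrite -(ge0_integralD_real mu (mBx -%R x mopp) (mBx id x mid) (kW0 -%R x) (kW0 id x)).
rewrite -ge0_integralZl_real; last 3 first.
- by apply: measurable_funD; exact: mBx.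
- by move=> y; apply: addr_ge0; exact: kW0.
- by rewrite invr_ge0.
rewrite -EFinM; apply: le_trans (HC x).
rewrite le_eqVlt; apply/orP; left; apply/eqP; apply: eq_integral => y _; congr EFin.
by rewrite opprK; ring.
Qed.

End weighted_comparison.

(** * The evolution of the pairings with bumps *)

Section evolution.
Context {R : realType} {d : nat}.
Local Notation V := 'rV[R]_d.
Local Notation mu := (lebesgue_rV R d).
Local Notation TR := (measurableTypeR R).
Local Notation leb := (@lebesgue_measure R).
Variables (K W : V -> R).
Hypothesis mK : measurable_fun setT K.
Hypothesis K_ge0 : forall y, 0 <= K y.
Hypothesis K_levy : (\int[mu]_y (Num.min 1 (enorm y ^+ 2) * K y)%:E < +oo)%E.
Hypothesis hW : comparison_weight K W.
Variables (eta : V -> R) (rho M : R).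
Hypothesis meta : measurable_fun setT eta.
Hypothesis eta_ge0 : forall z, 0 <= eta z.
Hypothesis eta_le1 : forall z, eta z <= 1.
Hypothesis eta_out : forall z, rho < enorm z -> eta z = 0.
Hypothesis M_ge0 : 0 <= M.
Hypothesis eta_sdiff : forall y z, `|sdiff eta y z| <= M * enorm y ^+ 2.
Variables (S : R) (omega : V -> TR -> R).
Hypothesis momega : measurable_fun setT (fun p : V * TR => omega p.1 p.2).
Hypothesis omega_out : forall z s, ~~ (0 < s < S) -> omega z s = 0.
Hypothesis omega_lty : (\int[leb]_s \int[mu]_z (`|omega z s| * W z)%:E < +oo)%E.

Let W_ge0 x : 0 <= W x. Proof. exact: ltW (cw_gt0 hW x). Qed.
Let mW := cw_measurable hW.

Definition profile (x z : V) : R := eta (z - x).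

Let mprofile x : measurable_fun setT (profile x).
Proof. by rewrite /profile; mfun. Qed.

Let profile_sdiff x y z : `|sdiff (profile x) y z| <= M * enorm y ^+ 2.
Proof.
apply: le_trans (eta_sdiff y (z - x)); rewrite /sdiff /profile.
have -> : z + y - x = z - x + y by rVring.
by have -> : z - y - x = z - x - y by rVring.
Qed.

Let profile_out x z : rho < enorm (z - x) -> profile x z = 0.
Proof. exact: eta_out. Qed.

Definition pairing (x : V) (s : TR) : R := \int[mu]_z (omega z s * profile x z).
Definition nonlocal_pairing (x : V) (s : TR) : R :=
  \int[mu]_z (omega z s * nonlocal_op K (profile x) z).

Hypothesis weak : forall (x : V) (lam b : R) (n : nat), 0 < b < S ->
  \int[leb]_s (cutoff_deriv lam n.+1%:R b s * pairing x s -
               cutoff lam n.+1%:R b s * nonlocal_pairing x s) = 0.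

Let momega' : measurable_fun setT (fun p : TR * V => omega p.2 p.1).
Proof. exact: (measurableT_comp momega (measurable_swap (T1 := TR) (T2 := V))). Qed.

Let momega_s s : measurable_fun setT (fun z : V => omega z s).
Proof. exact: (measurable_sect2 (f := omega) momega s). Qed.

Let mnomega : measurable_fun setT (fun p : TR * V => `|omega p.2 p.1|).
Proof. exact: (measurableT_comp (@normr_measurable R setT) momega'). Qed.

Let integrable_time_pairing (f : V -> R) (A : R) : measurable_fun setT f -> 0 <= A ->
  (forall z, `|f z| <= A * W z) ->
  leb.-integrable setT (EFin \o (fun s : TR => \int[mu]_z (omega z s * f z))).
Proof.
move=> mf A0 fA; pose F (s : TR) (z : V) := omega z s * f z.
have mF : measurable_fun setT (fun p : TR * V => F p.1 p.2).
  by apply: measurable_funM => //; exact: (measurableT_comp mf measurable_snd).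
apply: (integrable_Rintegral1 (f := F) mF).
apply: (@le_lt_trans _ _ (A%:E * \int[leb]_s \int[mu]_z (`|omega z s| * W z)%:E)%E); last first.
  by rewrite lte_mul_pinfty.
have mg : measurable_fun setT (fun p : TR * V => (`|omega p.2 p.1| * W p.2)%:E).
  by apply/measurable_EFinP; apply: measurable_funM => //; exact: (measurableT_comp mW measurable_snd).
have g0 (s : TR) (z : V) : (0 <= (`|omega z s| * W z)%:E)%E by rewrite lee_fin mulr_ge0.
have m1 := measurable_tonelli1 (m2 := mu) (fun (s : TR) (z : V) => (`|omega z s| * W z)%:E) mg g0.
rewrite -ge0_integralZl//; last by move=> s _; apply: integral_ge0 => z _.
apply: ge0_le_integral => //.
- by move=> s _; apply: integral_ge0 => z _; rewrite lee_fin.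
- apply: (measurable_tonelli1 (fun (s : TR) (z : V) => `|F s z|%:E)).
    by apply/measurable_EFinP; exact: (measurableT_comp (@normr_measurable R setT) mF).
  by move=> s z; rewrite lee_fin.
- by apply: measurable_funeM.
- move=> s _; rewrite -ge0_integralZl_real//; last 2 first.
  + by apply: measurable_funM => //; exact: (measurableT_comp (@normr_measurable R setT) (momega_s s)).
  + by move=> z; rewrite mulr_ge0.
  apply: ge0_le_integral_real.
  + apply: measurableT_comp => //; exact: measurable_funM.
  + apply: measurable_funM => //; apply: measurable_funM => //.
    exact: (measurableT_comp (@normr_measurable R setT) (momega_s s)).
  + by move=> z.
  + by move=> z; rewrite /F normrM mulrCA; exact: ler_wpM2l.
Qed.

Let integrable_pairing x : leb.-integrable setT (EFin \o pairing x).
Proof.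
have [A A0 HA] := indic_eball_le_weight hW x rho.
apply: (integrable_time_pairing (mprofile x) A0) => z.
rewrite ger0_norm; last exact: eta_ge0.
apply: le_trans (HA z).
by apply: (profile_le_indic (eta := profile x) (c := x) (rho := rho)) => // z'; [exact: eta_le1|exact: profile_out].
Qed.

Let mnonlocal x : measurable_fun setT (nonlocal_op K (profile x)).
Proof.
apply: (measurable_nonlocal_profile mK K_ge0 K_levy (mprofile x) (c := x) (rho := rho) (M := M)) => // z.
- exact: eta_ge0.
- exact: eta_le1.
- exact: profile_out.
Qed.

Let nonlocal_le x : exists2 A : R, 0 <= A & forall z, `|nonlocal_op K (profile x) z| <= A * W z.
Proof.
apply: (nonlocal_profile_le_weight mK K_ge0 K_levy hW (mprofile x) (c := x) (rho := rho) (M := M)) => // z.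
- exact: eta_ge0.
- exact: eta_le1.
- exact: profile_out.
Qed.

Let integrable_nonlocal_pairing x : leb.-integrable setT (EFin \o nonlocal_pairing x).
Proof. have [A A0 HA] := nonlocal_le x; exact: integrable_time_pairing (mnonlocal x) A0 HA. Qed.

Let omega_out_Rintegral (f : V -> R) s : ~~ (0 < s < S) -> \int[mu]_z (omega z s * f z) = 0.
Proof.
move=> sI; rewrite (_ : (fun z => _) = cst 0) ?Rintegral_cst ?mul0r//.
by apply/funext => z; rewrite omega_out// mul0r.
Qed.

Let mpairing : measurable_fun setT (fun p : V * TR => pairing p.1 p.2).
Proof.
apply: (measurable_Rintegral mu (f := fun (p : V * TR) (z : V) => omega z p.2 * eta (z - p.1))).
apply: measurable_funM.
  rewrite [X in measurable_fun _ X](_ : _ = (fun p : V * TR => omega p.1 p.2) \o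
    (fun q : (V * TR) * V => (q.2, q.1.2)))//.
  apply: measurableT_comp; first exact: momega.
  apply: measurable_fun_pair; first exact: measurable_snd.
  exact: (measurableT_comp measurable_snd measurable_fst).
apply: (measurableT_comp meta); apply: measurable_fun_rVB; first exact: measurable_snd.
exact: (measurableT_comp measurable_fst measurable_fst).
Qed.

Variable c : R.
Hypothesis c_gt0 : 0 < c.

(** The size of the pairing as a function of the position of the profile, damped in
    time so that it satisfies a stationary inequality. *)
Definition damped_size (x : V) : \bar R := (\int[leb]_s (expR (- c * s) * `|pairing x s|)%:E)%E.
Definition local_size (x : V) : \bar R :=
  (\int[leb]_s \int[mu]_z (`|omega z s| * \1_(eball x (rho + 1)) z)%:E)%E.

Let mdamped2 : measurable_fun setT (fun p : V * TR => (expR (- c * p.2) * `|pairing p.1 p.2|)%:E).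
Proof.
apply/measurable_EFinP; apply: measurable_funM.
  exact: (measurableT_comp (measurable_expRM _) measurable_snd).
exact: (measurableT_comp (@normr_measurable R setT) mpairing).
Qed.

Let damped2_ge0 (x : V) (s : TR) : (0 <= (expR (- c * s) * `|pairing x s|)%:E)%E.
Proof. by rewrite lee_fin mulr_ge0 ?expR_ge0. Qed.

Lemma measurable_damped_size : measurable_fun setT damped_size.
Proof. exact: (measurable_tonelli1 (fun (x : V) (s : TR) => (expR (- c * s) * `|pairing x s|)%:E)). Qed.

Lemma damped_size_ge0 x : (0 <= damped_size x)%E.
Proof. by apply: integral_ge0 => s _; exact: damped2_ge0. Qed.

Lemma local_size_ge0 x : (0 <= local_size x)%E.
Proof. by apply: integral_ge0 => s _; apply: integral_ge0 => z _; rewrite lee_fin mulr_ge0// indicE. Qed.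

Let mlocal3 : measurable_fun setT (fun q : (V * TR) * V => `|omega q.2 q.1.2| * \1_(eball q.1.1 (rho + 1)) q.2).
Proof.
apply: measurable_funM.
  rewrite [X in measurable_fun _ X](_ : _ = (fun p : TR * V => `|omega p.2 p.1|) \o
    (fun q : (V * TR) * V => (q.1.2, q.2)))//.
  apply: measurableT_comp; first exact: mnomega.
  apply: measurable_fun_pair; last exact: measurable_snd.
  exact: (measurableT_comp measurable_snd measurable_fst).
rewrite [X in measurable_fun _ X](_ : _ = (\1_(eball 0 (rho + 1)) : V -> R) \o
  (fun q : (V * TR) * V => q.2 - q.1.1)); last first.
  by apply/funext => q; rewrite /= !indicE; congr ((_ : bool)%:R); apply/idP/idP; rewrite !inE /eball /= subr0.
apply: measurableT_comp; first exact: measurable_eball_indic.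
apply: measurable_fun_rVB; first exact: measurable_snd.
exact: (measurableT_comp measurable_fst measurable_fst).
Qed.

Let local3_ge0 (x : V) (s : TR) (z : V) : 0 <= `|omega z s| * \1_(eball x (rho + 1)) z.
Proof. by rewrite mulr_ge0// indicE. Qed.

Let mlocal2 : measurable_fun setT (fun p : V * TR =>
  (\int[mu]_z (`|omega z p.2| * \1_(eball p.1 (rho + 1)) z)%:E)%E).
Proof.
apply: (measurable_tonelli1 (fun (p : V * TR) (z : V) => (`|omega z p.2| * \1_(eball p.1 (rho + 1)) z)%:E)).
  by apply/measurable_EFinP; exact: mlocal3.
by move=> p z; rewrite lee_fin.
Qed.

Let local2_ge0 (x : V) (s : TR) : (0 <= \int[mu]_z (`|omega z s| * \1_(eball x (rho + 1)) z)%:E)%E.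
Proof. by apply: integral_ge0 => z _; rewrite lee_fin. Qed.

Lemma measurable_local_size : measurable_fun setT local_size.
Proof.
exact: (measurable_tonelli1 (fun (x : V) (s : TR) =>
  \int[mu]_z (`|omega z s| * \1_(eball x (rho + 1)) z)%:E)%E mlocal2).
Qed.

Let ae_slice : {ae leb, forall s : TR, (\int[mu]_z (`|omega z s| * W z)%:E < +oo)%E}.
Proof.
have mg : measurable_fun setT (fun p : TR * V => (`|omega p.2 p.1| * W p.2)%:E).
  by apply/measurable_EFinP; apply: measurable_funM => //; exact: (measurableT_comp mW measurable_snd).
have g0 (s : TR) (z : V) : (0 <= (`|omega z s| * W z)%:E)%E by rewrite lee_fin mulr_ge0.
have m1 := measurable_tonelli1 (m2 := mu) (fun (s : TR) (z : V) => (`|omega z s| * W z)%:E) mg g0.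
have ig : leb.-integrable setT (fun s : TR => \int[mu]_z (`|omega z s| * W z)%:E)%E.
  apply/integrableP; split => //; under eq_integral do rewrite gee0_abs ?integral_ge0//.
  exact: omega_lty.
have [A [mA A0 sA]] := integrable_ae measurableT ig.
exists A; split=> // s /= ns; apply: sA => /= fs; apply: ns.
by move: (fs I); rewrite ge0_fin_numE// integral_ge0.
Qed.

Section radius.
Variable del : R.
Hypotheses (del0 : 0 < del) (del1 : del <= 1).

Let kf0 := kfar_ge0 K_ge0 del.
Let mkf := measurable_kfar mK del.
Let n0 : 0 <= knear_mass K del.
Proof. by apply: Rintegral_ge0 => y _; exact: knear_sqr_ge0. Qed.

Let near_ge0 x s :
  (0 <= (M * knear_mass K del)%:E * \int[mu]_z (`|omega z s| * \1_(eball x (rho + 1)) z)%:E)%E.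
Proof. by apply: mule_ge0; [rewrite lee_fin; exact: mulr_ge0|exact: local2_ge0]. Qed.

Let far_term (x : V) (s : TR) (y : V) : R :=
  expR (- c * s) * (kfar K del y * ((`|pairing (x - y) s| + `|pairing (x + y) s|) / 2)).

Let mfar_term x : measurable_fun setT (fun p : TR * V => far_term x p.1 p.2).
Proof.
have mp (L : V -> V) : measurable_fun setT L ->
    measurable_fun setT (fun p : TR * V => `|pairing (x + L p.2) p.1|).
  move=> mL; rewrite [X in measurable_fun _ X](_ : _ = (fun p : V * TR => `|pairing p.1 p.2|) \o
    (fun p : TR * V => (x + L p.2, p.1)))//.
  apply: measurableT_comp; first exact: (measurableT_comp (@normr_measurable R setT) mpairing).
  apply: measurable_fun_pair; last exact: measurable_fst.
  apply: measurable_fun_rVD; first exact: measurable_cst.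
  exact: (measurableT_comp mL measurable_snd).
apply: measurable_funM; first exact: (measurableT_comp (measurable_expRM _) measurable_fst).
apply: measurable_funM; first exact: (measurableT_comp mkf measurable_snd).
apply: measurable_funM; last exact: measurable_cst.
apply: measurable_funD; last exact: (mp id (@measurable_id _ _ _)).
by apply: (mp -%R); apply: measurable_fun_rVN; exact: measurable_id.
Qed.

Let far_term_ge0 x s y : 0 <= far_term x s y.
Proof.
apply: mulr_ge0; first exact: expR_ge0.
by apply: mulr_ge0; [exact: kf0|rewrite divr_ge0// addr_ge0].
Qed.

Let damped_slice x (s : TR) : (\int[mu]_z (`|omega z s| * W z)%:E < +oo)%E ->
  ((expR (- c * s) * `|kfar_mass K del * pairing x s - nonlocal_pairing x s|)%:E <=
   \int[mu]_y (far_term x s y)%:E +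
   (M * knear_mass K del)%:E * \int[mu]_z (`|omega z s| * \1_(eball x (rho + 1)) z)%:E)%E.
Proof.
move=> hs; have [sI|sI] := boolP (0 < s < S); last first.
  rewrite /pairing /nonlocal_pairing !omega_out_Rintegral// mulr0 subrr normr0 mulr0.
  apply: adde_ge0; first by apply: integral_ge0 => y _; rewrite lee_fin.
  exact: near_ge0.
have /andP[s0 sS] := sI.
have e1 : expR (- c * s) <= 1.
  by rewrite -expR0 ler_expR mulNr oppr_le0 mulr_ge0// ltW.
have [A A0 HA] := indic_eball_le_weight hW x rho.
have [A' A'0 HA'] := nonlocal_le x.
have ip : mu.-integrable setT (EFin \o (fun z => omega z s * profile x z)).
  apply: (integrable_slice hW (momega_s s) hs (mprofile x) A0) => z.
  rewrite ger0_norm; last exact: eta_ge0.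
  apply: le_trans (HA z).
  by apply: (profile_le_indic (eta := profile x) (c := x) (rho := rho)) => // z'; [exact: eta_le1|exact: profile_out].
have inl := integrable_slice hW (momega_s s) hs (mnonlocal x) A'0 HA'.
have E : kfar_mass K del * pairing x s - nonlocal_pairing x s =
    \int[mu]_z (omega z s * (kfar_mass K del * profile x z - nonlocal_op K (profile x) z)).
  rewrite /pairing -(RintegralZl _ measurableT ip).
  rewrite -(RintegralB measurableT (integrableZl measurableT _ ip) inl).
  by apply: eq_Rintegral => z _; rewrite mulrBr mulrCA.
have pE y : \int[mu]_z (omega z s * profile x (z + y)) = pairing (x - y) s.
  apply: eq_Rintegral => z _; congr (_ * eta _); rVring.
have D := damped_pairing_le mK K_ge0 K_levy hW (mprofile x) (fun z => eta_ge0 (z - x))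
  (fun z => eta_le1 (z - x)) (@profile_out x) M_ge0 (fun y z => profile_sdiff x y z) (momega_s s) hs del0 del1.
rewrite -E in D.
have DE : (\int[mu]_y (kfar K del y * ((`|\int[mu]_z (omega z s * profile x (z + y))| +
      `|\int[mu]_z (omega z s * profile x (z - y))|) / 2))%:E =
    \int[mu]_y (kfar K del y * ((`|pairing (x - y) s| + `|pairing (x + y) s|) / 2))%:E)%E.
  by apply: eq_integral => y _; rewrite !pE opprK.
rewrite DE in D.
have e0 : (0 <= (expR (- c * s))%:E :> \bar R)%E by rewrite lee_fin expR_ge0.
rewrite EFinM; apply: (le_trans (lee_wpmul2l e0 D)).
rewrite ge0_muleDr; last 2 first.
- by apply: integral_ge0 => y _; rewrite lee_fin mulr_ge0 ?kf0// divr_ge0// addr_ge0.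
- exact: near_ge0.
apply: leeD; last first.
  rewrite -[leRHS]mul1e; apply: lee_wpmul2r; last by rewrite lee_fin.
  exact: near_ge0.
have mpx : measurable_fun setT (fun y : V => kfar K del y * ((`|pairing (x - y) s| + `|pairing (x + y) s|) / 2)).
  have mp1 : measurable_fun setT (fun y : V => `|pairing y s|).
    exact: (measurable_sect2 (f := fun (y : V) (s : TR) => `|pairing y s|) (measurableT_comp (@normr_measurable R setT) mpairing) s).
  apply: measurable_funM; first exact: mkf.
  apply: measurable_funM; last exact: measurable_cst.
  apply: measurable_funD.
    apply: (measurableT_comp mp1); apply: measurable_fun_rVB; [exact: measurable_cst|exact: measurable_id].
  apply: (measurableT_comp mp1); apply: measurable_fun_rVD; [exact: measurable_cst|exact: measurable_id].
rewrite -ge0_integralZl_real; last 3 first.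
- exact: mpx.
- by move=> y; rewrite mulr_ge0 ?kf0// divr_ge0// addr_ge0.
- exact: expR_ge0.
exact: lexx.
Qed.

Let pairing_out x s : ~~ (0 < s < S) -> pairing x s = 0.
Proof. exact: omega_out_Rintegral. Qed.

Let nonlocal_pairing_out x s : ~~ (0 < s < S) -> nonlocal_pairing x s = 0.
Proof. exact: omega_out_Rintegral. Qed.

(** A subsolution property: up to the truncation error, the damped size is at most
    its average over the long jumps, divided by a rate that exceeds their mass. *)
Lemma damped_size_le x :
  ((kfar_mass K del + c)%:E * damped_size x <=
   (2^-1)%:E * (\int[mu]_y ((kfar K del y)%:E * damped_size (x - y)) +
                \int[mu]_y ((kfar K del y)%:E * damped_size (x + y))) +
   (M * knear_mass K del)%:E * local_size x)%E.
Proof.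
have T := damped_time_le (kfar_mass_ge0 K_ge0 del) c_gt0 (integrable_pairing x)
  (integrable_nonlocal_pairing x) (@pairing_out x) (@nonlocal_pairing_out x) (weak x _).
apply: (le_trans T).
have mfE : measurable_fun setT (fun p : TR * V => (far_term x p.1 p.2)%:E).
  by apply/measurable_EFinP; exact: mfar_term.
have fE0 (s : TR) (y : V) : (0 <= (far_term x s y)%:E)%E by rewrite lee_fin.
have Mk0 : (0 <= (M * knear_mass K del)%:E :> \bar R)%E by rewrite lee_fin mulr_ge0.
have mfar1 := measurable_tonelli1 (m2 := mu) (fun (s : TR) (y : V) => (far_term x s y)%:E) mfE fE0.
have mloc1 := measurable_sect1 (f := fun (x : V) (s : TR) =>
  \int[mu]_z (`|omega z s| * \1_(eball x (rho + 1)) z)%:E)%E mlocal2 x.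
have far0 (s : TR) : (0 <= \int[mu]_y (far_term x s y)%:E)%E by apply: integral_ge0 => y _.
apply: (@le_trans _ _ (\int[leb]_s (\int[mu]_y (far_term x s y)%:E +
   (M * knear_mass K del)%:E * \int[mu]_z (`|omega z s| * \1_(eball x (rho + 1)) z)%:E))%E).
  apply: ae_ge0_le_integral.
  - exact: measurableT.
  - by move=> s _; rewrite lee_fin mulr_ge0 ?expR_ge0.
  - apply/measurable_EFinP; apply: measurable_funM; first exact: measurable_expRM.
    apply: measurableT_comp => //; apply: measurable_funB.
      apply: measurable_funM => //; apply/measurable_EFinP; exact: measurable_int (integrable_pairing x).
    by apply/measurable_EFinP; exact: measurable_int (integrable_nonlocal_pairing x).
  - move=> s _; apply: adde_ge0 => //; exact: mule_ge0.
  - by apply: emeasurable_funD => //; exact: measurable_funeM.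
  - have [A [mA A0 sA]] := ae_slice; exists A; split=> // s /= ns; apply: sA => /= hs.
    by apply: ns => _; exact: damped_slice.
rewrite ge0_integralD//; last exact: measurable_funeM.
rewrite ge0_integralZl//; apply: leeD; last exact: lexx.
rewrite (tonelli (fun (s : TR) (y : V) => (far_term x s y)%:E) mfE fE0).
have mds (L : V -> V) : measurable_fun setT L -> measurable_fun setT (fun y => (kfar K del y)%:E * damped_size (x + L y))%E.
  move=> mL; apply: emeasurable_funM; first by apply/measurable_EFinP; exact: mkf.
  by apply: (measurableT_comp measurable_damped_size); apply: measurable_fun_rVD.
have ds0 (u y : V) : (0 <= (kfar K del y)%:E * damped_size u)%E.
  by apply: mule_ge0; [rewrite lee_fin|exact: damped_size_ge0].
have mopp : measurable_fun setT (-%R : V -> V) by apply: measurable_fun_rVN; exact: measurable_id.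
rewrite -ge0_integralD//; last 2 first.
- exact: (mds -%R mopp).
- exact: (mds id (@measurable_id _ _ _)).
rewrite -ge0_integralZl//; last 2 first.
- by apply: emeasurable_funD; [exact: (mds -%R mopp)|exact: (mds id (@measurable_id _ _ _))].
- by move=> y _; exact: adde_ge0.
rewrite le_eqVlt; apply/orP; left; apply/eqP; apply: eq_integral => y _.
have mpy u : measurable_fun setT (fun s : TR => expR (- c * s) * `|pairing u s|).
  by apply/measurable_EFinP; exact: (measurable_sect1 (f := fun (x : V) (s : TR) => (expR (- c * s) * `|pairing x s|)%:E) mdamped2 u).
transitivity (\int[leb]_s (2^-1 * kfar K del y *
   (expR (- c * s) * `|pairing (x - y) s| + expR (- c * s) * `|pairing (x + y) s|))%:E)%E.
  by apply: eq_integral => s _; congr EFin; rewrite /far_term; ring.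
rewrite ge0_integralZl_real; last 3 first.
- by apply: measurable_funD; exact: mpy.
- by move=> s; apply: addr_ge0; apply: mulr_ge0; [exact: expR_ge0| |exact: expR_ge0|].
- by rewrite mulr_ge0// invr_ge0.
rewrite ge0_integralD_real; [|exact: mpy|exact: mpy| |]; last 2 first.
- by move=> s; apply: mulr_ge0; [exact: expR_ge0|].
- by move=> s; apply: mulr_ge0; [exact: expR_ge0|].
by rewrite -ge0_muleDr ?damped_size_ge0// muleA -EFinM.
Qed.

End radius.

(** Exchanging the integrals, the weight is integrated over a ball around the point
    where [omega] is evaluated, and there it is comparable to its value at the
    centre. *)
Lemma local_total_lty : (\int[mu]_x ((W x)%:E * local_size x) < +oo)%E.
Proof.
have [H H0 HH] := cw_harnack hW (normr_ge0 (rho + 1)).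
pose vol := mu (eball (0 : V) `|rho + 1|).
have vol_fin : vol \is a fin_num by rewrite /vol ge0_fin_numE//; exact: lebesgue_eball_lty.
have Hv0 : 0 <= H * fine vol by apply: (mulr_ge0 (ltW H0)); apply: fine_ge0; exact: measure_ge0.
pose f (x : V) (s : TR) (z : V) : \bar R := (W x * (`|omega z s| * \1_(eball x (rho + 1)) z))%:E.
have f0 x s z : (0 <= f x s z)%E by rewrite lee_fin; apply: mulr_ge0 => //.
have mf : measurable_fun setT (fun q : (V * TR) * V => f q.1.1 q.1.2 q.2).
  apply/measurable_EFinP; apply: measurable_funM; last exact: mlocal3.
  exact: (measurableT_comp mW (measurableT_comp measurable_fst measurable_fst)).
have mf1 : measurable_fun setT (fun p : V * TR => \int[mu]_z f p.1 p.2 z)%E.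
  by apply: (measurable_tonelli1 (fun (p : V * TR) (z : V) => f p.1 p.2 z)).
have mf2 s : measurable_fun setT (fun p : V * V => f p.1 s p.2).
  rewrite [X in measurable_fun _ X](_ : _ = (fun q : (V * TR) * V => f q.1.1 q.1.2 q.2) \o
    (fun p : V * V => ((p.1, s), p.2)))//.
  apply: measurableT_comp; first exact: mf.
  apply: measurable_fun_pair; last exact: measurable_snd.
  by apply: measurable_fun_pair; [exact: measurable_fst|exact: measurable_cst].
rewrite (_ : (\int[mu]_x _ = \int[mu]_x \int[leb]_s \int[mu]_z f x s z)%E); last first.
  apply: eq_integral => x _; rewrite /local_size -ge0_integralZl//; last 2 first.
  - exact: (measurable_sect1 (f := fun (x : V) (s : TR) =>
      \int[mu]_z (`|omega z s| * \1_(eball x (rho + 1)) z)%:E)%E mlocal2 x).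
  - by rewrite lee_fin.
  apply: eq_integral => s _; rewrite -ge0_integralZl_real//.
  apply: measurable_funM; last exact: measurable_eball_indic.
  exact: (measurableT_comp (@normr_measurable R setT) (momega_s s)).
rewrite (tonelli (fun (x : V) (s : TR) => \int[mu]_z f x s z)%E mf1); last first.
  by move=> x s; apply: integral_ge0 => z _.
apply: (@le_lt_trans _ _ ((H * fine vol)%:E * \int[leb]_s \int[mu]_z (`|omega z s| * W z)%:E)%E); last first.
  by apply: lte_mul_pinfty; [rewrite lee_fin; exact: Hv0| |exact: omega_lty].
have mg : measurable_fun setT (fun p : TR * V => (`|omega p.2 p.1| * W p.2)%:E).
  by apply/measurable_EFinP; apply: measurable_funM => //; exact: (measurableT_comp mW measurable_snd).
have g0 (s : TR) (z : V) : (0 <= (`|omega z s| * W z)%:E)%E by rewrite lee_fin mulr_ge0.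
have m1 := measurable_tonelli1 (m2 := mu) (fun (s : TR) (z : V) => (`|omega z s| * W z)%:E) mg g0.
rewrite -ge0_integralZl//; last by move=> s _; apply: integral_ge0 => z _.
apply: ge0_le_integral => //.
- by move=> s _; apply: integral_ge0 => x _; apply: integral_ge0 => z _.
- apply: (measurable_tonelli2 (fun (x : V) (s : TR) => \int[mu]_z f x s z)%E mf1).
  by move=> x s; apply: integral_ge0 => z _.
- exact: measurable_funeM.
move=> s _; rewrite (tonelli (fun x z => f x s z) (mf2 s))//.
have mnos : measurable_fun setT (fun z => `|omega z s|).
  exact: (measurableT_comp (@normr_measurable R setT) (momega_s s)).
rewrite -ge0_integralZl_real//; last 2 first.
- exact: measurable_funM.
- by move=> z; exact: mulr_ge0.
apply: ge0_le_integral => //.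
- by move=> z _; apply: integral_ge0 => x _.
- exact: (measurable_tonelli2 (fun x z => f x s z) (mf2 s)).
- by apply/measurable_EFinP; apply: measurable_funM => //; exact: measurable_funM.
move=> z _.
have mz : measurable_fun setT (\1_(eball z `|rho + 1|) : V -> R) by exact: measurable_eball_indic.
apply: (@le_trans _ _ (\int[mu]_x (`|omega z s| * (H * W z) * \1_(eball z `|rho + 1|) x)%:E)%E).
  apply: ge0_le_integral => //.
  - exact: (measurable_sect2 (f := fun x z : V => f x s z) (mf2 s) z).
  - by apply/measurable_EFinP; apply: measurable_funM.
  - move=> x _; rewrite lee_fin !indicE mulrCA -[leRHS]mulrA; apply: ler_wpM2l => //.
    case: (boolP (z \in _)) => [|_]; last by rewrite mulr0 !mulr_ge0// ltW.
    rewrite inE /eball /= => zx; rewrite mulr1.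
    have xz : enorm (z - x) <= `|rho + 1| by apply: (le_trans zx); exact: ler_norm.
    rewrite mem_set; last by rewrite /= -enormN opprB.
    by rewrite mulr1; exact: HH.
rewrite ge0_integralZl_real//; last by rewrite !mulr_ge0// ltW.
rewrite integral_indic ?setIT//; last exact: measurable_eball.
rewrite [X in (_ * X <= _)%E](_ : _ = (fine vol)%:E); last first.
  by rewrite (fineK vol_fin); exact: lebesgue_eball_shift.
rewrite -EFinM lee_fin.
by rewrite le_eqVlt; apply/orP; left; apply/eqP; ring.
Qed.

Lemma damped_size_le_local x : (damped_size x <= local_size x)%E.
Proof.
apply: ge0_le_integral.
- exact: measurableT.
- by move=> s _; exact: damped2_ge0.
- exact: (measurable_sect1 (f := fun (x : V) (s : TR) => (expR (- c * s) * `|pairing x s|)%:E) mdamped2 x).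
- exact: (measurable_sect1 (f := fun (x : V) (s : TR) =>
    \int[mu]_z (`|omega z s| * \1_(eball x (rho + 1)) z)%:E)%E mlocal2 x).
move=> s _; have [sI|sI] := boolP (0 < s < S); last first.
  by rewrite /pairing omega_out_Rintegral// normr0 mulr0; exact: local2_ge0.
have /andP[s0 sS] := sI.
have e1 : expR (- c * s) <= 1.
  by rewrite -expR0 ler_expR mulNr oppr_le0 mulr_ge0// ltW.
apply: (@le_trans _ _ (`|pairing x s|)%:E); first by rewrite lee_fin ler_piMl.
have mF : measurable_fun setT (fun z => omega z s * profile x z) by exact: measurable_funM.
have mG : measurable_fun setT (fun z => `|omega z s| * \1_(eball x (rho + 1)) z).
  apply: measurable_funM; last exact: measurable_eball_indic.
  exact: (measurableT_comp (@normr_measurable R setT) (momega_s s)).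
have le_FG z : `|omega z s * profile x z| <= `|omega z s| * \1_(eball x (rho + 1)) z.
  rewrite normrM; apply: ler_wpM2l => //; rewrite ger0_norm; last exact: eta_ge0.
  apply: (profile_le_indic (eta := profile x) (c := x) (rho := rho)).
  - by move=> z'; exact: eta_le1.
  - exact: profile_out.
  - by rewrite lerDl.
have := leey (\int[mu]_z (`|omega z s| * \1_(eball x (rho + 1)) z)%:E)%E.
rewrite le_eqVlt => /orP[/eqP ->|fin]; first exact: leey.
have iF := integrable_dominated mF mG le_FG fin.
apply: (@le_trans _ (\bar R) (\int[mu]_z `|omega z s * profile x z|)%:E).
  by rewrite lee_fin; exact: le_normr_Rintegral.
rewrite -ge0_RintegralE; [|by move=> y; exact: normr_ge0|by move/integrableP : iF => []].
apply: ge0_le_integral_real => //.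
exact: (measurableT_comp (@normr_measurable R setT) mF).
Qed.

(** The weighted size of the damped pairing is controlled by itself with a smaller
    factor, up to an error that vanishes with the truncation radius. *)
Lemma damped_total_eq0 (C : R) : 0 <= C -> c = C + 1 ->
  (forall x : V, (\int[mu]_y (`|sdiff W y x| * K y)%:E <= (C * W x)%:E)%E) ->
  (\int[mu]_x ((W x)%:E * damped_size x) = 0)%E.
Proof.
move=> C0 cE HC.
set X := (\int[mu]_x _)%E; pose Z := (\int[mu]_x ((W x)%:E * local_size x))%E.
have mWE : measurable_fun setT (fun x => (W x)%:E) by apply/measurable_EFinP.
have WE0 x : (0 <= (W x)%:E :> \bar R)%E by rewrite lee_fin.
have ds0 := damped_size_ge0; have ls0 := local_size_ge0.
have mds := measurable_damped_size; have mls := measurable_local_size.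
have X0 : (0 <= X)%E by apply: integral_ge0 => x _; exact: mule_ge0.
have Z0 : (0 <= Z)%E by apply: integral_ge0 => x _; exact: mule_ge0.
have mX : measurable_fun setT (fun x => (W x)%:E * damped_size x)%E by exact: emeasurable_funM.
have XZ : (X <= Z)%E.
  apply: ge0_le_integral => //.
  - by move=> x _; exact: mule_ge0.
  - exact: emeasurable_funM.
  - by move=> x _; apply: lee_wpmul2l => //; exact: damped_size_le_local.
have Zoo : (Z < +oo)%E := local_total_lty.
have Zf : Z \is a fin_num by rewrite ge0_fin_numE.
have Xf : X \is a fin_num by rewrite (ge0_fin_numE X0); exact: (le_lt_trans XZ Zoo).
apply: (ereal_eq0_of_small X0 Xf (k := M * fine Z)); first by rewrite mulr_ge0// fine_ge0.
move=> e e0; have [del /andP[del0 del1] small] := knear_mass_small mK K_ge0 K_levy e0.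
have Mk0 : 0 <= knear_mass K del by apply: Rintegral_ge0 => y _; exact: knear_sqr_ge0.
have lam0 := kfar_mass_ge0 K_ge0 del; set lam := kfar_mass K del.
have kf0 := kfar_ge0 K_ge0 del; have mkf := measurable_kfar mK del.
have mkfE : measurable_fun setT (fun x => (kfar K del x)%:E) by apply/measurable_EFinP.
have mopp : measurable_fun setT (-%R : V -> V) by apply: measurable_fun_rVN; exact: measurable_id.
have mid : measurable_fun setT (id : V -> V) by exact: measurable_id.
have A0 (L : V -> V) (x : V) : (0 <= \int[mu]_y ((kfar K del y)%:E * damped_size (x + L y)%R))%E.
  by apply: integral_ge0 => y _; apply: mule_ge0; [rewrite lee_fin; exact: kf0|exact: ds0].
have mA (L : V -> V) : measurable_fun setT L ->
    measurable_fun setT (fun x : V => \int[mu]_y ((kfar K del y)%:E * damped_size (x + L y)%R)%E)%E.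
  move=> mL; apply: (measurable_tonelli1 (fun x y : V => (kfar K del y)%:E * damped_size (x + L y))%E).
    apply: emeasurable_funM; first exact: (measurableT_comp mkfE measurable_snd).
    apply: (measurableT_comp mds); apply: measurable_fun_rVD; first exact: measurable_fst.
    exact: (measurableT_comp mL measurable_snd).
  by move=> x y; apply: mule_ge0; [rewrite lee_fin; exact: kf0|exact: ds0].
have lamc0 : 0 <= lam + c by rewrite addr_ge0// ltW.
have h0 : 0 <= 2^-1 :> R by rewrite invr_ge0.
have step1 := weighted_integral_le mW W_ge0 mds ds0 (mA -%R mopp) (A0 -%R) (mA id mid) (A0 id)
  mls ls0 lamc0 h0 (mulr_ge0 M_ge0 Mk0) (damped_size_le del0 del1).
have transp := jump_average_le mW W_ge0 mds ds0 mkf kf0 (addr_ge0 lam0 C0)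
  (kfar_weight_le mK K_ge0 K_levy hW del0 del1 HC).
have := le_trans step1 (leeD transp (lexx _)).
rewrite -/X -/Z cE => h; have h1 := ereal_absorb Xf Zf h.
apply: (le_trans h1); rewrite mulrAC; apply: ler_wpM2l => //.
by rewrite mulr_ge0// fine_ge0.
Qed.

Lemma pairing_eq0_ae (C : R) : 0 <= C -> c = C + 1 ->
  (forall x : V, (\int[mu]_y (`|sdiff W y x| * K y)%:E <= (C * W x)%:E)%E) ->
  {ae (mu \x leb)%E, forall p : V * TR, pairing p.1 p.2 = 0}.
Proof.
move=> C0 cE HC; have X0 := damped_total_eq0 C0 cE HC.
pose F (p : V * TR) : \bar R := (W p.1 * (expR (- c * p.2) * `|pairing p.1 p.2|))%:E.
have F0 p : (0 <= F p)%E by rewrite lee_fin !mulr_ge0 ?expR_ge0.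
have mF : measurable_fun setT F.
  apply/measurable_EFinP; apply: measurable_funM; first exact: (measurableT_comp mW measurable_fst).
  by apply/measurable_EFinP; exact: mdamped2.
have IF : (\int[(mu \x leb)%E]_p `|F p| = 0)%E.
  under eq_integral do rewrite (gee0_abs (F0 _)).
  rewrite (fubini_tonelli1 F mF)// -X0; apply: eq_integral => x _.
  rewrite /fubini_F /F /= ge0_integralZl_real//.
  by apply/measurable_EFinP; exact: (measurable_sect1 (f := fun (x : V) (s : TR) => (expR (- c * s) * `|pairing x s|)%:E) mdamped2 x).
have [A [mA A0 sA]] := (ae_eq_integral_abs (mu \x leb)%E measurableT mF).1 IF.
exists A; split=> // p /= np; apply: sA => /= Fp; apply: np.
have : W p.1 * (expR (- c * p.2) * `|pairing p.1 p.2|) = 0 by exact: EFin_inj (Fp I).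
move/eqP; rewrite mulf_eq0 (gt_eqF (cw_gt0 hW p.1))/= mulf_eq0 gt_eqF ?expR_gt0//= => /eqP.
exact: normr0_eq0.
Qed.

End evolution.

(** * Functions determined by their integrals over boxes *)

Section open_boxes.
Context {R : realType} {d : nat}.
Local Notation V := 'rV[R]_d.
Local Notation mu := (lebesgue_rV R d).

Definition open_box (a b : V) : set V :=
  [set z | forall i, a ord0 i < z ord0 i < b ord0 i].

Lemma measurable_open_box a b : measurable (open_box a b).
Proof.
rewrite (_ : open_box a b =
    [set z : V | forall i, (`]a ord0 i, b ord0 i[%classic : set R) (z ord0 i)]).
  apply: (measurable_rV_box (A := fun i => `]a ord0 i, b ord0 i[%classic)) => i.
  exact: measurable_itv.
by apply/seteqP; split => z /= H i; have := H i; rewrite in_itv.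
Qed.

Lemma open_boxI a b a' b' : open_box a b `&` open_box a' b' =
  open_box (\row_i Num.max (a ord0 i) (a' ord0 i)) (\row_i Num.min (b ord0 i) (b' ord0 i)).
Proof.
apply/seteqP; split => z /=.
  move=> [H H'] i; rewrite !mxE gt_max lt_min.
  by move/andP: (H i) => [-> ->]; move/andP: (H' i) => [-> ->].
move=> H; split=> i; have := H i; rewrite !mxE gt_max lt_min => /andP[/andP[h1 h2] /andP[h3 h4]].
  by rewrite h1 h3.
by rewrite h2 h4.
Qed.

Let boxes : set (set V) := [set A | exists a b, A = open_box a b].

Let boxesI : setI_closed boxes.
Proof. by move=> _ _ [a [b ->]] [a' [b' ->]]; rewrite open_boxI; eexists; eexists. Qed.

(* A half-space is a countable union of boxes that exhaust it. *)
Let coord_ray i (c : R) : <<s boxes >> [set z : V | c < z ord0 i].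
Proof.
rewrite (_ : [set z : V | c < z ord0 i] = \bigcup_k open_box
    (\row_j (if j == i then c else - k%:R)) (\row_j k%:R)).
  by apply: sigma_algebra_bigcup => k; apply: sub_sigma_algebra; eexists; eexists.
apply/seteqP; split => z /=; last first.
  by move=> [k _ H]; have := H i; rewrite !mxE eqxx => /andP[].
move=> cz; have [k Hk] : exists k : nat, forall j, `|z ord0 j| < k%:R.
  exists (Num.bound (enorm z)) => j; apply: (le_lt_trans (coord_le_enorm z j)).
  by apply: archi_boundP; exact: enorm_ge0.
exists k => // j; rewrite !mxE; have := Hk j; rewrite ltr_norml => /andP[h1 ->].
by rewrite andbT; case: eqP => [->|].
Qed.

Lemma measurable_rV_open_boxE : (@measurable _ V) = <<s boxes >>.
Proof.
apply/seteqP; split; last first.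
  apply: smallest_sub; first exact: sigma_algebra_measurable.
  by move=> _ [a [b ->]]; exact: measurable_open_box.
apply: smallest_sub; first exact: smallest_sigma_algebra.
rewrite -bigcup_seq => B [i _] [C mC <-]; rewrite setTI.
have : <<s @RGenOInfty.G R >> C.
  have : (@ocitv R).-sigma.-measurable C by exact: mC.
  by rewrite RGenOInfty.measurableE.
move: C {mC}; apply: smallest_sub.
  split => /=.
  - by rewrite preimage_set0; exact: sigma_algebra0.
  - by move=> B' /= mB; rewrite setTD preimage_setC; exact: sigma_algebraC.
  - by move=> F mF /=; rewrite preimage_bigcup; exact: sigma_algebra_bigcup.
move=> _ [c ->] /=.
rewrite (_ : _ @^-1` _ = [set z : V | c < z ord0 i]); first exact: coord_ray.
by apply/seteqP; split => z /=; rewrite in_itv/= andbT.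
Qed.

(* Boxes are stable under intersection, and the sets of vanishing integral form a
   Dynkin system. *)
Let integral0_of_boxes (g : V -> R) : mu.-integrable setT (EFin \o g) ->
  (\int[mu]_z (g z)%:E = 0)%E ->
  (forall a b, \int[mu]_(z in open_box a b) (g z)%:E = 0)%E ->
  forall A, measurable A -> (\int[mu]_(z in A) (g z)%:E = 0)%E.
Proof.
move=> ig gT gbox A; rewrite [X in X A -> _]measurable_rV_open_boxE; move: A.
have mg := measurable_int _ ig.
apply: (@dynkin_induction _ V boxes (fun A => \int[mu]_(z in A) (g z)%:E = 0)%E
  measurable_rV_open_boxE boxesI).
- exact: gT.
- by move=> _ [a [b ->]].
- move=> A mA IA.
  have := @integral_setU _ _ _ mu A (~` A) (EFin \o g) mA (measurableC mA).
  rewrite setUv => /(_ mg); rewrite gT IA add0e => <- //.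
  by rewrite disj_set2E setICr.
- move=> F mF tF IF.
  rewrite integral_bigcup//; last by apply: integrableS ig => //; exact: bigcupT_measurable.
  by apply: eseries0 => k _ _; exact: IF.
Qed.

(** Compare the integrals over the sets where [f] is positive and negative, inside a
    large box. *)
Lemma ae_eq0_of_open_boxes (f : V -> R) : measurable_fun setT f ->
  (forall a b, mu.-integrable (open_box a b) (EFin \o f)) ->
  (forall a b, \int[mu]_(z in open_box a b) (f z)%:E = 0)%E ->
  {ae mu, forall z, f z = 0}.
Proof.
move=> mf if_ fbox.
pose B (k : nat) : set V := open_box (\row_j (- k%:R)) (\row_j k%:R).
have mB k : measurable (B k) by exact: measurable_open_box.
suff H k : {ae mu, forall z, B k z -> f z = 0}.
  have [A [mA A0 sA]] := ae_foralln H; exists A; split=> // z /= nz; apply: sA => /= Hz; apply: nz.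
  apply: (Hz (Num.bound (enorm z))) => j; rewrite !mxE -ltr_norml.
  apply: (le_lt_trans (coord_le_enorm z j)).
  by apply: archi_boundP; exact: enorm_ge0.
pose g z : R := f z * \1_(B k) z.
have gE A : measurable A -> (\int[mu]_(z in A) (g z)%:E = \int[mu]_(z in A `&` B k) (f z)%:E)%E.
  move=> mA; rewrite integral_mkcondr; apply: eq_integral => z _.
  by rewrite patchE /g indicE; case: (z \in B k); rewrite ?mulr1 ?mulr0.
have ig : mu.-integrable setT (EFin \o g).
  rewrite (_ : EFin \o g = (EFin \o f) \_ (B k)); first by rewrite -integrable_mkcond//; exact: if_.
  apply/funext => z; rewrite patchE /g /= indicE.
  by case: (z \in B k); rewrite ?mulr1 ?mulr0.
have I0 := integral0_of_boxes ig.
have {}I0 : forall A, measurable A -> (\int[mu]_(z in A) (g z)%:E = 0)%E.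
  apply: I0; first by rewrite gE// setTI; exact: fbox.
  by move=> a b; rewrite gE; [rewrite /B open_boxI; exact: fbox|exact: measurable_open_box].
have mg : measurable_fun setT (EFin \o g) := measurable_int _ ig.
have mg' : measurable_fun setT g by apply/measurable_EFinP.
have mpos : measurable [set z | 0 <= g z].
  rewrite -[X in measurable X]setTI.
  exact: (@measurable_fun_ler _ _ _ setT (cst 0) g).
have norm0 : (\int[mu]_z `|(g z)%:E| = 0)%E.
  rewrite -(setUv [set z | 0 <= g z]) ge0_integral_setU//; last 3 first.
  - exact: measurableC.
  - by rewrite setUv; exact: measurableT_comp.
  - by rewrite disj_set2E setICr.
  rewrite (eq_integral (fun z => (g z)%:E)); last first.
    by move=> z; rewrite inE /= => gz; rewrite ger0_norm.
  rewrite I0// add0e (eq_integral (fun z => (- (g z)%:E)%E)); last first.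
    by move=> z; rewrite inE /= => /negP; rewrite -ltNge => gz; rewrite ltr0_norm.
  rewrite integralN; first by rewrite I0 ?oppe0//; exact: measurableC.
  have iC : mu.-integrable (~` [set z | 0 <= g z]) (EFin \o g).
    by apply: integrableS ig => //; exact: measurableC.
  exact: (integrable_add_def (measurableC mpos) iC).
have [A [mA A0 sA]] := (ae_eq_integral_abs mu measurableT mg).1 norm0.
exists A; split=> // z /= nz; apply: sA => /= gz0; apply: nz => Bz; have := EFin_inj (gz0 I).
rewrite /g indicE mem_set// mulr1.
exact.
Qed.

End open_boxes.

Section bump_pairings.
Context {R : realType} {d : nat}.
Local Notation V := 'rV[R]_d.
Local Notation mu := (lebesgue_rV R d).

Lemma open_box_sub_eball (a b : V) : exists rho, open_box a b `<=` eball 0 rho.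
Proof.
exists (Num.sqrt d%:R * (enorm a + enorm b)); rewrite eball0E => z /= zab.
apply: enorm_le_coord => i.
have /andP[h1 h2] := zab i.
have := coord_le_enorm a i; have := coord_le_enorm b i.
rewrite !ler_norml => /andP[b1 b2] /andP[a1 a2].
have ea := enorm_ge0 a; have eb := enorm_ge0 b.
by apply/andP; split; lra.
Qed.

Lemma bump_le_indic n (a b z : V) : 0 < n -> bump n a b z <= \1_(open_box a b) z.
Proof.
move=> n0; rewrite indicE; case: (boolP (z \in _)) => [_|/negP zab]; first exact: bump_le1.
have [->//|h] := eqVneq (bump n a b z) 0.
by exfalso; apply: zab; rewrite inE /=; exact: bump_neq0 h.
Qed.

Let cvg_prod (I : Type) (r : seq I) (F : I -> nat -> R) (G : I -> R) :
  (forall i, F i n @[n --> \oo] --> G i) ->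
  \prod_(i <- r) F i n @[n --> \oo] --> \prod_(i <- r) G i.
Proof.
move=> FG; elim: r => [|i r IH].
  by rewrite big_nil; under eq_fun do rewrite big_nil; exact: cvg_cst.
by rewrite big_cons; under eq_fun do rewrite big_cons; exact: cvgM.
Qed.

Lemma bump_cvg (a b z : V) : bump n.+1%:R a b z @[n --> \oo] --> (\1_(open_box a b) z : R).
Proof.
rewrite indicE; case: (boolP (z \in _)) => [|/negP zab]; last first.
  rewrite (_ : (fun n => _) = fun=> 0); first exact: cvg_cst.
  apply/funext => n; apply/eqP/negPn/negP => h; apply: zab.
  by rewrite inE /=; exact: bump_neq0 h.
rewrite inE /= => zab.
rewrite (_ : (true%:R : R) = \prod_(i < d) 1); last by rewrite big1.
rewrite /bump.
apply: cvg_prod => i.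
have /andP[h1 h2] := zab i.
have e1 : (1 : {poly R}).[0] = 1 by rewrite hornerC.
have fc (x : R) : 0 < x -> flat 1 (n.+1%:R * x) @[n --> \oo] --> (1 : R).
  by move=> x0; have := @flat_cvg R 1 x x0; rewrite e1.
by rewrite -[X in _ --> X]mulr1; apply: cvgM; apply: fc; rewrite subr_gt0.
Qed.

Variables (K W : V -> R).
Hypothesis hW : comparison_weight K W.
Variable f : V -> R.
Hypothesis mf : measurable_fun setT f.
Hypothesis f_lty : (\int[mu]_z (`|f z| * W z)%:E < +oo)%E.

Let indic_box_le (a b : V) : exists2 A : R, 0 <= A & forall z, `|\1_(open_box a b) z| <= A * W z.
Proof.
have [rho Hrho] := open_box_sub_eball a b.
have [A A0 HA] := indic_eball_le_weight hW 0 rho.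
exists A => // z; rewrite ger0_norm ?indicE//; apply: le_trans (HA z).
rewrite !indicE; case: (boolP (z \in open_box a b)) => [|_] //=.
by rewrite inE => /Hrho zr; rewrite mem_set.
Qed.

Let integrable_box a b : mu.-integrable setT (EFin \o (fun z => f z * \1_(open_box a b) z)).
Proof.
have [A A0 HA] := indic_box_le a b.
apply: (integrable_slice hW mf f_lty _ A0 HA).
by apply: measurable_indic; exact: measurable_open_box.
Qed.

Let box_limit a b (phi : nat -> V -> R) : (forall n, measurable_fun setT (phi n)) ->
  (forall n z, 0 <= phi n z <= \1_(open_box a b) z) ->
  (forall z, phi n z @[n --> \oo] --> (\1_(open_box a b) z : R)) ->
  (forall n, \int[mu]_z (f z * phi n z) = 0) ->
  \int[mu]_z (f z * \1_(open_box a b) z) = 0.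
Proof.
move=> mphi phi01 phic phi0.
pose g z : R := f z * \1_(open_box a b) z.
have ig := integrable_box a b.
have ing := integrable_norm ig.
have dom n z : `|f z * phi n z| <= `|g z|.
  rewrite /g !normrM; apply: ler_wpM2l => //.
  by have /andP[p0 p1] := phi01 n z; rewrite !ger0_norm// indicE.
have mF n : measurable_fun setT (fun z => (f z * phi n z)%:E).
  by apply/measurable_EFinP; exact: measurable_funM.
have mG : measurable_fun setT (fun z => (g z)%:E) by exact: measurable_int ig.
have iF n : mu.-integrable setT (EFin \o (fun z => f z * phi n z)).
  apply: (integrable_dominated (g := fun z => `|g z|)).
  - exact: measurable_funM.
  - by apply: measurableT_comp => //; exact/measurable_EFinP.
  - exact: dom.
  - by move/integrableP : ig => [].
have cF : {ae mu, forall z, setT z -> (f z * phi n z)%:E @[n --> \oo] --> (g z)%:E}.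
  apply: aeW => z _; apply: cvg_EFin; first exact: nearW.
  by apply: cvgM; [exact: cvg_cst|exact: phic].
have df : {ae mu, forall z n, setT z -> (`|(f z * phi n z)%:E| <= (`|g z|%R)%:E)%E}.
  by apply: aeW => z n _; rewrite lee_fin; exact: dom.
have [_ _ H] := @dominated_convergence _ _ _ mu setT measurableT _ _ _ mF mG cF ing df.
rewrite (_ : (fun n => _) = fun=> 0%E) in H; last first.
  apply/funext => n; rewrite -[LHS]fineK; last exact: (integrable_fin_num measurableT (iF n)).
  by congr EFin; exact: phi0.
by rewrite /Rintegral -(cvg_unique _ (@cvg_cst _ _ _ _ _) H).
Qed.

Variable x : V.

Definition rat_point (q : 'rV[rat]_d) : V := \row_i ratr (q ord0 i).

Hypothesis bumps : forall (m : nat) (qa qb : 'rV[rat]_d),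
  \int[mu]_z (f z * bump m.+1%:R (rat_point qa + x) (rat_point qb + x) z) = 0.

Let rational_box qa qb :
  \int[mu]_z (f z * \1_(open_box (rat_point qa + x) (rat_point qb + x)) z) = 0.
Proof.
apply: (box_limit (phi := fun m => bump m.+1%:R (rat_point qa + x) (rat_point qb + x))).
- by move=> n; exact: measurable_bump.
- by move=> n z; rewrite bump_ge0 bump_le_indic.
- exact: bump_cvg.
- by move=> n; exact: bumps.
Qed.

Let rational_between (a b : V) : (forall i, a ord0 i < b ord0 i) ->
  exists q : 'rV[rat]_d, forall i, a ord0 i < (rat_point q + x) ord0 i < b ord0 i.
Proof.
move=> ab.
have H i : exists q : rat, a ord0 i - x ord0 i < ratr q < b ord0 i - x ord0 i.
  have [q] := @rat_in_itvoo R _ _ (ler_ltD (lexx (- x ord0 i)) (ab i)).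
  by rewrite in_itv/= ![- _ + _]addrC => qab; exists q.
exists (\row_i projT1 (cid (H i))) => i; rewrite !mxE.
have /andP[h1 h2] := projT2 (cid (H i)).
by move: h1 h2; rewrite ltrBlDr ltrBrDr => -> ->.
Qed.

(* A real box is the increasing limit of boxes with corners in the dense set of
   rational points translated by [x]. *)
Let real_box a b : \int[mu]_z (f z * \1_(open_box a b) z) = 0.
Proof.
have Ha n : exists q : 'rV[rat]_d, forall i,
    a ord0 i < (rat_point q + x) ord0 i < a ord0 i + n.+1%:R^-1.
  have [|q Hq] := @rational_between a (\row_i (a ord0 i + n.+1%:R^-1)).
    by move=> i; rewrite mxE ltrDl invr_gt0.
  by exists q => i; have := Hq i; rewrite [X in _ < _ < X -> _]mxE.
have Hb n : exists q : 'rV[rat]_d, forall i,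
    b ord0 i - n.+1%:R^-1 < (rat_point q + x) ord0 i < b ord0 i.
  have [|q Hq] := @rational_between (\row_i (b ord0 i - n.+1%:R^-1)) b.
    by move=> i; rewrite mxE gtrBl invr_gt0.
  by exists q => i; have := Hq i; rewrite [X in X < _ < _ -> _]mxE.
pose qa n := projT1 (cid (Ha n)); pose qb n := projT1 (cid (Hb n)).
pose B n := open_box (rat_point (qa n) + x) (rat_point (qb n) + x).
have Bsub n : B n `<=` open_box a b.
  move=> z Bz i; have /andP[h1 h2] := Bz i.
  have /andP[h3 _] := projT2 (cid (Ha n)) i; have /andP[_ h4] := projT2 (cid (Hb n)) i.
  by rewrite (lt_trans h3 h1) (lt_trans h2 h4).
apply: (box_limit (phi := fun n => \1_(B n))).
- by move=> n; apply: measurable_indic; exact: measurable_open_box.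
- move=> n z; rewrite !indicE ler0n/=; case: (boolP (z \in B n)) => //=.
  by rewrite inE => /Bsub zb; rewrite mem_set.
- move=> z; rewrite [X in _ --> X]indicE; case: (boolP (z \in open_box a b)) => [|/negP nz]; last first.
    rewrite (_ : (fun n => _) = fun=> 0); first exact: cvg_cst.
    apply/funext => n; rewrite indicE; case: (boolP (z \in B n)) => //.
    by rewrite inE => /Bsub zb; exfalso; apply: nz; rewrite inE.
  rewrite inE => zab; apply: cvg_near_cst.
  have small (e : R) : 0 < e -> \forall n \near \oo, (n.+1%:R)^-1 < e.
    move=> e0; near=> n; rewrite -[ltRHS]invrK ltf_pV2 ?posrE ?ltr0n ?invr_gt0//.
    have h : e^-1 < n%:R by near: n; exact: nbhs_infty_gtr.
    by apply: (lt_le_trans h); rewrite ler_nat.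
  have nearB i : \forall n \near \oo,
      a ord0 i + n.+1%:R^-1 < z ord0 i < b ord0 i - n.+1%:R^-1.
    have /andP[h1 h2] := zab i.
    near=> n.
    have k1 : n.+1%:R^-1 < z ord0 i - a ord0 i by near: n; apply: small; rewrite subr_gt0.
    have k2 : n.+1%:R^-1 < b ord0 i - z ord0 i by near: n; apply: small; rewrite subr_gt0.
    by rewrite -ltrBrDl k1 ltrBrDr -ltrBrDl k2.
  have nearB' : \forall n \near \oo, forall i,
      a ord0 i + n.+1%:R^-1 < z ord0 i < b ord0 i - n.+1%:R^-1 by exact: filter_forall.
  near=> n; rewrite indicE mem_set// => i.
  have Bn : forall i, a ord0 i + n.+1%:R^-1 < z ord0 i < b ord0 i - n.+1%:R^-1 by near: n.
  have /andP[h1 h2] := Bn i.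
  have /andP[_ h3] := projT2 (cid (Ha n)) i; have /andP[h4 _] := projT2 (cid (Hb n)) i.
  by rewrite (lt_trans h3 h1) (lt_trans h2 h4).
- by move=> n; exact: rational_box.
Unshelve. all: by end_near. Qed.

(** Bumps tend to the indicators of boxes as [m] grows; the point [x] is arbitrary
    because rational boxes translated by it still approximate all boxes. *)
Lemma ae_eq0_of_bump_pairings : {ae mu, forall z, f z = 0}.
Proof.
have E a b z : (((EFin \o f) \_ (open_box a b)) z = (f z * \1_(open_box a b) z)%:E)%E.
  by rewrite patchE /= indicE; case: (z \in open_box a b); rewrite ?mulr1 ?mulr0.
apply: ae_eq0_of_open_boxes => // a b.
  apply/(integrable_mkcond _ (measurable_open_box a b)).
  by apply: eq_integrable (integrable_box a b) => // z _; rewrite E.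
rewrite integral_mkcond (eq_integral (fun z => (f z * \1_(open_box a b) z)%:E)); last first.
  by move=> z _; rewrite -E.
rewrite -[LHS]fineK; last exact: (integrable_fin_num measurableT (integrable_box a b)).
by congr EFin; exact: real_box.
Qed.

End bump_pairings.

(** * The weak equation for one solution *)

Section nonnegative_version.
Context {R : realType} {d : nat}.
Local Notation V := 'rV[R]_d.
Local Notation mu := (lebesgue_rV R d).

Lemma nonlocal_op_unfold (K u : V -> R) x : nonlocal_op K u x =
  \int[mu]_y ((u x - (u (x + y) + u (x - y)) / 2) * K y).
Proof. exact: erefl. Qed.

Lemma symbol_unfold (K : V -> R) xi : symbol K xi = \int[mu]_y ((1 - cos (dotv xi y)) * K y).
Proof. exact: erefl. Qed.

(** The value of the kernel at the origin enters neither the operator nor its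
    symbol. *)
Lemma nonlocal_op_eq_off0 (K K' : V -> R) : (forall y, y != 0 -> K y = K' y) ->
  nonlocal_op K = nonlocal_op K'.
Proof.
move=> KK; apply/funext => u; apply/funext => x; rewrite !nonlocal_op_unfold.
apply: eq_Rintegral => y _; have [->|y0] := eqVneq y 0; last by rewrite KK.
by rewrite oppr0 !addr0 (_ : u x - _ = 0) ?mul0r//; field.
Qed.

Lemma symbol_eq_off0 (K K' : V -> R) : (forall y, y != 0 -> K y = K' y) ->
  symbol K = symbol K'.
Proof.
move=> KK; apply/funext => xi; rewrite !symbol_unfold.
apply: eq_Rintegral => y _; have [->|y0] := eqVneq y 0; last by rewrite KK.
have -> : dotv xi 0 = \sum_(i < d) xi ord0 i * (0 : V) ord0 i by exact: erefl.
by rewrite big1 ?cos0 ?subrr ?mul0r// => i _; rewrite mxE mulr0.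
Qed.

Lemma heat_kernel_eq_off0 (K K' : V -> R) P : (forall y, y != 0 -> K y = K' y) ->
  heat_kernel K P -> heat_kernel K' P.
Proof.
move=> KK [h1 h2 h3 h4 h5]; split => //.
by move=> t t0 xi; rewrite -(symbol_eq_off0 KK); exact: h4.
Qed.

Lemma mixed_growth_kernel_gt0 (K : V -> R) y : mixed_growth_kernel K -> y != 0 -> 0 < K y.
Proof.
case=> _ _ _ [phi [sphi [C C1 H] _]] y0; have ey := enorm_gt0 y0.
have /andP[h _] := H y y0; apply: lt_le_trans h.
have C0 : 0 < C by apply: lt_trans C1; exact: ltr01.
by rewrite divr_gt0 ?invr_gt0// mulr_gt0 ?exprn_gt0// (scale_gt0 sphi).
Qed.

(** The kernel is positive off the origin, so truncation below at [0] changes only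
    the value there. *)
Lemma mixed_growth_kernel_nonneg (K : V -> R) : mixed_growth_kernel K ->
  mixed_growth_kernel (fun y => Num.max (K y) 0).
Proof.
move=> hK; have E y : y != 0 -> Num.max (K y) 0 = K y.
  by move=> y0; rewrite max_l// ltW// mixed_growth_kernel_gt0.
case: (hK) => mK symK levyK [phi [sphi [C C1 H] growth]]; split.
- by apply: measurable_maxr => //; exact: measurable_cst.
- have [A [mA A0 sA]] := symK; exists A; split=> // y /= ny; apply: sA => /= -[Ky Ksym].
  by apply: ny; rewrite -Ksym max_l ?ltW.
- rewrite (eq_integral (fun y => (Num.min 1 (enorm y ^+ 2) * K y)%:E))// => y _; congr EFin.
  have [->|y0] := eqVneq y 0; last by rewrite E.
  by rewrite enorm0 expr0n/= min_r// !mul0r.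
- by exists phi; split=> //; exists C => // y y0; rewrite E//; exact: H.
Qed.

End nonnegative_version.

Section weak_pairings.
Context {R : realType} {d : nat}.
Local Notation V := 'rV[R]_d.
Local Notation mu := (lebesgue_rV R d).
Local Notation TR := (measurableTypeR R).
Local Notation leb := (@lebesgue_measure R).

(** If one of the two parts were infinite, so would be the integral. *)
Lemma integrable_of_fin_num (f : TR -> \bar R) : measurable_fun setT f ->
  (\int[leb]_s f s)%E \is a fin_num -> leb.-integrable setT f.
Proof.
move=> mf; rewrite integralE.
have p0 : (0 <= \int[leb]_s f^\+ s)%E by apply: integral_ge0 => s _; exact: funepos_ge0.
have n0 : (0 <= \int[leb]_s f^\- s)%E by apply: integral_ge0 => s _; exact: funeneg_ge0.
rewrite fin_numB => /andP[pf nf]; apply/integrableP; split => //.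
rewrite [ltLHS](_ : _ = \int[leb]_s (f^\+ s + f^\- s))%E; last first.
  by apply: eq_integral => s _; rewrite -[LHS]/((abse \o f) s) fune_abse.
rewrite ge0_integralD//; [|exact: measurable_funepos|exact: measurable_funeneg].
by apply: lte_add_pinfty; rewrite -ge0_fin_numE.
Qed.

(** The second differences of a bounded smooth function are integrable against the
    kernel. *)
Lemma nonlocal_opZ (K eta : V -> R) (c : R) z : measurable_fun setT K ->
  (forall y, 0 <= K y) -> (\int[mu]_y (Num.min 1 (enorm y ^+ 2) * K y)%:E < +oo)%E ->
  measurable_fun setT eta -> bounded_sdiff eta ->
  nonlocal_op K (fun y => eta y * c) z = c * nonlocal_op K eta z.
Proof.
move=> mK K0 levyK meta [A [L [M [HA _ HM]]]].
have msd : measurable_fun setT (fun y => sdiff eta y z).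
  by apply: measurable_funB => //; apply: measurable_funM => //; apply: measurable_funD; mfun.
have isd : mu.-integrable setT (EFin \o (fun y => sdiff eta y z * K y)).
  pose B := `|2 * A| + `|M|.
  apply: (integrable_dominated (g := fun y => B * (Num.min 1 (enorm y ^+ 2) * K y))).
  - exact: measurable_funM.
  - by apply: measurable_funM => //; exact: measurable_levy_integrand.
  - move=> y; rewrite normrM (ger0_norm (K0 y)) mulrA; apply: ler_wpM2r => //.
    have Aa u : `|eta u| <= `|A| by apply: (le_trans (HA u)); exact: ler_norm.
    have h2 : `|sdiff eta y z| <= `|2 * A|.
      rewrite normrM (ger0_norm (ler0n R 2)) /sdiff.
      have := Aa z; have := Aa (z + y); have := Aa (z - y); rewrite !ler_norml.
      by move=> /andP[? ?] /andP[? ?] /andP[? ?]; apply/andP; split; lra.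
    have h1 : `|sdiff eta y z| <= `|M| * enorm y ^+ 2.
      apply: (le_trans (HM z y)); apply: ler_wpM2r; [exact: sqr_ge0|exact: ler_norm].
    rewrite /B minEle; case: ifP => _.
      by rewrite mulr1; apply: (le_trans h2); rewrite lerDl.
    apply: (le_trans h1); apply: ler_wpM2r; first exact: sqr_ge0.
    by rewrite lerDr.
  - rewrite ge0_integralZl_real ?addr_ge0//; last 2 first.
    + exact: measurable_levy_integrand.
    + by move=> y; rewrite mulr_ge0// min1_sqr_ge0.
    by rewrite lte_mul_pinfty// lee_fin addr_ge0.
rewrite !nonlocal_op_unfold -(RintegralZl _ measurableT isd); apply: eq_Rintegral => y _.
by rewrite /sdiff; ring.
Qed.

End weak_pairings.

Section time_window.
Context {R : realType} {d : nat}.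
Local Notation V := 'rV[R]_d.
Local Notation mu := (lebesgue_rV R d).
Local Notation TR := (measurableTypeR R).
Local Notation leb := (@lebesgue_measure R).
Variables (T S : R) (u : V * R -> R).
Hypothesis ST : S < T.
Hypothesis mu_ : measurable_fun (setT `*` `]0%R, T[) u.

(** The extension by [0] outside the time window turns integrals over the window
    into integrals over the line. *)
Definition time_window (z : V) (s : TR) : R := if 0 < s < S then u (z, s) else 0.

Lemma measurable_time_window : measurable_fun setT (fun p : V * TR => time_window p.1 p.2).
Proof.
have mI (a b : R) : measurable (`]a, b[%classic : set TR) by exact: measurable_itv.
have E : (fun p : V * TR => 0 < p.2 < S) @^-1` [set true] = setT `*` `]0%R, S[.
  by apply/seteqP; split => p /=; rewrite in_itv/=; [move=> ->|move=> [_ ->]].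
apply: measurable_fun_if => //.
  by apply: (@measurable_fun_bool _ _ _ _ true); rewrite setTI E; exact: measurableX.
rewrite setTI E (_ : (fun p : V * TR => u (p.1, p.2)) = u); last by apply/funext => -[].
apply: measurable_funS mu_; first by apply: measurableX.
move=> p [_ /=]; rewrite !in_itv/= => /andP[p0 pS]; split => //=.
by rewrite p0 (lt_trans pS ST).
Qed.

Let mtw := measurable_time_window.

Lemma time_window_lty (W w : V -> R) (k : R) : measurable_fun setT W -> measurable_fun setT w ->
  (forall z, 0 <= W z) -> 0 <= k -> (forall z, W z <= k * w z) ->
  (\int[leb]_(t in `]0%R, S[) \int[mu]_x (`|u (x, t)| * w x)%:E < +oo)%E ->
  (\int[leb]_s \int[mu]_z (`|time_window z s| * W z)%:E < +oo)%E.
Proof.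
move=> mW mw W0 k0 Ww fin.
have w0 z : 0 <= k * w z by exact: le_trans (W0 z) (Ww z).
have mtn : measurable_fun setT (fun p : TR * V => `|time_window p.2 p.1|).
  have m1 := measurableT_comp (@normr_measurable R setT) mtw.
  exact: (measurableT_comp m1 (measurable_swap (T1 := TR) (T2 := V))).
have mg (v : V -> R) : measurable_fun setT v ->
    measurable_fun setT (fun p : TR * V => (`|time_window p.2 p.1| * v p.2)%:E).
  move=> mv; apply/measurable_EFinP; apply: measurable_funM => //.
  exact: (measurableT_comp mv measurable_snd).
have mkw : measurable_fun setT (fun z => k * w z) by exact: measurable_funM.
have g0 (v : V -> R) : (forall z, 0 <= v z) -> forall (s : TR) (z : V), (0 <= (`|time_window z s| * v z)%:E)%E.
  by move=> v0 s z; rewrite lee_fin; apply: mulr_ge0.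
apply: (@le_lt_trans _ _ (\int[leb]_s \int[mu]_z (`|time_window z s| * (k * w z))%:E)%E).
  apply: ge0_le_integral => //.
  - by move=> s _; apply: integral_ge0 => z _; exact: g0.
  - exact: (measurable_tonelli1 (fun (s : TR) (z : V) => (`|time_window z s| * W z)%:E) (mg _ mW) (g0 _ W0)).
  - exact: (measurable_tonelli1 (fun (s : TR) (z : V) => (`|time_window z s| * (k * w z))%:E) (mg _ mkw) (g0 _ w0)).
  move=> s _; have mts := measurable_sect1 (f := fun (s : TR) (z : V) => `|time_window z s|) mtn s.
  apply: ge0_le_integral_real.
  - exact: measurable_funM.
  - exact: measurable_funM.
  - by move=> z; exact: mulr_ge0.
  - by move=> z; apply: ler_wpM2l.
have [->|k1] := eqVneq k 0.
  rewrite integral0_eq// => s _; rewrite integral0_eq// => z _.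
  by rewrite mul0r mulr0.
have {}k1 : 0 < k by rewrite lt_neqAle eq_sym k1.
have w0' z : 0 <= w z by have := w0 z; rewrite pmulr_rge0.
have E s : (\int[mu]_z (`|time_window z s| * (k * w z))%:E =
    k%:E * ((fun t : TR => \int[mu]_x (`|u (x, t)| * w x)%:E) \_ `]0%R, S[) s)%E.
  have mts := measurable_sect1 (f := fun (s : TR) (z : V) => `|time_window z s|) mtn s.
  rewrite (eq_integral (fun z => (k * (`|time_window z s| * w z))%:E)); last first.
    by move=> z _; rewrite mulrCA.
  rewrite ge0_integralZl_real//; [|exact: measurable_funM|by move=> z; exact: mulr_ge0].
  congr (_ * _)%E; rewrite patchE /time_window; case: ifPn => sI.
    by move: sI; rewrite inE /= in_itv/= => ->.
  move/negP: sI; rewrite inE /= in_itv/= => /negP/negbTE ->.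
  by rewrite integral0_eq// => z _; rewrite normr0 mul0r.
under eq_integral do rewrite E.
have m1 := measurable_tonelli1 (m2 := mu) (fun (s : TR) (z : V) => (`|time_window z s| * (k * w z))%:E) (mg _ mkw) (g0 _ w0).
rewrite ge0_integralZl//; last 2 first.
- have -> : ((fun t : TR => \int[mu]_x (`|u (x, t)| * w x)%:E) \_ `]0%R, S[)%E =
      (fun s : TR => k^-1%:E * \int[mu]_z (`|time_window z s| * (k * w z))%:E)%E.
    by apply/funext => s; rewrite E muleA -EFinM mulVf ?gt_eqF// mul1e.
  exact: measurable_funeM.
- move=> s _; rewrite patchE; case: ifP => // _; apply: integral_ge0 => z _.
  by rewrite lee_fin mulr_ge0.
by rewrite -integral_mkcond lte_mul_pinfty// lee_fin ltW.
Qed.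

End time_window.

Section weak_cut.
Context {R : realType} {d : nat}.
Local Notation V := 'rV[R]_d.
Local Notation mu := (lebesgue_rV R d).
Local Notation TR := (measurableTypeR R).
Local Notation leb := (@lebesgue_measure R).
Variables (K W : V -> R).
Hypothesis mK : measurable_fun setT K.
Hypothesis K_ge0 : forall y, 0 <= K y.
Hypothesis K_levy : (\int[mu]_y (Num.min 1 (enorm y ^+ 2) * K y)%:E < +oo)%E.
Hypothesis hW : comparison_weight K W.
Variables (T S : R) (mu0 : (V -> R) -> R) (u : V * R -> R) (G : set TR).
Hypothesis ST : S < T.
Hypothesis mu_ : measurable_fun (setT `*` `]0%R, T[) u.
Hypothesis sol : weak_solution K T mu0 u.
Hypothesis mG : measurable G.
Hypothesis G_slice : forall s : TR, G s -> (\int[mu]_z (`|time_window S u z s| * W z)%:E < +oo)%E.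
Hypothesis G_ae : {ae leb, forall s : TR, 0 < s < S -> G s}.

(** Setting the solution to [0] on a null set of bad times makes every slice
    integrable against the weight, so that identities hold for all times. *)
Definition good_window (z : V) (s : TR) : R := \1_G s * time_window S u z s.

Let mtw := measurable_time_window ST mu_.

Lemma measurable_good_window : measurable_fun setT (fun p : V * TR => good_window p.1 p.2).
Proof.
apply: measurable_funM; last exact: mtw.
exact: (measurableT_comp (measurable_indic mG) measurable_snd).
Qed.

Let good_window_out z s : ~ G s -> good_window z s = 0.
Proof. by move=> Gs; rewrite /good_window indicE memNset// mul0r. Qed.

Lemma good_window_slice s : (\int[mu]_z (`|good_window z s| * W z)%:E < +oo)%E.
Proof.
have [Gs|Gs] := pselect (G s).
  rewrite (eq_integral (fun z => (`|time_window S u z s| * W z)%:E)); first exact: G_slice.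
  by move=> z _; rewrite /good_window indicE mem_set// mul1r.
by rewrite integral0_eq// => z _; rewrite good_window_out// normr0 mul0r.
Qed.

Let mgs s : measurable_fun setT (fun z => good_window z s).
Proof. exact: (measurable_sect2 (f := good_window) measurable_good_window s). Qed.

Section test.
Variables (m lam n b : R) (x y : V).
Hypotheses (m0 : 0 < m) (n0 : 0 < n) (bS : b < S).

Let eta := bump m x y.

Let meta : measurable_fun setT eta. Proof. exact: measurable_bump. Qed.

Let profile_bounds : exists rho M : R, [/\ 0 <= M, forall z, rho < enorm (z - 0) -> eta z = 0 &
  forall y z, `|sdiff eta y z| <= M * enorm y ^+ 2].
Proof.
have [rho _ Hrho] := bump_out x y m0; have [A [L [M [_ _ HM]]]] := bounded_sdiff_bump m x y.
exists rho, `|M|; split=> // [z|y' z]; first by rewrite subr0; exact: Hrho.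
apply: (le_trans (HM z y')); apply: ler_wpM2r; [exact: sqr_ge0|exact: ler_norm].
Qed.

Let eta_le : exists2 A : R, 0 <= A & forall z, `|eta z| <= A * W z.
Proof.
have [rho [M [M0 H1 H2]]] := profile_bounds.
have [A A0 HA] := indic_eball_le_weight hW 0 rho.
exists A => // z; rewrite ger0_norm ?bump_ge0//; apply: le_trans (HA z).
apply: (profile_le_indic (eta := eta) (c := 0) (rho := rho)) => // z'; exact: bump_le1.
Qed.

Let mLeta : measurable_fun setT (nonlocal_op K eta).
Proof.
have [rho [M [M0 H1 H2]]] := profile_bounds.
apply: (measurable_nonlocal_profile mK K_ge0 K_levy meta (c := 0) (rho := rho) (M := M)) => // z.
- exact: bump_ge0.
- exact: bump_le1.
Qed.

Let Leta_le : exists2 A : R, 0 <= A & forall z, `|nonlocal_op K eta z| <= A * W z.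
Proof.
have [rho [M [M0 H1 H2]]] := profile_bounds.
apply: (nonlocal_profile_le_weight mK K_ge0 K_levy hW meta (c := 0) (rho := rho) (M := M)) => // z.
- exact: bump_ge0.
- exact: bump_le1.
Qed.

Lemma integrable_good_bump s : mu.-integrable setT (EFin \o (fun z => good_window z s * eta z)).
Proof. have [A A0 HA] := eta_le; exact: (integrable_slice hW (mgs s) (good_window_slice s) meta A0 HA). Qed.

Lemma integrable_good_nonlocal s :
  mu.-integrable setT (EFin \o (fun z => good_window z s * nonlocal_op K eta z)).
Proof. have [A A0 HA] := Leta_le; exact: (integrable_slice hW (mgs s) (good_window_slice s) mLeta A0 HA). Qed.

Definition weak_density (s : TR) : R :=
  cutoff_deriv lam n b s * \int[mu]_z (good_window z s * eta z) -
  cutoff lam n b s * \int[mu]_z (good_window z s * nonlocal_op K eta z).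

Let F (z : V) (s : TR) : R := cutoff_deriv lam n b s * eta z - cutoff lam n b s * nonlocal_op K eta z.

Let mcut := @measurable_cutoff R lam n b.
Let mcutd := @measurable_cutoff_deriv R lam n b.

Let mF : measurable_fun setT (fun p : TR * V => F p.2 p.1).
Proof.
apply: measurable_funB; apply: measurable_funM.
- exact: (measurableT_comp mcutd measurable_fst).
- exact: (measurableT_comp meta measurable_snd).
- exact: (measurableT_comp mcut measurable_fst).
- exact: (measurableT_comp mLeta measurable_snd).
Qed.

Let mtwF : measurable_fun setT (fun p : TR * V => time_window S u p.2 p.1 * F p.2 p.1).
Proof.
by apply: measurable_funM; [exact: (measurableT_comp mtw (measurable_swap (T1 := TR) (T2 := V)))|exact: mF].
Qed.

Let measurable_weak_density : measurable_fun setT weak_density.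
Proof.
have mgw : measurable_fun setT (fun p : TR * V => good_window p.2 p.1).
  exact: (measurableT_comp measurable_good_window (measurable_swap (T1 := TR) (T2 := V))).
apply: measurable_funB; apply: measurable_funM; [exact: mcutd| |exact: mcut|].
  apply: (measurable_Rintegral mu (f := fun (s : TR) (z : V) => good_window z s * eta z)).
  by apply: measurable_funM; [exact: mgw|exact: (measurableT_comp meta measurable_snd)].
apply: (measurable_Rintegral mu (f := fun (s : TR) (z : V) => good_window z s * nonlocal_op K eta z)).
by apply: measurable_funM; [exact: mgw|exact: (measurableT_comp mLeta measurable_snd)].
Qed.

Let weak_densityE s : G s -> (\int[mu]_z (time_window S u z s * F z s)%:E = (weak_density s)%:E)%E.
Proof.
move=> Gs; have ie := integrable_good_bump s; have il := integrable_good_nonlocal s.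
have i1 := integrableZl measurableT (cutoff_deriv lam n b s) ie.
have i2 := integrableZl measurableT (cutoff lam n b s) il.
have i12 := integrableB measurableT i1 i2.
rewrite (eq_integral (fun z => (cutoff_deriv lam n b s * (good_window z s * eta z) -
    cutoff lam n b s * (good_window z s * nonlocal_op K eta z))%:E)); last first.
  move=> z _; congr EFin; rewrite /F /good_window indicE mem_set// mul1r; ring.
rewrite -[LHS]fineK; last exact: (integrable_fin_num measurableT i12).
congr EFin; rewrite /weak_density -(RintegralZl _ measurableT ie) -(RintegralZl _ measurableT il).
by rewrite -(RintegralB measurableT i1 i2).
Qed.

Let weak_density_out s : ~ G s -> weak_density s = 0.
Proof.
move=> Gs; rewrite /weak_density.
have E0 (f : V -> R) : \int[mu]_z (good_window z s * f z) = 0.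
  rewrite (_ : (fun z => _) = cst 0) ?Rintegral_cst ?mul0r//.
  by apply/funext => z; rewrite good_window_out// mul0r.
by rewrite !E0 !mulr0 subrr.
Qed.

(** The weak formulation for the product of a bump and a cutoff.  The right-hand
    side depends on the initial datum only, and cancels for two solutions. *)
Lemma weak_density_integral :
  (\int[leb]_s (weak_density s)%:E = (- mu0 (fun z => eta z * cutoff lam n b 0))%:E)%E.
Proof.
rewrite -(sol (test_function_bump_cutoff lam x y n0 m0 (lt_trans bS ST))).
rewrite [RHS]integral_mkcond.
have inner (s : TR) : (((fun t : TR => \int[mu]_z (u (z, t) *
      (derive1 (fun s0 : R => bump m x y (z, s0).1 * cutoff lam n b (z, s0).2) t -
       nonlocal_op K (fun y0 : V => bump m x y (y0, t).1 * cutoff lam n b (y0, t).2) z))%:E) \_ `]0%R, T[) s =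
    \int[mu]_z (time_window S u z s * F z s)%:E)%E.
  rewrite patchE; case: ifPn => [|/negP sT].
    rewrite inE /= in_itv/= => /andP[s0 sT]; apply: eq_integral => z _; congr EFin.
    have -> : derive1 (fun s0 : R => bump m x y (z, s0).1 * cutoff lam n b (z, s0).2) s = eta z * cutoff_deriv lam n b s.
      rewrite derive1E; 
      have dc := is_derive_cutoff lam n b s.
      have dM : is_derive s 1 (fun s0 : R => eta z * cutoff lam n b s0) (eta z * cutoff_deriv lam n b s).
        by apply: is_derive_eq; rewrite /GRing.scale/=; ring.
      exact: (@derive_val _ _ _ _ _ _ _ dM).
    rewrite (nonlocal_opZ _ _ mK K_ge0 K_levy meta (bounded_sdiff_bump m x y)).
    rewrite /time_window s0 /=; have [sS|Ss] := ltP s S; first by rewrite /F [eta z * _]mulrC.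
    by rewrite cutoff_out ?cutoff_deriv_out ?(le_trans (ltW bS) Ss)// mulr0 mul0r subrr mulr0 mul0r.
  rewrite integral0_eq// => z _; rewrite /time_window ifF ?mul0r//.
  apply/negbTE/negP => /andP[s0 sS]; apply: sT.
  by rewrite inE /= in_itv/= s0 (lt_trans sS ST).
rewrite (eq_integral (fun s : TR => \int[mu]_z (time_window S u z s * F z s)%:E)%E); last first.
  by move=> s _; exact: inner.
apply: ae_eq_integral => //.
- by apply/measurable_EFinP; exact: measurable_weak_density.
- exact: (measurable_integral_EFin mu (f := fun (s : TR) (z : V) => time_window S u z s * F z s) mtwF).
have [A [mA A0 sA]] := G_ae; exists A; split=> // s /= ns; apply: sA => /= Hs; apply: ns => _.
have [Gs|Gs] := pselect (G s); first by rewrite weak_densityE.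
rewrite weak_density_out// integral0_eq// => z _; rewrite /time_window ifF ?mul0r//.
by apply/negbTE/negP => sI; apply: Gs; exact: Hs.
Qed.

Lemma integrable_weak_density : leb.-integrable setT (EFin \o weak_density).
Proof.
apply: integrable_of_fin_num; first by apply/measurable_EFinP; exact: measurable_weak_density.
by rewrite weak_density_integral.
Qed.

End test.

End weak_cut.

(** * Uniqueness *)

Section product_null.
Context {R : realType} {d : nat}.
Local Notation V := 'rV[R]_d.
Local Notation mu := (lebesgue_rV R d).
Local Notation TR := (measurableTypeR R).
Local Notation leb := (@lebesgue_measure R).

(** A slice that misses the full set entirely has positive measure. *)
Lemma ae_product_section (Q : V * TR -> Prop) : {ae (mu \x leb)%E, forall p, Q p} ->
  {ae leb, forall s : TR, exists x : V, Q (x, s)}.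
Proof.
move=> [A [mA A0 sA]].
pose F (p : V * TR) : \bar R := (\1_A p)%:E.
have F0 p : (0 <= F p)%E by rewrite lee_fin indicE.
have mF : measurable_fun setT F by apply/measurable_EFinP; exact: measurable_indic.
have IF : (\int[leb]_s \int[mu]_x F (x, s) = 0)%E.
  rewrite -[LHS](fubini_tonelli2 (m1 := mu) (m2 := leb) F mF F0).
  by rewrite integral_indic// setIT.
have mG : measurable_fun setT (fun s : TR => \int[mu]_x F (x, s))%E.
  apply: (measurable_tonelli2 (fun (x : V) (s : TR) => F (x, s))) => //.
  by rewrite (_ : (fun z => _) = F)//; apply/funext => -[].
have IG : (\int[leb]_s `|\int[mu]_x F (x, s)| = 0)%E.
  by under eq_integral do rewrite gee0_abs ?integral_ge0//.
have [B [mB B0 sB]] := (ae_eq_integral_abs leb measurableT mG).1 IG.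
exists B; split=> // s /= ns; apply: sB => /= /(_ I) Is; apply: ns.
apply: contrapT => /forallNP nQ.
have As x : A (x, s) by apply: sA; exact: nQ.
have : (0 < mu (eball (0 : V) 1))%E by exact: lebesgue_eball_gt0.
apply/negP; rewrite -leNgt -Is.
apply: (@le_trans _ _ (\int[mu]_x (\1_(eball (0 : V) 1) x)%:E)%E).
  by rewrite integral_indic ?setIT//; exact: measurable_eball.
apply: ge0_le_integral => //.
- by apply/measurable_EFinP; exact: measurable_eball_indic.
- rewrite (_ : (fun x => F (x, s)) = cst 1%E)//.
  by apply/funext => x; rewrite /F indicE mem_set.
- by move=> x _; rewrite /F lee_fin !indicE (mem_set (As x)); case: (_ \in _).
Qed.

Lemma ae_product_of_slices (f : V -> TR -> R) :
  measurable_fun setT (fun p : V * TR => f p.1 p.2) ->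
  {ae leb, forall s : TR, {ae mu, forall z, f z s = 0}} ->
  {ae (mu \x leb)%E, forall p : V * TR, f p.1 p.2 = 0}.
Proof.
move=> mf Hs.
pose F (p : V * TR) : \bar R := (`|f p.1 p.2|)%:E.
have F0 p : (0 <= F p)%E by rewrite lee_fin.
have mF : measurable_fun setT F.
  by apply/measurable_EFinP; exact: (measurableT_comp (@normr_measurable R setT) mf).
have mG : measurable_fun setT (fun s : TR => \int[mu]_x F (x, s))%E.
  exact: (measurable_tonelli2 (fun (x : V) (s : TR) => F (x, s))).
have IF : (\int[(mu \x leb)%E]_p `|F p| = 0)%E.
  rewrite (eq_integral F); last by move=> p _; rewrite gee0_abs.
  rewrite (fubini_tonelli2 (m1 := mu) (m2 := leb) F mF F0).
  rewrite (ae_eq_integral (cst 0%E)) ?integral_cst ?mul0e//.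
  have [A [mA A0 sA]] := Hs; exists A; split=> // s /= ns; apply: sA => /= H; apply: ns => _.
  have mfs : measurable_fun setT (fun z => (f z s)%:E).
    by apply/measurable_EFinP; exact: (measurable_sect2 (f := f) mf s).
  apply: ((ae_eq_integral_abs mu measurableT mfs).2 _).
  have [B [mB B0 sB]] := H; exists B; split=> // z /= nz; apply: sB => /= fz; apply: nz => _.
  by rewrite fz.
have [A [mA A0 sA]] := (ae_eq_integral_abs (mu \x leb)%E measurableT mF).1 IF.
exists A; split=> // p /= np; apply: sA => /= Fp; apply: np.
by apply: normr0_eq0; exact: EFin_inj (Fp I).
Qed.

End product_null.

Section uniqueness.
Context {R : realType} {d : nat}.
Local Notation V := 'rV[R]_d.
Local Notation mu := (lebesgue_rV R d).
Local Notation TR := (measurableTypeR R).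
Local Notation leb := (@lebesgue_measure R).
Hypothesis d_gt0 : (0 < d)%N.
Variables (K : V -> R) (P : R -> V -> R) (T : R) (mu0 : (V -> R) -> R) (u1 u2 : V * R -> R).
Hypotheses (hK : mixed_growth_kernel K) (K_ge0 : forall y, 0 <= K y) (hP : heat_kernel K P).
Hypotheses (hu1 : L1loc_weighted T (P 1) u1) (hu2 : L1loc_weighted T (P 1) u2).
Hypotheses (sol1 : weak_solution K T mu0 u1) (sol2 : weak_solution K T mu0 u2).

Let mK := kernel_measurable hK.
Let K_levy := kernel_levy hK.

Section window.
Variable S : R.
Hypotheses (S0 : 0 < S) (ST : S < T).
Variable W : V -> R.
Hypothesis hW : comparison_weight K W.

Let mW := cw_measurable hW.
Let W_ge0 z : 0 <= W z. Proof. exact: ltW (cw_gt0 hW z). Qed.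

Let window_lty (u : V * R -> R) : L1loc_weighted T (P 1) u ->
  (\int[leb]_s \int[mu]_z (`|time_window S u z s| * W z)%:E < +oo)%E.
Proof.
case=> mu_ u_lty; have [c c0 Hc] := heat_kernel_ge_weight d_gt0 mK K_ge0 K_levy hP hW.
have mP : measurable_fun setT (P 1) by exact: continuous_measurable_rV (heat_continuous hP ltr01).
apply: (time_window_lty ST mu_ mW mP W_ge0 (k := c^-1)).
- by rewrite invr_ge0 ltW.
- by move=> z; rewrite -ler_pdivrMl ?invr_gt0// invrK.
- exact: u_lty.
Qed.

Let slice_size (u : V * R -> R) (s : TR) : \bar R := (\int[mu]_z (`|time_window S u z s| * W z)%:E)%E.

Let slice_size_ge0 u s : (0 <= slice_size u s)%E.
Proof. by apply: integral_ge0 => z _; rewrite lee_fin mulr_ge0. Qed.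

Let measurable_slice_size u : measurable_fun (setT `*` `]0%R, T[) u -> measurable_fun setT (slice_size u).
Proof.
move=> mu_; apply: (measurable_tonelli1 (fun (s : TR) (z : V) => (`|time_window S u z s| * W z)%:E)).
  apply/measurable_EFinP; apply: measurable_funM; last exact: (measurableT_comp mW measurable_snd).
  have m1 := measurableT_comp (@normr_measurable R setT) (measurable_time_window ST mu_).
  exact: (measurableT_comp m1 (measurable_swap (T1 := TR) (T2 := V))).
by move=> s z; rewrite lee_fin mulr_ge0.
Qed.

Let slice_size_ae u : L1loc_weighted T (P 1) u ->
  {ae leb, forall s : TR, slice_size u s \is a fin_num}.
Proof.
move=> hu; have iu : leb.-integrable setT (slice_size u).
  apply/integrableP; split; first exact: measurable_slice_size hu.1.
  rewrite (eq_integral (slice_size u)); first exact: window_lty.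
  by move=> s _; rewrite gee0_abs.
have [A [mA A0 sA]] := integrable_ae measurableT iu.
by exists A; split=> // s /= ns; apply: sA => /= fs; apply: ns; exact: fs I.
Qed.

Let G : set TR := [set s | 0 < s < S] `&`
  ([set s | slice_size u1 s \is a fin_num] `&` [set s | slice_size u2 s \is a fin_num]).

Let mG : measurable G.
Proof.
apply: measurableI.
  have -> : [set s : TR | 0 < s < S] = (`]0, S[%classic : set TR).
    by apply/seteqP; split => s /=; rewrite in_itv.
  exact: measurable_itv.
have mfin u : L1loc_weighted T (P 1) u -> measurable [set s | slice_size u s \is a fin_num].
  move=> hu; rewrite -[X in measurable X]setTI.
  exact: (emeasurable_fin_num measurableT (measurable_slice_size hu.1)).
by apply: measurableI; exact: mfin.
Qed.

Let G_ae : {ae leb, forall s : TR, 0 < s < S -> G s}.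
Proof.
have [A [mA A0 sA]] := slice_size_ae hu1; have [B [mB B0 sB]] := slice_size_ae hu2.
exists (A `|` B); split; first exact: measurableU.
  exact: (null_set_setU mA mB A0 B0).
move=> s /= ns; have [As|nAs] := pselect (A s); [by left|right]; apply: sB => /= f2; apply: ns => sI.
split=> //; split=> //=; apply: contrapT => f1; apply: nAs; exact: sA.
Qed.

Let G_slice1 (s : TR) : G s -> (\int[mu]_z (`|time_window S u1 z s| * W z)%:E < +oo)%E.
Proof. by case=> _ [+ _]; rewrite /= ge0_fin_numE. Qed.

Let G_slice2 (s : TR) : G s -> (\int[mu]_z (`|time_window S u2 z s| * W z)%:E < +oo)%E.
Proof. by case=> _ [_]; rewrite /= ge0_fin_numE. Qed.

Let g1 := good_window S u1 G.
Let g2 := good_window S u2 G.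
Let omega (z : V) (s : TR) : R := g1 z s - g2 z s.

Let momega : measurable_fun setT (fun p : V * TR => omega p.1 p.2).
Proof.
apply: measurable_funB.
- exact: (measurable_good_window ST hu1.1 mG).
- exact: (measurable_good_window ST hu2.1 mG).
Qed.

Let omega_out z (s : TR) : ~~ (0 < s < S) -> omega z s = 0.
Proof.
move=> sI; rewrite /omega /g1 /g2 /good_window /time_window (negbTE sI) !mulr0 subrr//.
Qed.

Let weighted_norm_ge0 (f : V -> TR -> R) (s : TR) : (0 <= \int[mu]_z (`|f z s| * W z)%:E)%E.
Proof. by apply: integral_ge0 => z _; rewrite lee_fin mulr_ge0. Qed.

Let measurable_weighted_norm (f : V -> TR -> R) :
  measurable_fun setT (fun p : V * TR => f p.1 p.2) ->
  measurable_fun setT (fun s : TR => \int[mu]_z (`|f z s| * W z)%:E)%E.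
Proof.
move=> mf; apply: (measurable_tonelli2 (fun (z : V) (s : TR) => (`|f z s| * W z)%:E)).
  apply/measurable_EFinP; apply: measurable_funM; last exact: (measurableT_comp mW measurable_fst).
  exact: (measurableT_comp (@normr_measurable R setT) mf).
by move=> z s; rewrite lee_fin mulr_ge0.
Qed.

Let mg1 : measurable_fun setT (fun p : V * TR => g1 p.1 p.2).
Proof. exact: (measurable_good_window ST hu1.1 mG). Qed.

Let mg2 : measurable_fun setT (fun p : V * TR => g2 p.1 p.2).
Proof. exact: (measurable_good_window ST hu2.1 mG). Qed.

Let omega_slice_le (s : TR) : (\int[mu]_z (`|omega z s| * W z)%:E <=
  \int[mu]_z (`|g1 z s| * W z)%:E + \int[mu]_z (`|g2 z s| * W z)%:E)%E.
Proof.
have ms (f : V -> TR -> R) : measurable_fun setT (fun p : V * TR => f p.1 p.2) ->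
    measurable_fun setT (fun z : V => `|f z s| * W z).
  move=> mf; apply: measurable_funM; last exact: mW.
  exact: (measurableT_comp (@normr_measurable R setT) (measurable_sect2 (f := f) mf s)).
have n0 (f : V -> TR -> R) z : 0 <= `|f z s| * W z by exact: mulr_ge0.
rewrite -(ge0_integralD_real mu (ms g1 mg1) (ms g2 mg2) (n0 g1) (n0 g2)).
apply: ge0_le_integral_real.
- exact: (ms omega momega).
- exact: measurable_funD (ms g1 mg1) (ms g2 mg2).
- exact: n0.
- by move=> z; rewrite -mulrDl; apply: ler_wpM2r; [exact: W_ge0|exact: ler_normB].
Qed.

Let omega_slice (s : TR) : (\int[mu]_z (`|omega z s| * W z)%:E < +oo)%E.
Proof.
apply: (le_lt_trans (omega_slice_le s)); apply: lte_add_pinfty.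
  exact: (good_window_slice G_slice1).
exact: (good_window_slice G_slice2).
Qed.

Let good_window_lty (u : V * R -> R) : L1loc_weighted T (P 1) u ->
  (\int[leb]_s \int[mu]_z (`|good_window S u G z s| * W z)%:E < +oo)%E.
Proof.
move=> hu; apply: le_lt_trans (window_lty hu).
have mgw := measurable_good_window ST hu.1 mG.
have mtw := measurable_time_window ST hu.1.
apply: ge0_le_integral.
- exact: measurableT.
- by move=> s _; exact: weighted_norm_ge0.
- exact: (measurable_weighted_norm mgw).
- exact: (measurable_weighted_norm mtw).
move=> s _; apply: ge0_le_integral_real.
- apply: measurable_funM; last exact: mW.
  exact: (measurableT_comp (@normr_measurable R setT) (measurable_sect2 (f := good_window S u G) mgw s)).
- apply: measurable_funM; last exact: mW.
  exact: (measurableT_comp (@normr_measurable R setT) (measurable_sect2 (f := time_window S u) mtw s)).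
- by move=> z; exact: mulr_ge0.
- move=> z; apply: ler_wpM2r; first exact: W_ge0.
  rewrite /good_window normrM indicE; case: (_ \in _); first by rewrite normr1 mul1r.
  by rewrite normr0 mul0r.
Qed.

Let omega_lty : (\int[leb]_s \int[mu]_z (`|omega z s| * W z)%:E < +oo)%E.
Proof.
have mn1 := measurable_weighted_norm mg1; have mn2 := measurable_weighted_norm mg2.
apply: (@le_lt_trans _ _ (\int[leb]_s (\int[mu]_z (`|g1 z s| * W z)%:E + \int[mu]_z (`|g2 z s| * W z)%:E))%E).
  apply: ge0_le_integral.
  - exact: measurableT.
  - by move=> s _; exact: weighted_norm_ge0.
  - exact: (measurable_weighted_norm momega).
  - exact: (emeasurable_funD mn1 mn2).
  - by move=> s _; exact: omega_slice_le.
rewrite (ge0_integralD leb measurableT (fun s _ => weighted_norm_ge0 g1 s) mn1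
  (fun s _ => weighted_norm_ge0 g2 s) mn2).
by apply: lte_add_pinfty; [exact: good_window_lty hu1|exact: good_window_lty hu2].
Qed.

Let omega_pairing_ae (m : nat) (a b : V) :
  {ae (mu \x leb)%E, forall p : V * TR, pairing (bump m.+1%:R a b) omega p.1 p.2 = 0}.
Proof.
have m0 : 0 < m.+1%:R :> R by rewrite ltr0n.
have [rho _ Hrho] := bump_out a b m0; have [A [L [M [_ _ HM]]]] := bounded_sdiff_bump m.+1%:R a b.
have [C C0 HC] := cw_sdiff_kernel hW.
have HM' y z : `|sdiff (bump m.+1%:R a b) y z| <= `|M| * enorm y ^+ 2.
  by apply: (le_trans (HM z y)); apply: ler_wpM2r; [exact: sqr_ge0|exact: ler_norm].
apply: (pairing_eq0_ae mK K_ge0 K_levy hW (measurable_bump m.+1%:R a b)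
  (bump_ge0 m.+1%:R a b) (bump_le1 m.+1%:R a b) Hrho (normr_ge0 M) HM' momega omega_out omega_lty _
  (c := C + 1) _ C0 erefl HC); last by rewrite ltr_wpDl.
move=> x lam s n /andP[s0 sS].
have n0 : 0 < n.+1%:R :> R by rewrite ltr0n.
have profE : profile (bump m.+1%:R a b) x = bump m.+1%:R (a + x) (b + x).
  by apply/funext => z; exact: bump_shift.
have i1 := integrable_weak_density mK K_ge0 K_levy hW ST hu1.1 sol1 mG G_slice1 G_ae lam (a + x) (b + x) m0 n0 sS.
have i2 := integrable_weak_density mK K_ge0 K_levy hW ST hu2.1 sol2 mG G_slice2 G_ae lam (a + x) (b + x) m0 n0 sS.
have d1 := weak_density_integral mK K_ge0 K_levy hW ST hu1.1 sol1 mG G_slice1 G_ae lam (a + x) (b + x) m0 n0 sS.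
have d2 := weak_density_integral mK K_ge0 K_levy hW ST hu2.1 sol2 mG G_slice2 G_ae lam (a + x) (b + x) m0 n0 sS.
transitivity (\int[leb]_t (weak_density K S u1 G m.+1%:R lam n.+1%:R s (a + x) (b + x) t -
    weak_density K S u2 G m.+1%:R lam n.+1%:R s (a + x) (b + x) t)); last first.
  by rewrite (RintegralB measurableT i1 i2) /Rintegral d1 d2 subrr.
apply: eq_Rintegral => t _.
have b1 := integrable_good_bump hW ST hu1.1 mG G_slice1 (a + x) (b + x) m0 t.
have b2 := integrable_good_bump hW ST hu2.1 mG G_slice2 (a + x) (b + x) m0 t.
have l1 := integrable_good_nonlocal mK K_ge0 K_levy hW ST hu1.1 mG G_slice1 (a + x) (b + x) m0 t.
have l2 := integrable_good_nonlocal mK K_ge0 K_levy hW ST hu2.1 mG G_slice2 (a + x) (b + x) m0 t.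
rewrite /pairing /nonlocal_pairing profE.
have -> : \int[mu]_z (omega z t * bump m.+1%:R (a + x) (b + x) z) =
    \int[mu]_z (g1 z t * bump m.+1%:R (a + x) (b + x) z) - \int[mu]_z (g2 z t * bump m.+1%:R (a + x) (b + x) z).
  by rewrite -(RintegralB measurableT b1 b2); apply: eq_Rintegral => z _; rewrite mulrBl.
have -> : \int[mu]_z (omega z t * nonlocal_op K (bump m.+1%:R (a + x) (b + x)) z) =
    \int[mu]_z (g1 z t * nonlocal_op K (bump m.+1%:R (a + x) (b + x)) z) -
    \int[mu]_z (g2 z t * nonlocal_op K (bump m.+1%:R (a + x) (b + x)) z).
  by rewrite -(RintegralB measurableT l1 l2); apply: eq_Rintegral => z _; rewrite mulrBl.
rewrite /weak_density -/g1 -/g2.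
ring.
Qed.

Let omega_ae : {ae leb, forall s : TR, {ae mu, forall z, omega z s = 0}}.
Proof.
pose Q (n : nat) (p : V * TR) : Prop :=
  if unpickle n is Some (m, (qa, qb)) then
    pairing (bump m.+1%:R (rat_point qa) (rat_point qb)) omega p.1 p.2 = 0
  else True.
have HQ n : {ae (mu \x leb)%E, forall p, Q n p}.
  rewrite /Q; case: (@unpickle (nat * ('rV[rat]_d * 'rV[rat]_d))%type n) => [[m [qa qb]]|].
    exact: omega_pairing_ae.
  exact: aeW.
have [A [mA A0 sA]] := ae_product_section (ae_foralln HQ).
exists A; split=> // s /= ns; apply: sA => /= -[x Hx]; apply: ns.
have ms : measurable_fun setT (fun z => omega z s) := measurable_sect2 (f := omega) momega s.
apply: (ae_eq0_of_bump_pairings hW ms (omega_slice s) (x := x)) => m qa qb.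
have := Hx (pickle (m, (qa, qb))); rewrite /Q pickleK /= => <-.
by apply: eq_Rintegral => z _; rewrite /profile bump_shift.
Qed.

(** The estimate is carried out strictly before the final time, where the solutions
    are integrable in time. *)
Lemma uniqueness_window : {ae (mu \x leb)%E, forall p : V * TR, 0 < p.2 < S -> u1 p = u2 p}.
Proof.
have mdiff : measurable_fun setT (fun p : V * TR => time_window S u1 p.1 p.2 - time_window S u2 p.1 p.2).
  by apply: measurable_funB; [exact: (measurable_time_window ST hu1.1)|exact: (measurable_time_window ST hu2.1)].
have H : {ae leb, forall s : TR, {ae mu, forall z, time_window S u1 z s - time_window S u2 z s = 0}}.
  have [A [mA A0 sA]] := omega_ae; have [B [mB B0 sB]] := G_ae.
  exists (A `|` B); split; first exact: measurableU.
    exact: (null_set_setU mA mB A0 B0).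
  move=> s /= ns; have [Bs|nBs] := pselect (B s); [by right|left]; apply: sA => /= ws; apply: ns.
  have Gs : 0 < s < S -> G s by apply: contrapT => h; apply: nBs; exact: sB.
  have [sI|sI] := boolP (0 < s < S); last first.
    by apply: aeW => z; rewrite /time_window (negbTE sI) subrr.
  have [C [mC C0 sC]] := ws; exists C; split=> // z /= nz; apply: sC => /= wz; apply: nz.
  by move: wz; rewrite /omega /g1 /g2 /good_window indicE (mem_set (Gs sI)) !mul1r.
have [A [mA A0 sA]] := ae_product_of_slices (f := fun z s => time_window S u1 z s - time_window S u2 z s) mdiff H.
exists A; split=> // -[z s] /= nz; apply: sA => /= h; apply: nz => sI.
by move: h; rewrite /time_window sI => /eqP; rewrite subr_eq0 => /eqP.
Qed.

End window.

End uniqueness.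

Theorem theorem3p5 (R : realType) (d : nat) (d_gt0 : (0 < d)%N)
    (K : 'rV[R]_d -> R) (hK : mixed_growth_kernel K)
    (P : R -> 'rV[R]_d -> R) (hP : heat_kernel K P)
    (T : R) (T_gt0 : 0 < T)
    (mu0 : ('rV[R]_d -> R) -> R) (hmu0 : radon_measure mu0)
    (u1 u2 : 'rV[R]_d * R -> R)
    (hu1 : L1loc_weighted T (P 1) u1) (hu2 : L1loc_weighted T (P 1) u2)
    (hsol1 : weak_solution K T mu0 u1) (hsol2 : weak_solution K T mu0 u2) :
  {ae (lebesgue_rV R d \x @lebesgue_measure R)%E,
    forall z : 'rV[R]_d * R, 0 < z.2 < T -> u1 z = u2 z}.
Proof.
pose K' y := Num.max (K y) 0.
have KK y : y != 0 -> K y = K' y.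
  by move=> y0; rewrite /K' max_l// ltW// mixed_growth_kernel_gt0.
have hK' : mixed_growth_kernel K' := mixed_growth_kernel_nonneg hK.
have K'_ge0 y : 0 <= K' y by rewrite /K' le_max lexx orbT.
have hP' := heat_kernel_eq_off0 KK hP.
have sol (u : 'rV[R]_d * R -> R) : weak_solution K T mu0 u -> weak_solution K' T mu0 u.
  by move=> h theta htheta; rewrite -(nonlocal_op_eq_off0 KK); exact: h.
have [W hW] := comparison_weight_exists hK' K'_ge0.
pose S (k : nat) : R := T * (1 - k.+2%:R^-1).
have k1 (k : nat) : (k.+2%:R)^-1 < 1 :> R by rewrite invf_lt1 ?ltr0n// ltr1n.
have S0 k : 0 < S k by rewrite mulr_gt0// subr_gt0.
have ST k : S k < T by rewrite gtr_pMr// gtrBl invr_gt0.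
have H k := uniqueness_window d_gt0 hK' K'_ge0 hP' hu1 hu2 (sol _ hsol1) (sol _ hsol2) (S0 k) (ST k) hW.
have [A [mA A0 sA]] := ae_foralln H.
exists A; split=> // z /= nz; apply: sA => /= h; apply: nz => /andP[z0 zT].
suff [k Hk] : exists k, z.2 < S k by apply: (h k); rewrite z0.
have e0 : 0 < 1 - z.2 / T by rewrite subr_gt0 ltr_pdivrMr// mul1r.
exists (Num.bound (1 - z.2 / T)^-1).
rewrite /S -ltr_pdivrMl// mulrC ltrBrDr -ltrBrDl -[ltRHS]invrK.
rewrite ltf_pV2 ?posrE ?ltr0n ?invr_gt0//.
apply: (lt_le_trans (archi_boundP _)); first by rewrite invr_ge0 ltW.
by rewrite ler_nat -addn2 leq_addr.
Qed.
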